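(* Let $g$ be a non-constant, mean-zero, real valued step function on $\mathbb T=\mathbb R/(2\pi\mathbb Z)$. Let $u(t,x)$ be the solution, with $u(0,\cdot)=g$, of either the Airy equation $u_t+u_{xxx}=0$ or the KdV equation $u_t+u_{xxx}+uu_x=0$ ($t\in\mathbb R$, $x\in\mathbb T$). Fix $k,\ell\in\mathbb N$ with $\gcd(k,\ell)=1$, and for $c\in\mathbb R$ let $F_c(x)=u\left(c-\frac k\ell x,\,x\right)$, $x\in[0,2\pi\ell]$. Then for a.e. $c\in\mathbb R$, $F_c\in C^{\frac1{27}-}$ and the fractal dimension of the graph of $F_c$ is in $\left[\frac{11}6,\frac{53}{27}\right]$.
   Context: The Airy solution is $e^{-t\partial_{xxx}}g=\sum_n\widehat g(n)e^{itn^3+inx}$. For KdV, $u$ is the unique global solution given by the $L^2(\mathbb T)$ well-posedness theory (Bourgain). $C^{s-}=\bigcap_{r<s}C^r$ (Hölder spaces). The restriction of $u$ to a line is understood as the sum of the restriction of the linear part $e^{-t\partial_{xxx}}g$ (defined by the series restricted to the line, converging in $L^2$ over $[0,2\pi\ell]$) and the restriction of $u-e^{-t\partial_{xxx}}g$ (a continuous function of $(t,x)$); $F_c\in C^\alpha$ means agreement a.e. with a Hölder-$\alpha$ function, to which the graph statement refers. A step function is a finite linear combination of indicator functions of intervals (arcs). The fractal (upper box-counting) dimension of a bounded set $E$ is $\limsup_{\epsilon\to0}\frac{\log\mathcal N(E,\epsilon)}{\log(1/\epsilon)}$, with $\mathcal N(E,\epsilon)$ the minimum number of $\epsilon$-balls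 needed to cover $E$. *)

(* Defs.v *)
From HB Require Import structures.
From mathcomp Require Import all_boot all_order all_algebra.
From mathcomp Require Import all_classical all_reals all_analysis.
From mathcomp Require Import complex.

Set Implicit Arguments.
Unset Strict Implicit.
Unset Printing Implicit Defensive.

Import Order.TTheory GRing.Theory Num.Theory.
Import numFieldNormedType.Exports.

Local Open Scope classical_set_scope.
Local Open Scope ring_scope.
Local Open Scope complex_scope.

(* Functions on the torus R/(2 pi Z) are represented by 2 pi-periodic functions
   on the real line; elements of L^2 by Borel representatives. *)

Section Airy_KdV.
Variable R : realType.
Implicit Types (g v : R -> R) (u w : R -> R -> R).

Local Notation mu := (@lebesgue_measure R).

Definition period : R := pi *+ 2.

Definition L2_on (a b : R) (f : R -> R) : Prop :=
  measurable_fun setT f /\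
  mu.-integrable `[a, b] (EFin \o (fun x => f x ^+ 2)).

Definition L2_torus v : Prop := periodic v period /\ L2_on 0 period v.

Definition step_function g : Prop :=
  periodic g period /\
  exists s : seq (R * interval R), forall x : R, 0 <= x < period ->
    g x = \sum_(p <- s) p.1 * \1_([set` p.2]) x.

(* Constancy is that of an L^2 function: the arcs in step_function may be
   single points, and values at finitely many points are disregarded. *)
Definition ae_constant g : Prop :=
  exists a : R, {ae mu, forall x, g x = a}.

Definition mean_zero g : Prop := Rintegral mu `[0, period] g = 0.

Definition cis (y : R) : R[i] := cos y +i* sin y.

Definition normsq (z : R[i]) : R := complex.Re z ^+ 2 + complex.Im z ^+ 2.

Definition Cintegral (D : set R) (f : R -> R[i]) : R[i] :=
  Rintegral mu D (fun x => complex.Re (f x)) +i*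
  Rintegral mu D (fun x => complex.Im (f x)).

(* Integral from a to b with orientation: one of the two intervals is empty or
   a single point. *)
Definition oriented_Cintegral (a b : R) (f : R -> R[i]) : R[i] :=
  Cintegral `[a, b] f - Cintegral `[b, a] f.

Definition fourier v (n : int) : R[i] :=
  (period^-1)%:C *
  Cintegral `[0, period] (fun x => (v x)%:C * cis (- (n%:~R * x))).

(* Frequencies: e^{- t d_xxx} multiplies the n-th coefficient by e^{i t n^3}. *)
Definition airy_solution g u : Prop :=
  (forall t, L2_torus (u t)) /\
  (forall t n, fourier (u t) n = cis (t * n%:~R ^+ 3) * fourier g n).

Definition continuous_in_L2 u : Prop :=
  (forall t, L2_torus (u t)) /\
  (forall t0, Rintegral mu `[0, period] (fun x => (u t x - u t0 x) ^+ 2)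
                @[t --> t0] --> (0 : R)).

(* Duhamel's formula for u_t + u_xxx + (u ^ 2 / 2)_x = 0, coefficientwise; at
   t = 0 it gives u 0 = g in L^2. *)
Definition kdv_duhamel g u : Prop :=
  forall t n, fourier (u t) n =
    cis (t * n%:~R ^+ 3) * fourier g n
    - (0 +i* (n%:~R / 2)) *
      oriented_Cintegral 0 t (fun s =>
        cis ((t - s) * n%:~R ^+ 3) * fourier (fun x => u s x ^+ 2) n).

(* Restriction to [-T, T] of Bourgain's space Y^0: on this interval u has an
   extension whose space-time Fourier transform a n tau lies in
   L^2(<tau - n^3> dtau dn), i.e. X^{0,1/2}, and in l^2_n L^1_tau. *)
Definition bourgain_class (T : R) u : Prop :=
  exists a : int -> R -> R[i],
    [/\ forall n, measurable_fun setT (fun tau => complex.Re (a n tau)) /\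
                  measurable_fun setT (fun tau => complex.Im (a n tau)),
        (\esum_(n in [set: int]) \int[mu]_tau
           ((1 + `|tau - n%:~R ^+ 3|) * normsq (a n tau))%:E < +oo)%E,
        (\esum_(n in [set: int])
           (\int[mu]_tau (Num.sqrt (normsq (a n tau)))%:E) ^+ 2 < +oo)%E &
        forall t n, `|t| <= T ->
          fourier (u t) n =
          Cintegral setT (fun tau => cis (t * tau) * a n tau)].

(* The solution of Bourgain's L^2 theory: the space C(R; L^2) together with
   bourgain_class is the class in which that theory gives existence and
   uniqueness for mean-zero data. *)
Definition kdv_solution g u : Prop :=
  [/\ continuous_in_L2 u, kdv_duhamel g u &
      forall T : R, 0 < T -> bourgain_class T u].

(* The Fourier series of e^{- t d_xxx} g over |n| <= N. *)
Definition airy_partial_sum g (N : nat) (t x : R) : R[i] :=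
  \sum_(j < N.*2.+1) let n := j%:Z - N%:Z in
    fourier g n * cis (t * n%:~R ^+ 3 + n%:~R * x).

Section line.
Variables k l : nat.

Definition line_time (c x : R) : R := c - k%:R / l%:R * x.

Definition line_end : R := period * l%:R.

(* L is the sum in L^2(0, 2 pi l) of the Fourier series of e^{- t d_xxx} g
   restricted to the line t = c - (k / l) x. *)
Definition airy_restriction g (c : R) (L : R -> R) : Prop :=
  L2_on 0 line_end L /\
  (fun N : nat => Rintegral mu `[0, line_end]
     (fun x => normsq (airy_partial_sum g N (line_time c x) x - (L x)%:C)))
    @ \oo --> (0 : R).

(* F agrees a.e. with the restriction of u to the line, where u is the sum of
   the Airy evolution V of g and of a continuous function w. *)
Definition line_restriction g u (c : R) (F : R -> R) : Prop :=
  exists (V w : R -> R -> R) (L : R -> R),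
    [/\ airy_solution g V,
        continuous (fun p : R * R => w p.1 p.2),
        forall t, {ae mu, forall x, u t x = V t x + w t x},
        airy_restriction g c L &
        {ae mu, forall x, 0 <= x <= line_end ->
                  F x = L x + w (line_time c x) x}].

End line.

Definition hoelder_on (a b r : R) (F : R -> R) : Prop :=
  exists C : R, forall x y, a <= x <= b -> a <= y <= b ->
    `|F x - F y| <= C * (`|x - y| `^ r).

(* The class C^{s-} on [a, b]. *)
Definition hoelder_below (a b s : R) (F : R -> R) : Prop :=
  forall r : R, 0 < r -> r < s -> hoelder_on a b r F.

Definition graph_on (a b : R) (F : R -> R) : set (R * R) :=
  [set (x, F x) | x in `[a, b]].

Definition disc (p : R * R) (e : R) : set (R * R) :=
  [set q | (q.1 - p.1) ^+ 2 + (q.2 - p.2) ^+ 2 < e ^+ 2].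

(* The infimum is a minimum when E is bounded and 0 < e. *)
Definition covering_number (E : set (R * R)) (e : R) : R :=
  inf [set (n%:R : R) | n in
    [set n : nat | exists p : 'I_n -> R * R,
                     E `<=` \bigcup_(i in [set: 'I_n]) disc (p i) e]].

Definition box_dim (E : set (R * R)) : \bar R :=
  limf_esup (fun e : R => (ln (covering_number E e) / ln e^-1)%:E) 0^'+.

End Airy_KdV.

(* Main.v *)
Require Import Defs.
From HB Require Import structures.
From mathcomp Require Import all_boot all_order all_algebra.
From mathcomp Require Import all_classical all_reals all_analysis.
From mathcomp Require Import measurable_realfun complex.
From mathcomp Require Import ring lra zify.

Set Implicit Arguments.
Unset Strict Implicit.
Unset Printing Implicit Defensive.

Import Order.TTheory GRing.Theory Num.Theory.
Import numFieldNormedType.Exports.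
Import ComplexField.Normc.

Local Open Scope classical_set_scope.
Local Open Scope ring_scope.
Local Open Scope complex_scope.

(** On the line [t = c - (k/l) x] the Airy evolution is the series of
    [ĝ(n) e^(i (c n^3 + n x - (k/l) x n^3))], where [n ĝ(n)] is a sum of
    exponentials [e^(-i n x_j)] over the jumps of [g].  For a.e. [c] the numbers
    [c - k x_j / l], suitably normalised, are not well approximable, so that the
    coefficients of [n^3] and of [n] are never both close to fractions with the
    same small denominator.  For each [x] the cancellation comes either from
    Weyl's inequality for the cubic phase or, when [n^3] has a coefficient close
    to a fraction with small denominator [q], from the linear phase along the
    residue classes modulo [q].  Every dyadic block of the series is then
    [O(N^(-d))] uniformly in [x], for every [d < 1/9], its increments over [h] are
    [O(N^(3-d) h)], and this gives the Hölder exponents below [1/27] and the upper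
    bound [2 - 1/27].

    For the lower bound, take [h] of order [n^-3].  The increment [f = L(. + h) - L]
    has squared [L^2] norm at least of order [1/n], because the jumps keep
    [|ĝ(m)| ~ 1/m] in mean square, while its [L^4] norm is controlled up to
    [n^eps] by the [l^2] norm of its coefficients: the number of solutions of
    [p(a) + p(b) = M], with [p(a) = l a - k a^3], is bounded by a number of
    divisors.  Comparing the two moments bounds the integral of [|f|] below by
    [h^(1/6 + eps)], and a graph covered by few balls of radius [h] cannot
    oscillate this much in mean.

    For KdV, set [v_n(t) = e^(-i t n^3) û(t)(n)].  Two integrations by parts in
    time in Duhamel's formula (differentiation by parts) turn the equation into a
    sum of smoother terms, the resonant ones collapsing to [|v_n|^2 v_n / n].
    A bootstrap first gives [v_n(t) - v_n(0) = O(1/n)], then, using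
    [ĝ(n) = O(1/n)], [v_n(t) - v_n(0) = O(|n|^(-7/4))].  So [u] is the Airy
    evolution plus a function that is Hölder continuous with an exponent
    [1/5 > 1/6], which changes neither of the two bounds. *)

(** * Complex exponentials and integrals *)

(** On the line the coefficient of [n^3] takes all values as [x] varies, so no condition can be put
    on a single time. Only the combination [al + (k/l) be] of the two coefficients is constant in
    [x], one constant for each jump, and the condition on [c] concerns it. The exponent [1/9]
    balances two regimes: Weyl's inequality gives [N^(1-d)] when the denominator [q] lies between
    [N^(4d)] and [N^(3-4d)]; for smaller [q] the linear phase gives about [q^2] times the variation
    [N^(4d)/q], hence [N^(8d)], and [8d = 1 - d]. Frequencies along the line grow like [n^3], whence
    [1/27 = (1/9)/3]; at [h = n^-3] an increment of mean square [1/n] has size [h^(1/6)], whence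
    [11/6 = 2 - 1/6]. A correction with modes [O(n^-a)] is Hölder of exponents below [(a - 1)/3], so
    [a] must exceed [3/2] to beat [1/6]: the decay [1/n] is that of the data and only feeds the
    second round. As [u] is merely continuous in [L^2], the normal form is carried out on truncated
    sums, whose errors vanish uniformly on compact time intervals. *)

Arguments cis {_} _ : simpl never.

Section normc_cis.
Variable R : realType.
Implicit Types (x y : R) (z w : R[i]).

Lemma normc_ge0 z : 0 <= normc z.
Proof. by case: z => a b; exact: sqrtr_ge0. Qed.

Lemma normcD z w : normc (z + w) <= normc z + normc w.
Proof. exact: (@le_normcD R z w). Qed.

Lemma normcB z w : normc (z - w) <= normc z + normc w.
Proof. by rewrite -(normcN w) normcD. Qed.

Lemma normc_distrC z w : normc (z - w) = normc (w - z).
Proof. by rewrite -normcN opprB. Qed.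

Lemma normc_leB z w : normc z <= normc w + normc (z - w).
Proof. by rewrite -[in leLHS](subrKC w z) normcD. Qed.

Lemma normc_sum (I : Type) (r : seq I) (P : pred I) (F : I -> R[i]) :
  normc (\sum_(i <- r | P i) F i) <= \sum_(i <- r | P i) normc (F i).
Proof.
elim/big_ind2 : _ => [|x1 x2 y1 y2 h1 h2|//]; first by rewrite normc0.
by apply: le_trans (normcD _ _) _; exact: lerD.
Qed.

Lemma normcR x : normc x%:C = `|x|.
Proof. by rewrite /= expr0n /= addr0 sqrtr_sqr. Qed.

Lemma normcJ z : normc (conjc z) = normc z.
Proof. by case: z => a b /=; rewrite sqrrN. Qed.

Lemma normcX z n : normc (z ^+ n) = normc z ^+ n.
Proof. by elim: n => [|n IH]; rewrite ?expr0 ?normc1 // !exprS normcM IH. Qed.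

Lemma normsqE z : normsq z = normc z ^+ 2.
Proof. by case: z => a b; rewrite /normsq /= sqr_sqrtr// addr_ge0// sqr_ge0. Qed.

Lemma normc_mulJ z : z * (conjc z) = (normc z ^+ 2)%:C.
Proof.
by rewrite -normsqE /normsq; case: z => a b /=; simpc; congr (_ +i* _); ring.
Qed.

Lemma normc_Re z : `|complex.Re z| <= normc z.
Proof.
by rewrite -(sqrtr_sqr (complex.Re z)); case: z => a b /=; rewrite ler_sqrt ?addr_ge0 ?sqr_ge0// lerDl sqr_ge0.
Qed.

Lemma normc_Im z : `|complex.Im z| <= normc z.
Proof.
by rewrite -(sqrtr_sqr (complex.Im z)); case: z => a b /=; rewrite ler_sqrt ?addr_ge0 ?sqr_ge0// lerDr sqr_ge0.
Qed.

Lemma normc_le_ReIm z : normc z <= `|complex.Re z| + `|complex.Im z|.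
Proof.
rewrite -(@ler_pXn2r _ 2)// ?nnegrE ?normc_ge0 ?addr_ge0//.
rewrite -normsqE /normsq sqrrD !real_normK ?num_real// -addrA lerD2l lerDr.
by rewrite mulrn_wge0// mulr_ge0.
Qed.

Lemma ReD z w : complex.Re (z + w) = complex.Re z + complex.Re w.
Proof. by case: z w => [a b] [c d]. Qed.

Lemma ImD z w : complex.Im (z + w) = complex.Im z + complex.Im w.
Proof. by case: z w => [a b] [c d]. Qed.

Lemma ReN z : complex.Re (- z) = - complex.Re z.
Proof. by case: z. Qed.

Lemma ImN z : complex.Im (- z) = - complex.Im z.
Proof. by case: z. Qed.

Lemma ReJ z : complex.Re (conjc z) = complex.Re z.
Proof. by case: z. Qed.

Lemma ImJ z : complex.Im (conjc z) = - complex.Im z.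
Proof. by case: z. Qed.

Lemma conjcM z w : (conjc (z * w)) = (conjc z) * (conjc w).
Proof. exact: (rmorphM (@conjc R)). Qed.

Lemma conjc_sum (I : Type) (r : seq I) (P : pred I) (F : I -> R[i]) :
  (conjc (\sum_(i <- r | P i) F i)) = \sum_(i <- r | P i) (conjc (F i)).
Proof. exact: (rmorph_sum (@conjc R)). Qed.

Lemma Re_mul z w : complex.Re (z * w) =
  complex.Re z * complex.Re w - complex.Im z * complex.Im w.
Proof. by case: z w => [a b] [c d]. Qed.

Lemma Im_mul z w : complex.Im (z * w) =
  complex.Re z * complex.Im w + complex.Im z * complex.Re w.
Proof. by case: z w => [a b] [c d]. Qed.

Lemma Re_sum (I : Type) (r : seq I) (P : pred I) (F : I -> R[i]) :
  complex.Re (\sum_(i <- r | P i) F i) = \sum_(i <- r | P i) complex.Re (F i).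
Proof. by elim/big_ind2 : _ => // x1 x2 y1 y2 <- <-; rewrite ReD. Qed.

Lemma Im_sum (I : Type) (r : seq I) (P : pred I) (F : I -> R[i]) :
  complex.Im (\sum_(i <- r | P i) F i) = \sum_(i <- r | P i) complex.Im (F i).
Proof. by elim/big_ind2 : _ => // x1 x2 y1 y2 <- <-; rewrite ImD. Qed.

Lemma cis0 : cis (0 : R) = 1.
Proof. by rewrite /cis cos0 sin0. Qed.

Lemma cisD x y : cis (x + y) = cis x * cis y.
Proof. by rewrite /cis cosD sinD; simpc; congr (_ +i* _); ring. Qed.

Lemma cisN x : cis (- x) = (conjc (cis x)).
Proof. by rewrite /cis cosN sinN. Qed.

Lemma cisMn x n : cis x ^+ n = cis (n%:R * x).
Proof.
elim: n => [|n IH]; first by rewrite mul0r cis0.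
by rewrite exprS IH -cisD -nat1r mulrDl mul1r.
Qed.

Lemma normc_cis x : normc (cis x) = 1.
Proof. by rewrite /= cos2Dsin2 sqrtr1. Qed.

Lemma cisNl x : cis (- x) * cis x = 1.
Proof. by rewrite -cisD addNr cis0. Qed.

Lemma cisNr x : cis x * cis (- x) = 1.
Proof. by rewrite -cisD subrr cis0. Qed.

Lemma cis_period_nat n : cis (n%:R * period R) = 1.
Proof. by rewrite -cisMn /cis /period cos2pi sin2pi expr1n. Qed.

Lemma cis_period_int (m : int) : cis (m%:~R * period R) = 1.
Proof.
case: m => n; first exact: cis_period_nat.
by rewrite NegzE mulrNz mulNr cisN cis_period_nat conjc1.
Qed.

Lemma period_gt0 : 0 < period R.
Proof. by rewrite /period pmulrn_lgt0 // pi_gt0. Qed.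

Lemma normc_sub_cis_sqr x y :
  normc (cis x - cis y) ^+ 2 = 4 * sin ((x - y) / 2) ^+ 2.
Proof.
rewrite -normsqE /normsq /cis; simpc => /=.
rewrite sin2cos2.
have := cos_mulr2n ((x - y) / 2).
have -> : (x - y) / 2 *+ 2 = x - y by rewrite -mulr_natr; field.
rewrite cosB => h.
have e : cos ((x - y) / 2) ^+ 2 = (cos x * cos y + sin x * sin y + 1) / 2.
  by rewrite h -mulr_natr; field.
rewrite e.
have := cos2Dsin2 x; have := cos2Dsin2 y => hy hx.
have -> : (cos x - cos y) ^+ 2 + (sin x - sin y) ^+ 2 =
  (cos x ^+ 2 + sin x ^+ 2) + (cos y ^+ 2 + sin y ^+ 2)
  - 2 * (cos x * cos y + sin x * sin y) by ring.
by rewrite hx hy; field.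
Qed.

Lemma sin_MVT x : 0 < x -> exists2 c : R, 0 < c < x & sin x = cos c * x.
Proof.
move=> x0.
have d y : y \in `]0, x[ -> is_derive y 1 (@sin R) (cos y).
  by move=> _; exact: is_derive_sin.
have c : {within `[0, x], continuous (@sin R)}.
  by apply: continuous_subspaceT => y; exact: continuous_sin.
have [e] := MVT x0 d c.
by rewrite in_itv /= sin0 !subr0 => he ->; exists e.
Qed.

Lemma abs_sin_le x : `|sin x| <= `|x|.
Proof.
have pos y : 0 < y -> `|sin y| <= `|y|.
  move=> y0; have [c _ ->] := sin_MVT y0.
  by rewrite normrM ler_piMl// cos_max.
have [x0|x0|->] := ltgtP x 0; last by rewrite sin0.
- by rewrite -(normrN x) -(normrN (sin x)) -sinN pos// oppr_gt0.
- exact: pos.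
Qed.

Lemma sin_sqr_le x : sin x ^+ 2 <= x ^+ 2.
Proof.
rewrite -(real_normK (num_real (sin x))) -(real_normK (num_real x)).
by rewrite ler_pXn2r ?nnegrE// abs_sin_le.
Qed.

Lemma cis_lipschitz x y : normc (cis x - cis y) <= `|x - y|.
Proof.
rewrite -(@ler_pXn2r _ 2)// ?nnegrE ?normc_ge0// normc_sub_cis_sqr.
rewrite (real_normK (num_real (x - y))).
apply: (@le_trans _ _ (4 * ((x - y) / 2) ^+ 2)); first by rewrite ler_pM2l// sin_sqr_le.
by rewrite le_eqVlt; apply/orP; left; apply/eqP; field.
Qed.

Lemma normc_cisB_le2 x y : normc (cis x - cis y) <= 2.
Proof. by apply: le_trans (normcB _ _) _; rewrite !normc_cis. Qed.

(** On [[0, 1]] the mean value theorem gives [sin x >= x cos 1], and [cos 1 >= 1/2] follows from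
    [|e^i - 1| <= 1]; on [[1, pi/2]] monotonicity and [pi/2 < 2] are enough. *)
Lemma sin_ge_quarter x : 0 <= x <= pi / 2 -> x / 4 <= sin x.
Proof.
move=> /andP[]; rewrite le_eqVlt => /predU1P[<- _|x0 xp].
  by rewrite sin0 mul0r.
have cos1 : 2^-1 <= cos (1 : R).
  have := normc_sub_cis_sqr (1 : R) 0; rewrite cis0 subr0 -normsqE /normsq /cis; simpc => /=.
  have h2 := sin_sqr_le (1 / 2 : R).
  have := cos2Dsin2 (1 : R).
  by rewrite mul1r in h2 *; nra.
have sm y : 0 < y <= 1 -> y / 2 <= sin y.
  move=> /andP[y0 y1]; have [c /andP[c0 cy] ->] := sin_MVT y0.
  have c1 : cos 1 <= cos c.
    have cpi1 : (1 : R) <= pi by apply: le_trans (pi_ge2 R); rewrite ler1n.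
    rewrite leNgt ltr_cos -?leNgt ?in_itv /= ?ler01 ?cpi1 ?(ltW c0) //=.
    - by apply: ltW; apply: lt_le_trans cy y1.
    - by apply: le_trans cpi1; apply: ltW; apply: lt_le_trans cy y1.
  by rewrite mulrC ler_pM2r//; exact: le_trans cos1 c1.
have [x1|x1] := leP x 1.
  apply: le_trans (sm x _); last by rewrite x0.
  by nra.
have h1 : sin 1 <= sin x.
  have p1 := pihalf_ge1 R; have p0 := pi_gt0 R.
  rewrite leNgt ltr_sin -?leNgt ?in_itv /= ?(ltW x1)//; lra.
apply: le_trans h1; apply: le_trans (sm 1 _); last by rewrite ltr01 lexx.
by have := pihalf_lt2 R; lra.
Qed.

(** [|1 - e^(ix)| = 2 |sin (x/2)|]: within half a period of 0 the chord is comparable with the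
    distance to the period lattice. *)
Lemma cis_chord_ge x : `|x| <= pi -> `|x| / 4 <= normc (1 - cis x).
Proof.
move=> xpi.
rewrite -(@ler_pXn2r _ 2)// ?nnegrE ?normc_ge0// ?divr_ge0//.
rewrite -cis0 normc_sub_cis_sqr sub0r.
have -> : sin (- x / 2) ^+ 2 = sin (`|x| / 2) ^+ 2.
  by case: (ler0P x) => _ //; rewrite mulNr sinN sqrrN.
have h : `|x| / 2 / 4 <= sin (`|x| / 2).
  by apply: sin_ge_quarter; rewrite divr_ge0//= ler_pM2r.
have h0 : 0 <= `|x| by [].
nra.
Qed.

End normc_cis.

Section complex_integral.
Variable R : realType.
Local Notation mu := (@lebesgue_measure R).
Local Notation T := (measurableTypeR R).
Implicit Types (D : set T) (f g : T -> R[i]) (z : R[i]).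

Definition rintegrable D (f : T -> R) := mu.-integrable D (EFin \o f).

Lemma rintegrableD D (f g : T -> R) : measurable D ->
  rintegrable D f -> rintegrable D g -> rintegrable D (fun x => f x + g x).
Proof. by move=> mD hf hg; exact: (integrableD mD hf hg). Qed.

Lemma rintegrableB D (f g : T -> R) : measurable D ->
  rintegrable D f -> rintegrable D g -> rintegrable D (fun x => f x - g x).
Proof. by move=> mD hf hg; exact: (integrableB mD hf hg). Qed.

Lemma rintegrableZ D (f : T -> R) a : measurable D ->
  rintegrable D f -> rintegrable D (fun x => a * f x).
Proof. by move=> mD hf; exact: (integrableZl mD a hf). Qed.

Lemma rintegrable_sum D (I : Type) (r : seq I) (P : pred I) (F : I -> T -> R) :
  measurable D -> (forall i, P i -> rintegrable D (F i)) ->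
  rintegrable D (fun x => \sum_(i <- r | P i) F i x).
Proof.
move=> mD hF; elim: r => [|i r IH].
  apply: (eq_integrable mD (cst 0%E)); last exact: integrable0.
  by move=> x _ /=; rewrite big_nil.
case: (boolP (P i)) => Pi.
  apply: (eq_integrable mD (EFin \o (fun x => F i x + \sum_(i <- r | P i) F i x))).
    by move=> x _ /=; rewrite big_cons Pi.
  by apply: rintegrableD => //; exact: hF.
apply: (eq_integrable mD _ _ _ IH) => x _ /=.
by rewrite big_cons (negbTE Pi).
Qed.

Lemma rintegrable_le D (f g : T -> R) : measurable D -> measurable_fun D f ->
  rintegrable D g -> (forall x, D x -> `|f x| <= g x) -> rintegrable D f.
Proof.
move=> mD mf hg fg; apply: (le_integrable mD _ _ hg); first exact/measurable_EFinP.
move=> x Dx /=; rewrite lee_fin; apply: le_trans (fg x Dx) _; exact: ler_norm.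
Qed.

Lemma rintegrable_cont a b (f : R -> R) : continuous f -> rintegrable `[a, b] f.
Proof.
move=> cf; apply: continuous_compact_integrable; first exact: segment_compact.
exact: continuous_subspaceT.
Qed.

Lemma rintegrable_measurable D (f : T -> R) : rintegrable D f -> measurable_fun D f.
Proof. by case/integrableP => /measurable_EFinP. Qed.

Lemma continuous_measurable_on D (f : T -> R) : continuous f -> measurable_fun D f.
Proof.
by move=> cf; apply: measurable_funTS; exact: continuous_measurable_fun.
Qed.

Lemma lebesgue_measure_cc a b : a <= b -> mu `[a, b] = (b - a)%:E.
Proof.
move=> ab; rewrite lebesgue_measure_itv/= lte_fin; case: ltP => // ba.
by have -> : b = a; rewrite ?subrr//; apply/eqP; rewrite eq_le ba ab.
Qed.

Lemma Rintegral_cst_itv a b r : a <= b ->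
  Rintegral mu `[a, b] (fun=> r) = r * (b - a).
Proof.
move=> ab; rewrite Rintegral_cst//; congr (_ * _).
exact: (congr1 fine (lebesgue_measure_cc ab)).
Qed.

Lemma Rintegral_sum D (I : Type) (r : seq I) (P : pred I) (F : I -> T -> R) :
  measurable D -> (forall i, P i -> rintegrable D (F i)) ->
  Rintegral mu D (fun x => \sum_(i <- r | P i) F i x) =
  \sum_(i <- r | P i) Rintegral mu D (F i).
Proof.
move=> mD hF; elim: r => [|i r IH].
  rewrite big_nil; under eq_Rintegral do rewrite big_nil.
  by rewrite Rintegral_cst// mul0r.
rewrite big_cons; case: ifPn => Pi.
  rewrite -IH -RintegralD//; first by apply: eq_Rintegral => x _; rewrite big_cons Pi.
    exact: hF.
  exact: rintegrable_sum.
by rewrite -IH; apply: eq_Rintegral => x _; rewrite big_cons (negbTE Pi).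
Qed.

Definition Cintegrable D f :=
  rintegrable D (fun x => complex.Re (f x)) /\ rintegrable D (fun x => complex.Im (f x)).

Lemma eq_Cintegrable D f g : measurable D -> (forall x, D x -> f x = g x) ->
  Cintegrable D f -> Cintegrable D g.
Proof.
move=> mD fg [h1 h2]; split.
  by apply: (eq_integrable mD _ _ _ h1) => x /set_mem Dx /=; rewrite fg.
by apply: (eq_integrable mD _ _ _ h2) => x /set_mem Dx /=; rewrite fg.
Qed.

Lemma eq_Cintegral D f g : (forall x, D x -> f x = g x) ->
  Cintegral D f = Cintegral D g.
Proof.
move=> fg; rewrite /Cintegral.
by congr (_ +i* _); apply: eq_Rintegral => x /set_mem Dx; rewrite fg.
Qed.

Lemma CintegrableD D f g : measurable D -> Cintegrable D f -> Cintegrable D g ->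
  Cintegrable D (fun x => f x + g x).
Proof.
move=> mD [f1 f2] [g1 g2]; split.
  by apply: (eq_integrable mD _ _ _ (rintegrableD mD f1 g1)) => x _ /=; rewrite ReD.
by apply: (eq_integrable mD _ _ _ (rintegrableD mD f2 g2)) => x _ /=; rewrite ImD.
Qed.

Lemma CintegrableZ D z f : measurable D -> Cintegrable D f ->
  Cintegrable D (fun x => z * f x).
Proof.
move=> mD [f1 f2]; split.
  apply: (eq_integrable mD _ _ _ (rintegrableB mD (rintegrableZ (complex.Re z) mD f1)
    (rintegrableZ (complex.Im z) mD f2))) => x _ /=; by rewrite Re_mul.
apply: (eq_integrable mD _ _ _ (rintegrableD mD (rintegrableZ (complex.Re z) mD f2)
    (rintegrableZ (complex.Im z) mD f1))) => x _ /=; by rewrite Im_mul.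
Qed.

Lemma CintegrableB D f g : measurable D -> Cintegrable D f -> Cintegrable D g ->
  Cintegrable D (fun x => f x - g x).
Proof.
move=> mD hf hg; apply: (eq_Cintegrable mD _ (CintegrableD mD hf (CintegrableZ (-1) mD hg))).
by move=> x _; rewrite mulN1r.
Qed.

Lemma CintegralD D f g : measurable D -> Cintegrable D f -> Cintegrable D g ->
  Cintegral D (fun x => f x + g x) = Cintegral D f + Cintegral D g.
Proof.
move=> mD [f1 f2] [g1 g2]; rewrite /Cintegral; simpc; congr (_ +i* _).
  by rewrite -RintegralD//; apply: eq_Rintegral => x _; rewrite ReD.
by rewrite -RintegralD//; apply: eq_Rintegral => x _; rewrite ImD.
Qed.

Lemma CintegralZ D z f : measurable D -> Cintegrable D f ->
  Cintegral D (fun x => z * f x) = z * Cintegral D f.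
Proof.
move=> mD [f1 f2]; rewrite /Cintegral [z in RHS]complexE; case: z => a b /=; simpc.
congr (_ +i* _).
  rewrite -!RintegralZl// -RintegralB//; try exact: rintegrableZ.
  by apply: eq_Rintegral => x _; rewrite Re_mul.
rewrite -!RintegralZl// -RintegralD//; try exact: rintegrableZ.
by apply: eq_Rintegral => x _; rewrite Im_mul.
Qed.

Lemma CintegralB D f g : measurable D -> Cintegrable D f -> Cintegrable D g ->
  Cintegral D (fun x => f x - g x) = Cintegral D f - Cintegral D g.
Proof.
move=> mD hf hg; rewrite -[X in _ - X]mul1r -mulNr -CintegralZ// -CintegralD//.
  by apply: eq_Cintegral => x _; rewrite mulN1r.
exact: CintegrableZ.
Qed.

Lemma Cintegrable_sum D (I : Type) (r : seq I) (P : pred I) (F : I -> T -> R[i]) :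
  measurable D -> (forall i, P i -> Cintegrable D (F i)) ->
  Cintegrable D (fun x => \sum_(i <- r | P i) F i x).
Proof.
move=> mD hF; split.
  apply: (eq_integrable mD _ _ _ (@rintegrable_sum D _ r P (fun i x => complex.Re (F i x)) mD _)).
    by move=> x _ /=; rewrite Re_sum.
  by move=> i /hF [].
apply: (eq_integrable mD _ _ _ (@rintegrable_sum D _ r P (fun i x => complex.Im (F i x)) mD _)).
  by move=> x _ /=; rewrite Im_sum.
by move=> i /hF [].
Qed.

Lemma Cintegral_sum D (I : Type) (r : seq I) (P : pred I) (F : I -> T -> R[i]) :
  measurable D -> (forall i, P i -> Cintegrable D (F i)) ->
  Cintegral D (fun x => \sum_(i <- r | P i) F i x) =
  \sum_(i <- r | P i) Cintegral D (F i).
Proof.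
move=> mD hF; apply/eqP; rewrite eq_complex; apply/andP; split; apply/eqP.
  rewrite Re_sum /= -Rintegral_sum//; last by move=> i /hF [].
  by apply: eq_Rintegral => x _; rewrite Re_sum.
rewrite Im_sum /= -Rintegral_sum//; last by move=> i /hF [].
by apply: eq_Rintegral => x _; rewrite Im_sum.
Qed.

Lemma Cintegral_conj D f : measurable D -> Cintegrable D f ->
  Cintegral D (fun x => (conjc (f x))) = (conjc (Cintegral D f)).
Proof.
move=> mD [_ h]; rewrite /Cintegral /=; congr (_ +i* _).
  by apply: eq_Rintegral => x _; case: (f x).
rewrite -mulN1r -RintegralZl//; apply: eq_Rintegral => x _; rewrite mulN1r.
by case: (f x).
Qed.

Lemma measurable_normc D f : measurable_fun D (fun x => complex.Re (f x)) ->
  measurable_fun D (fun x => complex.Im (f x)) ->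
  measurable_fun D (fun x => normc (f x)).
Proof.
move=> m1 m2; have -> : (fun x => normc (f x)) =
    Num.sqrt \o (fun x => complex.Re (f x) ^+ 2 + complex.Im (f x) ^+ 2).
  by apply/funext => x /=; case: (f x).
apply: measurableT_comp.
  by apply: continuous_measurable_fun; exact: sqrt_continuous.
by apply: measurable_funD; exact: measurable_funX.
Qed.

Lemma rintegrable_normc D f : measurable D -> Cintegrable D f ->
  rintegrable D (fun x => normc (f x)).
Proof.
move=> mD [h1 h2].
apply: (@rintegrable_le _ _ (fun x => `|complex.Re (f x)| + `|complex.Im (f x)|)) => //.
- by apply: measurable_normc; exact: rintegrable_measurable.
- by apply: rintegrableD => //; exact: integrable_norm.
- by move=> x _; rewrite ger0_norm ?normc_ge0// normc_le_ReIm.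
Qed.

Lemma Cintegrable_le D f (g : R -> R) : measurable D ->
  measurable_fun D (fun x => complex.Re (f x)) ->
  measurable_fun D (fun x => complex.Im (f x)) ->
  rintegrable D g -> (forall x, D x -> normc (f x) <= g x) -> Cintegrable D f.
Proof.
move=> mD m1 m2 hg fg; split; apply: (rintegrable_le mD _ hg) => // x Dx.
  by apply: le_trans (normc_Re _) _; exact: fg.
by apply: le_trans (normc_Im _) _; exact: fg.
Qed.

(** Multiplication by the conjugate of the integral makes it real, which reduces the inequality to
    one for real parts. *)
Lemma normc_Cintegral D f : measurable D -> Cintegrable D f ->
  normc (Cintegral D f) <= Rintegral mu D (fun x => normc (f x)).
Proof.
move=> mD hf; set z := Cintegral D f.
have ge0 : 0 <= Rintegral mu D (fun x => normc (f x)).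
  by apply: Rintegral_ge0 => x _; exact: normc_ge0.
have [->|z0] := eqVneq z 0; first by rewrite normc0.
have nz : 0 < normc z.
  by rewrite lt_neqAle normc_ge0 andbT eq_sym; apply: contra z0 => /eqP/eq0_normc ->.
rewrite -(ler_pM2l nz) -expr2.
have -> : normc z ^+ 2 = Rintegral mu D (fun x => complex.Re ((conjc z) * f x)).
  have := normc_mulJ z; rewrite mulrC {1}/z -CintegralZ// => /(congr1 (@complex.Re R)) /= <-.
  by [].
rewrite -RintegralZl//; last exact: rintegrable_normc.
apply: le_Rintegral => //.
- exact: (CintegrableZ (conjc z) mD hf).1.
- by apply: rintegrableZ => //; exact: rintegrable_normc.
- move=> x _; apply: le_trans (ler_norm _) _; apply: le_trans (normc_Re _) _.
  by rewrite normcM normcJ.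
Qed.

Definition Ccontinuous f :=
  continuous (fun x => complex.Re (f x)) /\ continuous (fun x => complex.Im (f x)).

Lemma CcontinuousD f g : Ccontinuous f -> Ccontinuous g -> Ccontinuous (fun x => f x + g x).
Proof.
move=> [f1 f2] [g1 g2]; split.
  under eq_fun do rewrite ReD; by move=> x; apply: continuousD; [exact: f1|exact: g1].
under eq_fun do rewrite ImD; by move=> x; apply: continuousD; [exact: f2|exact: g2].
Qed.

Lemma CcontinuousM f g : Ccontinuous f -> Ccontinuous g -> Ccontinuous (fun x => f x * g x).
Proof.
move=> [f1 f2] [g1 g2]; split.
  under eq_fun do rewrite Re_mul; move=> x.
  by apply: cvgB; apply: cvgM; [exact: f1|exact: g1|exact: f2|exact: g2].
under eq_fun do rewrite Im_mul; move=> x.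
by apply: cvgD; apply: cvgM; [exact: f1|exact: g2|exact: f2|exact: g1].
Qed.

Lemma Ccontinuous_cst z : Ccontinuous (fun=> z).
Proof. by split => x; exact: cst_continuous. Qed.

Lemma Ccontinuous_real (f : R -> R) : continuous f -> Ccontinuous (fun x => (f x)%:C).
Proof. by move=> cf; split => //= x; exact: cst_continuous. Qed.

Lemma Ccontinuous_cis (f : R -> R) : continuous f -> Ccontinuous (fun x => cis (f x)).
Proof.
move=> cf; split => x /=.
  by apply: (@continuous_comp _ _ _ f cos); [exact: cf|exact: continuous_cos].
by apply: (@continuous_comp _ _ _ f sin); [exact: cf|exact: continuous_sin].
Qed.

Lemma continuous_mulc (a : R) : continuous (fun x : R => a * x).
Proof. by move=> x; apply: continuousM; [exact: cst_continuous|exact: cvg_id]. Qed.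

Lemma Ccontinuous_cis_lin a : Ccontinuous (fun x => cis (a * x)).
Proof. by apply: Ccontinuous_cis; exact: continuous_mulc. Qed.

Lemma Ccontinuous_sum (I : Type) (r : seq I) (P : pred I) (F : I -> T -> R[i]) :
  (forall i, P i -> Ccontinuous (F i)) -> Ccontinuous (fun x => \sum_(i <- r | P i) F i x).
Proof.
move=> hF; elim: r => [|i r IH].
  by under eq_fun do rewrite big_nil; exact: Ccontinuous_cst.
under eq_fun do rewrite big_cons.
case Pi : (P i) => //.
by apply: CcontinuousD => //; exact: hF.
Qed.

Lemma Cintegrable_cont a b f : Ccontinuous f -> Cintegrable `[a, b] f.
Proof. by move=> [h1 h2]; split; exact: rintegrable_cont. Qed.

Lemma continuous_normc f : Ccontinuous f -> continuous (fun x => normc (f x)).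
Proof.
move=> [h1 h2]; have -> : (fun x => normc (f x)) =
    Num.sqrt \o (fun x => complex.Re (f x) ^+ 2 + complex.Im (f x) ^+ 2).
  by apply/funext => x /=; case: (f x).
move=> x; apply: continuous_comp; last exact: sqrt_continuous.
by apply: cvgD; under eq_fun do rewrite expr2; apply: cvgM; (exact: h1 || exact: h2).
Qed.

Lemma CintegrableM_cont a b f g B : Cintegrable `[a, b] f -> Ccontinuous g ->
  (forall x, normc (g x) <= B) -> Cintegrable `[a, b] (fun x => f x * g x).
Proof.
move=> hf [g1 g2] gB; have [[f1 f2] mD] := (hf, measurable_itv `[a, b]).
have [mf1 mf2] := (rintegrable_measurable f1, rintegrable_measurable f2).
have mg1 := continuous_measurable_on (D := `[a, b]) g1.
have mg2 := continuous_measurable_on (D := `[a, b]) g2.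
apply: (@Cintegrable_le _ _ (fun x => B * normc (f x))) => //.
- rewrite (_ : (fun x => _) = fun x => complex.Re (f x) * complex.Re (g x) -
    complex.Im (f x) * complex.Im (g x)); last by apply/funext => x; rewrite Re_mul.
  by apply: measurable_funB; exact: measurable_funM.
- rewrite (_ : (fun x => _) = fun x => complex.Re (f x) * complex.Im (g x) +
    complex.Im (f x) * complex.Re (g x)); last by apply/funext => x; rewrite Im_mul.
  by apply: measurable_funD; exact: measurable_funM.
- by apply: rintegrableZ => //; exact: rintegrable_normc.
- by move=> x _; rewrite normcM mulrC ler_wpM2r ?normc_ge0.
Qed.

Lemma Cintegral_cis (a b om : R) : a < b -> om != 0 ->
  Cintegral `[a, b] (fun x => cis (om * x)) = (cis (om * b) - cis (om * a)) / (0 +i* om).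
Proof.
move=> ab om0.
have dlin (x : R) : is_derive x (1 : R) (fun y : R => om * y) om.
  by rewrite -[X in is_derive _ _ _ X]mulr1; exact: is_deriveZ.
have ftc (F f : R -> R) : (forall x : R, is_derive x (1 : R) F (f x)) -> continuous f ->
    Rintegral mu `[a, b] f = F b - F a.
  move=> dF cf; have dv x : derivable F x 1 by case: (dF x).
  rewrite /Rintegral (@continuous_FTC2 R f F)//.
  - exact: continuous_subspaceT.
  - have cF : continuous F.
      by move=> x; apply: differentiable_continuous; apply/derivable1_diffP; exact: dv.
    split; [by move=> x _; exact: dv| |].
      exact: cvg_at_right_filter (cF a).
    exact: cvg_at_left_filter (cF b).
  - by move=> x _; rewrite derive1E; by case: (dF x).
rewrite /Cintegral /cis /=.
have [c1 c2] := Ccontinuous_cis_lin om.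
have d1 (x : R) : is_derive x (1 : R) (fun x => om^-1 * sin (om * x)) (cos (om * x)).
  have := is_deriveZ om^-1 (is_derive1_comp (is_derive_sin (om * x)) (dlin x)).
  by move=> h; apply: (@is_derive_eq _ _ _ _ _ _ _ _ h); rewrite /GRing.scale /= mulrCA mulVf ?mulr1.
have d2 (x : R) : is_derive x (1 : R) (fun x => - om^-1 * cos (om * x)) (sin (om * x)).
  have := is_deriveZ (- om^-1) (is_derive1_comp (is_derive_cos (om * x)) (dlin x)).
  by move=> h; apply: (@is_derive_eq _ _ _ _ _ _ _ _ h); rewrite /GRing.scale /=; field.
rewrite (ftc _ _ d1 c1) (ftc _ _ d2 c2).
have omC : (0 +i* om) != 0 :> R[i] by rewrite eq_complex negb_and /= om0 orbT.
apply: (mulIf omC); rewrite divfK//; simpc; congr (_ +i* _); field => //.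
Qed.

Lemma Cintegral_cis_period (om P : R) : 0 < P -> om != 0 -> cis (om * P) = 1 ->
  Cintegral `[0, P] (fun x => cis (om * x)) = 0.
Proof. by move=> P0 om0 h; rewrite Cintegral_cis// h mulr0 cis0 subrr mul0r. Qed.

Lemma Cintegral_cst (a b : R) z : a <= b -> Cintegral `[a, b] (fun=> z) = z * (b - a)%:C.
Proof. by move=> ab; rewrite /Cintegral !Rintegral_cst_itv//; case: z => p q; simpc. Qed.

End complex_integral.

(** Indexed as in [airy_partial_sum], but as a sequence of integers, so that sums over it can be
    reindexed by permutations and compared by inclusion. *)
Definition zrange (K : nat) : seq int := [seq j%:Z - K%:Z | j <- iota 0 K.*2.+1].

Lemma zrange_uniq K : uniq (zrange K).
Proof. by rewrite map_inj_uniq ?iota_uniq// => i j /addIr []. Qed.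

Lemma mem_zrange K (n : int) : (n \in zrange K) = (`|n|%N <= K)%N.
Proof.
apply/mapP/idP => [[j]|h]; first by rewrite mem_iota => h ->; lia.
by exists (absz (n + K%:Z)); [rewrite mem_iota|]; lia.
Qed.

Lemma big_zrange (S : nmodType) K (F : int -> S) :
  \sum_(n <- zrange K) F n = \sum_(j < K.*2.+1) F (j%:Z - K%:Z).
Proof. by rewrite big_map -val_enum_ord big_map big_enum. Qed.

(** * Orthogonality of exponentials with possibly equal frequencies *)

Section exponential_sums.
Variable R : realType.
Local Notation mu := (@lebesgue_measure R).
Local Notation T := (measurableTypeR R).
Implicit Types (p : int -> R[i]) (s : seq int).

Lemma CintegralR (D : set T) (h : T -> R) :
  Cintegral D (fun x => (h x)%:C) = (Rintegral mu D h)%:C.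
Proof. by rewrite /Cintegral /=; congr (_ +i* _); rewrite /Rintegral integral0. Qed.

Lemma Ccontinuous_normsq (f : T -> R[i]) : Ccontinuous f -> continuous (fun x => normsq (f x)).
Proof.
move=> [h1 h2] x; rewrite /normsq.
by apply: cvgD; under eq_fun do rewrite expr2; apply: cvgM; (exact: h1 || exact: h2).
Qed.

Lemma exp_sum_continuous (I : Type) (s : seq I) (a : I -> R[i]) (om : I -> R) :
  Ccontinuous (fun x => \sum_(i <- s) a i * cis (om i * x)).
Proof.
apply: Ccontinuous_sum => i _; apply: CcontinuousM; first exact: Ccontinuous_cst.
exact: Ccontinuous_cis_lin.
Qed.

(** Pairs of indices with different frequencies integrate to zero over a common period. Frequencies
    may coincide, so the diagonal becomes the relation [om i == om j]: along the line distinct [n]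
    can share a frequency, and for the fourth moment the indices are pairs. *)
Lemma exp_sum_L2 (I : Type) (s : seq I) (a : I -> R[i]) (om : I -> R) (P : R) :
  0 < P -> (forall i j, cis ((om i - om j) * P) = 1) ->
  (Rintegral mu `[0, P] (fun x => normsq (\sum_(i <- s) a i * cis (om i * x))))%:C =
  P%:C * \sum_(i <- s) \sum_(j <- s | om i == om j) a i * (conjc (a j)).
Proof.
move=> P0 hP; rewrite -CintegralR.
have e x : (normsq (\sum_(i <- s) a i * cis (om i * x)))%:C =
    \sum_(i <- s) \sum_(j <- s) a i * (conjc (a j)) * cis ((om i - om j) * x).
  rewrite normsqE -normc_mulJ. rewrite rmorph_sum mulr_suml; apply: eq_bigr => i _.
  rewrite mulr_sumr; apply: eq_bigr => j _.
  by rewrite /= conjcM -cisN mulrBl cisD; ring.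
have ii i j : Cintegrable `[0, P] (fun x => a i * (conjc (a j)) * cis ((om i - om j) * x)).
  by apply: Cintegrable_cont; apply: CcontinuousM; [exact: Ccontinuous_cst|exact: Ccontinuous_cis_lin].
rewrite (eq_Cintegral (fun x _ => e x)) Cintegral_sum//; last by move=> i _; exact: Cintegrable_sum.
rewrite mulr_sumr; apply: eq_bigr => i _; rewrite Cintegral_sum//.
rewrite mulr_sumr [RHS]big_mkcond /=; apply: eq_bigr => j _.
rewrite CintegralZ//; last exact: (Cintegrable_cont _ _ (Ccontinuous_cis_lin _)).
case: eqP => [->|/eqP h].
  rewrite subrr; under eq_Cintegral do rewrite mul0r cis0.
  by rewrite Cintegral_cst ?ltW// mul1r subr0 mulrC.
by rewrite Cintegral_cis_period ?subr_eq0// mulr0.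
Qed.

End exponential_sums.

(** * Square integrable functions on the torus and Bessel's inequality *)

Section torus_L2.
Variable R : realType.
Local Notation mu := (@lebesgue_measure R).
Local Notation T := (measurableTypeR R).
Local Notation per := (period R).
Local Notation D := (`[0, per]%classic : set T).
Implicit Types (p : int -> R[i]) (s : seq int) (f : T -> R).

Definition square_integrable f := measurable_fun D f /\ rintegrable D (fun x => f x ^+ 2).

Definition trig s p (x : R) : R[i] := \sum_(n <- s) p n * cis (n%:~R * x).

Lemma square_integrable_rintegrable f : square_integrable f -> rintegrable D f.
Proof.
move=> [mf hf]; apply: (@rintegrable_le _ _ _ (fun x => 1 + f x ^+ 2)) => //.
  apply: rintegrableD => //; apply: rintegrable_cont => x; exact: cst_continuous.
move=> x _; rewrite -(real_normK (num_real (f x))).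
by have := sqr_ge0 (`|f x| - 1); have := normr_ge0 (f x); nra.
Qed.

Lemma square_integrableM f g : square_integrable f -> square_integrable g ->
  rintegrable D (fun x => f x * g x).
Proof.
move=> [mf hf] [mg hg]; apply: (@rintegrable_le _ _ _ (fun x => f x ^+ 2 + g x ^+ 2)) => //.
- exact: measurable_funM.
- exact: rintegrableD.
- move=> x _; rewrite normrM -(real_normK (num_real (f x))) -(real_normK (num_real (g x))).
  by have := sqr_ge0 (`|f x| - `|g x|); have := normr_ge0 (f x); have := normr_ge0 (g x); nra.
Qed.

Lemma fourier_integrable f n : rintegrable D f ->
  Cintegrable D (fun x => (f x)%:C * cis (- (n%:~R * x))).
Proof.
move=> hf; apply: (@CintegrableM_cont _ _ _ _ _ 1).
- split => //=; apply: (eq_integrable _ (cst 0%E)) => //; exact: integrable0.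
- by under eq_fun do rewrite -mulNr; exact: Ccontinuous_cis_lin.
- by move=> x; rewrite normc_cis.
Qed.

Lemma Cintegral_fourier f n : Cintegral D (fun x => (f x)%:C * cis (- (n%:~R * x))) =
  per%:C * fourier f n.
Proof.
rewrite /fourier mulrA -rmorphM mulfV ?mul1r//.
by rewrite gt_eqF// period_gt0.
Qed.

Lemma trig_continuous s p : Ccontinuous (trig s p).
Proof. exact: exp_sum_continuous. Qed.

Lemma trig_L2 s p : uniq s ->
  Rintegral mu D (fun x => normsq (trig s p x)) = per * \sum_(n <- s) normsq (p n).
Proof.
move=> us; apply: complexI; rewrite (@exp_sum_L2 _ _ s p (fun n : int => n%:~R) per (period_gt0 R)).
  rewrite rmorphM; congr (_ * _); rewrite rmorph_sum.
  apply: eq_big_seq => n ns; rewrite -big_filter.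
  have -> : [seq j <- s | n%:~R == j%:~R :> R] = [:: n].
    rewrite (@eq_filter _ _ (pred1 n)); first exact: filter_pred1_uniq.
    by move=> j; rewrite eqr_int eq_sym.
  by rewrite big_seq1 normc_mulJ normsqE.
by move=> i j; rewrite -rmorphB /= cis_period_int.
Qed.

Lemma rintegrable_dist f s p : square_integrable f ->
  rintegrable D (fun x => normsq ((f x)%:C - trig s p x)).
Proof.
move=> [mf hf]; have [c1 c2] := trig_continuous s p.
apply: (@rintegrable_le _ _ _ (fun x => 2 * f x ^+ 2 + 2 * normsq (trig s p x))) => //.
- rewrite /normsq /=; apply: measurable_funD; apply: measurable_funX.
    rewrite (_ : (fun x => _) = fun x => f x - complex.Re (trig s p x)).
      by apply: measurable_funB => //; exact: continuous_measurable_on.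
    by apply/funext => x; rewrite ReD ReN.
  rewrite (_ : (fun x => _) = fun x => 0 - complex.Im (trig s p x)).
    by apply: measurable_funB => //; exact: continuous_measurable_on.
  by apply/funext => x; rewrite ImD ImN.
- apply: rintegrableD => //; apply: rintegrableZ => //.
  by apply: rintegrable_cont; apply: Ccontinuous_normsq; exact: trig_continuous.
- move=> x _; rewrite ger0_norm /normsq ?addr_ge0 ?sqr_ge0// ReD ImD ReN ImN /=.
  by have := sqr_ge0 (f x + complex.Re (trig s p x)); have := sqr_ge0 (complex.Im (trig s p x)); nra.
Qed.

(** Pythagoras for an arbitrary trigonometric polynomial: the choice [p = fourier f] gives Bessel's
    inequality, and a general [p] the best approximation property. *)
Lemma dist_trig f s p : square_integrable f -> uniq s ->
  Rintegral mu D (fun x => normsq ((f x)%:C - trig s p x)) =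
  Rintegral mu D (fun x => f x ^+ 2) - per * \sum_(n <- s) normsq (fourier f n)
  + per * \sum_(n <- s) normsq (p n - fourier f n).
Proof.
move=> hf us; have [mf hf2] := hf; have hf1 := square_integrable_rintegrable hf.
pose h x := (f x)%:C * (conjc (trig s p x)).
have hsum : h = fun x => \sum_(n <- s) (conjc (p n)) * ((f x)%:C * cis (- (n%:~R * x))).
  apply/funext => x; rewrite /h /trig rmorph_sum mulr_sumr; apply: eq_bigr => n _.
  by rewrite /= conjcM cisN; ring.
have ih : Cintegrable D h.
  rewrite hsum; apply: Cintegrable_sum => // n _; apply: CintegrableZ => //.
  exact: fourier_integrable.
have eh : Cintegral D h = per%:C * \sum_(n <- s) (conjc (p n)) * fourier f n.
  rewrite hsum Cintegral_sum//; last first.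
    by move=> n _; apply: CintegrableZ => //; exact: fourier_integrable.
  rewrite mulr_sumr; apply: eq_bigr => n _; rewrite CintegralZ//; last exact: fourier_integrable.
  by rewrite Cintegral_fourier; ring.
have it : rintegrable D (fun x => normsq (trig s p x)).
  by apply: rintegrable_cont; apply: Ccontinuous_normsq; exact: trig_continuous.
have e x : normsq ((f x)%:C - trig s p x) =
    (f x ^+ 2 + normsq (trig s p x)) + (-2) * complex.Re (h x).
  rewrite /normsq ReD ImD ReN ImN Re_mul ReJ ImJ /=; ring.
rewrite (eq_Rintegral _ (fun x _ => e x)).
have [ih1 _] := ih.
rewrite RintegralD//; [|exact: rintegrableD|exact: rintegrableZ].
rewrite RintegralD// RintegralZl// trig_L2//.
have -> : Rintegral mu D (fun x => complex.Re (h x)) = complex.Re (Cintegral D h) by [].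
rewrite eh Re_mul /= mul0r subr0 Re_sum -addrA -[RHS]addrA; congr (_ + _).
rewrite !mulr_sumr -!sumrN -!big_split /=; apply: eq_bigr => n _.
rewrite /normsq ReD ImD ReN ImN Re_mul ReJ ImJ; ring.
Qed.

Lemma bessel f s : square_integrable f -> uniq s ->
  \sum_(n <- s) normsq (fourier f n) <= per^-1 * Rintegral mu D (fun x => f x ^+ 2).
Proof.
move=> hf us; rewrite ler_pdivlMl ?period_gt0// -subr_ge0.
have := dist_trig (fourier f) hf us.
rewrite (big1 _ _ (fun n => normsq (fourier f n - fourier f n))); last first.
  by move=> n _; rewrite subrr normsqE normc0 expr0n.
rewrite mulr0 addr0 => <-; apply: Rintegral_ge0 => x _.
by rewrite normsqE sqr_ge0.
Qed.

End torus_L2.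

(** * Trigonometric approximation on the torus *)

Section kernel.
Variable R : realType.
Local Notation mu := (@lebesgue_measure R).
Local Notation T := (measurableTypeR R).
Local Notation per := (period R).
Local Notation D := (`[0, per]%classic : set T).

(** The mean of [((1 + cos z) / 2)^N] is [C(2N, N) / 4^N]. The bound says that the mass of the
    kernel [peak] decays only polynomially, while its values away from the peaks decay
    geometrically. *)
Lemma central_bin_ge N : (4 ^ N <= N.*2.+1 * 'C(N.*2, N))%N.
Proof.
elim: N => [//|N IH].
have /= h1 := mul_bin_diag N.*2.+2 N; have /= h2 := mul_bin_diag N.*2.+1 N.
have h3 : 'C(N.*2.+1, N.+1) = 'C(N.*2.+1, N).
  by rewrite -[RHS]bin_sub; [congr 'C(_, _)|]; lia.
rewrite doubleS expnS; rewrite h3 in h2.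
rewrite -(@leq_pmul2l N.+1)//; set x := 'C(N.*2.+2, N.+1) in h1 *.
set y := 'C(N.*2.+1, N) in h1 h2 *; set z := 'C(N.*2, N) in IH h2.
by nia.
Qed.

(** This is [cos^(2N) (z/2)], a nonnegative trigonometric polynomial of degree [N] peaked at the
    multiples of the period: an approximate identity after division by its mass. *)
Definition peak N (z : R) : R := ((1 + cos z) / 2) ^+ N.

Definition peak_coef N (n : int) : R[i] := ('C(N.*2, absz (n + N%:Z)%R)%:R / 4 ^+ N)%:C.

(** Binomial theorem in [(1 + cos z) / 2 = e^(-iz) (1 + e^(iz))^2 / 4]. *)
Lemma peak_trig N z : (peak N z)%:C = trig (zrange N) (peak_coef N) z.
Proof.
have e : ((1 + cos z) / 2)%:C = cis (- z) * (1 + cis z) ^+ 2 / 4 :> R[i].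
  have -> : cis (- z) * (1 + cis z) ^+ 2 =
    cis (- z) + 2 * (cis (- z) * cis z) + cis (- z) * cis z * cis z by ring.
  rewrite cisNl mulr1 mul1r /cis cosN sinN.
  have -> : 4 = (4 : R)%:C by rewrite rmorph_nat.
  have -> : 2 = (2 : R)%:C by rewrite rmorph_nat.
  rewrite -fmorphV; simpc; congr (_ +i* _); last by ring.
  by field.
rewrite /peak rmorphXn /= -/(real_complex _) e expr_div_n exprMn -exprM mulnC muln2 -mulrA.
rewrite exprDn mulr_suml mulr_sumr /trig big_zrange.
apply: eq_bigr => j _; rewrite expr1n mul1r /peak_coef subrK absz_nat.
have -> : cis ((j%:Z - N%:Z)%:~R * z) = cis (- z) ^+ N * cis z ^+ j.
  by rewrite !cisMn -cisD; congr cis; rewrite intrB -!pmulrn; ring.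
have -> : ('C(N.*2, j)%:R / 4 ^+ N)%:C = 'C(N.*2, j)%:R / 4 ^+ N :> R[i].
  by rewrite rmorphM fmorphV rmorphXn /= !rmorph_nat.
by rewrite -mulr_natl; set c := _^-1; ring.
Qed.

Lemma peak_ge0 N z : 0 <= peak N z.
Proof. by rewrite exprn_ge0// divr_ge0// -lerBlDl sub0r cos_geN1. Qed.

Lemma peak_continuous N : continuous (peak N).
Proof.
move=> x; apply: (@continuous_comp _ _ _ (fun z => (1 + cos z) / 2) (fun t => t ^+ N)); last exact: exprn_continuous.
by apply: cvgM; [apply: cvgD; [exact: cvg_cst|exact: continuous_cos]|exact: cvg_cst].
Qed.

Lemma peak_shift_continuous N x : continuous (fun y : R => peak N (x - y)).
Proof.
move=> y; apply: (@continuous_comp _ _ _ (fun y => x - y) (peak N)); last exact: peak_continuous.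
by apply: cvgB; [exact: cvg_cst|exact: cvg_id].
Qed.

Definition peak_mass N : R := per * ('C(N.*2, N)%:R / 4 ^+ N).

Lemma trig_shift s (p : int -> R[i]) x y : trig s p (x - y) =
  \sum_(n <- s) p n * cis (n%:~R * x) * cis (- (n%:~R * y)).
Proof. by apply: eq_bigr => n _; rewrite mulrBr cisD mulrA. Qed.

Lemma peak_mass_eq N x : Rintegral mu D (fun y => peak N (x - y)) = peak_mass N.
Proof.
apply: complexI; rewrite -CintegralR.
have ci n : Ccontinuous (fun y => peak_coef N n * cis (n%:~R * x) * cis (- (n%:~R * y))).
  apply: CcontinuousM; first exact: Ccontinuous_cst.
  by under eq_fun do rewrite -mulNr; exact: Ccontinuous_cis_lin.
rewrite (eq_Cintegral (fun y _ => etrans (peak_trig N (x - y)) (trig_shift _ _ x y))).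
rewrite Cintegral_sum//; last by move=> n _; exact: Cintegrable_cont.
rewrite (bigD1_seq 0) ?zrange_uniq ?mem_zrange//= big1 ?addr0.
  under eq_Cintegral do rewrite !mul0r oppr0 cis0 !mulr1.
  rewrite Cintegral_cst ?ltW ?period_gt0// subr0 /peak_coef /peak_mass add0r absz_nat.
  by rewrite -rmorphM mulrC.
move=> n n0; rewrite CintegralZ//; last first.
  by apply: Cintegrable_cont; under eq_fun do rewrite -mulNr; exact: Ccontinuous_cis_lin.
under eq_Cintegral do rewrite -mulNr.
rewrite Cintegral_cis_period ?mulr0 ?period_gt0// ?oppr_eq0 ?intr_eq0//.
by rewrite -intrN cis_period_int.
Qed.

Lemma peak_mass_ge N : per / (N.*2.+1)%:R <= peak_mass N.
Proof.
rewrite ler_pM2l ?period_gt0// ler_pdivlMr ?exprn_gt0// ler_pdivrMl// -natrX -natrM ler_nat.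
exact: central_bin_ge.
Qed.

(** Both points lie in one period and [x] keeps the distance [eta] from its ends, so [|x - y|] stays
    [eta] away from 0 and from the next peak at [per]. *)
Lemma peak_tail (eta x y : R) N : 0 < eta -> eta <= pi ->
  eta <= x <= per - eta -> 0 <= y <= per -> eta <= `|x - y| ->
  peak N (x - y) <= ((1 + cos eta) / 2) ^+ N.
Proof.
move=> e0 epi /andP[x1 x2] /andP[y1 y2] xy.
have hp : per = pi + pi by rewrite /period mulr2n.
rewrite lerXn2r ?nnegrE ?divr_ge0// -?lerBlDl ?sub0r ?cos_geN1//.
rewrite ler_pM2r// lerD2l -(cos_norm (x - y)).
set t := `|x - y| in xy *.
have t2 : t <= per - eta by rewrite /t ler_norml; lra.
have [tp|tp] := leP t pi.
  by rewrite leNgt ltr_cos -?leNgt// in_itv/=; lra.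
have -> : cos t = cos (per - t).
  by rewrite -cosN -(cosD2pi (- t)) /period addrC.
by rewrite leNgt ltr_cos -?leNgt ?in_itv/=; lra.
Qed.

End kernel.

Section density.
Variable R : realType.
Local Notation mu := (@lebesgue_measure R).
Local Notation T := (measurableTypeR R).
Local Notation per := (period R).
Local Notation D := (`[0, per]%classic : set T).

Lemma continuous_segment_unif (g : R -> R) (a b e : R) : continuous g -> 0 < e ->
  exists2 eta : R, 0 < eta &
    forall x y, a <= x <= b -> `|x - y| < eta -> `|g x - g y| <= e.
Proof.
move=> cg e0.
have h : forall x, `[a, b]%classic x -> \forall x' \near x & i \near 0^'+,
    forall y, `|x' - y| < i -> `|g x' - g y| <= e.
  move=> x _; have /cvgrPdist_le /(_ (e / 2)) := cg x.
  rewrite divr_gt0// => /(_ isT) /nbhs_ballP [d /= d0 hd].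
  have d2 : 0 < d / 2 by rewrite divr_gt0.
  exists (ball x (d / 2), [set i | i < d / 2]) => /=.
    by split; [exact: nbhsx_ballx|exact: nbhs_right_lt].
  move=> [x' i] /= [xx' hi] y yi.
  have xx'' : ball x d x' by apply: le_ball xx'; rewrite ler_pdivrMr// ler_pMr// ler1n.
  have xy : ball x d y.
    rewrite /ball /= in xx' *.
    apply: le_lt_trans (ler_distD x' _ _) _.
    by have := lt_trans yi hi; lra.
  apply: le_trans (ler_distD (g x) _ _) _.
  by have := hd _ xx''; have := hd _ xy; rewrite (distrC (g x')); lra.
have H := (@compact_near_coveringP R `[a, b]).1 (@segment_compact R a b) R 0^'+ _ _ h.
have {}H := H (at_right_proper_filter (0 : R)).
have [eta [eta0 He]] : exists eta : R, 0 < eta /\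
    `[a, b]%classic `<=` (fun x => forall y, `|x - y| < eta -> `|g x - g y| <= e).
  have [eta /= [h1 h2]] := @filter_ex _ (0 : R)^'+ _ _ (filterI H (nbhs_right_gt (0 : R))).
  by exists eta.
by exists eta => // x y xab; apply: He; rewrite /= in_itv.
Qed.

Lemma bernoulli_ge (x : R) n : 0 <= x -> 1 + n%:R * x <= (1 + x) ^+ n.
Proof.
move=> x0; elim: n => [|n IH]; first by rewrite mul0r addr0 expr0.
rewrite exprS -nat1r; apply: (@le_trans _ _ ((1 + x) * (1 + n%:R * x))).
  by have := mulr_ge0 (ler0n R n) (sqr_ge0 x); nra.
by rewrite ler_wpM2l// addr_ge0.
Qed.

(** With [N = 2m], one factor [rho^m] absorbs the linear growth by Bernoulli's inequality for
    [rho^-1], and the other one tends to 0. *)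
Lemma expr_linear_small (rho B delta : R) : 0 < rho -> rho < 1 -> 0 <= B -> 0 < delta ->
  exists N : nat, B * (N.*2.+1)%:R * rho ^+ N <= delta.
Proof.
move=> r0 r1 B0 d0; pose s := rho^-1 - 1.
have s0 : 0 < s by rewrite subr_gt0 invf_gt1.
have C0 : 0 < B * (1 + 4 / s) + 1.
  by rewrite ltr_wpDl// mulr_ge0// addr_ge0// divr_ge0// ltW.
have : rho ^+ n @[n --> \oo] --> 0 by apply: cvg_expr; rewrite gtr0_norm.
move/cvgrPdist_le => /(_ (delta / (B * (1 + 4 / s) + 1))).
rewrite divr_gt0// => /(_ isT) [m _ /(_ m (leqnn m))] /=.
rewrite sub0r normrN ger0_norm ?exprn_ge0 ?(ltW r0)// ler_pdivlMr// => hm.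
exists m.*2; rewrite -[in X in rho ^+ X]addnn exprD.
have rm : 0 <= rho ^+ m by rewrite exprn_ge0// ltW.
have h : (m.*2.*2.+1)%:R * rho ^+ m <= 1 + 4 / s.
  have es : 1 + s = rho^-1 by rewrite /s addrC subrK.
  have := bernoulli_ge m (ltW s0); rewrite es exprVn => hb.
  have rmp : 0 < rho ^+ m by rewrite exprn_gt0.
  have hb1 : (1 + m%:R * s) * rho ^+ m <= 1.
    by rewrite -ler_pdivlMr// mul1r.
  have -> : (m.*2.*2.+1)%:R = 1 + 4 * m%:R :> R.
    by rewrite -addn1 natrD addrC -!muln2 !natrM; congr (_ + _); ring.
  have h1 : rho ^+ m <= 1 by rewrite exprn_ile1// ltW.
  have m0 : 0 <= m%:R :> R by [].
  rewrite mulrDl mul1r lerD// -mulrA ler_pM2l// -[leRHS]mul1r ler_pdivlMr//.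
  by nra.
have : B * ((m.*2.*2.+1)%:R * rho ^+ m) * rho ^+ m <= B * (1 + 4 / s) * rho ^+ m.
  by rewrite ler_wpM2r// ler_wpM2l.
rewrite mulrDr mulr1 in hm; rewrite (mulrC (rho ^+ m)) in hm.
have : 0 <= 1 * rho ^+ m by rewrite mul1r.
by rewrite -!mulrA => h2 h3; rewrite mulrDl in hm; lra.
Qed.

Lemma rintegrable_indic (a b : R) : rintegrable D (\1_(`[a, b]%classic : set T)).
Proof.
apply: (@rintegrable_le _ _ _ (fun=> 1)) => //.
- by apply: rintegrable_cont => x; exact: cst_continuous.
- by move=> x _; rewrite indicE ger0_norm// lern1 leq_b1.
Qed.

Lemma Rintegral_indic_le (a b : R) : a <= b -> Rintegral mu D (\1_(`[a, b]%classic : set T)) <= b - a.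
Proof.
move=> ab; rewrite /Rintegral integral_indic//.
have m1 : measurable (`[a, b]%classic : set T) by [].
have h : (mu (`[a, b]%classic `&` D) <= (b - a)%:E)%E.
  rewrite -lebesgue_measure_cc//; apply: le_measure; rewrite ?inE//; first exact: measurableI.
apply: (@fine_le _ (mu (`[a, b]%classic `&` D)) ((b - a)%:E)) => //.
by rewrite ge0_fin_numE//; exact: le_lt_trans h (ltry _).
Qed.

(** Here [c] is the convolution of [g] over one period with the normalised kernel. As [g] need not
    be periodic, it approximates [g] only away from the two ends; near them just the bound [2 M] is
    left. The factor [2N + 1] is the price of the normalisation. *)
Lemma peak_approx (g : R -> R) (M eta delta : R) N (x : R) : continuous g ->
  (forall y, 0 <= y <= per -> `|g y| <= M) ->
  0 < eta -> eta <= pi ->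
  (forall x y, 0 <= x <= per -> `|x - y| < eta -> `|g x - g y| <= delta) ->
  0 <= x <= per ->
  let c x := (peak_mass R N)^-1 * Rintegral mu D (fun y => g y * peak N (x - y)) in
  `|g x - c x| <= 2 * M /\
  (eta <= x <= per - eta ->
   `|g x - c x| <= delta + 2 * M * (N.*2.+1)%:R * ((1 + cos eta) / 2) ^+ N).
Proof.
move=> cg gM e0 epi hg xD c.
have m0 : 0 < peak_mass R N.
  by apply: lt_le_trans (peak_mass_ge R N); rewrite divr_gt0// period_gt0.
have ip : rintegrable D (fun y => peak N (x - y)).
  by apply: rintegrable_cont; exact: peak_shift_continuous.
have ig : rintegrable D (fun y => g y * peak N (x - y)).
  by apply: rintegrable_cont => y; apply: cvgM; [exact: cg|exact: peak_shift_continuous].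
have M0 : 0 <= M by apply: le_trans (gM x xD); exact: normr_ge0.
have e : g x - c x = (peak_mass R N)^-1 * Rintegral mu D (fun y => (g x - g y) * peak N (x - y)).
  rewrite /c.
  have -> : Rintegral mu D (fun y => (g x - g y) * peak N (x - y)) =
      g x * peak_mass R N - Rintegral mu D (fun y => g y * peak N (x - y)).
    rewrite -(peak_mass_eq N x) -RintegralZl// -RintegralB//; last exact: rintegrableZ.
    by apply: eq_Rintegral => y _; rewrite mulrBl.
  by field; rewrite gt_eqF.
have bound (h : R -> R) : rintegrable D h ->
    (forall y, 0 <= y <= per -> `|g x - g y| * peak N (x - y) <= h y) ->
    `|g x - c x| <= (peak_mass R N)^-1 * Rintegral mu D h.
  move=> ih hh; rewrite e normrM ger0_norm ?invr_ge0 ?(ltW m0)//.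
  rewrite ler_pM2l ?invr_gt0//.
  have ib : rintegrable D (fun y => (g x - g y) * peak N (x - y)).
    apply: rintegrable_cont => y; apply: cvgM; last exact: peak_shift_continuous.
    by apply: cvgB; [exact: cvg_cst|exact: cg].
  apply: le_trans (le_normr_Rintegral _ ib) _ => //.
  apply: le_Rintegral => //; first exact: integrable_norm.
  move=> y; rewrite /= in_itv /= => yD; rewrite normrM (ger0_norm (peak_ge0 _ _)).
  exact: hh.
split.
  apply: le_trans (bound (fun y => 2 * M * peak N (x - y)) _ _) _.
  - exact: rintegrableZ.
  - move=> y yD; rewrite ler_wpM2r ?peak_ge0//.
    by apply: le_trans (ler_normB _ _) _; have := gM x xD; have := gM y yD; lra.
  - by rewrite RintegralZl// peak_mass_eq mulrCA mulVf ?gt_eqF// mulr1.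
move=> hx; set rN := ((1 + cos eta) / 2) ^+ N.
have rN0 : 0 <= rN by rewrite exprn_ge0// divr_ge0// -lerBlDl sub0r cos_geN1.
have dl0 : 0 <= delta.
  by have := hg x x xD; rewrite !subrr normr0 => /(_ e0).
apply: le_trans (bound (fun y => delta * peak N (x - y) + 2 * M * rN) _ _) _.
- apply: rintegrableD => //; first exact: rintegrableZ.
  by apply: rintegrable_cont => y; exact: cst_continuous.
- move=> y yD; have [xy|xy] := ltP `|x - y| eta.
    rewrite ler_wpDr ?mulr_ge0//.
    by rewrite ler_wpM2r ?peak_ge0// hg.
  rewrite ler_wpDl ?mulr_ge0 ?peak_ge0//.
  apply: ler_pM => //; first exact: peak_ge0.
    by apply: le_trans (ler_normB _ _) _; have := gM x xD; have := gM y yD; lra.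
  exact: peak_tail.
- rewrite RintegralD//; last 2 first.
    exact: rintegrableZ.
    by apply: rintegrable_cont => y; exact: cst_continuous.
  rewrite RintegralZl// peak_mass_eq (Rintegral_cst_itv _ (ltW (period_gt0 R))) subr0.
  rewrite [leLHS](_ : _ = delta + (peak_mass R N)^-1 * (2 * M * rN * per)); last first.
    by field; rewrite gt_eqF.
  rewrite lerD2l.
  rewrite ler_pdivrMl//.
  have h := peak_mass_ge R N; rewrite ler_pdivrMr ?ltr0n// in h.
  have -> : peak_mass R N * (2 * M * (N.*2.+1)%:R * rN) =
    2 * M * rN * (peak_mass R N * (N.*2.+1)%:R) by ring.
  by rewrite ler_wpM2l// !mulr_ge0.
Qed.

End density.

Section completeness.
Variable R : realType.
Local Notation mu := (@lebesgue_measure R).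
Local Notation T := (measurableTypeR R).
Local Notation per := (period R).
Local Notation D := (`[0, per]%classic : set T).
Local Notation L2 := (@square_integrable R).

Lemma continuous_square_integrable (g : T -> R) : continuous g -> L2 g.
Proof.
move=> cg; split; first exact: continuous_measurable_on.
by apply: rintegrable_cont => x; under eq_fun do rewrite expr2; apply: cvgM; exact: cg.
Qed.

Lemma continuous_bounded_segment (g : R -> R) (a b : R) : a <= b -> continuous g ->
  exists M, forall x, a <= x <= b -> `|g x| <= M.
Proof.
move=> ab cg; have cn : {within `[a, b], continuous (fun x => `|g x|)}.
  by apply: continuous_subspaceT => x; apply: cvg_norm; exact: cg.
have [c _ hc] := EVT_max ab cn.
by exists `|g c| => x xab; apply: hc; rewrite in_itv.
Qed.

(** The two end intervals, where the approximation may fail, have length at most [eta] each and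
    contribute at most [4 M^2] per unit length. *)
Lemma trig_dense_continuous (g : R -> R) (e : R) : continuous g -> 0 < e ->
  exists K p, Rintegral mu D (fun x => normsq ((g x)%:C - trig (zrange K) p x)) <= e.
Proof.
move=> cg e0; have p0 := period_gt0 R; have pi0 := pi_gt0 R.
have [M0 hM0] := continuous_bounded_segment (ltW p0) cg.
pose M := `|M0| + 1.
have M1 : 0 < M by rewrite ltr_wpDl.
have gM y : 0 <= y <= per -> `|g y| <= M.
  by move=> /hM0 h; apply: le_trans h _; apply: le_trans (ler_norm _) _; rewrite lerDl.
(* As [delta^2 <= delta], this gives [4 delta^2 per <= e/2]. *)
pose delta := Num.min 1 (e / (8 * per)).
have dl0 : 0 < delta by rewrite lt_min ltr01 divr_gt0// mulr_gt0.
have [eta1 eta1_0 heta] := continuous_segment_unif 0 per cg dl0.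
(* The last term makes [4 M^2] times the length [2 eta] of the end intervals at most [e/2]. *)
pose eta := Num.min (Num.min eta1 2^-1) (e / (16 * M ^+ 2)).
have eta0 : 0 < eta by rewrite !lt_min eta1_0 invr_gt0 ltr0n divr_gt0// mulr_gt0// exprn_gt0.
have eta_1 : eta <= 2^-1 by rewrite /eta !ge_min lexx !orbT.
have pi1 : 2 <= pi :> R := pi_ge2 R.
have etapi : eta <= pi by lra.
have eta_e : eta <= e / (16 * M ^+ 2) by rewrite /eta !ge_min lexx !orbT.
pose rho := (1 + cos eta) / 2.
have ce : cos eta < 1.
  by rewrite -cos0 ltr_cos ?in_itv//=; lra.
have cp : 0 < cos eta.
  by apply: cos_gt0_pihalf; have := pihalf_ge1 R; lra.
have [|||| N hN] := @expr_linear_small R rho (2 * M) delta.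
- by rewrite /rho; lra.
- by rewrite /rho; lra.
- by lra.
- by [].
pose c x := (peak_mass R N)^-1 * Rintegral mu D (fun y => g y * peak N (x - y)).
have hc x : 0 <= x <= per -> `|g x - c x| <= 2 * M /\
   (eta <= x <= per - eta -> `|g x - c x| <= 2 * delta).
  move=> xD; have [] := @peak_approx R g M eta delta N x cg gM eta0 etapi _ xD.
    move=> x1 y1 x1D xy; apply: heta => //.
    by apply: lt_le_trans xy _; rewrite /eta !ge_min lexx.
  move=> h1 h2; split=> // /h2 h; apply: le_trans h _.
  by rewrite /rho in hN; lra.
(* Convolution with a trigonometric polynomial yields one, and multiplies the coefficients. *)
pose p n := ((peak_mass R N)^-1 * per)%:C * peak_coef R N n * fourier g n.
have gi := square_integrable_rintegrable (continuous_square_integrable cg).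
have tp x : trig (zrange N) p x = (c x)%:C.
  rewrite /c rmorphM /= -/(real_complex R _) -CintegralR.
  have e1 y : (g y * peak N (x - y))%:C = \sum_(n <- zrange N)
      (peak_coef R N n * cis (n%:~R * x)) * ((g y)%:C * cis (- (n%:~R * y))).
    rewrite rmorphM /= peak_trig trig_shift mulr_sumr; apply: eq_bigr => n _.
    by rewrite mulrCA.
  rewrite (eq_Cintegral (fun y _ => e1 y)) Cintegral_sum//; last first.
    by move=> n _; apply: CintegrableZ => //; exact: fourier_integrable.
  rewrite mulr_sumr; apply: eq_bigr => n _.
  rewrite CintegralZ//; last exact: fourier_integrable.
  by rewrite Cintegral_fourier /p rmorphM /=; ring.
exists N, p.
pose I1 := \1_(`[0, eta]%classic : set T) : T -> R.
pose I2 := \1_(`[per - eta, per]%classic : set T) : T -> R.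
have i12 : rintegrable D (fun x => I1 x + I2 x) by apply: rintegrableD => //; exact: rintegrable_indic.
have ic (k : R) : rintegrable D (fun=> k) by apply: rintegrable_cont => x; exact: cst_continuous.
apply: (@le_trans _ _ (Rintegral mu D (fun x => 4 * delta ^+ 2 + 4 * M ^+ 2 * (I1 x + I2 x)))).
  apply: le_Rintegral => //.
  - exact/rintegrable_dist/continuous_square_integrable.
  - by apply: rintegrableD => //; exact: rintegrableZ.
  - move=> x; rewrite /= in_itv /= => xD; rewrite tp normsqE -rmorphB normcR.
    have [h1 h2] := hc x xD.
    have i1 : 0 <= I1 x by rewrite /I1 indicE.
    have i2 : 0 <= I2 x by rewrite /I2 indicE.
    have n0 := normr_ge0 (g x - c x).
    have [h|h] := boolP (eta <= x <= per - eta).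
      have := h2 h => {}h2; have : `|g x - c x| ^+ 2 <= 4 * delta ^+ 2 by nra.
      by move=> h3; apply: le_trans h3 _; rewrite lerDl !mulr_ge0// addr_ge0.
    have : 1 <= I1 x + I2 x.
      rewrite negb_and -!ltNge in h; case/orP: h => h.
        rewrite ler_wpDr// /I1 indicE mem_set//= in_itv/=; lra.
      rewrite ler_wpDl// /I2 indicE mem_set//= in_itv/=; lra.
    move=> i3; have : `|g x - c x| ^+ 2 <= 4 * M ^+ 2 by nra.
    move=> h3; apply: le_trans h3 _.
    have M2 : 0 <= M ^+ 2 by apply: sqr_ge0.
    have d2 : 0 <= delta ^+ 2 by apply: sqr_ge0.
    by nra.
have mD : measurable D by [].
rewrite (RintegralD mD (ic (4 * delta ^+ 2)) (rintegrableZ (4 * M ^+ 2) mD i12)).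
rewrite (RintegralZl _ mD i12) (RintegralD mD (rintegrable_indic 0 eta) (rintegrable_indic (per - eta) per)).
rewrite (Rintegral_cst_itv _ (ltW p0)) subr0.
have h1 := Rintegral_indic_le (ltW eta0); rewrite subr0 in h1.
have h2 : Rintegral mu D I2 <= eta.
  have ee : per - (per - eta) = eta by ring.
  by have := @Rintegral_indic_le R (per - eta) per; rewrite ee; apply; lra.
have hd : 4 * delta ^+ 2 * per <= e / 2.
  have d1 : delta <= 1 by rewrite /delta ge_min lexx.
  have d2 : delta <= e / (8 * per) by rewrite /delta ge_min lexx orbT.
  rewrite ler_pdivlMr ?mulr_gt0// in d2.
  have : delta ^+ 2 <= delta by rewrite expr2 ler_piMl// ltW.
  by nra.
have he : 4 * M ^+ 2 * (2 * eta) <= e / 2.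
  by rewrite ler_pdivlMr ?mulr_gt0 ?exprn_gt0// in eta_e; lra.
have M2 : 0 <= M ^+ 2 by apply: sqr_ge0.
have : 4 * M ^+ 2 * (Rintegral mu D I1 + Rintegral mu D I2) <= 4 * M ^+ 2 * (2 * eta).
  by rewrite ler_wpM2l ?mulr_ge0//; lra.
by lra.
Qed.

(** The map taking [a] to [a |a|] carries L^2 to L^1, and its inverse is Hölder continuous of
    exponent 1/2; this turns the density of continuous functions in L^1 into density in L^2. *)
Lemma signed_square_gap (a b : R) : (a - b) ^+ 2 <= 2 * `|a * `|a| - b * `|b| |.
Proof.
wlog ba : a b / b <= a.
  move=> h; have [/h//|ab] := leP b a.
  by rewrite -sqrrN opprB distrC; apply: h; exact: ltW.
have d : 0 <= a - b by rewrite subr_ge0.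
have key : (a - b) ^+ 2 <= 2 * (a * `|a| - b * `|b|).
  case: (ger0P a) => ha; case: (ger0P b) => hb.
  - by have := mulr_ge0 d ha; have := mulr_ge0 d hb; nra.
  - by have := sqr_ge0 (a + b); nra.
  - by lra.
  - have ha' : 0 <= - a by lra.
    have hb' : 0 <= - b by lra.
    by have := mulr_ge0 d ha'; have := mulr_ge0 d hb'; nra.
by apply: le_trans key _; rewrite ler_pM2l// ler_norm.
Qed.

Lemma trig_dense (f : T -> R) (e : R) : L2 f -> 0 < e ->
  exists K p, Rintegral mu D (fun x => normsq ((f x)%:C - trig (zrange K) p x)) <= e.
Proof.
have aux (x y : R) : x <= e / 8 -> y <= e / 4 -> 4 * x + 2 * y <= e by lra.
move=> hf e0; have [mf hf2] := hf.
pose h x := f x * `|f x|.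
have mh : measurable_fun D h by apply: measurable_funM => //; exact: measurableT_comp.
have ih : rintegrable D h.
  apply: (rintegrable_le _ mh hf2) => // x _.
  by rewrite /h normrM normr_id -expr2 real_normK// num_real.
have [k [ck ik hk]] : exists k : R -> R, [/\ continuous k, rintegrable D k &
    Rintegral mu D (fun x => `|h x - k x|) <= e / 8].
  have Dfin : (mu D < +oo)%E by rewrite lebesgue_measure_cc ?ltry// ltW// period_gt0.
  have [//|//|//|g_ [cg ig]] := @approximation_continuous_integrable R D h.
  move=> /fine_cvgP[] [m _ fgfin] /cvgrPdist_le /(_ (e / 8)).
  rewrite divr_gt0// => /(_ isT) [q _ /(_ _ (leq_addr m q))] /=.
  rewrite sub0r normrN => hq; exists (g_ (q + m)%N); split => //.
  - exact: ig.
  - by rewrite /Rintegral; apply: (le_trans _ hq); exact: (ler_norm (fine _)).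
(* The signed square root of [k], so that [g |g| = k]. *)
pose g x := Num.sqrt (k x) - Num.sqrt (- k x).
have cg : continuous g.
  move=> x; apply: cvgB.
    by apply: continuous_comp; [exact: ck|exact: sqrt_continuous].
  by apply: (@continuous_comp _ _ _ (fun x => - k x)); [apply: cvgN; exact: ck|exact: sqrt_continuous].
have gk x : g x * `|g x| = k x.
  rewrite /g; have [k0|k0] := leP 0 (k x).
    rewrite (ler0_sqrtr (a := - k x)) ?oppr_le0// subr0 ger0_norm ?sqrtr_ge0//.
    by rewrite -expr2 sqr_sqrtr.
  rewrite (ler0_sqrtr (ltW k0)) sub0r normrN ger0_norm ?sqrtr_ge0// mulNr -expr2 sqr_sqrtr ?opprK//.
  by rewrite oppr_ge0 ltW.
have e4 : 0 < e / 4 by rewrite divr_gt0.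
have [K [p hp]] := trig_dense_continuous cg e4.
exists K, p.
have i1 : rintegrable D (fun x => `|h x - k x|).
  by apply: integrable_norm; exact: (rintegrableB (measurable_itv _) ih ik).
have i2 := rintegrable_dist (zrange K) p (continuous_square_integrable cg).
apply: (@le_trans _ _ (Rintegral mu D (fun x => 4 * `|h x - k x| + 2 * normsq ((g x)%:C - trig (zrange K) p x)))).
  apply: le_Rintegral => //.
  - exact: rintegrable_dist.
  - by apply: rintegrableD => //; exact: rintegrableZ.
  - move=> x _; have := signed_square_gap (f x) (g x); rewrite gk -/(h x) /normsq !ReD !ImD /= ReN ImN !add0r.
    set A := `|_|; set B := complex.Re _; set C := complex.Im _.
    by have := sqr_ge0 (f x - g x - (g x - B)); have := sqr_ge0 C; nra.
rewrite RintegralD//; [|exact: rintegrableZ|exact: rintegrableZ].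
by rewrite !RintegralZl//; exact: aux.
Qed.

End completeness.

Lemma sum_subset (I : eqType) (V : numDomainType) (s s' : seq I) (F : I -> V) :
  uniq s -> uniq s' -> {subset s <= s'} -> (forall i, 0 <= F i) ->
  \sum_(i <- s) F i <= \sum_(i <- s') F i.
Proof.
move=> us us' ss F0.
rewrite [leRHS](bigID (mem s)) /= -[leLHS]addr0 lerD ?sumr_ge0//.
rewrite le_eqVlt; apply/orP; left; apply/eqP; rewrite -[RHS]big_filter; apply: perm_big.
apply: uniq_perm => //; first exact: filter_uniq.
by move=> i; rewrite mem_filter; case: (boolP (i \in s)) => //= /ss ->.
Qed.

Lemma zrange_sub (K K' : nat) : (K <= K')%N -> {subset zrange K <= zrange K'}.
Proof. by move=> h n; rewrite !mem_zrange => /leq_trans; apply. Qed.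

(** * Projections on low frequencies and the coefficients of a square *)

Section projections.
Variable R : realType.
Local Notation mu := (@lebesgue_measure R).
Local Notation T := (measurableTypeR R).
Local Notation per := (period R).
Local Notation D := (`[0, per]%classic : set T).
Local Notation L2 := (@square_integrable R).
Implicit Types (f g : T -> R).

Definition energy f : R := Rintegral mu D (fun x => f x ^+ 2).

Definition proj_defect f K : R :=
  Rintegral mu D (fun x => normsq ((f x)%:C - trig (zrange K) (fourier f) x)).

Lemma energy_ge0 f : 0 <= energy f.
Proof. by apply: Rintegral_ge0 => x _; exact: sqr_ge0. Qed.

Lemma proj_defectE f K : L2 f ->
  proj_defect f K = energy f - per * \sum_(n <- zrange K) normsq (fourier f n).
Proof.
move=> hf; rewrite /proj_defect dist_trig ?zrange_uniq// [X in _ + per * X]big1 ?mulr0 ?addr0//.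
by move=> n _; rewrite subrr normsqE normc0 expr0n.
Qed.

(** The Fourier projection is the best approximation, and a larger range only improves it. *)
Lemma proj_defect_le f K K' p : L2 f -> (K <= K')%N ->
  proj_defect f K' <= Rintegral mu D (fun x => normsq ((f x)%:C - trig (zrange K) p x)).
Proof.
move=> hf KK'; rewrite proj_defectE// dist_trig ?zrange_uniq// -/(energy f).
have per0 := period_gt0 R.
have : \sum_(n <- zrange K) normsq (fourier f n) <= \sum_(n <- zrange K') normsq (fourier f n).
  apply: sum_subset; rewrite ?zrange_uniq//; first exact: zrange_sub.
  by move=> n; rewrite normsqE sqr_ge0.
have : 0 <= \sum_(n <- zrange K) normsq (p n - fourier f n).
  by apply: sumr_ge0 => n _; rewrite normsqE sqr_ge0.
by nra.
Qed.

Lemma proj_defect_small f (e : R) : L2 f -> 0 < e ->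
  exists K0, forall K, (K0 <= K)%N -> proj_defect f K <= e.
Proof.
move=> hf e0; have [K [p hp]] := trig_dense hf e0.
by exists K => K' KK'; apply: le_trans hp; exact: proj_defect_le.
Qed.

Lemma L2B f g : L2 f -> L2 g -> L2 (fun x => f x - g x).
Proof.
move=> hf hg; have [[mf if2] [mg ig2]] := (hf, hg); split; first exact: measurable_funB.
have i := rintegrableD (measurable_itv _) (rintegrableB (measurable_itv _) if2
  (rintegrableZ 2 (measurable_itv _) (square_integrableM hf hg))) ig2.
by apply: (eq_integrable _ _ _ _ i) => // x _ /=; rewrite -EFinD || congr EFin; ring.
Qed.

(** The defect of [f] is controlled by that of a nearby [g]; with compactness this makes the tails
    small uniformly in time. *)
Lemma proj_defect_perturb f g K : L2 f -> L2 g ->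
  proj_defect f K <= 2 * energy (fun x => f x - g x) + 2 * proj_defect g K.
Proof.
move=> hf hg; have hfg := L2B hf hg.
apply: le_trans (@proj_defect_le f K K (fourier g) hf (leqnn K)) _.
have mD : measurable D by [].
have i1 := rintegrable_dist (zrange K) (fourier g) hg.
rewrite /energy /proj_defect -(RintegralZl _ mD hfg.2) -(RintegralZl _ mD i1).
rewrite -(RintegralD mD (rintegrableZ 2 mD hfg.2) (rintegrableZ 2 mD i1)).
apply: le_Rintegral => //.
- exact: rintegrable_dist.
- by apply: rintegrableD => //; apply: rintegrableZ => //; case: hfg.
- move=> x _; rewrite /normsq !ReD !ImD ReN ImN /= !add0r.
  set B := complex.Re _; set C := complex.Im _.
  by have := sqr_ge0 (f x - g x - (g x - B)); have := sqr_ge0 C; nra.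
Qed.

Lemma normc_fourier_le f n : rintegrable D f ->
  normc (fourier f n) <= per^-1 * Rintegral mu D (fun x => `|f x|).
Proof.
move=> hf; have per0 := period_gt0 R.
rewrite normcM normcR ger0_norm ?invr_ge0 ?(ltW per0)// ler_pM2l ?invr_gt0//.
apply: le_trans (normc_Cintegral _ (fourier_integrable n hf)) _ => //.
rewrite le_eqVlt; apply/orP; left; apply/eqP; apply: eq_Rintegral => x _.
by rewrite normcM normcR normc_cis mulr1.
Qed.

Lemma normc_fourier_sqr_le f n : L2 f ->
  normc (fourier (fun x => f x ^+ 2) n) <= per^-1 * energy f.
Proof.
move=> [mf hf]; apply: le_trans (normc_fourier_le n hf) _.
rewrite le_eqVlt; apply/orP; left; apply/eqP; congr (_ * _).
by apply: eq_Rintegral => x _; rewrite ger0_norm// sqr_ge0.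
Qed.

Lemma fourierB f g n : rintegrable D f -> rintegrable D g ->
  fourier (fun x => f x - g x) n = fourier f n - fourier g n.
Proof.
move=> hf hg; rewrite /fourier -mulrBr -CintegralB//; try exact: fourier_integrable.
by congr (_ * _); apply: eq_Cintegral => x _; rewrite rmorphB /= mulrBl.
Qed.

(** [f^2 - g^2 = (f - g)(f + g)] and Young's inequality with a free parameter: [lam] is taken small
    against the energy of [g], and only then the distance small against [lam]. *)
Lemma fourier_sqr_perturb f g n (lam : R) : L2 f -> L2 g -> 0 < lam ->
  normc (fourier (fun x => f x ^+ 2) n - fourier (fun x => g x ^+ 2) n) <=
  per^-1 * ((1 + lam^-1) * energy (fun x => f x - g x) + lam * energy g).
Proof.
move=> hf hg l0; have [[mf if2] [mg ig2]] := (hf, hg).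
have mD : measurable D by [].
have i1 := (L2B hf hg).2.
rewrite -fourierB//; apply: le_trans (normc_fourier_le _ (rintegrableB mD if2 ig2)) _.
rewrite ler_pM2l ?invr_gt0 ?period_gt0// /energy -(RintegralZl _ mD i1) -(RintegralZl _ mD ig2).
rewrite -(RintegralD mD (rintegrableZ _ mD i1) (rintegrableZ _ mD ig2)).
apply: le_Rintegral => //.
- by apply: integrable_norm; exact: (rintegrableB mD if2 ig2).
- by apply: rintegrableD => //; exact: rintegrableZ.
- move=> x _; rewrite subr_sqr normrM -[(_ - _) ^+ 2]real_normK ?num_real//.
  rewrite -[g x ^+ 2]real_normK ?num_real//.
  have : `|f x + g x| <= `|f x - g x| + 2 * `|g x|.
    have -> : f x + g x = (f x - g x) + 2 * g x by ring.
    by apply: le_trans (ler_normD _ _) _; rewrite normrM ger0_norm.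
  set a := `|f x - g x|; set b := `|g x| => hs.
  have a0 : 0 <= a by exact: normr_ge0.
  apply: (@le_trans _ _ (a * (a + 2 * b))); first by rewrite ler_wpM2l.
  rewrite -subr_ge0.
  have -> : (1 + lam^-1) * a ^+ 2 + lam * b ^+ 2 - a * (a + 2 * b) = lam^-1 * (a - lam * b) ^+ 2.
    by field; rewrite gt_eqF.
  by rewrite mulr_ge0 ?invr_ge0 ?sqr_ge0// ltW.
Qed.

(** The coefficients of the square of the truncated series: both indices are confined to the range,
    so the sum is finite for each [n] and symmetric. *)
Definition conv K (F : int -> R[i]) n : R[i] :=
  \sum_(a <- zrange K) \sum_(b <- zrange K | a + b == n) F a * F b.

Lemma Cintegral_trig_sqr K p n :
  Cintegral D (fun x => trig (zrange K) p x ^+ 2 * cis (- (n%:~R * x))) = per%:C * conv K p n.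
Proof.
have e x : trig (zrange K) p x ^+ 2 * cis (- (n%:~R * x)) =
    \sum_(a <- zrange K) \sum_(b <- zrange K) p a * p b * cis ((a + b - n)%:~R * x).
  rewrite expr2 {1}/trig !mulr_suml; apply: eq_bigr => a _.
  rewrite /trig mulr_sumr mulr_suml; apply: eq_bigr => b _.
  by rewrite intrB intrD mulrBl mulrDl !cisD; ring.
have ii a b : Cintegrable D (fun x => p a * p b * cis ((a + b - n)%:~R * x)).
  by apply: Cintegrable_cont; apply: CcontinuousM; [exact: Ccontinuous_cst|exact: Ccontinuous_cis_lin].
rewrite (eq_Cintegral (fun x _ => e x)) Cintegral_sum//; last by move=> i _; exact: Cintegrable_sum.
rewrite /conv mulr_sumr; apply: eq_bigr => a _; rewrite Cintegral_sum//.
rewrite mulr_sumr [RHS]big_mkcond /=; apply: eq_bigr => b _.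
rewrite CintegralZ//; last exact: (Cintegrable_cont _ _ (Ccontinuous_cis_lin _)).
rewrite -subr_eq0; case: eqP => [->|/eqP h].
  under eq_Cintegral do rewrite mul0r cis0.
  by rewrite (Cintegral_cst _ (ltW (period_gt0 R))) mul1r subr0 mulrC.
by rewrite Cintegral_cis_period ?mulr0 ?period_gt0// ?intr_eq0// cis_period_int.
Qed.

(** The splitting of [fourier_sqr_perturb], with the projection of [f] in place of a second
    function. The bound is uniform in [n]. *)
Lemma fourier_sqr_conv f n K (lam : R) : L2 f -> 0 < lam ->
  normc (fourier (fun x => f x ^+ 2) n - conv K (fourier f) n) <=
  per^-1 * ((1 + lam^-1) * proj_defect f K + lam * energy f).
Proof.
move=> hf l0; have [mf if2] := hf; have mD : measurable D by [].
have per0 := period_gt0 R.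
have perC : (per%:C : R[i]) != 0 by rewrite eq_complex negb_and /= gt_eqF.
pose P := trig (zrange K) (fourier f).
have cP : Ccontinuous P := trig_continuous _ _.
have cP2 : Ccontinuous (fun x => P x ^+ 2 * cis (- (n%:~R * x))).
  apply: CcontinuousM; first by under eq_fun do rewrite expr2; exact: CcontinuousM.
  by under eq_fun do rewrite -mulNr; exact: Ccontinuous_cis_lin.
have iP := Cintegrable_cont 0 per cP2.
have i2 := fourier_integrable n if2.
have -> : fourier (fun x => f x ^+ 2) n - conv K (fourier f) n =
   (per^-1)%:C * Cintegral D (fun x => ((f x ^+ 2)%:C - P x ^+ 2) * cis (- (n%:~R * x))).
  rewrite (eq_Cintegral (fun x _ => mulrBl _ _ _)) CintegralB// Cintegral_trig_sqr Cintegral_fourier.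
  by rewrite -mulrBr mulrA fmorphV mulVf ?mul1r.
rewrite normcM normcR ger0_norm ?invr_ge0 ?(ltW per0)// ler_pM2l ?invr_gt0//.
have iB : Cintegrable D (fun x => ((f x ^+ 2)%:C - P x ^+ 2) * cis (- (n%:~R * x))).
  by apply: (eq_Cintegrable _ _ (CintegrableB mD i2 iP)) => // x _; rewrite mulrBl.
apply: le_trans (normc_Cintegral _ iB) _ => //.
have i1 := rintegrable_dist (zrange K) (fourier f) hf.
rewrite /energy /proj_defect -(RintegralZl _ mD i1) -(RintegralZl _ mD if2).
rewrite -(RintegralD mD (rintegrableZ _ mD i1) (rintegrableZ _ mD if2)).
apply: le_Rintegral => //.
- exact: rintegrable_normc.
- by apply: rintegrableD => //; exact: rintegrableZ.
- move=> x _; rewrite normcM normc_cis mulr1 -/(P x) normsqE rmorphXn /= subr_sqr normcM.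
  rewrite -[f x ^+ 2]real_normK ?num_real//.
  have : normc ((f x)%:C + P x) <= normc ((f x)%:C - P x) + 2 * `|f x|.
    have -> : (f x)%:C + P x = (2 * f x)%:C - ((f x)%:C - P x) by rewrite rmorphM /= rmorph_nat; ring.
    apply: le_trans (normcB _ _) _.
    by rewrite normcR normrM [`|2|]ger0_norm// addrC.
  set a := normc (_ - _); set b := `|f x| => hs.
  have a0 : 0 <= a by exact: normc_ge0.
  apply: (@le_trans _ _ (a * (a + 2 * b))); first by rewrite ler_wpM2l.
  rewrite -subr_ge0.
  have -> : (1 + lam^-1) * a ^+ 2 + lam * b ^+ 2 - a * (a + 2 * b) = lam^-1 * (a - lam * b) ^+ 2.
    by field; rewrite gt_eqF.
  by rewrite mulr_ge0 ?invr_ge0 ?sqr_ge0// ltW.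
Qed.

Lemma fourier_eq0_ae f : L2 f -> (forall n, fourier f n = 0) ->
  {ae mu, forall x, D x -> f x = 0}.
Proof.
move=> hf f0; have [mf if2] := hf.
have e0 : energy f = 0.
  apply/eqP; rewrite eq_le energy_ge0 andbT; apply/ler_addgt0Pl => e e0.
  have [K /(_ K (leqnn K))] := proj_defect_small hf e0.
  rewrite proj_defectE// big1 ?mulr0 ?subr0 ?addr0// => n _.
  by rewrite f0 normsqE normc0 expr0n.
have mD : measurable D by [].
have : (\int[mu]_(x in D) `|(f x ^+ 2)%:E| = 0)%E.
  have fn := integrable_fin_num mD if2.
  rewrite (eq_integral (EFin \o (fun x => f x ^+ 2))); last first.
    by move=> x _ /=; rewrite ger0_norm// sqr_ge0.
  by rewrite -[LHS]fineK// -/(Rintegral _ _ _) -/(energy f) e0.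
move/(ae_eq_integral_abs _ mD (measurable_int _ if2)).
apply: filterS => x /= h Dx; have := h Dx => -[] /eqP.
by rewrite sqrf_eq0 => /eqP.
Qed.

End projections.

(** * Divisor bound and Weyl sums *)

Section divisor_bound.
Variable R : realType.

(** A divisor [d] of [m n] is the product of [gcd (d, m)], which divides [m], and of
    [d / gcd (d, m)], which divides [n]. *)
Lemma size_divisorsM m n : (0 < m)%N -> (0 < n)%N ->
  (size (divisors (m * n)) <= size (divisors m) * size (divisors n))%N.
Proof.
move=> m0 n0; rewrite -(size_allpairs muln); apply: uniq_leq_size; first exact: divisors_uniq.
move=> d; rewrite -dvdn_divisors ?muln_gt0 ?m0// => dmn.
have g0 : (0 < gcdn d m)%N by rewrite gcdn_gt0 m0 orbT.
have dg : d = (gcdn d m * (d %/ gcdn d m))%N by rewrite mulnC divnK// dvdn_gcdl.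
rewrite dg; apply: allpairs_f; first by rewrite -dvdn_divisors// dvdn_gcdr.
rewrite -dvdn_divisors//.
have co : coprime (d %/ gcdn d m) (m %/ gcdn d m).
  by rewrite /coprime -(eqn_pmul2r g0) muln_gcdl !divnK ?dvdn_gcdl ?dvdn_gcdr// mul1n.
rewrite -(Gauss_dvdr _ co) -(dvdn_pmul2l g0) -dg mulnA.
by rewrite [(gcdn d m * _)%N]mulnC divnK// dvdn_gcdr.
Qed.

Lemma size_divisors_pfactor p k : prime p -> (size (divisors (p ^ k)) <= k.+1)%N.
Proof.
move=> pp; have -> : k.+1 = size [seq (p ^ i)%N | i <- iota 0 k.+1] by rewrite size_map size_iota.
apply: uniq_leq_size; first exact: divisors_uniq.
move=> d; rewrite -dvdn_divisors ?expn_gt0 ?prime_gt0// => /(dvdn_pfactor _ _ pp)[m mk ->].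
by apply: map_f; rewrite mem_iota.
Qed.

(** Submultiplicativity reduces the bound to prime powers, where [k + 1 <= c p^(k e)] by Bernoulli's
    inequality, with [c = 1] as soon as [p^e >= 2]. Only the primes below [Q] cost a factor [c0]. *)
Lemma divisor_bound (e : R) : 0 < e -> exists2 C : R, 0 < C &
  forall n, (0 < n)%N -> (size (divisors n))%:R <= C * n%:R `^ e.
Proof.
move=> e0; pose be : R := 2 `^ e.
have be1 : 1 < be by have := @gt0_ltr_powR R e e0 1 2; rewrite powR1 !nnegrE ltr1n; exact.
pose c0 := 1 + (be - 1)^-1.
have c01 : 1 <= c0 by rewrite lerDl invr_ge0 subr_ge0 ltW.
have c0g : 0 < c0 by apply: lt_le_trans c01.
pose Q := (Num.truncn (2 `^ e^-1 : R)).+1.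
pose c (p : nat) := if (p < Q)%N then c0 else 1.
have pfac p k : prime p -> (k.+1)%:R <= c p * (p ^ k)%:R `^ e.
  move=> pp; have p2 : (2 : R) <= p%:R by rewrite ler_nat prime_gt1.
  have -> : (p ^ k)%:R `^ e = (p%:R `^ e) ^+ k :> R.
    by rewrite natrX -powR_mulrn// -powRrM mulrC powRrM powR_mulrn// powR_ge0.
  have mono (x : R) : 1 <= x -> x <= p%:R `^ e -> 1 + k%:R * (x - 1) <= (p%:R `^ e) ^+ k.
    move=> x1 xp; apply: (@le_trans _ _ (x ^+ k)).
      by apply: le_trans (@bernoulli_ge R (x - 1) k _) _; rewrite ?subr_ge0// addrC subrK.
    by rewrite lerXn2r// nnegrE ?powR_ge0//; exact: le_trans x1.
  rewrite /c; case: ltnP => pQ.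
    have hb : be <= p%:R `^ e by apply: ge0_ler_powR; rewrite ?nnegrE// ltW.
    have := mono be (ltW be1) hb => h.
    apply: le_trans (ler_wpM2l (ltW c0g) h).
    rewrite -nat1r /c0 mulrDl mul1r.
    have b0 : 0 < be - 1 by rewrite subr_gt0.
    have -> : (be - 1)^-1 * (1 + k%:R * (be - 1)) = (be - 1)^-1 + k%:R by field; rewrite gt_eqF.
    have : 0 <= (be - 1)^-1 by rewrite invr_ge0 ltW.
    by have := mulr_ge0 (ler0n R k) (ltW b0); lra.
  have hp : (2 : R) <= p%:R `^ e.
    have h2 : 2 `^ e^-1 <= p%:R :> R.
      by apply: ltW; apply: lt_le_trans (truncnS_gt _) _; rewrite ler_nat.
    have h3 : (2 `^ e^-1) `^ e <= p%:R `^ e.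
      by apply: ge0_ler_powR; rewrite ?nnegrE ?powR_ge0// ltW.
    by rewrite -powRrM mulVf ?gt_eqF// powRr1 in h3.
  have h12 : (1 : R) <= 2 by rewrite ler1n.
  have := mono 2 h12 hp; rewrite mul1r -nat1r.
  by lra.
exists (c0 ^+ Q); first by rewrite exprn_gt0.
move=> n n0.
have dprod (s : seq (nat * nat)) : all (fun f => prime f.1) s ->
  (size (divisors (\prod_(f <- s) f.1 ^ f.2)))%:R <=
  \prod_(f <- s) (c f.1) * (\prod_(f <- s) f.1 ^ f.2)%:R `^ e.
  elim: s => [|f s IH] /=; first by rewrite !big_nil powR1 mulr1.
  move=> /andP[pf /[dup] sP /IH {}IH]; rewrite !big_cons.
  set m := (\prod_(f <- s) f.1 ^ f.2)%N in IH *.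
  have m0 : (0 < m)%N.
    rewrite /m; elim: s sP {IH m} => [|f' s IH] /=; first by rewrite big_nil.
    by move=> /andP[pf' /IH h]; rewrite big_cons muln_gt0 h expn_gt0 prime_gt0.
  have f0 : (0 < f.1 ^ f.2)%N by rewrite expn_gt0 prime_gt0.
  apply: (@le_trans _ _ ((size (divisors (f.1 ^ f.2)))%:R * (size (divisors m))%:R)).
    by rewrite -natrM ler_nat size_divisorsM.
  rewrite natrM powRM// mulrACA ler_pM//.
  by apply: le_trans (pfac _ f.2 pf); rewrite ler_nat size_divisors_pfactor.
rewrite {1 2}(prod_prime_decomp n0).
apply: le_trans (dprod _ _) _.
  apply/allP => -[p k] /mem_prime_decomp [] //.
rewrite -(prod_prime_decomp n0) ler_wpM2r ?powR_ge0//.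
have -> : \prod_(f <- prime_decomp n) c f.1 = \prod_(p <- primes n) c p.
  by rewrite /primes /unzip1 big_map.
have -> : \prod_(p <- primes n) c p = c0 ^+ size [seq p <- primes n | (p < Q)%N].
  elim: (primes n) => [|p s IH]; first by rewrite big_nil expr0.
  by rewrite big_cons IH /c /=; case: ifP => _ /=; rewrite ?exprS ?mul1r.
apply: ler_weXn2l => //.
rewrite -[leqRHS](size_iota 0); apply: uniq_leq_size.
  by rewrite filter_uniq// primes_uniq.
by move=> p; rewrite mem_filter mem_iota => /andP[].
Qed.

End divisor_bound.

Section series_bounds.
Variable R : realType.

Lemma geometric_le (x : R) J : 0 <= x -> x < 1 -> \sum_(j < J) x ^+ j <= (1 - x)^-1.
Proof.
move=> x0 x1; have h : 0 < 1 - x by rewrite subr_gt0.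
rewrite -[leRHS]mul1r ler_pdivlMr// mulrC.
have -> : (1 - x) * (\sum_(j < J) x ^+ j) = 1 - x ^+ J.
  by apply: oppr_inj; rewrite -mulNr !opprB -subrX1.
by rewrite gerBl exprn_ge0.
Qed.

Lemma ler_sum_ord (F : nat -> R) M N : (M <= N)%N -> (forall i, 0 <= F i) ->
  \sum_(i < M) F i <= \sum_(i < N) F i.
Proof.
by move=> MN F0; rewrite -(subnKC MN) big_split_ord /= lerDl sumr_ge0.
Qed.

(** Dyadic blocks: the [2^J] terms from [2^J] on are each at most [2^(-pJ)], which leaves a
    geometric series of ratio [2^(1-p)]. *)
Lemma pseries_bound (p : R) : 1 < p -> exists2 C : R, 0 < C &
  forall n, \sum_(i < n) (i.+1)%:R `^ (- p) <= C.
Proof.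
move=> p1; pose x : R := 2 `^ (1 - p).
have x0 : 0 <= x by exact: powR_ge0.
have x1 : x < 1.
  rewrite /x -(opprB p) powRN invf_lt1 ?powR_gt0//.
  have p0 : 0 < p - 1 by rewrite subr_gt0.
  by have := gt0_ltr_powR p0 (x := 1) (y := 2); rewrite powR1 !nnegrE ltr1n; exact.
exists (1 - x)^-1; first by rewrite invr_gt0 subr_gt0.
have p0 : 0 < p by apply: lt_trans p1.
have dy J : \sum_(i < (2 ^ J).-1) (i.+1)%:R `^ (- p) <= \sum_(j < J) x ^+ j.
  elim: J => [|J IH]; first by rewrite !big_ord0.
  have e : (2 ^ J.+1).-1 = ((2 ^ J).-1 + 2 ^ J)%N.
    by have := expn_gt0 2 J; rewrite expnS /=; lia.
  rewrite e big_split_ord /= big_ord_recr /=; apply: lerD => //.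
  apply: (@le_trans _ _ (\sum_(i < 2 ^ J) (2 ^ J)%:R `^ (- p))).
    apply: ler_sum => i _; rewrite !powRN lef_pV2 ?posrE ?powR_gt0 ?ltr0n ?expn_gt0//.
    apply: ge0_ler_powR; rewrite ?nnegrE ?(ltW p0)// ler_nat.
    by have := expn_gt0 2 J; lia.
  have e2 : (2 ^ J)%:R = 2 `^ J%:R :> R by rewrite natrX powR_mulrn.
  have -> : x ^+ J = 2 `^ ((1 - p) * J%:R) by rewrite powRrM powR_mulrn// powR_ge0.
  rewrite sumr_const card_ord -[leLHS]mulr_natl e2 -powRrM -powRD; last by rewrite pnatr_eq0 implybT.
  by rewrite (_ : J%:R + J%:R * - p = (1 - p) * J%:R)//; ring.
move=> n; apply: le_trans (geometric_le n x0 x1); apply: le_trans (dy n).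
have hn : (n <= (2 ^ n).-1)%N by have := ltn_expl n (isT : 1 < 2)%N; lia.
by apply: (ler_sum_ord (F := fun i => i.+1%:R `^ (- p))) => // i; exact: powR_ge0.
Qed.

(** Comparison of [1/i] with [n^e i^(-1-e)]: the logarithm is weakened to a power at once, so that
    only powers occur in Weyl's inequality. *)
Lemma harmonic_bound (e : R) : 0 < e -> exists2 C : R, 0 < C &
  forall n, \sum_(i < n) (i.+1)%:R^-1 <= C * n%:R `^ e.
Proof.
move=> e0; have [|C C0 hC] := @pseries_bound (1 + e); first by rewrite ltrDl.
exists C => // n; apply: le_trans (ler_wpM2r (powR_ge0 _ _) (hC n)).
rewrite mulr_suml; apply: ler_sum => i _.
rewrite opprD powRD; last by rewrite pnatr_eq0 implybT.
rewrite powR_inv1// -mulrA ler_peMr ?invr_ge0// powRN mulrC.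
rewrite ler_pdivlMr ?powR_gt0// mul1r.
by apply: ge0_ler_powR; rewrite ?nnegrE ?(ltW e0)// ler_nat.
Qed.

End series_bounds.

(** * Weyl differencing of cubic sums *)

Section weyl_differencing.
Variable R : realType.
Implicit Types (z : nat -> R[i]).

(** The square is expanded along the differences [h + 1] of the two indices; conjugate pairs give
    twice a real part. *)
Lemma van_der_corput z M :
  normc (\sum_(i < M) z i) ^+ 2 <= \sum_(i < M) normc (z i) ^+ 2 +
    2 * \sum_(h < M) normc (\sum_(i < M - h.+1) z (i + h.+1)%N * conjc (z i)).
Proof.
have key : normc (\sum_(i < M) z i) ^+ 2 = \sum_(i < M) normc (z i) ^+ 2 +
    2 * complex.Re (\sum_(h < M) \sum_(i < M - h.+1) z (i + h.+1)%N * conjc (z i)).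
  elim: M => [|M IH]; first by rewrite !big_ord0 normc0 expr0n mulr0 addr0.
  rewrite !big_ord_recr /= subnn big_ord0 addr0.
  have -> : \sum_(h < M) \sum_(i < M.+1 - h.+1) z (i + h.+1)%N * conjc (z i) =
     \sum_(h < M) \sum_(i < M - h.+1) z (i + h.+1)%N * conjc (z i) + z M * conjc (\sum_(i < M) z i).
    rewrite rmorph_sum mulr_sumr [X in _ + X](reindex_inj rev_ord_inj) /= -big_split /=.
    apply: eq_bigr => h _; have hM := ltn_ord h.
    have -> : (M.+1 - h.+1 = (M - h.+1).+1)%N by lia.
    by rewrite big_ord_recr /= subnK.
  have sq (a b : R[i]) : normc (a + b) ^+ 2 = normc a ^+ 2 + normc b ^+ 2 + 2 * complex.Re (b * conjc a).
    by rewrite -!normsqE /normsq ReD ImD Re_mul ReJ ImJ; ring.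
  by rewrite sq IH ReD; ring.
rewrite key lerD2l ler_pM2l//; apply: le_trans (ler_norm _) _.
apply: le_trans (normc_Re _) _; exact: normc_sum.
Qed.

(** Up to constants the distance from [t] to the multiples of [2 pi]; it is the denominator of the
    geometric series and it is subadditive. *)
Definition chord (t : R) : R := normc (1 - cis t).

Lemma chord_ge0 t : 0 <= chord t. Proof. exact: normc_ge0. Qed.

Lemma geometric_cis t M : normc (\sum_(i < M) cis (i%:R * t)) * chord t <= 2.
Proof.
rewrite -normcM; under eq_bigr do rewrite -cisMn.
have -> : (\sum_(i < M) cis t ^+ i) * (1 - cis t) = 1 - cis t ^+ M.
  by rewrite mulrC; apply: oppr_inj; rewrite -mulNr !opprB -subrX1.
by rewrite cisMn -cis0; exact: normc_cisB_le2.
Qed.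

(* The bound min(N, 2 / chord t), read as N when chord t = 0. *)
Definition geom_bound (N : nat) (t : R) : R :=
  if N%:R * chord t <= 2 then N%:R else 2 / chord t.

Lemma geom_bound_ge0 N t : 0 <= geom_bound N t.
Proof. by rewrite /geom_bound; case: ifP => // _; rewrite divr_ge0// chord_ge0. Qed.

Lemma geom_bound_leN N t : geom_bound N t <= N%:R.
Proof.
rewrite /geom_bound; case: ifPn => //; rewrite -ltNge => h.
have c0 : 0 < chord t.
  rewrite lt_neqAle chord_ge0 andbT eq_sym; apply/eqP => c0.
  by rewrite c0 mulr0 ltNge ler0n in h.
by rewrite ler_pdivrMr// ltW.
Qed.

Lemma geom_bound_le N t : 0 < chord t -> geom_bound N t <= 2 / chord t.
Proof. by move=> c0; rewrite /geom_bound; case: ifP => // h; rewrite ler_pdivlMr. Qed.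

Lemma normc_sum_cis (f : nat -> R) M : normc (\sum_(i < M) cis (f i)) <= M%:R.
Proof.
apply: le_trans (normc_sum _ _ _) _.
by under eq_bigr do rewrite normc_cis; rewrite sumr_const card_ord.
Qed.

Lemma geom_sum_bound N M t (c : R) : (M <= N)%N ->
  normc (\sum_(i < M) cis (i%:R * t + c)) <= geom_bound N t.
Proof.
move=> MN; under eq_bigr do rewrite cisD.
rewrite -mulr_suml normcM normc_cis mulr1 /geom_bound; case: ifPn => [_|].
  by apply: le_trans (normc_sum_cis (fun i => i%:R * t) M) _; rewrite ler_nat.
rewrite -ltNge => h.
have c0 : 0 < chord t.
  rewrite lt_neqAle chord_ge0 andbT eq_sym; apply/eqP => c0.
  by rewrite c0 mulr0 ltNge ler0n in h.
by rewrite ler_pdivlMr// geometric_cis.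
Qed.

Lemma cauchy_sum (n : nat) (F : 'I_n -> R) :
  (\sum_(i < n) F i) ^+ 2 <= n%:R * \sum_(i < n) F i ^+ 2.
Proof.
have h : 0 <= \sum_(i < n) \sum_(j < n) (F i - F j) ^+ 2.
  by apply: sumr_ge0 => i _; apply: sumr_ge0 => j _; exact: sqr_ge0.
have e : \sum_(i < n) \sum_(j < n) (F i - F j) ^+ 2 =
    2 * (n%:R * \sum_(i < n) F i ^+ 2 - (\sum_(i < n) F i) ^+ 2).
  have e1 i : \sum_(j < n) (F i - F j) ^+ 2 =
      n%:R * F i ^+ 2 + \sum_(j < n) F j ^+ 2 - 2 * F i * \sum_(j < n) F j.
    rewrite mulr_sumr -sumrN -[in n%:R](card_ord n) mulr_natl -sumr_const -!big_split /=.
    by apply: eq_bigr => j _; ring.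
  under eq_bigr do rewrite e1.
  rewrite !big_split /= -mulr_sumr sumr_const card_ord sumrN -mulr_suml -mulr_sumr -mulr_natl.
  by ring.
by move: h; rewrite e; lra.
Qed.

(** Two rounds of differencing bring the cubic phase down to a linear one of slope
    [6 a (h+1) (h'+1)], in which [b] and [c] survive only as constants; the Cauchy-Schwarz
    inequality between the rounds accounts for the fourth power. *)
Lemma weyl_cubic_gb (a b c : R) M N : (M <= N)%N -> (0 < N)%N ->
  normc (\sum_(i < M) cis (a * i%:R ^+ 3 + b * i%:R ^+ 2 + c * i%:R)) ^+ 4 <=
  10 * N%:R ^+ 3 + 16 * N%:R *
    \sum_(h < N) \sum_(h' < N) geom_bound N (6 * a * h.+1%:R * h'.+1%:R).
Proof.
move=> MN N0.
have N1 : (1 : R) <= N%:R by rewrite ler1n.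
have MN' : M%:R <= N%:R :> R by rewrite ler_nat.
pose z i := cis (a * i%:R ^+ 3 + b * i%:R ^+ 2 + c * i%:R : R).
set S := normc _.
have cisJ (x y : R) : cis x * conjc (cis y) = cis (x - y) by rewrite -cisN -cisD.
have sumone (f : nat -> R) (m : nat) : (m <= N)%N -> \sum_(i < m) normc (cis (f i)) ^+ 2 <= N%:R.
  move=> mN; under eq_bigr do rewrite normc_cis expr1n.
  by rewrite sumr_const card_ord ler_nat.
pose T (h : nat) := normc (\sum_(i < M - h.+1) z (i + h.+1)%N * conjc (z i)).
have hS : S ^+ 2 <= N%:R + 2 * \sum_(h < M) T h.
  by apply: le_trans (van_der_corput z M) _; rewrite lerD2r; exact: (sumone (fun i => a * i%:R ^+ 3 + b * i%:R ^+ 2 + c * i%:R)).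
pose G (h : nat) := \sum_(h' < N) geom_bound N (6 * a * h.+1%:R * h'.+1%:R).
have G0 h : 0 <= G h by apply: sumr_ge0 => i _; exact: geom_bound_ge0.
have hT (h : 'I_M) : T h ^+ 2 <= N%:R + 2 * G h.
  pose f (h i : nat) : R := (a * (i + h.+1)%:R ^+ 3 + b * (i + h.+1)%:R ^+ 2 + c * (i + h.+1)%:R) -
      (a * i%:R ^+ 3 + b * i%:R ^+ 2 + c * i%:R).
  have ez i : z (i + h.+1)%N * conjc (z i) = cis (f h i) by rewrite cisJ.
  rewrite /T; under eq_bigr do rewrite ez.
  apply: le_trans (van_der_corput (fun i => cis (f h i)) _) _.
  apply: lerD; first by apply: (sumone (f h)); apply: leq_trans (leq_subr _ _) MN.
  rewrite ler_pM2l//.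
  have hN : (M - h.+1 <= N)%N by apply: leq_trans (leq_subr _ _) MN.
  apply: (@le_trans _ _ (\sum_(h' < M - h.+1) geom_bound N (6 * a * h.+1%:R * h'.+1%:R))).
    apply: ler_sum => h' _.
    (* The second difference of a cubic is linear in [i]; its constant term is read off at
       [i = 0]. *)
    have e i : cis (f h (i + h'.+1)%N) * conjc (cis (f h i)) =
        cis (i%:R * (6 * a * h.+1%:R * h'.+1%:R) + (f h h'.+1 - f h 0%N)).
      rewrite cisJ /f; congr cis; rewrite !natrD !add0r; ring.
    under eq_bigr do rewrite e.
    by apply: geom_sum_bound; apply: leq_trans (leq_subr _ _) hN.
  by apply: (ler_sum_ord (F := fun h' => geom_bound N (6 * a * h.+1%:R * h'.+1%:R))) => // i; exact: geom_bound_ge0.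
have hTT : (\sum_(h < M) T h) ^+ 2 <= N%:R ^+ 3 + 2 * N%:R * \sum_(h < N) G h.
  apply: le_trans (cauchy_sum _) _.
  apply: (@le_trans _ _ (N%:R * \sum_(h < N) (N%:R + 2 * G h))).
    apply: ler_pM => //; first by apply: sumr_ge0 => i _; exact: sqr_ge0.
    apply: (@le_trans _ _ (\sum_(h < M) (N%:R + 2 * G h))); first by apply: ler_sum => h _; exact: hT.
    by apply: (ler_sum_ord (F := fun h => N%:R + 2 * G h)) => // i; rewrite addr_ge0// mulr_ge0//.
  rewrite big_split /= sumr_const card_ord -mulr_sumr -mulr_natl; lra.
have S0 : 0 <= S ^+ 2 by exact: sqr_ge0.
rewrite -[4%N]/(2 * 2)%N exprM.
have : (S ^+ 2) ^+ 2 <= 2 * N%:R ^+ 2 + 8 * (\sum_(h < M) T h) ^+ 2.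
  have T0 : 0 <= \sum_(h < M) T h by apply: sumr_ge0 => i _; exact: normc_ge0.
  set X := \sum_(h < M) T h in hS T0 *.
  have : (S ^+ 2) ^+ 2 <= (N%:R + 2 * X) ^+ 2.
    by rewrite lerXn2r// nnegrE; apply: le_trans hS.
  by have := sqr_ge0 (N%:R - 2 * X); lra.
have : N%:R ^+ 2 <= N%:R ^+ 3 :> R by apply: ler_weXn2l.
rewrite /G in hTT; lra.
Qed.

End weyl_differencing.

Section weyl_inequality.
Variable R : realType.
Local Notation per := (period R).

Lemma chordD (x y : R) : chord (x + y) <= chord x + chord y.
Proof.
rewrite /chord cisD.
have -> : 1 - cis x * cis y = (1 - cis x) + cis x * (1 - cis y) by ring.
by apply: le_trans (normcD _ _) _; rewrite lerD2l normcM normc_cis mul1r.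
Qed.

Lemma chord_le (x : R) : chord x <= `|x|.
Proof. by rewrite /chord -cis0 -[in leRHS](normrN x) -[in leRHS](sub0r x) cis_lipschitz. Qed.

Lemma chordN (x : R) : chord (- x) = chord x.
Proof.
by rewrite /chord cisN -(normcJ (1 - cis x)) -{1}(conjc1 R) rmorphB.
Qed.

Lemma chordDper (x : R) (m : int) : chord (x + m%:~R * per) = chord x.
Proof. by rewrite /chord cisD cis_period_int mulr1. Qed.

Lemma period_ge4 : 4 <= per.
Proof. by rewrite /period -mulr_natr; have := pi_ge2 R; lra. Qed.

Lemma period_le8 : per <= 8.
Proof. by rewrite /period -mulr_natr; have := pihalf_lt2 R; lra. Qed.

Lemma chord_ge (x : R) : `|x| <= 1 / 2 -> `|x| <= chord (per * x).
Proof.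
move=> hx; have p4 := period_ge4.
have h : `|per * x| <= pi.
  by rewrite normrM gtr0_norm ?period_gt0// /period -mulr_natr; have := pi_gt0 R; nra.
apply: le_trans (cis_chord_ge h).
by rewrite normrM gtr0_norm ?period_gt0//; have := normr_ge0 x; nra.
Qed.

(** The perturbation [rho] moves the chord by at most [16/q], which is at most half of [m/q] when
    [m = min (k, q - k)] is at least 32. The few residues closer to 0 modulo [q] get the trivial
    bound [N]. *)
Lemma geom_bound_frac N (q k : nat) (rho : R) : (k < q)%N -> `|rho| <= 2 / q%:R ->
  geom_bound N (per * (k%:R / q%:R + rho)) <=
  N%:R * (k < 32)%N%:R + N%:R * (q - k < 32)%N%:R + 4 * q%:R * (k%:R^-1 + (q - k)%:R^-1).
Proof.
move=> kq hr; have q0 : 0 < q%:R :> R by rewrite ltr0n; lia.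
have nn : 0 <= 4 * q%:R * (k%:R^-1 + (q - k)%:R^-1) :> R.
  by rewrite !mulr_ge0 ?addr_ge0 ?invr_ge0.
have N0 : 0 <= N%:R :> R by [].
have hgb := geom_bound_leN N (per * (k%:R / q%:R + rho)).
have [k32|k32] := ltnP k 32.
  by have := mulr_ge0 N0 (ler0n R (q - k < 32)%N); rewrite mulr1; lra.
have [qk32|qk32] := ltnP (q - k) 32.
  by rewrite mulr1 mulr0; lra.
rewrite !mulr0 !add0r.
pose m := minn k (q - k).
have m32 : (32 <= m)%N by rewrite leq_min k32 qk32.
have mR : (32 : R) <= m%:R by rewrite ler_nat.
have m0 : 0 < m%:R :> R by apply: lt_le_trans mR.
have p8 := period_le8; have per0 := period_gt0 R.
have hk : m%:R / q%:R <= chord (per * (k%:R / q%:R)).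
  have [h|h] := leP (k%:R / q%:R) (1 / 2 : R).
    have xq : 0 <= k%:R / q%:R :> R by rewrite divr_ge0.
    apply: le_trans (chord_ge _); rewrite ger0_norm//.
    by apply: ler_wpM2r; rewrite ?invr_ge0// ler_nat geq_minl.
  have e : per * (k%:R / q%:R) = - (per * ((q - k)%:R / q%:R)) + 1%:~R * per.
    by rewrite natrB ?(ltnW kq)//; field; rewrite gt_eqF.
  have xq : 0 <= (q - k)%:R / q%:R :> R by rewrite divr_ge0.
  rewrite e chordDper chordN; apply: le_trans (chord_ge _); rewrite ger0_norm//.
    by apply: ler_wpM2r; rewrite ?invr_ge0// ler_nat geq_minr.
  rewrite natrB ?(ltnW kq)// mulrBl mulfV ?gt_eqF//.
  by move: h; rewrite -subr_gt0; lra.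
have hc : m%:R / q%:R / 2 <= chord (per * (k%:R / q%:R + rho)).
  have h1 : chord (per * (k%:R / q%:R)) <= chord (per * (k%:R / q%:R + rho)) + chord (- (per * rho)).
    have -> : per * (k%:R / q%:R) = per * (k%:R / q%:R + rho) + - (per * rho) by ring.
    exact: chordD.
  have h2 : chord (- (per * rho)) <= 16 / q%:R.
    apply: le_trans (chord_le _) _; rewrite normrN normrM gtr0_norm//.
    apply: (@le_trans _ _ (8 * (2 / q%:R))); first by apply: ler_pM => //; exact: ltW.
    by rewrite mulrA; have -> : 8 * 2 = 16 :> R by ring.
  have h3 : 32 / q%:R <= m%:R / q%:R :> R by rewrite ler_pM2r ?invr_gt0.
  have h4 : 16 / q%:R = 32 / q%:R / 2 :> R by field; rewrite gt_eqF.
  by lra.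
have c0 : 0 < chord (per * (k%:R / q%:R + rho)).
  by apply: lt_le_trans hc; rewrite !divr_gt0.
apply: le_trans (geom_bound_le _ c0) _.
apply: (@le_trans _ _ (4 * q%:R * m%:R^-1)).
  rewrite ler_pdivrMr//; apply: le_trans (ler_wpM2l _ hc); last by rewrite !mulr_ge0 ?invr_ge0.
  by rewrite le_eqVlt; apply/orP; left; apply/eqP; field; rewrite !gt_eqF.
rewrite ler_pM2l ?mulr_gt0// /m /minn; case: ifP => _; rewrite ?lerDl ?lerDr ?invr_ge0//.
Qed.

Definition harmonic_sum (q : nat) : R := \sum_(i < q) (i.+1)%:R^-1.

(** As [p] is prime to [q], the residues of [p r + m] modulo [q] are a permutation of
    [0, ..., q - 1], so that the block is a harmonic sum. The remainders [rho] collect the error of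
    approximation and the fractional part of [q tau]. *)
Lemma geom_bound_block N (p : int) (q : nat) (al tau : R) : (0 < q)%N -> coprimez p q ->
  `|al - p%:~R / q%:R| <= 1 / q%:R ^+ 2 ->
  \sum_(r < q) geom_bound N (per * (al * r%:R + tau)) <= 64 * N%:R + 8 * q%:R * harmonic_sum q.
Proof.
move=> q0 cpq hal; have qR : 0 < q%:R :> R by rewrite ltr0n.
have qz : (q%:Z : int) != 0 by lia.
pose m := Num.floor (q%:R * tau).
pose kz (r : nat) : int := ((p * r%:Z + m) %% q%:Z)%Z.
have kz0 r : 0 <= kz r by rewrite modz_ge0.
have kzq r : (absz (kz r) < q)%N.
  by have := ltz_pmod (p * r%:Z + m) (_ : 0 < q%:Z); rewrite ltz_nat q0 -/(kz r) => /(_ isT); have := kz0 r; lia.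
pose k (r : 'I_q) : 'I_q := Ordinal (kzq r).
have kinj : injective k.
  move=> r1 r2 /(congr1 val) /= e.
  have {}e : kz r1 = kz r2 by have := kz0 r1; have := kz0 r2; lia.
  have : (p * r1%:Z + m == p * r2%:Z + m %[mod q%:Z])%Z by apply/eqP.
  rewrite eqz_mod_dvd.
  have -> : p * r1%:Z + m - (p * r2%:Z + m) = p * (r1%:Z - r2%:Z) by ring.
  rewrite Gauss_dvdzr 1?coprimez_sym// => d; apply: val_inj => /=.
  have : (r1%:Z == r2%:Z %[mod q%:Z])%Z by rewrite eqz_mod_dvd.
  by rewrite !modz_small ?ltz_nat ?ltn_ord//= => /eqP [].
apply: (@le_trans _ _ (\sum_(r < q) (N%:R * (k r < 32)%N%:R + N%:R * (q - k r < 32)%N%:R +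
    4 * q%:R * ((k r)%:R^-1 + (q - k r)%:R^-1)))).
  apply: ler_sum => r _.
  pose rho := (al - p%:~R / q%:R) * r%:R + (tau - m%:~R / q%:R).
  have e : per * (al * r%:R + tau) = per * ((k r)%:R / q%:R + rho) +
      (((p * r%:Z + m) %/ q%:Z)%Z)%:~R * per.
    set D := ((p * r%:Z + m) %/ q%:Z)%Z.
    have ez : p * r%:Z + m = D * q%:Z + (absz (kz r))%:Z by rewrite (gez0_abs (kz0 r)); exact: divz_eq.
    have := congr1 (fun x : int => x%:~R : R) ez.
    rewrite !intrD !intrM -!pmulrn -[absz (kz r)]/(k r : nat) /rho => {}ez.
    have -> : (k r)%:R = p%:~R * r%:R + m%:~R - D%:~R * q%:R :> R by rewrite ez; ring.
    by field; rewrite gt_eqF.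
  have -> : geom_bound N (per * (al * r%:R + tau)) = geom_bound N (per * ((k r)%:R / q%:R + rho)).
    by rewrite /geom_bound e chordDper.
  apply: geom_bound_frac; first exact: kzq.
  have h1 : `|(al - p%:~R / q%:R) * r%:R| <= 1 / q%:R.
    rewrite normrM normr_nat.
    apply: (@le_trans _ _ (1 / q%:R ^+ 2 * q%:R)).
      by apply: ler_pM => //; rewrite ler_nat ltnW.
    by rewrite le_eqVlt; apply/orP; left; apply/eqP; field; rewrite gt_eqF.
  have h2 : `|tau - m%:~R / q%:R| <= 1 / q%:R.
    have -> : tau - m%:~R / q%:R = (q%:R * tau - m%:~R) / q%:R by field; rewrite gt_eqF.
    rewrite normrM [`|q%:R^-1|]gtr0_norm ?invr_gt0// ler_pM2r ?invr_gt0//.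
    have := floor_itv (q%:R * tau); rewrite -/m intrD => /andP[h3 h4].
    by rewrite ger0_norm ?subr_ge0//; lra.
  by apply: le_trans (ler_normD _ _) _; have -> : 2 / q%:R = 1 / q%:R + 1 / q%:R :> R by [ring|]; exact: lerD.
rewrite -(@reindex_inj _ _ _ _ k xpredT (fun k : 'I_q => N%:R * (k < 32)%N%:R + N%:R * (q - k < 32)%N%:R +
    4 * q%:R * (k%:R^-1 + (q - k)%:R^-1)) kinj).
rewrite !big_split /= -!mulr_sumr big_split /=.
have c1 n : \sum_(i < n) (i < 32)%N%:R <= 32 :> R.
  have : \sum_(i < n) (i < 32)%N%:R <= (minn n 32)%:R :> R.
    elim: n => [|n IH]; first by rewrite big_ord0.
    rewrite big_ord_recr /=; case: ltnP => h.
      by apply: le_trans (lerD IH (lexx _)) _; rewrite -natrD ler_nat; lia.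
    by rewrite addr0; apply: le_trans IH _; rewrite ler_nat; lia.
  by move/le_trans; apply; rewrite ler_nat geq_minr.
have rev (F : nat -> R) : \sum_(i < q) F (q - i)%N = \sum_(i < q) F i.+1.
  rewrite (reindex_inj rev_ord_inj) /=; apply: eq_bigr => i _; congr F.
  by have := ltn_ord i; lia.
have c2 : \sum_(i < q) (q - i < 32)%N%:R <= 32 :> R.
  rewrite (rev (fun i => (i < 32)%N%:R)); apply: le_trans (c1 q); apply: ler_sum => i _.
  by rewrite ler_nat; case: (ltnP i.+1 32) => //; case: (ltnP i 32) => //; lia.
have c3 : \sum_(i < q) (q - i)%:R^-1 = harmonic_sum q by rewrite (rev (fun i => i%:R^-1)).
have c4 : \sum_(i < q) i%:R^-1 <= harmonic_sum q.
  case: q q0 {qR qz m kz kz0 kzq k kinj rev c1 c2 c3 cpq hal} => // q _.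
  rewrite big_ord_recl invr0 add0r /harmonic_sum big_ord_recr /= lerDl invr_ge0//.
rewrite c3.
have N0 : 0 <= N%:R :> R by [].
have := ler_wpM2l N0 (c1 q); have := ler_wpM2l N0 c2.
have q40 : 0 <= 4 * q%:R :> R by rewrite mulr_ge0.
have := ler_wpM2l q40 c4; rewrite mulrDr; lra.
Qed.

Lemma sum_blocks (F : nat -> R) B q :
  \sum_(i < B * q) F i = \sum_(b < B) \sum_(r < q) F (b * q + r)%N.
Proof.
elim: B => [|B IH]; first by rewrite !big_ord0.
by rewrite mulSnr big_split_ord /= IH big_ord_recr.
Qed.

Lemma geom_bound_sum N L (p : int) (q : nat) (al : R) : (0 < q)%N -> coprimez p q ->
  `|al - p%:~R / q%:R| <= 1 / q%:R ^+ 2 ->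
  \sum_(H < L) geom_bound N (per * (al * H%:R)) <=
  (L%:R / q%:R + 1) * (64 * N%:R + 8 * q%:R * harmonic_sum q).
Proof.
move=> q0 cpq hal; have qR : 0 < q%:R :> R by rewrite ltr0n.
have X0 : 0 <= 64 * N%:R + 8 * q%:R * harmonic_sum q.
  by rewrite addr_ge0 ?mulr_ge0// sumr_ge0.
apply: (@le_trans _ _ (\sum_(H < (L %/ q).+1 * q) geom_bound N (per * (al * H%:R)))).
  apply: (ler_sum_ord (F := fun H => geom_bound N (per * (al * H%:R)))).
    by apply: ltnW; exact: ltn_ceil.
  by move=> i; exact: geom_bound_ge0.
rewrite (sum_blocks (fun H => geom_bound N (per * (al * H%:R)))).
apply: (@le_trans _ _ (\sum_(b < (L %/ q).+1) (64 * N%:R + 8 * q%:R * harmonic_sum q))).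
  apply: ler_sum => b _; apply: le_trans (geom_bound_block N (al * (b * q)%:R) q0 cpq hal).
  by apply: ler_sum => r _; rewrite natrD mulrDr addrC.
rewrite sumr_const card_ord -[leLHS]mulr_natl ler_wpM2r// -addn1 natrD lerD2r.
by rewrite ler_pdivlMr// -natrM ler_nat leq_trunc_div.
Qed.

(** A given [H] is [6 (h+1) (h'+1)] for at most as many pairs as it has divisors, since [h + 1]
    divides [H] and determines [h']. *)
Lemma divisor_regroup N (g : nat -> R) (D : R) : 0 <= D -> (forall H, 0 <= g H) ->
  (forall H, (0 < H)%N -> (H <= 6 * N ^ 2)%N -> (size (divisors H))%:R <= D) ->
  \sum_(h < N) \sum_(h' < N) g (6 * (h.+1 * h'.+1))%N <= D * \sum_(H < (6 * N ^ 2).+1) g H.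
Proof.
move=> D0 g0 hD; set L := (6 * N ^ 2).+1.
have e (x : nat) : (x < L)%N -> g x = \sum_(H < L) (x == H)%:R * g H.
  move=> xL; rewrite (bigD1 (Ordinal xL))//= eqxx mul1r big1 ?addr0// => i hi.
  by rewrite eq_sym (negbTE (_ : i != x :> nat)) ?mul0r//; apply: contra hi => /eqP h; apply/eqP/val_inj.
have bnd (h h' : 'I_N) : (6 * (h.+1 * h'.+1) < L)%N.
  by rewrite ltnS leq_pmul2l// -mulnn leq_mul.
under eq_bigr do under eq_bigr do rewrite (e _ (bnd _ _)).
under eq_bigr do rewrite exchange_big /=.
rewrite exchange_big /= mulr_sumr; apply: ler_sum => H _.
under eq_bigr do rewrite -mulr_suml.
rewrite -mulr_suml ler_wpM2r//.
have inner (h : 'I_N) : \sum_(h' < N) ((6 * (h.+1 * h'.+1))%N == H)%:R <= (h.+1 %| H)%N%:R :> R.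
  have [/existsP[h0 /eqP h0E]|/existsPn hn] := boolP [exists h' : 'I_N, (6 * (h.+1 * h'.+1))%N == H].
    rewrite (bigD1 h0)//= h0E eqxx big1 ?addr0.
      by rewrite -h0E mulnCA dvdn_mulr.
    move=> i ih; case: eqP => // h1; exfalso; move/eqP: ih; apply; apply: val_inj => /=; nia.
  by rewrite big1// => h' _; rewrite (negbTE (hn h')).
have [H0|H0] := posnP H.
  by rewrite big1// => h _; rewrite big1// => h' _; case: eqP => // h1; exfalso; nia.
apply: (@le_trans _ _ (size (divisors H))%:R); last by apply: hD => //; rewrite -ltnS; exact: ltn_ord.
apply: (@le_trans _ _ (\sum_(h < N) (h.+1 %| H)%N%:R)); first by apply: ler_sum => h _; exact: inner.
rewrite -natr_sum ler_nat.
have -> : (\sum_(h < N) (h.+1 %| H) = size [seq (val h).+1 | h <- enum [pred h : 'I_N | h.+1 %| H]])%N.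
  by rewrite size_map -cardE -sum1_card [RHS]big_mkcond; apply: eq_bigr => h _; rewrite inE; case: (_ %| _)%N.
apply: uniq_leq_size; first by rewrite map_inj_uniq ?enum_uniq// => x y [] /val_inj.
by move=> d /mapP[h]; rewrite mem_enum inE => hd ->; rewrite -dvdn_divisors.
Qed.

End weyl_inequality.

Section weyl_power_bound.
Variable R : realType.
Local Notation per := (period R).

Lemma abel_sum (A phi : nat -> R[i]) M (B : R) :
  (forall m, (m <= M)%N -> normc (\sum_(i < m) A i) <= B) ->
  normc (\sum_(i < M) A i * phi i) <=
  B * (normc (phi M) + \sum_(i < M) normc (phi i.+1 - phi i)).
Proof.
move=> hB.
have -> : \sum_(i < M) A i * phi i = (\sum_(i < M) A i) * phi M -
    \sum_(i < M) (\sum_(j < i.+1) A j) * (phi i.+1 - phi i).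
  elim: M {hB} => [|M IH]; first by rewrite !big_ord0 mul0r subr0.
  by rewrite big_ord_recr IH /= [in RHS]big_ord_recr /= [X in _ = _ - X]big_ord_recr /= big_ord_recr /=; ring.
apply: le_trans (normcB _ _) _; rewrite mulrDr; apply: lerD.
  by rewrite normcM ler_wpM2r ?normc_ge0// hB.
apply: le_trans (normc_sum _ _ _) _; rewrite mulr_sumr; apply: ler_sum => i _.
by rewrite normcM ler_wpM2r ?normc_ge0// hB.
Qed.

(** Pigeonhole: [X + 1] fractional parts in [X] intervals of length [1/X]. Reducing the fraction
    shrinks its denominator, which only weakens the bound to be proved. *)
Lemma dirichlet_approx (al : R) (X : nat) : (0 < X)%N ->
  exists (p : int) (q : nat), [/\ (0 < q)%N, (q <= X)%N, coprimez p q &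
    `|al - p%:~R / q%:R| <= 1 / (q%:R * X%:R)].
Proof.
move=> X0; have XR : 0 < X%:R :> R by rewrite ltr0n.
pose fr (i : nat) : R := i%:R * al - (Num.floor (i%:R * al))%:~R.
have fr0 i : 0 <= fr i by rewrite subr_ge0 floor_le.
have fr1 i : fr i < 1 by have := floorD1_gt (i%:R * al); rewrite intrD /fr; lra.
pose bin (i : nat) := Num.truncn (X%:R * fr i).
have binP i : (bin i)%:R <= X%:R * fr i < (bin i).+1%:R by apply: truncn_itv; rewrite mulr_ge0.
have binX i : (bin i < X)%N.
  have /andP[h _] := binP i; rewrite -(ltr_nat R); apply: le_lt_trans h _.
  by rewrite -[ltRHS]mulr1 ltr_pM2l.
pose f (i : 'I_X.+1) : 'I_X := Ordinal (binX i).
have [i [j [ij fij]]] : exists i j : 'I_X.+1, (i < j)%N /\ f i = f j.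
  have : ~~ injectiveb f.
    by apply/negP => /injectiveP /leq_card; rewrite !card_ord ltnn.
  case/injectivePn => i [j ij fij].
  have [h|h|h] := ltngtP i j; [by exists i, j|by exists j, i|].
  by move/val_inj: h => h; rewrite h eqxx in ij.
pose q0 := (j - i)%N; pose p0 := Num.floor (j%:R * al) - Num.floor (i%:R * al).
have q00 : (0 < q0)%N by rewrite subn_gt0.
have q0X : (q0 <= X)%N by have := ltn_ord j; rewrite /q0; lia.
have key : `|q0%:R * al - p0%:~R| <= 1 / X%:R.
  have -> : q0%:R * al - p0%:~R = fr j - fr i by rewrite /q0 natrB ?(ltnW ij)// /p0 intrB /fr; ring.
  have /andP[h1 h2] := binP i; have /andP[h3 h4] := binP j.
  have e : bin j = bin i by have /(congr1 val) := fij.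
  rewrite e -?natr1 in h3 h4; rewrite -natr1 in h2.
  rewrite -(ler_pM2l XR) -[X in X * `|_|](gtr0_norm XR) -normrM mulrBr.
  by rewrite mul1r mulfV ?gt_eqF// ler_norml; lra.
pose g := gcdn (absz p0) q0.
have g0 : (0 < g)%N by rewrite gcdn_gt0 q00 orbT.
have gR : 0 < g%:R :> R by rewrite ltr0n.
exists (p0 %/ g%:Z)%Z, (q0 %/ g)%N.
have gp : p0 = (p0 %/ g%:Z)%Z * g%:Z.
  by rewrite divzK// dvdzE absz_nat /g dvdn_gcdl.
have gq : q0 = (q0 %/ g * g)%N by rewrite divnK// dvdn_gcdr.
have qq0 : (0 < q0 %/ g)%N by move: q00; rewrite {1}gq muln_gt0 => /andP[].
have qqR : 0 < (q0 %/ g)%:R :> R by rewrite ltr0n.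
split => //.
- by apply: leq_trans q0X; exact: leq_div.
- rewrite /coprimez /gcdz /= eqz_nat.
  have := erefl g; rewrite {1}/g {1}gp {1}gq abszM /= -muln_gcdl => /eqP.
  by rewrite -[X in _ == X]mul1n eqn_pmul2r.
- have e1 : al - (p0 %/ g%:Z)%Z%:~R / (q0 %/ g)%:R = (q0%:R * al - p0%:~R) / q0%:R.
    rewrite {2}gp {2 3}gq intrM natrM -pmulrn; field.
    by rewrite !gt_eqF.
  rewrite e1 normrM [`|q0%:R^-1|]gtr0_norm ?invr_gt0 ?ltr0n//.
  apply: (@le_trans _ _ (1 / X%:R / q0%:R)); first by rewrite ler_pM2r ?invr_gt0 ?ltr0n.
  rewrite !mul1r -invfM mulrC lef_pV2 ?posrE ?mulr_gt0 ?ltr0n//.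
  by rewrite ler_pM2r// ler_nat leq_div.
Qed.

(** Weyl's inequality with the logarithm and the divisor function put into [N^(5e)]: two powers of
    [N^e] come from the divisors of [H <= 6 N^2], three from the harmonic sum up to [q <= N^3]. *)
Lemma weyl_power (e : R) : 0 < e -> exists2 C : R, 0 < C &
  forall (al b c : R) (M N : nat) (p : int) (q : nat),
  (M <= N)%N -> (0 < N)%N -> (0 < q)%N -> (q <= N ^ 3)%N -> coprimez p q ->
  `|al - p%:~R / q%:R| <= 1 / q%:R ^+ 2 ->
  normc (\sum_(i < M) cis (per * (al * i%:R ^+ 3 + b * i%:R ^+ 2 + c * i%:R))) ^+ 4 <=
  C * N%:R `^ (1 + 5 * e) * ((N%:R ^+ 2 / q%:R + 1) * (N%:R + q%:R)).
Proof.
move=> e0; have [C1 C10 hC1] := divisor_bound e0; have [C2 C20 hC2] := harmonic_bound e0.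
pose D0 := C1 * 6 `^ e.
have D00 : 0 < D0 by rewrite mulr_gt0// powR_gt0.
pose K := 64 + 8 * C2.
have K0 : 0 < K by rewrite addr_gt0// mulr_gt0.
exists (10 + 16 * D0 * 7 * K); first by rewrite addr_gt0// !mulr_gt0.
move=> al b c M N p q MN N0 q0 qN cpq hal.
set n : R := N%:R; have n1 : 1 <= n by rewrite ler1n.
have n0 : 0 < n by apply: lt_le_trans n1.
have qR : 0 < q%:R :> R by rewrite ltr0n.
set ne := n `^ e; have ne1 : 1 <= ne by rewrite /ne -[leLHS](powRr0 n) ler_powR// ltW.
have ne0 : 0 < ne by apply: lt_le_trans ne1.
have -> : n `^ (1 + 5 * e) = n * ne ^+ 5.
  rewrite powRD; last by rewrite (gt_eqF n0) implybT.
  by rewrite powRr1 ?(ltW n0)//; congr (_ * _); rewrite mulrC powRrM powR_mulrn// powR_ge0.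
set S := normc _.
pose L := (6 * N ^ 2).+1; pose D := D0 * ne ^+ 2.
have hS := weyl_cubic_gb (per * al) (per * b) (per * c) MN N0.
have -> : S = normc (\sum_(i < M) cis (per * al * i%:R ^+ 3 + per * b * i%:R ^+ 2 + per * c * i%:R)).
  by congr normc; apply: eq_bigr => i _; congr cis; ring.
apply: le_trans hS _; rewrite -/n.
have D0' : 0 <= D by rewrite mulr_ge0 ?exprn_ge0// ltW.
have hD H : (0 < H)%N -> (H <= 6 * N ^ 2)%N -> (size (divisors H))%:R <= D.
  move=> H0 HN; apply: le_trans (hC1 _ H0) _.
  rewrite /D /D0 -mulrA ler_pM2l//.
  apply: (@le_trans _ _ ((6 * n ^+ 2) `^ e)).
    apply: ge0_ler_powR; rewrite ?nnegrE ?(ltW e0)// ?mulr_ge0 ?exprn_ge0 ?(ltW n0)//.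
    by rewrite -natrX -natrM ler_nat.
  by rewrite powRM ?exprn_ge0 ?(ltW n0)// expr2 powRM ?(ltW n0).
have := divisor_regroup D0' (fun H => geom_bound_ge0 N (per * (al * H%:R))) hD.
have e1 (h h' : 'I_N) : per * (al * (6 * (h.+1 * h'.+1))%:R) = 6 * (per * al) * h.+1%:R * h'.+1%:R.
  by rewrite !natrM; ring.
under eq_bigr do under eq_bigr do rewrite e1.
set W := \sum_(h < N) _ => hW.
have hsum := geom_bound_sum N L q0 cpq hal.
have hH : harmonic_sum R q <= C2 * ne ^+ 3.
  apply: le_trans (hC2 q) _; rewrite ler_pM2l//.
  apply: (@le_trans _ _ ((n ^+ 3) `^ e)).
    apply: ge0_ler_powR; rewrite ?nnegrE ?(ltW e0)// ?exprn_ge0 ?(ltW n0)//.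
    by rewrite -natrX ler_nat.
  by rewrite -powR_mulrn ?(ltW n0)// powRAC powR_mulrn// ltW.
have h1 : L%:R / q%:R + 1 <= 7 * (n ^+ 2 / q%:R + 1).
  have : L%:R / q%:R <= 7 * n ^+ 2 / q%:R.
    rewrite ler_pM2r ?invr_gt0// /L -addn1 natrD natrM natrX -/n.
    have n2 : 1 <= n ^+ 2 by rewrite exprn_ege1.
    by lra.
  by rewrite mulrDr mulrA; lra.
have ne3 : 1 <= ne ^+ 3 by rewrite exprn_ege1.
have h2 : 64 * n + 8 * q%:R * harmonic_sum R q <= K * ne ^+ 3 * (n + q%:R).
  have q80 : 0 <= 8 * q%:R :> R by rewrite mulr_ge0// ltW.
  have a1 := ler_wpM2l q80 hH.
  have a2 : n <= ne ^+ 3 * n by rewrite ler_peMl// ltW.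
  rewrite /K; have a3 : 0 <= ne ^+ 3 * q%:R by rewrite mulr_ge0 ?ltW// exprn_gt0.
  have a4 : 0 <= C2 * (ne ^+ 3 * n) by rewrite !mulr_ge0 ?ltW// exprn_gt0.
  by nra.
set Y := (n ^+ 2 / q%:R + 1) * (n + q%:R).
have hs2 : \sum_(H < L) geom_bound N (per * (al * H%:R)) <= 7 * K * ne ^+ 3 * Y.
  apply: le_trans hsum _; apply: (@le_trans _ _ (7 * (n ^+ 2 / q%:R + 1) * (K * ne ^+ 3 * (n + q%:R)))).
    apply: ler_pM => //.
    by rewrite addr_ge0 ?mulr_ge0 ?sumr_ge0.
  by rewrite le_eqVlt /Y; apply/orP; left; apply/eqP; ring.
have hW2 : W <= D * (7 * K * ne ^+ 3 * Y) by apply: le_trans hW _; rewrite ler_wpM2l.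
have hY : n ^+ 2 <= Y.
  rewrite /Y mulrDl mulrDr divfK ?gt_eqF//.
  have : 0 <= n ^+ 2 / q%:R * n by rewrite mulr_ge0 ?divr_ge0 ?exprn_ge0// ltW.
  by lra.
have Y0 : 0 <= Y by apply: le_trans hY; exact: sqr_ge0.
have ne5 : 1 <= ne ^+ 5 by rewrite exprn_ege1.
have a1 : n ^+ 3 <= n * ne ^+ 5 * Y.
  have : n * n ^+ 2 <= n * Y by rewrite ler_pM2l.
  have : n * Y * 1 <= n * Y * ne ^+ 5 by rewrite ler_wpM2l// mulr_ge0// ltW.
  by rewrite mulr1 mulrAC -exprS; lra.
have a2 : n * W <= n * (D * (7 * K * ne ^+ 3 * Y)) by rewrite ler_pM2l.
have a3 : n * (D * (7 * K * ne ^+ 3 * Y)) = D0 * 7 * K * (n * ne ^+ 5 * Y) by rewrite /D; ring.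
rewrite a3 in a2; rewrite -mulrA; nra.
Qed.

End weyl_power_bound.

Section weyl_line.
Variable R : realType.
Local Notation per := (period R).

(** The cubic phase with coefficient [p/q] has period [q], so a shift of the sum by [q] multiplies
    it by [e^(2 pi i q be)]; the difference consists of two blocks of [q] terms, whatever the length
    [m]. *)
Lemma periodic_twist (p : int) (q : nat) (be : R) (N m : nat) : (0 < q)%N ->
  normc (\sum_(i < m) cis (per * (p%:~R / q%:R * (N + i)%:R ^+ 3 + be * (N + i)%:R))) *
    chord (per * (q%:R * be)) <= 2 * q%:R.
Proof.
move=> q0; have qR : (q%:R : R) != 0 by rewrite pnatr_eq0 -lt0n.
pose ph (i : nat) : R := per * (p%:~R / q%:R * (N + i)%:R ^+ 3 + be * (N + i)%:R).
rewrite -normcM; set T := \sum_(i < m) _.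
have shift i : cis (ph (q + i)%N) = cis (per * (q%:R * be)) * cis (ph i).
  rewrite -cisD; pose n := (N + i)%N.
  have -> : ph (q + i)%N = per * (q%:R * be) + ph i +
      (p * (3 * n * n + 3 * n * q + q * q)%N%:Z)%:~R * per.
    have en : (N + (q + i))%:R = n%:R + q%:R :> R by rewrite -natrD /n; congr _%:R; lia.
    rewrite /ph en intrM -pmulrn !natrD !natrM /n !natrD.
    by field.
  by rewrite [in LHS]cisD cis_period_int mulr1.
have e : T + \sum_(i < q) cis (ph (m + i)%N) =
    \sum_(i < q) cis (ph i) + cis (per * (q%:R * be)) * T.
  have -> : T + \sum_(i < q) cis (ph (m + i)%N) = \sum_(i < m + q) cis (ph i).
    by rewrite big_split_ord.
  by rewrite addnC big_split_ord /= mulr_sumr; congr (_ + _); apply: eq_bigr => i _; rewrite shift.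
have -> : T * (1 - cis (per * (q%:R * be))) =
    \sum_(i < q) cis (ph i) - \sum_(i < q) cis (ph (m + i)%N).
  apply: (addIr (\sum_(i < q) cis (ph (m + i)%N))).
  by rewrite subrK mulrBr mulr1 addrAC e mulrC addrK.
apply: le_trans (normcB _ _) _.
have h1 := normc_sum_cis ph q; have h2 := normc_sum_cis (fun i => ph (m + i)%N) q.
by have := lerD h1 h2; lra.
Qed.

(** If [al] is close to [p/q] with small [q], then [be] cannot be close to a fraction [b/q], for
    otherwise [al + (k/l) be] would be too close to [(l p + k b) / (l q)]. Hence the cubic phase
    cancels for large [q] and the linear one for small [q]. *)
Lemma weyl_diophantine (k l : nat) (d : R) : (0 < k)%N -> (0 < l)%N -> 0 < d -> d < 1 / 9 ->
  exists2 eta : R, 0 < eta & forall ka : R, 0 < ka -> exists2 C : R, 0 < C &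
  forall al be : R,
  (forall (Q : nat) (B : int), (0 < Q)%N ->
     ka * Q%:R `^ (- (2 + eta)) <= `|al + k%:R / l%:R * be - B%:~R / Q%:R|) ->
  forall N M, (0 < N)%N -> (M <= N)%N ->
  normc (\sum_(i < M) cis (per * (al * (N + i)%:R ^+ 3 + be * (N + i)%:R))) <= C * N%:R `^ (1 - d).
Proof.
(* The gap between [d] and [d0] pays for the [N^(5e)] in Weyl's inequality. *)
move=> k0 l0 d_gt0 d9; pose d0 := (d + 1 / 9) / 2.
have [d00 [dd0 d09]] : 0 < d0 /\ d < d0 /\ d0 < 1 / 9 by rewrite /d0; lra.
(* Chosen so that [4 d0 (2 + eta) = 1 - d0], the balance between the two cases; it is positive
   because [d0 < 1/9]. *)
pose eta := (1 - 9 * d0) / (4 * d0).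
have eta0 : 0 < eta by rewrite divr_gt0 ?mulr_gt0//; lra.
have etaE : 4 * d0 * (2 + eta) = 1 - d0 by rewrite /eta; field; rewrite gt_eqF.
pose e := 4 / 5 * (d0 - d).
have e0 : 0 < e by rewrite /e; lra.
have [C1 C10 hC1] := weyl_power e0.
exists eta => // ka ka0.
have kR : 0 < k%:R :> R by rewrite ltr0n.
have lR : 0 < l%:R :> R by rewrite ltr0n.
pose r : R := k%:R / l%:R; have r0 : 0 < r by rewrite divr_gt0.
pose lp : R := l%:R `^ (2 + eta); have lp0 : 0 < lp by rewrite powR_gt0.
pose A := 4 * lp / ka; have A0 : 0 < A by rewrite divr_gt0// mulr_gt0.
pose kp := ka / (2 * r * lp); have kp0 : 0 < kp by rewrite divr_gt0// mulr_gt0// mulr_gt0.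
(* [129 = 1 + 128]: the end modulus and the total variation of the slowly varying factor
   [e^(2 pi i th n^3)]. The number is kept opaque to the arithmetic below. *)
have [cc hcc cc0] : exists2 cc : R, 129 <= cc & 0 < cc by exists 129.
have h258 : 0 < 2 * cc / kp by rewrite divr_gt0// mulr_gt0.
exists (A + (4 * C1 + 1) + 2 * cc / kp).
  have h4 : 0 < 4 * C1 + 1 by rewrite addr_gt0// mulr_gt0.
  by rewrite addr_gt0// addr_gt0.
move=> al be hdio N M N0 MN.
set n : R := N%:R; have n1 : 1 <= n by rewrite ler1n.
have n0 : 0 < n by apply: lt_le_trans n1.
have pw0 x : 0 < n `^ x by exact: powR_gt0.
have pwD x y : n `^ (x + y) = n `^ x * n `^ y by rewrite powRD// (gt_eqF n0) implybT.
have pwle x y : x <= y -> n `^ x <= n `^ y by apply: ler_powR.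
have pw_nat (m : nat) : n ^+ m = n `^ m%:R by rewrite powR_mulrn// ltW.
set S := normc _.
have SM : S <= n.
  apply: le_trans (normc_sum_cis (fun i => per * (al * (N + i)%:R ^+ 3 + be * (N + i)%:R)) M) _.
  by rewrite ler_nat.
have S0 : 0 <= S by exact: normc_ge0.
have p1 : 1 <= n `^ (1 - d) by rewrite -[leLHS](powRr0 n); apply: pwle; lra.
suff : S <= A * n `^ (1 - d) \/ S <= (4 * C1 + 1) * n `^ (1 - d) \/ S <= 2 * cc / kp * n `^ (1 - d).
  have a1 : 0 <= A * n `^ (1 - d) by rewrite mulr_ge0// ltW.
  have a2 : 0 <= (4 * C1 + 1) * n `^ (1 - d) by rewrite mulr_ge0 ?addr_ge0 ?mulr_ge0// ltW.
  have a3 : 0 <= 2 * cc / kp * n `^ (1 - d) by rewrite mulr_ge0 ?powR_ge0// (ltW h258).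
  have e1 : (A + (4 * C1 + 1) + 2 * cc / kp) * n `^ (1 - d) =
     A * n `^ (1 - d) + (4 * C1 + 1) * n `^ (1 - d) + 2 * cc / kp * n `^ (1 - d) by rewrite -!mulrDl.
  rewrite e1; set a := A * _ in a1 *; set a' := _ * _ in a2 *; set a'' := _ * _ in a3 *.
  by move: a1 a2 a3; clear; move=> a1 a2 a3 [h|[h|h]]; lra.
(* Below the threshold [A] the trivial bound is enough; above it the approximation error [th] is
   absorbed by the Diophantine bound. *)
have [nA|An] := leP n A.
  by left; apply: le_trans SM _; apply: le_trans nA _; rewrite ler_peMr// ltW.
right; pose Y := n `^ (3 - 4 * d0).
have Y1 : 1 <= Y by rewrite -[leLHS](powRr0 n); apply: pwle; lra.
pose X := Num.truncn Y.
have /andP[XY YX] : X%:R <= Y < X.+1%:R by apply: truncn_itv; apply: le_trans Y1.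
have X0 : (0 < X)%N by rewrite truncn_gt0.
have XR : 1 <= X%:R :> R by rewrite ler1n.
have X2 : Y <= 2 * X%:R by rewrite -natr1 in YX; lra.
have [p [q [q0 qX cpq hal]]] := dirichlet_approx al X0.
have qR : 1 <= q%:R :> R by rewrite ler1n.
have qR0 : 0 < q%:R :> R by apply: lt_le_trans qR.
have qXR : q%:R <= X%:R :> R by rewrite ler_nat.
have XR0 : 0 < X%:R :> R by apply: lt_le_trans XR.
(* For large denominators Weyl's inequality is applied to the cubic polynomial in [i] that arises by
   expanding [(N + i)^3]. *)
have [qs|qb] := leP q%:R (n `^ (4 * d0)); last first.
  left; have qY : q%:R <= Y by apply: le_trans XY.
  have qN3 : (q <= N ^ 3)%N.
    rewrite -(ler_nat R) natrX -/n; apply: le_trans qY _; rewrite pw_nat; apply: pwle.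
    by lra.
  have hal2 : `|al - p%:~R / q%:R| <= 1 / q%:R ^+ 2.
    apply: le_trans hal _; rewrite ler_pM2l// lef_pV2 ?posrE ?mulr_gt0//.
    by rewrite expr2 ler_pM2l.
  have := hC1 al (3 * al * n) (3 * al * n ^+ 2 + be) M N p q MN N0 q0 qN3 cpq hal2.
  have -> : normc (\sum_(i < M) cis (per * (al * i%:R ^+ 3 + 3 * al * n * i%:R ^+ 2 +
      (3 * al * n ^+ 2 + be) * i%:R))) = S.
    rewrite (_ : normc _ = normc (cis (per * (al * n ^+ 3 + be * n)) * \sum_(i < M)
      cis (per * (al * i%:R ^+ 3 + 3 * al * n * i%:R ^+ 2 + (3 * al * n ^+ 2 + be) * i%:R)))); last first.
      by rewrite normcM normc_cis mul1r.
    rewrite mulr_sumr /S.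
    by congr normc; apply: eq_bigr => i _; rewrite -cisD; congr cis; rewrite natrD -/n; ring.
  have hY : (n ^+ 2 / q%:R + 1) * (n + q%:R) <= 4 * Y.
    have b1 : n ^+ 3 / q%:R <= Y.
      rewrite ler_pdivrMr// pw_nat.
      have -> : 3 = (3 - 4 * d0) + 4 * d0 :> R by ring.
      by rewrite pwD ler_pM2l// ltW.
    have b2 : n ^+ 2 <= Y by rewrite pw_nat; apply: pwle; lra.
    have b3 : n <= n ^+ 2 by rewrite ler_eXnr.
    have -> : (n ^+ 2 / q%:R + 1) * (n + q%:R) = n ^+ 3 / q%:R + n ^+ 2 + n + q%:R.
      by field; rewrite gt_eqF.
    by lra.
  move=> h; have {}h : S ^+ 4 <= 4 * C1 * (n `^ (1 - d)) ^+ 4.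
    apply: le_trans h _.
    apply: (@le_trans _ _ (C1 * n `^ (1 + 5 * e) * (4 * Y))).
      by rewrite ler_pM2l// mulr_gt0.
    rewrite le_eqVlt; apply/orP; left; apply/eqP.
    have -> : (n `^ (1 - d)) ^+ 4 = n `^ (1 + 5 * e) * Y.
      by rewrite -powR_mulrn ?powR_ge0// -powRrM /Y -pwD; congr (n `^ _); rewrite /e; field.
    by ring.
  rewrite -(@ler_pXn2r _ 4)// ?nnegrE ?mulr_ge0 ?addr_ge0 ?mulr_ge0 ?(ltW C10) ?(ltW (pw0 _))//.
  apply: le_trans h _; rewrite exprMn ler_wpM2r ?exprn_ge0 ?(ltW (pw0 _))//.
  have : 4 * C1 + 1 <= (4 * C1 + 1) ^+ 4 by rewrite ler_eXnr// lerDr mulr_ge0// ltW.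
  by lra.
right; pose th := al - p%:~R / q%:R.
have hth : `|th| <= 2 / (q%:R * Y).
  apply: le_trans hal _; rewrite ler_pdivrMr ?mulr_gt0// mulrC mulrA ler_pdivlMr ?mulr_gt0//; last exact: lt_le_trans Y1.
  by rewrite mul1r; have := ler_wpM2l (ltW qR0) X2; lra.
have Y0 : 0 < Y by apply: lt_le_trans Y1.
have qpw x : 0 <= x -> q%:R `^ x <= n `^ (4 * d0 * x).
  by move=> x0; rewrite powRrM; apply: ge0_ler_powR; rewrite ?nnegrE// ltW.
(* The error [th] is at most half of the Diophantine lower bound at the denominator [l q], since
   [q^(1+eta) <= N] and [N^2 <= Y]. *)
have small : 2 / (q%:R * Y) <= ka / 2 * (l * q)%:R `^ (- (2 + eta)).
  rewrite powRN natrM powRM ?(ltW lR) ?(ltW qR0)// -/lp.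
  have -> : q%:R `^ (2 + eta) = q%:R * q%:R `^ (1 + eta) :> R.
    have -> : 2 + eta = 1 + (1 + eta) by ring.
    by rewrite powRD ?(gt_eqF qR0) ?implybT// powRr1 ?ltW.
  have h1 : q%:R `^ (1 + eta) <= n.
    apply: le_trans (qpw _ _) _; first by lra.
    rewrite -[leRHS]powRr1 ?(ltW n0)//; apply: pwle.
    by rewrite !mulrDr in etaE *; lra.
  have h2 : 4 * lp * n <= ka * Y.
    have h3 : 4 * lp <= ka * n.
      by rewrite [leRHS]mulrC -ler_pdivrMr//; apply: ltW.
    have h4 : n * n <= Y by rewrite -expr2 pw_nat; apply: pwle; lra.
    have := ler_wpM2r (ltW n0) h3; have := ler_wpM2l (ltW ka0) h4; lra.
  have z0 : 0 < q%:R `^ (1 + eta) :> R by apply: powR_gt0.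
  set z := q%:R `^ (1 + eta) in h1 z0 *.
  rewrite ler_pdivrMr ?mulr_gt0//.
  have -> : ka / 2 * (lp * (q%:R * z))^-1 * (q%:R * Y) = ka * Y / (2 * lp * z).
    by field; rewrite !gt_eqF.
  rewrite ler_pdivlMr ?mulr_gt0//.
  have : 4 * lp * z <= 4 * lp * n by rewrite ler_pM2l// mulr_gt0.
  by lra.
pose b := Num.floor (q%:R * be + 1 / 2).
have hb : `|q%:R * be - b%:~R| <= 1 / 2.
  have := floor_itv (q%:R * be + 1 / 2); rewrite -/b intrD => /andP[].
  by rewrite ler_norml; lra.
have gap : kp * q%:R `^ (- (1 + eta)) <= `|q%:R * be - b%:~R|.
  have lq0 : (0 < l * q)%N by rewrite muln_gt0 l0.
  have := hdio (l * q)%N (l%:Z * p + k%:Z * b) lq0.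
  have -> : al + k%:R / l%:R * be - (l%:Z * p + k%:Z * b)%:~R / (l * q)%:R =
      th + r / q%:R * (q%:R * be - b%:~R).
    rewrite intrD !intrM -!pmulrn natrM /th /r; field.
    by rewrite !gt_eqF.
  move=> h1; have := le_trans h1 (ler_normD _ _).
  rewrite normrM [`|r / _|]gtr0_norm ?divr_gt0// => h2.
  have h3 : ka / 2 * (l * q)%:R `^ (- (2 + eta)) <= r / q%:R * `|q%:R * be - b%:~R|.
    by have := le_trans hth small; lra.
  move: h3; rewrite !powRN natrM powRM ?(ltW lR) ?(ltW qR0)// -/lp.
  have -> : q%:R `^ (2 + eta) = q%:R * q%:R `^ (1 + eta) :> R.
    have -> : 2 + eta = 1 + (1 + eta) by ring.
    by rewrite powRD ?(gt_eqF qR0) ?implybT// powRr1 ?ltW.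
  have z0 : 0 < q%:R `^ (1 + eta) :> R by apply: powR_gt0.
  set z := q%:R `^ (1 + eta) in z0 *; set x := `|_| => h3.
  have rq : 0 < r / q%:R by rewrite divr_gt0.
  rewrite -(ler_pM2l rq); apply: le_trans h3.
  by rewrite le_eqVlt /kp; apply/orP; left; apply/eqP; field; rewrite !gt_eqF.
have chordb : kp * q%:R `^ (- (1 + eta)) <= chord (per * (q%:R * be)).
  apply: le_trans gap _; apply: le_trans (chord_ge hb) _.
  have -> : per * (q%:R * be) = per * (q%:R * be - b%:~R) + b%:~R * per by ring.
  by rewrite chordDper.
pose z : R := q%:R `^ (1 + eta); have z0 : 0 < z by apply: powR_gt0.
have T_le m : normc (\sum_(i < m) cis (per * (p%:~R / q%:R * (N + i)%:R ^+ 3 + be * (N + i)%:R))) <=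
    2 * q%:R * z / kp.
  have := periodic_twist p be N m q0; set T := normc _ => hT.
  have T0 : 0 <= T by exact: normc_ge0.
  have := le_trans (ler_wpM2l T0 chordb) hT; rewrite powRN -/z => h.
  by rewrite ler_pdivlMr// -ler_pdivrMr// -mulrA.
have := @abel_sum R (fun i => cis (per * (p%:~R / q%:R * (N + i)%:R ^+ 3 + be * (N + i)%:R)))
  (fun i => cis (per * (th * (N + i)%:R ^+ 3))) M _ (fun m _ => T_le m).
have -> : normc (\sum_(i < M) cis (per * (p%:~R / q%:R * (N + i)%:R ^+ 3 + be * (N + i)%:R)) *
    cis (per * (th * (N + i)%:R ^+ 3))) = S.
  by congr normc; apply: eq_bigr => i _; rewrite -cisD; congr cis; rewrite /th; ring.
rewrite normc_cis => hS.
(* The phase is monotone in [i], so the variation is at most [per |th| ((2N)^3)], and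
   [|th| <= 2/(q Y)] with [N^3 = Y N^(4 d0)]. *)
have var : \sum_(i < M) normc (cis (per * (th * (N + i.+1)%:R ^+ 3)) - cis (per * (th * (N + i)%:R ^+ 3))) <=
    128 * n `^ (4 * d0) / q%:R.
  apply: (@le_trans _ _ (\sum_(i < M) (per * `|th| * ((N + i.+1)%:R ^+ 3 - (N + i)%:R ^+ 3)))).
    apply: ler_sum => i _; apply: le_trans (cis_lipschitz _ _) _.
    rewrite -mulrBr -mulrBr !normrM (gtr0_norm (period_gt0 R)) mulrA ler_wpM2l ?mulr_ge0 ?(ltW (period_gt0 R))//.
    by rewrite ger0_norm// subr_ge0 lerXn2r ?nnegrE// ler_nat leq_add2l.
  rewrite -mulr_sumr.
  have -> : \sum_(i < M) ((N + i.+1)%:R ^+ 3 - (N + i)%:R ^+ 3) = (N + M)%:R ^+ 3 - n ^+ 3 :> R.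
    elim: M {MN S SM S0 hS} => [|m IH]; first by rewrite big_ord0 addn0 subrr.
    by rewrite big_ord_recr /= IH; ring.
  have h1 : (N + M)%:R ^+ 3 - n ^+ 3 <= 8 * n ^+ 3.
    have Mn : M%:R <= n by rewrite ler_nat.
    have h : (N + M)%:R <= 2 * n by rewrite natrD -/n mulr_natl mulr2n lerD2l.
    have h3 : (N + M)%:R ^+ 3 <= (2 * n) ^+ 3 by rewrite lerXn2r ?nnegrE ?mulr_ge0// ltW.
    have n3 : 0 <= n ^+ 3 by rewrite exprn_ge0// ltW.
    have e8 : (2 * n) ^+ 3 = 8 * n ^+ 3 by ring.
    by rewrite e8 in h3; rewrite lerBlDr; apply: le_trans h3 _; rewrite lerDl.
  have p8 := period_le8 R; have per0 := period_gt0 R.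
  apply: (@le_trans _ _ (8 * (2 / (q%:R * Y)) * (8 * n ^+ 3))).
    apply: ler_pM => //; first by rewrite mulr_ge0// ltW.
      by rewrite subr_ge0 lerXn2r ?nnegrE ?(ltW n0)// ler_nat leq_addr.
    by apply: ler_pM => //; exact: ltW.
  have e3 : n ^+ 3 = Y * n `^ (4 * d0) by rewrite pw_nat /Y -pwD; congr (n `^ _); ring.
  rewrite e3 le_eqVlt; apply/orP; left; apply/eqP; field.
  by rewrite !gt_eqF.
have hq1 : 1 <= n `^ (4 * d0) / q%:R by rewrite ler_pdivlMr// mul1r.
have hz : z * n `^ (4 * d0) <= n `^ (1 - d).
  have zl : z <= n `^ (4 * d0 * (1 + eta)) by apply: qpw; lra.
  apply: (@le_trans _ _ (n `^ (4 * d0 * (1 + eta)) * n `^ (4 * d0))); first by rewrite ler_pM2r.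
  rewrite -pwD; apply: pwle.
  by rewrite !mulrDr in etaE *; lra.
apply: le_trans hS _.
apply: (@le_trans _ _ (2 * q%:R * z / kp * (cc * (n `^ (4 * d0) / q%:R)))).
  have pz : 0 < 2 * q%:R * z / kp by apply: divr_gt0 => //; apply: mulr_gt0 => //; apply: mulr_gt0.
  rewrite (ler_pM2l pz); rewrite -mulrA in var.
  move: var hcc hq1; clear; move: (n `^ (4 * d0) / q%:R) (\sum_(i < M) _) => x y h1 h2 h3.
  have : 129 * x <= cc * x by rewrite ler_wpM2r// (le_trans _ h3).
  by lra.
have -> : 2 * q%:R * z / kp * (cc * (n `^ (4 * d0) / q%:R)) = 2 * cc / kp * (z * n `^ (4 * d0)).
  by field; rewrite !gt_eqF.
by rewrite (ler_pM2l h258).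
Qed.

End weyl_line.

(** * Diophantine approximation and the series on the line *)

Section diophantine.
Variable R : realType.
Local Notation mu := (@lebesgue_measure R).
Local Notation T := (measurableTypeR R).

(** Borel-Cantelli in quantitative form. For each unit interval and each [j], the [c] that violate
    the bound with constant [1/(j+1)] form a set of measure [O(1/(j+1))]: there are [O(Q)] relevant
    fractions of denominator [Q], each with an interval of length [O(Q^(-2-eta) / (j+1))]. *)
Lemma diophantine_ae (s s0 eta : R) : 0 < s -> 0 < eta ->
  {ae mu, forall c : R, exists2 ka : R, 0 < ka &
    forall (Q : nat) (B : int), (0 < Q)%N ->
      ka * Q%:R `^ (- (2 + eta)) <= `|s * c + s0 - B%:~R / Q%:R|}.
Proof.
move=> s_gt0 eta0.
have [|C C0 hC] := @pseries_bound R (1 + eta); first by rewrite ltrDl.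
pose w (j Q : nat) : R := j.+1%:R^-1 * Q.+1%:R `^ (- (2 + eta)).
have w0 j Q : 0 < w j Q by rewrite mulr_gt0 ?invr_gt0// powR_gt0.
(* Here [Q] stands for the denominator [Q + 1], and the numerators run over [4 (Q + 1)] values from
   [(Q + 1)(m - 1)] on. As the widths are at most 1, this catches every fraction that matters when
   [s c + s0] lies in [[m, m + 1)]. *)
pose ctr (m : int) (Q i : nat) : R := (((Q.+1)%:Z * (m - 1) + i%:Z)%:~R / Q.+1%:R - s0) / s.
pose I m j Q i : set T := `[ctr m Q i - w j Q / s, ctr m Q i + w j Q / s]%classic.
pose U m j Q : set T := \big[setU/set0]_(i < 4 * Q.+1) I m j Q i.
pose E m j : set T := \bigcup_Q U m j Q.
have mI m j Q i : measurable (I m j Q i) by exact: measurable_itv.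
have mU m j Q : measurable (U m j Q) by apply: bigsetU_measurable.
have mE m j : measurable (E m j) by apply: bigcupT_measurable.
have muI m j Q i : mu (I m j Q i) = (2 * w j Q / s)%:E.
  have h : 0 <= w j Q / s by rewrite ltW// divr_gt0.
  by rewrite /I lebesgue_measure_cc; [congr EFin; field; rewrite gt_eqF|lra].
have muU m j Q : (mu (U m j Q) <= (8 / s * j.+1%:R^-1 * Q.+1%:R `^ (- (1 + eta)))%:E)%E.
  apply: (le_trans (Boole_inequality mu (A := I m j Q) (n := 4 * Q.+1) _)) => //.
  rewrite (eq_bigr (fun=> (2 * w j Q / s)%:E)); last by move=> i _; exact: muI.
  rewrite sumEFin lee_fin sumr_const card_ord -[leLHS]mulr_natl natrM /w.
  have -> : - (1 + eta) = 1 + - (2 + eta) by ring.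
  rewrite powRD; last by rewrite pnatr_eq0 implybT.
  rewrite powRr1//; set z := _ `^ _; rewrite le_eqVlt; apply/orP; left; apply/eqP.
  by field; rewrite nat1r pnatr_eq0 /= gt_eqF.
have muE m j : (mu (E m j) <= (8 / s * C * j.+1%:R^-1)%:E)%E.
  apply: (le_trans (generalized_Boole_inequality mu (mU m j) (mE m j))).
  apply: lime_le; first by apply: is_cvg_nneseries.
  apply: nearW => n; rewrite big_mkord.
  apply: (@le_trans _ _ (\sum_(Q < n) (8 / s * j.+1%:R^-1 * Q.+1%:R `^ (- (1 + eta)))%:E)%E).
    by apply: lee_sum => Q _; exact: muU.
  rewrite sumEFin lee_fin -mulr_sumr mulrAC ler_wpM2r ?invr_ge0//.
  by rewrite ler_wpM2l// divr_ge0// ltW.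
pose N m := \bigcap_j E m j.
have mN m : measurable (N m) by apply: bigcapT_measurable.
have N0 m : mu (N m) = 0%E.
  apply/eqP; rewrite eq_le measure_ge0 andbT; apply/lee_addgt0Pr => e e0; rewrite add0e.
  have K0 : 0 < 8 / s * C by rewrite mulr_gt0// divr_gt0.
  pose j := Num.truncn (8 / s * C / e).
  apply: (@le_trans _ _ (mu (E m j))).
    by apply: le_measure; rewrite ?inE// => x; apply.
  apply: le_trans (muE m j) _; rewrite lee_fin ler_pdivrMr// [leRHS]mulrC -ler_pdivrMr//.
  by apply: ltW; exact: truncnS_gt.
have ng : mu.-negligible (\bigcup_i (N i%:Z `|` N (- i%:Z)) : set T).
  apply: negligible_bigcup => i; apply: negligibleU; apply/negligibleP => //; exact: N0.
apply: negligibleS ng => c /= hc.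
pose m := Num.floor (s * c + s0).
have cN : N m c.
  move=> j _; apply: contrapT => hE; apply: hc.
  exists j.+1%:R^-1; first by rewrite invr_gt0.
  move=> Q B; case: Q => // Q _; rewrite -/(w j Q) leNgt; apply/negP => hlt.
  apply: hE; exists Q => //.
  have wl1 : w j Q <= 1.
    rewrite /w powRN -invfM invf_le1 ?mulr_gt0 ?powR_gt0//.
    rewrite -[leLHS]mul1r ler_pM// ?ler1n//.
    by rewrite -[leLHS](powRr0 Q.+1%:R) ler_powR ?ler1n// addr_ge0// ltW.
  have QR : 0 < Q.+1%:R :> R by [].
  have QR1 : 1 <= Q.+1%:R :> R by rewrite ler1n.
  have hB : `|Q.+1%:R * (s * c + s0) - B%:~R| < Q.+1%:R.
    have -> : Q.+1%:R * (s * c + s0) - B%:~R = Q.+1%:R * (s * c + s0 - B%:~R / Q.+1%:R) by field.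
    rewrite normrM gtr0_norm// gtr_pMr//; exact: lt_le_trans hlt wl1.
  have /andP[m1 m2] := floor_itv (s * c + s0); rewrite -/m intrD in m1 m2.
  have b1 : (Q.+1)%:Z * (m - 1) <= B.
    rewrite -(ler_int R) intrM intrB -pmulrn; move: hB; rewrite ltr_norml => /andP[_].
    by have := ler_wpM2l (ltW QR) m1; lra.
  have b2 : B < (Q.+1)%:Z * (m + 2).
    rewrite -(ltr_int R) intrM intrD -pmulrn; move: hB; rewrite ltr_norml => /andP[+ _].
    by have := ler_wpM2l (ltW QR) (ltW m2); lra.
  pose i := absz (B - (Q.+1)%:Z * (m - 1))%R.
  have iE : i%:Z = B - (Q.+1)%:Z * (m - 1) by rewrite /i gez0_abs// subr_ge0.
  have i4 : (i < 4 * Q.+1)%N by lia.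
  rewrite /U -bigcup_mkord; exists i => //=.
  rewrite /I /= in_itv /= /ctr iE.
  have -> : (Q.+1)%:Z * (m - 1) + (B - (Q.+1)%:Z * (m - 1)) = B by ring.
  have e : c = (B%:~R / Q.+1%:R - s0) / s + (s * c + s0 - B%:~R / Q.+1%:R) / s.
    by field; rewrite nat1r pnatr_eq0 gt_eqF.
  have hs : `|(s * c + s0 - B%:~R / Q.+1%:R) / s| <= w j Q / s.
    by rewrite normrM [`|s^-1|]gtr0_norm ?invr_gt0// ler_pM2r ?invr_gt0// ltW.
  move: hs e; rewrite ler_norml.
  move: ((s * c + s0 - B%:~R / Q.+1%:R) / s) ((B%:~R / Q.+1%:R - s0) / s) (w j Q / s).
  by clear; move=> y a b /andP[h1 h2] ->; apply/andP; split; lra.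
exists (absz m) => //; case: (lerP 0 m) => m0; [left|right].
  by rewrite gez0_abs.
by rewrite ltz0_abs// opprK.
Qed.

End diophantine.

Section line_series.
Variable R : realType.
Local Notation mu := (@lebesgue_measure R).
Local Notation per := (period R).
Variables (k l : nat) (js : seq (R[i] * R)).

Definition jump_sum (n : nat) : R[i] := \sum_(p <- js) p.1 * cis (- (n%:R * p.2)).

Definition line_phase (c x : R) (n : nat) : R := line_time k l c x * n%:R ^+ 3 + n%:R * x.

(** As [0^-1 = 0], the term at [n = 0] vanishes. *)
Definition line_term (c x : R) (n : nat) : R[i] :=
  jump_sum n * (n%:R^-1)%:C * cis (line_phase c x n).

Definition line_sum (c x : R) (N : nat) : R[i] := \sum_(n < N) line_term c x n.

Definition weyl_good (c d : R) : Prop := exists2 C : R, 0 <= C & forall x N M,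
  (0 < N)%N -> (M <= N)%N ->
  normc (\sum_(i < M) jump_sum (N + i) * cis (line_phase c x (N + i))) <= C * N%:R `^ (1 - d).

(** For a jump at [p.2] the two coefficients satisfy [al + (k/l) be = (c - (k/l) p.2) / per], free
    of [x]. Each of the finitely many jumps removes a null set of [c]. *)
Lemma weyl_good_ae (d : R) : (0 < k)%N -> (0 < l)%N -> 0 < d -> d < 1 / 9 ->
  {ae mu, forall c, weyl_good c d}.
Proof.
move=> k0 l0 d0 d9; have per0 := period_gt0 R.
have lN : (l%:R : R) != 0 by rewrite pnatr_eq0 -lt0n.
have perN : per != 0 by rewrite gt_eqF.
have [eta eta0 hw] := weyl_diophantine k0 l0 d0 d9.
rewrite /weyl_good /jump_sum; elim: js => [|p s IH].
  apply: aeW => c; exists 0 => // x N M _ _; rewrite big1 ?normc0 ?mul0r// => i _.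
  by rewrite big_nil mul0r.
have s_gt0 : 0 < per^-1 by rewrite invr_gt0.
have hd := diophantine_ae (- (k%:R / l%:R * p.2 / per)) s_gt0 eta0.
apply: (@filterS2 _ _ (ae_filter_ringOfSetsType mu) _ _ _ _ IH hd) => c [C C0 hC] [ka ka0 hka].
have [C' C'0 hC'] := hw ka ka0.
exists (C + normc p.1 * C'); first by rewrite addr_ge0// mulr_ge0 ?normc_ge0// ltW.
move=> x N M N0 MN.
pose al := (c - k%:R / l%:R * x) / per; pose be := (x - p.2) / per.
have dio (Q : nat) (B : int) : (0 < Q)%N ->
    ka * Q%:R `^ (- (2 + eta)) <= `|al + k%:R / l%:R * be - B%:~R / Q%:R|.
  move=> /hka; move/(_ B); congr (_ <= `|_ - _|); rewrite /al /be.
  by clear -perN lN; move: (period R) perN => P perN; field; rewrite perN.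
have := hC' al be dio N M N0 MN => h.
under eq_bigr do rewrite big_cons mulrDl.
rewrite big_split /= mulrDl addrC; apply: le_trans (normcD _ _) _; apply: lerD; first exact: hC.
rewrite -mulrA; apply: le_trans (ler_wpM2l (normc_ge0 _) h).
rewrite -normcM mulr_sumr le_eqVlt; apply/orP; left; apply/eqP; congr normc.
apply: eq_bigr => i _; rewrite -mulrA -cisD; congr (_ * cis _).
rewrite /line_phase /line_time /al /be.
by clear -perN lN; move: (period R) perN => P perN; field; rewrite perN.
Qed.

Section fixed_line.
Variables (c d C : R).
Hypotheses (d0 : 0 < d) (C0 : 0 <= C).
Hypothesis hC : forall x N M, (0 < N)%N -> (M <= N)%N ->
  normc (\sum_(i < M) jump_sum (N + i) * cis (line_phase c x (N + i))) <= C * N%:R `^ (1 - d).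

Let r : R := k%:R / l%:R.
Let r0 : 0 <= r. Proof. by rewrite divr_ge0. Qed.

Lemma powR_1B (N : nat) : (0 < N)%N -> N%:R `^ (1 - d) / N%:R = N%:R `^ (- d) :> R.
Proof.
move=> N0; have n0 : 0 < N%:R :> R by rewrite ltr0n.
by rewrite powRD ?(gt_eqF n0) ?implybT// powRr1 ?ltW// mulrAC mulfV ?gt_eqF// mul1r.
Qed.

(** Summation by parts against the monotone weight [1/n]. *)
Lemma block_bound x N M : (0 < N)%N -> (M <= N)%N ->
  normc (\sum_(i < M) line_term c x (N + i)) <= C * N%:R `^ (- d).
Proof.
move=> N0 MN; have n0 : 0 < N%:R :> R by rewrite ltr0n.
pose A i := jump_sum (N + i) * cis (line_phase c x (N + i)).
pose phi i : R[i] := ((N + i)%:R^-1)%:C.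
have -> : \sum_(i < M) line_term c x (N + i) = \sum_(i < M) A i * phi i.
  by apply: eq_bigr => i _; rewrite /A /phi /line_term; ring.
apply: le_trans (@abel_sum R A phi M (C * N%:R `^ (1 - d)) _) _.
  by move=> m mM; apply: hC => //; apply: leq_trans MN.
rewrite -powR_1B// mulrA ler_wpM2l ?mulr_ge0 ?powR_ge0//.
have inv0 i : 0 < (N + i)%:R :> R by rewrite ltr0n ltn_addr.
have -> : \sum_(i < M) normc (phi i.+1 - phi i) = \sum_(i < M) ((N + i)%:R^-1 - (N + i.+1)%:R^-1).
  apply: eq_bigr => i _; rewrite /phi -rmorphB normcR distrC ger0_norm// subr_ge0.
  by rewrite lef_pV2 ?posrE// ler_nat leq_add2l.
have -> : \sum_(i < M) ((N + i)%:R^-1 - (N + i.+1)%:R^-1) = N%:R^-1 - (N + M)%:R^-1 :> R.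
  elim: M {MN} => [|m IH]; first by rewrite big_ord0 addn0 subrr.
  by rewrite big_ord_recr /= IH addrA subrK.
by rewrite /phi normcR ger0_norm ?invr_ge0// addrC subrK.
Qed.

Definition line_freq (n : nat) : R := n%:R - r * n%:R ^+ 3.

Lemma line_phase_shift x h n : line_phase c (x + h) n = line_phase c x n + line_freq n * h.
Proof. by rewrite /line_phase /line_freq /line_time -/r; ring. Qed.

Lemma line_freq_le n : `|line_freq n| <= (1 + r) * n%:R ^+ 3.
Proof.
apply: le_trans (ler_normB _ _) _; rewrite normr_nat ger0_norm ?mulr_ge0 ?exprn_ge0// mulrDl mul1r lerD2r.
by case: n => [|n]; [rewrite exprn_ge0|rewrite ler_eXnr// ler1n].
Qed.

(** A shift by [h] multiplies the [n]-th term by [e^(i f h)] with [f = line_freq n = O(n^3)].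
    Summation by parts puts this factor into the weight, whose end value and total variation give
    the [4] and the [16] that make up [20]. *)
Lemma block_diff_bound x h N M : (0 < N)%N -> (M <= N)%N ->
  normc (\sum_(i < M) (line_term c (x + h) (N + i) - line_term c x (N + i))) <=
  C * N%:R `^ (- d) * (20 * (1 + r) * (N%:R ^+ 3 * `|h|)).
Proof.
move=> N0 MN; have n0 : 0 < N%:R :> R by rewrite ltr0n.
have n1 : 1 <= N%:R :> R by rewrite ler1n.
pose A i := jump_sum (N + i) * cis (line_phase c x (N + i)).
pose phi i : R[i] := (cis (line_freq (N + i) * h) - 1) * ((N + i)%:R^-1)%:C.
have -> : \sum_(i < M) (line_term c (x + h) (N + i) - line_term c x (N + i)) = \sum_(i < M) A i * phi i.
  apply: eq_bigr => i _; rewrite /A /phi /line_term line_phase_shift cisD; ring.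
apply: le_trans (@abel_sum R A phi M (C * N%:R `^ (1 - d)) _) _.
  by move=> m mM; apply: hC => //; apply: leq_trans MN.
have -> : C * N%:R `^ (- d) * (20 * (1 + r) * (N%:R ^+ 3 * `|h|)) =
    C * N%:R `^ (1 - d) * (20 * (1 + r) * (N%:R ^+ 2 * `|h|)).
  by rewrite -powR_1B//; field; rewrite gt_eqF.
rewrite ler_wpM2l ?mulr_ge0 ?powR_ge0//.
have inv0 i : 0 < (N + i)%:R :> R by rewrite ltr0n ltn_addr.
have h0 : 0 <= `|h| by [].
have le2 i : (i <= N)%N -> (N + i)%:R <= 2 * N%:R :> R.
  by move=> iN; rewrite -natrM ler_nat; lia.
have cis1 n : normc (cis (line_freq n * h) - 1) <= (1 + r) * n%:R ^+ 3 * `|h|.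
  rewrite -cis0; apply: le_trans (cis_lipschitz _ _) _; rewrite subr0 normrM ler_wpM2r//.
  exact: line_freq_le.
have p1 : normc (phi M) <= 4 * (1 + r) * (N%:R ^+ 2 * `|h|).
  rewrite /phi normcM normcR ger0_norm ?invr_ge0// ler_pdivrMr//.
  apply: le_trans (cis1 _) _; have := le2 _ MN; set n := (N + M)%:R => hn.
  have n0' : 0 < n by exact: inv0.
  have -> : 4 * (1 + r) * (N%:R ^+ 2 * `|h|) * n = (1 + r) * ((2 * N%:R) ^+ 2 * n) * `|h| by ring.
  rewrite ler_wpM2r// ler_wpM2l ?addr_ge0//.
  by rewrite exprSr ler_pM2r// lerXn2r ?nnegrE ?mulr_ge0// ltW.
have p2 (i : 'I_M) : normc (phi i.+1 - phi i) <= 16 * (1 + r) * (N%:R * `|h|).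
  have iN : (i < N)%N := leq_trans (ltn_ord i) MN.
  have := le2 _ (ltnW iN); set n := (N + i)%N => hn.
  have nn0 : 0 < n%:R :> R by exact: inv0.
  have nn1 : 1 <= n%:R :> R by rewrite ler1n /n; lia.
  have e : phi i.+1 - phi i = (cis (line_freq n.+1 * h) - cis (line_freq n * h)) * (n.+1%:R^-1)%:C +
     (cis (line_freq n * h) - 1) * (n.+1%:R^-1 - n%:R^-1)%:C.
    by rewrite /phi addnS -/n rmorphB; ring.
  rewrite e; apply: le_trans (normcD _ _) _; rewrite !normcM !normcR.
  have q1 : normc (cis (line_freq n.+1 * h) - cis (line_freq n * h)) <= (1 + 7 * r) * n%:R ^+ 2 * `|h|.
    apply: le_trans (cis_lipschitz _ _) _; rewrite -mulrBl normrM ler_wpM2r//.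
    rewrite /line_freq -natr1.
    have -> : n%:R + 1 - r * (n%:R + 1) ^+ 3 - (n%:R - r * n%:R ^+ 3) = 1 - r * (3 * n%:R ^+ 2 + 3 * n%:R + 1) :> R by ring.
    apply: le_trans (ler_normB _ _) _; rewrite normr1 normrM (ger0_norm r0) ger0_norm; last by rewrite !addr_ge0 ?mulr_ge0 ?exprn_ge0// ltW.
    have n2 : 1 <= n%:R ^+ 2 :> R by rewrite exprn_ege1.
    have n3 : n%:R <= n%:R ^+ 2 :> R by rewrite ler_eXnr.
    rewrite mulrDl mul1r lerD// -mulrA [X in X <= _]mulrC -mulrA [X in _ <= X]mulrCA || idtac.
    have : r * (3 * n%:R ^+ 2 + 3 * n%:R + 1) <= r * (7 * n%:R ^+ 2).
      by rewrite ler_wpM2l//; lra.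
    by lra.
  have s1 : `|n.+1%:R^-1| <= n%:R^-1 :> R.
    by rewrite ger0_norm ?invr_ge0// lef_pV2 ?posrE// ler_nat.
  have s2 : `|n.+1%:R^-1 - n%:R^-1| <= n%:R^-1 ^+ 2 :> R.
    rewrite distrC ger0_norm ?subr_ge0 ?lef_pV2 ?posrE ?ler_nat//.
    have -> : n%:R^-1 - n.+1%:R^-1 = n%:R^-1 * n.+1%:R^-1 :> R.
      have a1 : n%:R + 1 != 0 :> R by rewrite natr1 pnatr_eq0.
      by rewrite -natr1; field; rewrite a1 gt_eqF.
    by rewrite expr2 ler_pM2l ?invr_gt0// lef_pV2 ?posrE// ler_nat.
  apply: (@le_trans _ _ ((1 + 7 * r) * n%:R ^+ 2 * `|h| * n%:R^-1 + (1 + r) * n%:R ^+ 3 * `|h| * n%:R^-1 ^+ 2)).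
    apply: lerD; apply: ler_pM => //; exact: normc_ge0.
  have -> : (1 + 7 * r) * n%:R ^+ 2 * `|h| * n%:R^-1 + (1 + r) * n%:R ^+ 3 * `|h| * n%:R^-1 ^+ 2 =
     (2 + 8 * r) * n%:R * `|h| by field; rewrite gt_eqF.
  have -> : 16 * (1 + r) * (N%:R * `|h|) = (8 + 8 * r) * (2 * N%:R) * `|h| by ring.
  rewrite ler_wpM2r//; apply: ler_pM => //; last by rewrite lerD2r ler_nat.
  by rewrite addr_ge0// mulr_ge0.
have p3 : \sum_(i < M) normc (phi i.+1 - phi i) <= 16 * (1 + r) * (N%:R ^+ 2 * `|h|).
  apply: (@le_trans _ _ (\sum_(i < M) 16 * (1 + r) * (N%:R * `|h|))); first by apply: ler_sum => i _; exact: p2.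
  rewrite sumr_const card_ord -[leLHS]mulr_natl.
  have -> : 16 * (1 + r) * (N%:R ^+ 2 * `|h|) = N%:R * (16 * (1 + r) * (N%:R * `|h|)) by ring.
  by rewrite ler_wpM2r ?ler_nat// !mulr_ge0// ?addr_ge0// ltW.
by move: p1 p3; clear; move: (normc _) (\sum_(i < M) _) (N%:R ^+ 2 * `|h|) => x y z h1 h2; rewrite -/r; lra.
Qed.

(** Of the two bounds, with and without the factor [y = N^3 |h|], the smaller is at most the one
    with [y^rho]. *)
Lemma block_diff_interp rho x h N M : (0 < N)%N -> (M <= N)%N -> 0 <= rho -> rho <= 1 ->
  normc (\sum_(i < M) (line_term c (x + h) (N + i) - line_term c x (N + i))) <=
  C * (20 * (1 + r)) * N%:R `^ (3 * rho - d) * `|h| `^ rho.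
Proof.
move=> N0 MN rho0 rho1; have n0 : 0 < N%:R :> R by rewrite ltr0n.
have h1 := block_diff_bound x h N0 MN.
have h2 : normc (\sum_(i < M) (line_term c (x + h) (N + i) - line_term c x (N + i))) <=
    C * N%:R `^ (- d) * (20 * (1 + r)).
  rewrite sumrB; apply: le_trans (normcB _ _) _.
  apply: le_trans (lerD (block_bound _ N0 MN) (block_bound _ N0 MN)) _.
  by have := mulr_ge0 C0 (powR_ge0 N%:R (- d)); have := r0; nra.
set y := N%:R ^+ 3 * `|h| in h1; have y0 : 0 <= y by rewrite mulr_ge0// exprn_ge0// ltW.
have -> : C * (20 * (1 + r)) * N%:R `^ (3 * rho - d) * `|h| `^ rho =
    C * N%:R `^ (- d) * (20 * (1 + r)) * y `^ rho.
  rewrite /y powRM ?exprn_ge0 ?(ltW n0)// -powR_mulrn ?(ltW n0)// -powRrM powRD ?(gt_eqF n0) ?implybT//.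
  by ring.
have K0 : 0 <= C * N%:R `^ (- d) * (20 * (1 + r)) by rewrite !mulr_ge0 ?powR_ge0 ?addr_ge0.
have [y1|y1] := leP y 1.
  apply: le_trans h1 _; rewrite mulrA ler_wpM2l//.
  have [->|yn] := eqVneq y 0; first exact: powR_ge0.
  by apply: ger1_powR => //; rewrite y1 andbT lt_neqAle eq_sym yn.
apply: le_trans h2 _; rewrite ler_peMr//.
by rewrite -[leLHS](powRr0 y) ler_powR// ltW.
Qed.

Lemma line_sum_add x N M : line_sum c x (N + M) = line_sum c x N + \sum_(i < M) line_term c x (N + i).
Proof. by rewrite /line_sum big_split_ord. Qed.

(** Dyadic blocks form a geometric series of ratio [2^(-d)]; in [key] the number [j] counts the
    doublings from [N]. *)
Lemma line_sum_cauchy : exists2 K : R, 0 <= K & forall x N N', (0 < N)%N -> (N <= N')%N ->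
  normc (line_sum c x N' - line_sum c x N) <= K * N%:R `^ (- d).
Proof.
pose t : R := 2 `^ (- d).
have t0 : 0 <= t by exact: powR_ge0.
have t1 : t < 1.
  rewrite /t powRN invf_lt1 ?powR_gt0//.
  by have := gt0_ltr_powR d0 (x := 1) (y := 2); rewrite powR1 !nnegrE ltr1n; exact.
exists (C * (1 - t)^-1); first by rewrite mulr_ge0// invr_ge0 subr_ge0 ltW.
move=> x N N' N0 NN'.
have key j M : (N <= M)%N -> (M <= 2 ^ j * N)%N ->
    normc (line_sum c x M - line_sum c x N) <= C * N%:R `^ (- d) * \sum_(i < j) t ^+ i.
  elim: j M => [|j IH] M NM Mj.
    have -> : M = N by rewrite expn0 mul1n in Mj; lia.
    by rewrite subrr normc0 big_ord0 mulr0.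
  have [h|h] := leqP M (2 ^ j * N).
    apply: le_trans (IH _ NM h) _; rewrite ler_wpM2l ?mulr_ge0 ?powR_ge0//.
    by rewrite big_ord_recr /= lerDl exprn_ge0.
  set P := (2 ^ j * N)%N in IH h.
  have P0 : (0 < P)%N by rewrite muln_gt0 expn_gt0 N0.
  have NP : (N <= P)%N by rewrite leq_pmull// expn_gt0.
  rewrite -(subnKC (ltnW h)) line_sum_add addrAC; apply: le_trans (normcD _ _) _.
  rewrite big_ord_recr /= mulrDr; apply: lerD; first exact: (IH _ NP (leqnn _)).
  have := @block_bound x P (M - P) P0; rewrite expnS in Mj.
  move/(_ _)=> hb; apply: le_trans (hb _) _; first by rewrite /P; lia.
  rewrite /P natrM powRM// natrX -powR_mulrn// powRAC powR_mulrn ?powR_ge0// -/t.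
  by rewrite -mulrA ler_wpM2l// mulrC.
(* [N' <= 2^N' N] is a crude count of the doublings, but the bound for the geometric series does not
   depend on it. *)
apply: le_trans (key N' N' NN' _) _.
  by apply: leq_trans (leq_pmulr _ N0); apply: ltnW; exact: ltn_expl.
rewrite mulrAC ler_wpM2r ?powR_ge0// ler_wpM2l//.
exact: geometric_le.
Qed.

(** The increments of the dyadic blocks are geometric with ratio [2^(3 rho - d)], which is below 1
    exactly when [3 rho < d]. *)
Lemma line_sum_holder rho : 0 < rho -> rho <= 1 -> 3 * rho < d ->
  exists2 K : R, 0 <= K & forall x h J,
  normc (line_sum c (x + h) (2 ^ J) - line_sum c x (2 ^ J)) <= K * `|h| `^ rho.
Proof.
move=> rho0 rho1 hd; pose t : R := 2 `^ (3 * rho - d).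
have t0 : 0 <= t by exact: powR_ge0.
have t1 : t < 1.
  rewrite /t -(opprB d) powRN invf_lt1 ?powR_gt0//.
  have dp : 0 < d - 3 * rho by rewrite subr_gt0.
  by have := gt0_ltr_powR dp (x := 1) (y := 2); rewrite powR1 !nnegrE ltr1n; exact.
pose K := C * (20 * (1 + r)); have K0 : 0 <= K by rewrite !mulr_ge0 ?addr_ge0.
exists (K * (1 - t)^-1); first by rewrite mulr_ge0// invr_ge0 subr_ge0 ltW.
move=> x h J.
suff H : normc (line_sum c (x + h) (2 ^ J) - line_sum c x (2 ^ J)) <=
    K * `|h| `^ rho * \sum_(j < J) t ^+ j.
  apply: le_trans H _; rewrite mulrAC ler_wpM2r ?powR_ge0// ler_wpM2l//.
  exact: geometric_le.
elim: J => [|J IH].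
  rewrite /line_sum expn0 !big_ord1 big_ord0 mulr0 /line_term invr0 !mulr0 !mul0r subrr normc0 //.
have e y : line_sum c y (2 ^ J.+1) = line_sum c y (2 ^ J) + \sum_(i < 2 ^ J) line_term c y (2 ^ J + i).
  by rewrite expnS mul2n -addnn line_sum_add.
rewrite !e opprD addrACA -[X in _ + X]sumrB; apply: le_trans (normcD _ _) _.
rewrite big_ord_recr /= mulrDr; apply: lerD; first exact: IH.
apply: le_trans (@block_diff_interp rho x h (2 ^ J) (2 ^ J) _ _ _ _) _ => //.
- by rewrite expn_gt0.
- exact: ltW.
rewrite natrX -powR_mulrn// powRAC powR_mulrn ?powR_ge0// -/t -/K.
by rewrite mulrAC.
Qed.

End fixed_line.
End line_series.

(** * Moments of exponential sums along the line *)

Section line_frequencies.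
Variables (k l : nat).
Hypotheses (k0 : (0 < k)%N) (l0 : (0 < l)%N).

(** The frequency of the [n]-th term along the line, multiplied by [l] to be an integer. *)
Definition line_int (n : int) : int := l%:Z * n - k%:Z * n ^+ 3.

(** The difference of the two values factors as [(n - m)(l - k (n^2 + n m + m^2))], and
    [n^2 + n m + m^2 >= 3 n^2 / 4] exceeds [l]. *)
Lemma line_int_inj n m : (2 * l < absz n)%N -> line_int n = line_int m -> n = m.
Proof.
move=> nl e; apply/eqP; rewrite -subr_eq0; apply: contraT => nm.
have : (n - m) * (k%:Z * (n ^+ 2 + n * m + m ^+ 2) - l%:Z) = 0.
  have -> : (n - m) * (k%:Z * (n ^+ 2 + n * m + m ^+ 2) - l%:Z) = line_int m - line_int n.
    by rewrite /line_int; ring.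
  by rewrite e subrr.
move/eqP; rewrite mulf_eq0 (negbTE nm) /= subr_eq0 => /eqP h.
have s0 : 0 <= (n + 2 * m) ^+ 2 by exact: sqr_ge0.
have n2 : (2 * l%:Z) ^+ 2 < n ^+ 2.
  rewrite exprMn !expr2; have [n0|n0] := lerP 0 n.
    have : 2 * l%:Z < n by lia.
    by nia.
  have : 2 * l%:Z < - n by lia.
  by nia.
have x3 : 3 * n ^+ 2 <= 4 * (n ^+ 2 + n * m + m ^+ 2).
  rewrite -subr_ge0; have -> : 4 * (n ^+ 2 + n * m + m ^+ 2) - 3 * n ^+ 2 = (n + 2 * m) ^+ 2 by ring.
  exact: s0.
have q1 : n ^+ 2 + n * m + m ^+ 2 <= l%:Z.
  have k1 : 1 <= k%:Z by lia.
  rewrite -h; apply: ler_peMl => //.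
  rewrite -(@pmulr_rge0 _ 4)//; apply: le_trans x3.
  by rewrite mulr_ge0// sqr_ge0.
have : l%:Z <= l%:Z ^+ 2 by rewrite ler_eXnr//; lia.
by rewrite exprMn in n2; lia.
Qed.

Lemma line_int_fiber (v : int) (s : seq int) : uniq s ->
  {in s, forall m, line_int m = v} -> (size s <= 3)%N.
Proof.
move=> us hs; pose p : {poly int} := l%:Z *: 'X - k%:Z *: 'X^3 - v%:P.
have p0 : p != 0.
  apply/eqP => /(congr1 (fun q : {poly int} => q`_3)).
  rewrite /p !coefE /=; lia.
have sp : (size p <= 4)%N.
  apply/leq_sizeP => j j4; rewrite /p !coefE.
  by case: j j4 => [|[|[|[|j]]]] //= _; rewrite !mulr0 !subr0.
rewrite -ltnS; apply: leq_trans sp; apply: max_poly_roots => //.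
apply/allP => m /hs hm; rewrite /root /p !(hornerD, hornerN, hornerZ, hornerXn, hornerX, hornerC).
by rewrite -hm /line_int; apply/eqP; ring.
Qed.

(** The sum of the values at [a] and [b] is [(a + b)(l - k ((a + b)^2 - 3 a b))]. So [a + b] divides
    [M] and determines [a b], hence the pair up to order; the 4 counts the sign of the divisor and
    the order. *)
Lemma line_int_sum_fiber (M : int) (L : seq (int * int)) : M != 0 -> uniq L ->
  {in L, forall p, line_int p.1 + line_int p.2 = M} -> (size L <= 4 * size (divisors (absz M)))%N.
Proof.
move=> M0 uL hL; pose phi (p : int * int) := (p.1 + p.2, p.1 <= p.2).
pose ds := [seq d%:Z | d <- divisors (absz M)] ++ [seq - d%:Z | d <- divisors (absz M)].
have fac p : p \in L -> (p.1 + p.2) * (l%:Z - k%:Z * ((p.1 + p.2) ^+ 2 - 3 * (p.1 * p.2))) = M.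
  by move=> /hL <-; rewrite /line_int; ring.
have inj : {in L &, injective phi}.
  move=> [n m] [n' m'] /fac /= h1 /fac /= h2 [] hs hb.
  have s0 : n + m != 0 by apply: contra M0 => /eqP s0; rewrite -h1 s0 mul0r.
  rewrite -hs -h1 in h2.
  have /(mulfI s0) h3 := h2.
  have h4 : n * m = n' * m'.
    have k1 : k%:Z != 0 by lia.
    have : k%:Z * (3 * (n * m)) = k%:Z * (3 * (n' * m')) by lia.
    by move=> /(mulfI k1); lia.
  have : (n - m - (n' - m')) * (n - m + (n' - m')) = 0.
    have -> : (n - m - (n' - m')) * (n - m + (n' - m')) =
      ((n + m) ^+ 2 - (n' + m') ^+ 2) - 4 * (n * m - n' * m') by ring.
    by rewrite hs h4; ring.
  move/eqP; rewrite mulf_eq0 => /orP[] /eqP h5.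
    by congr pair; lia.
  case: (lerP n m) hb => nm /esym hb.
    by congr pair; lia.
  by move: hb => /negbT; rewrite -ltNge => hb; congr pair; lia.
rewrite -(size_map phi).
apply: (@leq_trans (size [seq (d, b) | d <- ds, b <- [:: true; false]])).
  apply: uniq_leq_size; first by rewrite map_inj_in_uniq.
  move=> _ /mapP[p pL ->]; apply: allpairs_f; last by case: (_ <= _).
  have dv : (absz (p.1 + p.2)%R \in divisors (absz M)).
    rewrite -dvdn_divisors ?absz_gt0// -(fac p pL) abszM; exact: dvdn_mulr.
  rewrite mem_cat /phi /=; case: (lerP 0 (p.1 + p.2)) => h; apply/orP; [left|right]; apply/mapP.
    by exists (absz (p.1 + p.2)%R) => //; rewrite gez0_abs.
  by exists (absz (p.1 + p.2)%R) => //; rewrite ltz0_abs// opprK.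
by rewrite size_allpairs /ds size_cat !size_map /=; lia.
Qed.

End line_frequencies.

Section line_moments.
Variable R : realType.
Local Notation mu := (@lebesgue_measure R).
Local Notation T := (measurableTypeR R).
Local Notation per := (period R).
Variables (k l : nat).
Hypotheses (k0 : (0 < k)%N) (l0 : (0 < l)%N).
Local Notation q := (line_int k l).
Local Notation P := (line_end R l).

Definition line_om (n : int) : R := (q n)%:~R / l%:R.

Definition osc (s : seq int) (a : int -> R[i]) (x : R) : R[i] :=
  \sum_(n <- s) a n * cis (line_om n * x).

Lemma line_end_gt0 : 0 < P.
Proof. by rewrite /line_end mulr_gt0 ?period_gt0// ltr0n. Qed.

Lemma line_om_eq n m : (line_om n == line_om m) = (q n == q m).
Proof.
have l1 : (l%:R : R)^-1 != 0 by rewrite invr_eq0 pnatr_eq0 -lt0n.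
by rewrite /line_om (inj_eq (mulIf l1)) eqr_int.
Qed.

Lemma line_om_period (z : int) : cis (z%:~R / l%:R * P) = 1.
Proof.
have -> : z%:~R / l%:R * P = z%:~R * per.
  rewrite /line_end; have lN : (l%:R : R) != 0 by rewrite pnatr_eq0 -lt0n.
  by move: (period R) => p; field; rewrite lN.
exact: cis_period_int.
Qed.

(** An index with [|n| > 2 l] shares its frequency with no other one, so the sum splits
    orthogonally. The low part, where frequencies may collide, has a nonnegative integral and is
    dropped. *)
Lemma osc_L2 s a : uniq s ->
  P * \sum_(n <- s | (2 * l < absz n)%N) normsq (a n) <=
  Rintegral mu `[0, P] (fun x => normsq (osc s a x)).
Proof.
move=> us; pose g := [pred n : int | (2 * l < absz n)%N].
have hP (i j : int) : cis ((line_om i - line_om j) * P) = 1.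
  by rewrite /line_om -mulrBl -intrB line_om_period.
have id t := @exp_sum_L2 R int t a line_om P line_end_gt0 hP.
pose B (i j : int) := a i * conjc (a j).
have e : (Rintegral mu `[0, P] (fun x => normsq (osc s a x)))%:C =
   (P * \sum_(n <- s | g n) normsq (a n))%:C +
   (Rintegral mu `[0, P] (fun x => normsq (osc [seq n <- s | ~~ g n] a x)))%:C.
  rewrite /osc !id.
  have -> : (P * \sum_(n <- s | g n) normsq (a n))%:C = P%:C * (\sum_(n <- s | g n) normsq (a n))%:C by exact: rmorphM.
  apply: etrans (mulrDr _ _ _); congr (_ * _).
  rewrite (bigID g) /=; congr (_ + _).
    rewrite rmorph_sum -big_filter -[RHS]big_filter; apply: eq_big_seq => n; rewrite mem_filter => /andP[gn ns].
    rewrite (eq_bigl (pred1 n)); last first.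
      move=> j; rewrite line_om_eq /=; apply/eqP/eqP => [h|->//]. 
      by apply/esym; exact: (@line_int_inj k l k0 l0 n j gn h).
    rewrite -big_filter (_ : [seq j <- s | _] = [:: n]); last exact: filter_pred1_uniq.
    by rewrite big_seq1 normc_mulJ normsqE.
  rewrite -big_filter; apply: eq_big_seq => n; rewrite mem_filter => /andP[gn ns].
  rewrite -big_filter -[RHS]big_filter; congr (\sum_(j <- _) _).
  rewrite -filter_predI; apply: eq_in_filter => j js /=.
  rewrite line_om_eq; apply/idP/andP => [/eqP h|[]//]; split; first by rewrite h.
  by apply: contra gn => gj; rewrite /g /= (_ : n = j)//; apply/esym; exact: (line_int_inj k0 l0 gj).
have -> : Rintegral mu `[0, P] (fun x => normsq (osc s a x)) =
   P * \sum_(n <- s | g n) normsq (a n) +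
   Rintegral mu `[0, P] (fun x => normsq (osc [seq n <- s | ~~ g n] a x)).
  by apply: complexI; rewrite e -rmorphD.
by rewrite lerDl; apply: Rintegral_ge0 => x _; rewrite normsqE sqr_ge0.
Qed.

(** [w_i w_j <= (w_i^2 + w_j^2) / 2] and the symmetry of [rel] reduce the double sum to counts of
    fibres, which are asked for only where [w] does not vanish. *)
Lemma sum_pair_fiber (I : eqType) (t : seq I) (w : I -> R) (rel : I -> I -> bool) (B : I -> R) :
  (forall i, 0 <= w i) -> (forall i j, rel i j = rel j i) ->
  (forall i, i \in t -> w i != 0 -> (count (rel i) t)%:R <= B i) ->
  \sum_(i <- t) \sum_(j <- t | rel i j) w i * w j <= \sum_(i <- t) w i ^+ 2 * B i.
Proof.
move=> w0 rs hB.
have step : \sum_(i <- t) \sum_(j <- t | rel i j) w i * w j <=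
   \sum_(i <- t) \sum_(j <- t | rel i j) (w i ^+ 2 / 2 + w j ^+ 2 / 2).
  by apply: ler_sum => i _; apply: ler_sum => j _; have := sqr_ge0 (w i - w j); lra.
apply: le_trans step _.
have e2 : \sum_(i <- t) \sum_(j <- t | rel i j) (w i ^+ 2 / 2 + w j ^+ 2 / 2) =
    \sum_(i <- t) \sum_(j <- t | rel i j) w i ^+ 2.
  under eq_bigr do rewrite big_split /=.
  rewrite big_split /=.
  have -> : \sum_(i <- t) \sum_(j <- t | rel i j) w j ^+ 2 / 2 = \sum_(i <- t) \sum_(j <- t | rel i j) w i ^+ 2 / 2.
    rewrite (exchange_big_dep xpredT) //=.
    by apply: eq_bigr => j _; apply: eq_bigl => i; rewrite rs.
  rewrite -big_split /=; apply: eq_bigr => i _; rewrite -big_split /=; apply: eq_bigr => j _.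
  by field.
rewrite e2 big_seq [leRHS]big_seq; apply: ler_sum => i it.
have -> : \sum_(j <- t | rel i j) w i ^+ 2 = w i ^+ 2 * (count (rel i) t)%:R.
  by rewrite big_const_seq iter_addr_0 mulr_natr.
have [->|wi] := eqVneq (w i) 0; first by rewrite expr0n !mul0r.
by rewrite ler_wpM2l ?sqr_ge0// hB.
Qed.

Lemma line_int_sum_le n m : n != 0 -> m != 0 ->
  (absz (q n + q m))%:R <= 2 * (k + l)%:R * (absz n)%:R ^+ 3 * (absz m)%:R ^+ 3 :> R.
Proof.
have cube (z : int) : z != 0 -> `|z| <= `|z| ^+ 3 by move=> z0; apply: ler_eXnr => //; lia.
have one (z : int) : z != 0 -> 1 <= `|z| ^+ 3 by move=> z0; apply: exprn_ege1; lia.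
have b (z : int) : z != 0 -> `|q z| <= (k%:Z + l%:Z) * `|z| ^+ 3.
  move=> z0; rewrite /line_int; apply: le_trans (ler_normB _ _) _.
  rewrite (normrM l%:Z) (normrM k%:Z) normrX mulrDl addrC lerD//.
  by rewrite ler_pM// cube.
move=> n0 m0.
have h : `|q n + q m| <= (2 * (k%:Z + l%:Z)) * `|n| ^+ 3 * `|m| ^+ 3.
  apply: le_trans (ler_normD _ _) _; apply: le_trans (lerD (b n n0) (b m m0)) _.
  have := one n n0; have := one m m0; move: (`|n| ^+ 3) (`|m| ^+ 3) => x y y1 x1.
  rewrite -mulrDr (mulrC 2) -!mulrA ler_wpM2l//.
  by nia.
have : (`|q n + q m|%:~R : R) <= ((2 * (k%:Z + l%:Z)) * `|n| ^+ 3 * `|m| ^+ 3)%:~R by rewrite ler_int.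
have x3 (z : int) : (`|z| ^+ 3)%:~R = `|z|%:~R ^+ 3 :> R by exact: rmorphXn.
have hM (y z : int) : (y * z)%:~R = y%:~R * z%:~R :> R by exact: intrM.
by rewrite !natr_absz (hM _ (`|m| ^+ 3)) (hM _ (`|n| ^+ 3)) !x3 (hM 2) natrD intrD.
Qed.

(* The square of the exponential sum is one over pairs of frequencies, whose
   coincidences are counted by divisors. *)
Lemma osc_L4 (e : R) : 0 < e -> exists2 C : R, 0 <= C & forall s a, uniq s -> a 0 = 0 ->
  Rintegral mu `[0, P] (fun x => normc (osc s a x) ^+ 4) <=
  C * (\sum_(n <- s) normsq (a n) * (absz n)%:R `^ e) ^+ 2.
Proof.
(* The sum of two frequencies is [O(|n|^3 |m|^3)], so the divisor bound is needed with exponent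
   [e/3]. *)
move=> e0; have e3 : 0 < e / 3 by rewrite divr_gt0.
have [D D0 hD] := divisor_bound e3.
pose K : R := 2 * (k + l)%:R.
have K0 : 0 <= K by rewrite mulr_ge0.
exists (P * (9 + 4 * D * K `^ (e / 3))).
  by rewrite mulr_ge0 ?(ltW line_end_gt0)// addr_ge0// !mulr_ge0// ?powR_ge0// ltW.
move=> s a us a0.
pose w n := normc (a n).
have w0 n : 0 <= w n by exact: normc_ge0.
pose W (n : int) : R := (absz n)%:R `^ e.
have W0 n : 0 <= W n by exact: powR_ge0.
have W1 n : w n != 0 -> 1 <= W n.
  move=> wn; have n0 : n != 0 by apply: contra wn => /eqP ->; rewrite /w a0 normc0.
  rewrite /W -[leLHS](powRr0 (absz n)%:R); apply: ler_powR; last exact: ltW.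
  by rewrite ler1n absz_gt0.
pose t := [seq (n, m) | n <- s, m <- s].
have ut : uniq t by apply: allpairs_uniq => // -[x1 x2] [y1 y2] _ _ [-> ->].
pose A (p : int * int) := a p.1 * a p.2.
pose Om (p : int * int) : R := line_om p.1 + line_om p.2.
pose M (p : int * int) := q p.1 + q p.2.
have OmE p p' : (Om p == Om p') = (M p == M p').
  have l1 : (l%:R : R)^-1 != 0 by rewrite invr_eq0 pnatr_eq0 -lt0n.
  by rewrite /Om /line_om -!mulrDl -!intrD (inj_eq (mulIf l1)) eqr_int.
have hP (i j : int * int) : cis ((Om i - Om j) * P) = 1.
  by rewrite /Om /line_om -!mulrDl -mulrBl -!intrD -intrB line_om_period.
have sq x : normc (osc s a x) ^+ 4 = normsq (\sum_(p <- t) A p * cis (Om p * x)).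
  rewrite normsqE (_ : \sum_(p <- t) _ = osc s a x * osc s a x) ?normcM ?exprMn -?exprD//.
  rewrite /osc big_distrl /= /t big_allpairs; apply: eq_bigr => n _.
  rewrite big_distrr /=; apply: eq_bigr => m _.
  by rewrite /A /Om /= mulrDl cisD; ring.
have id := @exp_sum_L2 R _ t A Om P line_end_gt0 hP.
pose v p := w p.1 * w p.2.
have v0 p : 0 <= v p by rewrite mulr_ge0.
have I1 : Rintegral mu `[0, P] (fun x => normc (osc s a x) ^+ 4) <=
    P * \sum_(p <- t) \sum_(p' <- t | M p == M p') v p * v p'.
  rewrite (_ : (fun x => _) = fun x => normsq (\sum_(p <- t) A p * cis (Om p * x))); last exact/funext.
  apply: le_trans (ler_norm _) _; rewrite -normcR id normcM normcR ger0_norm ?(ltW line_end_gt0)//.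
  rewrite ler_wpM2l ?(ltW line_end_gt0)//; apply: le_trans (normc_sum _ _ _) _.
  apply: ler_sum => p _; apply: le_trans (normc_sum _ _ _) _.
  rewrite (eq_bigl _ _ (OmE p)); apply: ler_sum => p' _.
  by rewrite normcM normcJ /A !normcM.
apply: le_trans I1 _; rewrite -mulrA ler_wpM2l ?(ltW line_end_gt0)//.
set S := \sum_(n <- s) _.
have SE : S = \sum_(n <- s) w n ^+ 2 * W n by apply: eq_bigr => n _; rewrite normsqE.
have S0 : 0 <= S by rewrite SE sumr_ge0// => n _; rewrite mulr_ge0// sqr_ge0.
(* Pairs with [M = 0] escape the divisor count. There the first index prescribes the frequency of
   the second, which leaves at most 3 values. *)
rewrite (bigID (fun p => M p == 0)) /= [leRHS]mulrDl; apply: lerD.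
  have -> : \sum_(p <- t | M p == 0) \sum_(p' <- t | M p == M p') v p * v p' =
      (\sum_(p <- t | M p == 0) v p) ^+ 2.
    rewrite expr2 big_distrl /=; apply: eq_bigr => p /eqP Mp.
    by rewrite big_distrr /= Mp; apply: eq_bigl => p'; rewrite eq_sym.
  have h : \sum_(p <- t | M p == 0) v p <= 3 * S.
    rewrite big_mkcond /= /t big_allpairs /=.
    have -> : \sum_(i <- s) \sum_(j <- s) (if M (i, j) == 0 then v (i, j) else 0) =
        \sum_(i <- s) \sum_(j <- s | q i + q j == 0) w i * w j.
      by apply: eq_bigr => i _; rewrite [RHS]big_mkcond.
    apply: le_trans (@sum_pair_fiber _ s w (fun i j => q i + q j == 0) (fun=> 3) _ _ _) _ => //.
    - by move=> i j; rewrite addrC.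
    - move=> i _ _; rewrite ler_nat -size_filter.
       apply: (@line_int_fiber k l k0 l0 (- q i)); first exact: filter_uniq.
      by move=> m; rewrite mem_filter addrC addr_eq0 => /andP[/eqP].
    rewrite SE mulr_sumr; apply: ler_sum => n _; rewrite mulrC ler_wpM2l//.
    have [->|/W1 h] := eqVneq (w n) 0; first by rewrite expr0n mul0r.
    by rewrite ler_peMr ?sqr_ge0.
  rewrite (_ : 9 * S ^+ 2 = (3 * S) ^+ 2); last by ring.
  by rewrite ler_sqr// nnegrE ?mulr_ge0// sumr_ge0.
(* Setting the weights of the pairs with [M = 0] to zero lets the fibre count be applied to all of
   [t]. *)
pose v' p := if M p == 0 then 0 else v p.
have v'0 p : 0 <= v' p by rewrite /v'; case: ifP.
pose B (p : int * int) : R := 4 * D * K `^ (e / 3) * (W p.1 * W p.2).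
apply: (@le_trans _ _ (\sum_(p <- t) \sum_(p' <- t | M p == M p') v' p * v' p')).
  rewrite big_mkcond /=; apply: ler_sum => p _.
  case: ifP => [Mp|_]; last by rewrite sumr_ge0// => p' _; rewrite mulr_ge0.
  by apply: ler_sum => p' /eqP pp; rewrite /v' -pp (negbTE Mp).
apply: le_trans (@sum_pair_fiber _ t v' (fun p p' => M p == M p') B v'0 _ _) _.
- by move=> i j; rewrite eq_sym.
- move=> p _; rewrite /v'; case: ifP => [_|/negbT Mp]; first by rewrite eqxx.
  rewrite mulf_eq0 negb_or => /andP[w1 w2].
  have n1 : p.1 != 0 by apply: contra w1 => /eqP ->; rewrite /w a0 normc0.
  have n2 : p.2 != 0 by apply: contra w2 => /eqP ->; rewrite /w a0 normc0.
  have c1 : (count (fun p' => M p == M p') t <= 4 * size (divisors (absz (M p))))%N.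
    rewrite -size_filter; apply: (line_int_sum_fiber k0 l0 Mp); first exact: filter_uniq.
    by move=> p'; rewrite mem_filter => /andP[/eqP ->].
  apply: (@le_trans _ _ (4 * size (divisors (absz (M p))))%:R); first by rewrite ler_nat.
  rewrite natrM /B -!mulrA ler_wpM2l//.
  apply: le_trans (hD _ _) _; first by rewrite absz_gt0.
  rewrite ler_wpM2l ?(ltW D0)//.
  have x3 (z : int) : ((absz z)%:R ^+ 3) `^ (e / 3) = W z.
    by rewrite -powR_mulrn// -powRrM /W; congr (_ `^ _); field.
  rewrite -(x3 p.1) -(x3 p.2) -powRM ?exprn_ge0// -powRM ?mulr_ge0 ?exprn_ge0//.
  apply: ge0_ler_powR; rewrite ?nnegrE ?(ltW e3)//; first by rewrite !mulr_ge0 ?exprn_ge0.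
  by rewrite mulrA; exact: line_int_sum_le.
rewrite /t big_allpairs /= expr2 SE mulr_suml mulr_sumr; apply: ler_sum => n _.
rewrite mulr_sumr mulr_sumr; apply: ler_sum => m _.
have h : v' (n, m) ^+ 2 <= w n ^+ 2 * w m ^+ 2.
  rewrite /v' /v -exprMn; case: ifP => _ //; by rewrite expr0n /= sqr_ge0.
rewrite /B /= mulrC.
apply: le_trans (ler_wpM2l _ h) _.
  by rewrite !mulr_ge0// ?powR_ge0// ltW.
by rewrite le_eqVlt; apply/orP; left; apply/eqP; ring.
Qed.

(* If the second moment is large and the fourth moment small, the first moment
   is large: y^2 <= lam y + y^4 / lam^2. *)
Lemma osc_L1 (e : R) : 0 < e -> exists2 C : R, 0 <= C & forall s a (lam : R), uniq s -> a 0 = 0 -> 0 < lam ->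
  P * \sum_(n <- s | (2 * l < absz n)%N) normsq (a n)
    - C * (\sum_(n <- s) normsq (a n) * (absz n)%:R `^ e) ^+ 2 / lam ^+ 2
  <= lam * Rintegral mu `[0, P] (fun x => normc (osc s a x)).
Proof.
move=> e0; have [C C0 hC] := osc_L4 e0; exists C => // s a lam us a0 lam0.
have hc : Ccontinuous (osc s a) by exact: exp_sum_continuous.
have c1 := continuous_normc hc.
have mD : measurable (`[0, P]%classic : set T) by [].
have i1 : rintegrable `[0, P] (fun x => lam * normc (osc s a x)).
  by apply: rintegrableZ => //; exact: rintegrable_cont.
have c4 : continuous (fun x => normc (osc s a x) ^+ 4).
  by move=> x; apply: (@continuous_comp _ _ _ _ (fun y : R => y ^+ 4)); [exact: c1|exact: exprn_continuous].
have i4 : rintegrable `[0, P] (fun x => (lam ^+ 2)^-1 * normc (osc s a x) ^+ 4).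
  by apply: rintegrableZ => //; exact: rintegrable_cont.
rewrite lerBlDr; apply: le_trans (osc_L2 a us) _.
apply: (@le_trans _ _ (Rintegral mu `[0, P] (fun x => lam * normc (osc s a x) + (lam ^+ 2)^-1 * normc (osc s a x) ^+ 4))).
  apply: le_Rintegral => //.
  - by apply: rintegrable_cont; exact: Ccontinuous_normsq.
  - exact: rintegrableD.
  move=> x _; rewrite normsqE; move: (normc_ge0 (osc s a x)); move: (normc _) => y y0.
  have [yl|yl] := lerP y lam.
    apply: (@le_trans _ _ (lam * y)); first by rewrite expr2 ler_wpM2r.
    by rewrite lerDl mulr_ge0 ?exprn_ge0// invr_ge0 exprn_ge0// ltW.
  rewrite -[leLHS]add0r; apply: lerD; first by rewrite mulr_ge0// ltW.
  rewrite ler_pdivlMl ?exprn_gt0// (_ : y ^+ 4 = y ^+ 2 * y ^+ 2); last by rewrite -exprD.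
  apply: ler_wpM2r; first exact: sqr_ge0.
  by rewrite ler_sqr ?nnegrE// ltW.
rewrite (RintegralD mD i1 i4) (RintegralZl _ mD); last exact: rintegrable_cont.
rewrite (RintegralZl _ mD); last exact: rintegrable_cont.
rewrite lerD2l mulrC ler_wpM2r ?invr_ge0 ?exprn_ge0 ?(ltW lam0)//.
exact: hC.
Qed.

End line_moments.

(** * Differentiation by parts for KdV *)

Section complex_derivative.
Variable R : realType.
Local Notation Ci := (0 +i* 1 : R[i]).

Definition Cderive (f : R -> R[i]) (t : R) (d : R[i]) : Prop :=
  is_derive t 1 (fun s => complex.Re (f s)) (complex.Re d) /\
  is_derive t 1 (fun s => complex.Im (f s)) (complex.Im d).

Lemma CderiveE f g t d e : Cderive f t d -> (forall s, f s = g s) -> d = e -> Cderive g t e.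
Proof. by move=> h /funext <- <-. Qed.

Lemma Cderive_cst z t : Cderive (fun=> z) t 0.
Proof. by split; exact: is_derive_cst. Qed.

Lemma CderiveD f g t d e : Cderive f t d -> Cderive g t e ->
  Cderive (fun s => f s + g s) t (d + e).
Proof.
move=> [f1 f2] [g1 g2]; split.
  rewrite ReD (_ : (fun s : R => _) = (fun s => complex.Re (f s)) + (fun s => complex.Re (g s))).
    exact: is_deriveD.
  by apply/funext => s; rewrite ReD.
rewrite ImD (_ : (fun s : R => _) = (fun s => complex.Im (f s)) + (fun s => complex.Im (g s))).
  exact: is_deriveD.
by apply/funext => s; rewrite ImD.
Qed.

Lemma is_derive_ext (F H : R -> R) (t d e : R) : is_derive t 1 F d ->
  (forall s, F s = H s) -> d = e -> is_derive t 1 H e.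
Proof. by move=> h /funext <- <-. Qed.

Lemma CderiveM f g t d e : Cderive f t d -> Cderive g t e ->
  Cderive (fun s => f s * g s) t (d * g t + f t * e).
Proof.
move=> [f1 f2] [g1 g2]; split.
  apply: is_derive_ext (is_deriveB (is_deriveM f1 g1) (is_deriveM f2 g2)) _ _ => [s|].
    by rewrite Re_mul.
  by rewrite ReD !Re_mul /GRing.scale /=; ring.
apply: is_derive_ext (is_deriveD (is_deriveM f1 g2) (is_deriveM f2 g1)) _ _ => [s|].
  by rewrite Im_mul.
by rewrite ImD !Im_mul /GRing.scale /=; ring.
Qed.

Lemma CderiveZ z f t d : Cderive f t d -> Cderive (fun s => z * f s) t (z * d).
Proof.
move=> h; apply: CderiveE (CderiveM (Cderive_cst z t) h) _ _ => //.
by rewrite mul0r add0r.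
Qed.

Lemma Cderive_sum (I : Type) (r : seq I) (P : pred I) (f : I -> R -> R[i]) t d :
  (forall i, P i -> Cderive (f i) t (d i)) ->
  Cderive (fun s => \sum_(i <- r | P i) f i s) t (\sum_(i <- r | P i) d i).
Proof.
move=> h; elim: r => [|i r IH].
  apply: CderiveE (Cderive_cst 0 t) _ _ => [s|]; by rewrite big_nil.
have [Pi|Pi] := boolP (P i).
  apply: CderiveE (CderiveD (h i Pi) IH) _ _ => [s|]; by rewrite big_cons Pi.
by apply: CderiveE IH _ _ => [s|]; rewrite big_cons (negbTE Pi).
Qed.

Lemma Cderive_cis (a t : R) :
  Cderive (fun s => cis (- (a * s))) t (- (Ci * a%:C) * cis (- (a * t))).
Proof.
have h : is_derive t 1 (fun s => - (a * s)) (- a).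
  rewrite (_ : (fun s : R => _) = - (a \*: (@id R))); last by apply/funext.
  by apply: is_derive_eq; rewrite scaler1.
split.
  have := @is_derive1_comp R cos (fun s => - (a * s)) t _ _ (is_derive_cos (- (a * t))) h.
  move=> /is_derive_eq; apply; rewrite /cis /=; ring.
have := @is_derive1_comp R sin (fun s => - (a * s)) t _ _ (is_derive_sin (- (a * t))) h.
move=> /is_derive_eq; apply; rewrite /cis /=; ring.
Qed.

(** The mean value theorem fails for complex values. It is applied to the real function
    [Re (conj z f)], where [z] is the increment of [f]; its own increment is [|z|^2]. *)
Lemma Cderive_mean_value f d (T M s t : R) :
  (forall r, `|r| <= T -> Cderive f r (d r)) -> (forall r, `|r| <= T -> normc (d r) <= M) ->
  `|s| <= T -> `|t| <= T -> normc (f t - f s) <= M * `|t - s|.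
Proof.
move=> hd hM; wlog st : s t / s <= t.
  move=> h sT tT; have [st|st] := leP s t; first exact: h.
  by rewrite normc_distrC distrC; apply: h => //; exact: ltW.
move=> sT tT; pose z := f t - f s.
pose phi r := complex.Re (conjc z * f r).
have phiT : phi t - phi s = normc z ^+ 2.
  rewrite /phi -ReN -ReD -mulrN -mulrDr mulrC normc_mulJ //.
have dphi (r : R) : `|r| <= T -> is_derive (r : R) (1 : R) phi (complex.Re (conjc z * d r)).
  by move=> rT; have [] := CderiveZ (conjc z) (hd r rT).
have cphi r : `|r| <= T -> {for r, continuous phi}.
  by move=> /dphi h; apply: differentiable_continuous; apply/derivable1_diffP; exact: ex_derive.
have bd r : `|r| <= T -> `|complex.Re (conjc z * d r)| <= normc z * M.
  move=> rT; apply: le_trans (normc_Re _) _; rewrite normcM normcJ.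
  by rewrite ler_wpM2l ?normc_ge0// hM.
have M0 : 0 <= M by apply: le_trans (normc_ge0 _) (hM t tT).
have inT r : r \in `[s, t] -> `|r| <= T.
  rewrite in_itv /= => /andP[sr rt]; move: sT tT; rewrite !ler_norml => /andP[s1 _] /andP[_ t2].
  by rewrite (le_trans s1)// (le_trans rt).
have key : normc z ^+ 2 <= normc z * M * `|t - s|.
  rewrite -phiT.
  have [||c ct ->] := @MVT_segment R phi (fun r => complex.Re (conjc z * d r)) s t st.
  - by move=> r /subset_itv_oo_cc /inT; exact: dphi.
  - apply: continuous_in_subspaceT => r; rewrite inE /= => /inT; exact: cphi.
  rewrite [`|t - s|]ger0_norm ?subr_ge0// ler_wpM2r ?subr_ge0//.
  by apply: le_trans (ler_norm _) (bd _ (inT _ ct)).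
have [z0|z0] := eqVneq (normc z) 0; first by rewrite -/z z0 mulr_ge0.
have zp : 0 < normc z by rewrite lt_neqAle eq_sym z0 normc_ge0.
by rewrite -/z -(ler_pM2l zp) -expr2 mulrA.
Qed.

End complex_derivative.

(** The substitution of [n - b] for [b] preserves the range only if both [b] and [n - b] are
    confined to it, which is how all the truncations below are made. *)
Lemma sum_zrange_reflect (S : nmodType) K (n : int) (P : pred int) (h : int -> S) :
  (forall b, P (n - b) = P b) ->
  \sum_(b <- zrange K | (n - b \in zrange K) && P b) h b =
  \sum_(b <- zrange K | (n - b \in zrange K) && P b) h (n - b).
Proof.
move=> hP; rewrite -big_filter -[RHS]big_filter -[RHS](big_map (fun b => n - b) xpredT h).
apply: perm_big; apply: uniq_perm; first by rewrite filter_uniq// zrange_uniq.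
  by rewrite map_inj_uniq ?filter_uniq ?zrange_uniq// => x y /addrI /oppr_inj.
have K1 b : n - (n - b) = b by rewrite opprB addrC subrK.
move=> b; rewrite mem_filter; apply/idP/mapP => [/andP[/andP[h1 h2] h3]|[c]].
  by exists (n - b); rewrite ?mem_filter K1 ?h1 ?h3 ?hP ?h2.
by rewrite mem_filter => /andP[/andP[h1 h2] h3] ->; rewrite K1 h3 hP h2 h1.
Qed.

Lemma big_pred2_seq (S : nmodType) (I : eqType) (s : seq I) (x y : I) (f : I -> S) :
  uniq s -> x \in s -> y \in s ->
  \sum_(c <- s | (c == x) || (c == y)) f c = if x == y then f x else f x + f y.
Proof.
move=> us xs ys; case: eqVneq => [<-|xy].
  under eq_bigl do rewrite orbb.
  by rewrite -big_filter filter_pred1_uniq// big_seq1.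
rewrite (bigID (pred1 x)) /=.
rewrite (eq_bigl (pred1 x)) => [|c /=]; last by case: eqVneq; rewrite ?andbF.
rewrite -big_filter filter_pred1_uniq// big_seq1; congr (_ + _).
rewrite (eq_bigl (pred1 y)) => [|c /=]; last first.
  by case: (c =P x) => [->|]; rewrite ?andbF ?andbT ?(negbTE xy).
by rewrite -big_filter filter_pred1_uniq// big_seq1.
Qed.

(** If [f] and [g] together determine the pair [(b, c)], the double sum is part of a product of two
    simple sums. *)
Lemma double_sum_le (R : realType) K (P : int -> int -> bool) (f g : int -> int -> int)
    (F G : int -> R) (A B : R) :
  (forall b c b' c', f b c = f b' c' -> g b c = g b' c' -> b = b' /\ c = c') ->
  (forall n, 0 <= F n) -> (forall n, 0 <= G n) ->
  (forall M, \sum_(n <- zrange M) F n <= A) -> (forall M, \sum_(n <- zrange M) G n <= B) ->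
  \sum_(b <- zrange K) \sum_(c <- zrange K | P b c) F (f b c) * G (g b c) <= A * B.
Proof.
move=> inj F0 G0 hA hB.
pose t := [seq (b, c) | b <- zrange K, c <- zrange K].
have ut : uniq t by apply: allpairs_uniq; rewrite ?zrange_uniq// => -[x1 x2] [y1 y2] _ _ [-> ->].
pose ph (p : int * int) := (f p.1 p.2, g p.1 p.2).
have iph : injective ph by move=> [b c] [b' c'] [h1 h2]; have [-> ->] := inj _ _ _ _ h1 h2.
pose M := (\max_(p <- t) maxn (absz (f p.1 p.2)) (absz (g p.1 p.2)))%N.
pose t' := [seq (b, c) | b <- zrange M, c <- zrange M].
have ut' : uniq t' by apply: allpairs_uniq; rewrite ?zrange_uniq// => -[x1 x2] [y1 y2] _ _ [-> ->].
have ss : {subset map ph t <= t'}.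
  move=> _ /mapP[p pt ->]; apply: allpairs_f; rewrite mem_zrange;
    apply: (@leq_trans (maxn (absz (f p.1 p.2)) (absz (g p.1 p.2)))) (leq_bigmax_seq _ pt isT).
    exact: leq_maxl.
  exact: leq_maxr.
pose FG (p : int * int) := F p.1 * G p.2.
have FG0 p : 0 <= FG p by exact: mulr_ge0.
apply: (@le_trans _ _ (\sum_(p <- map ph t) FG p)).
  rewrite [leRHS]big_map /t big_allpairs; apply: ler_sum => b _.
  rewrite [leLHS]big_mkcond /=; apply: ler_sum => c _; case: ifP => // _; exact: FG0.
apply: (@le_trans _ _ (\sum_(p <- t') FG p)).
  by apply: sum_subset => //; rewrite map_inj_uniq.
rewrite /t' big_allpairs /FG /=.
under eq_bigr do rewrite -mulr_sumr.
by rewrite -mulr_suml ler_pM// sumr_ge0.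
Qed.

Lemma zrange_pseries (R : realType) (p : R) : 1 < p -> exists2 Z : R, 0 <= Z & forall M,
  \sum_(n <- zrange M) (if n == 0 then 0 else `|n|%:~R `^ (- p)) <= Z.
Proof.
move=> p1; have [Z /ltW Z0 hZ] := pseries_bound p1.
exists (2 * Z); first by rewrite mulr_ge0.
move=> M; pose h (n : int) : R := if n == 0 then 0 else `|n|%:~R `^ (- p).
have h0 n : 0 <= h n by rewrite /h; case: ifP => // _; exact: powR_ge0.
apply: (@le_trans _ _ (\sum_(n <- 0 :: [seq i.+1%:Z | i <- iota 0 M] ++ [seq - i.+1%:Z | i <- iota 0 M]) h n)).
  apply: sum_subset => //; first exact: zrange_uniq.
    rewrite /= cat_uniq !map_inj_uniq ?iota_uniq//; try by move=> ? ?; lia.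
    rewrite mem_cat; apply/and4P; split => //.
      by rewrite negb_or; apply/andP; split; apply/mapP => -[i _]; lia.
    by apply/hasPn => _ /mapP[i _ ->]; apply/mapP => -[j _]; lia.
  move=> n; rewrite mem_zrange inE mem_cat => nM.
  case: n nM => [[|n]|n] /= nM //.
    by apply/orP; left; apply/mapP; exists n => //; rewrite mem_iota.
  by apply/orP; right; apply/mapP; exists n; rewrite ?mem_iota// NegzE.
rewrite big_cons {1}/h eqxx add0r big_cat !big_map /= mulr_natl mulr2n.
have iE (F : nat -> R) : \sum_(i <- iota 0 M) F i = \sum_(i < M) F i.
  by rewrite -val_enum_ord big_map big_enum.
rewrite !iE; apply: lerD; apply: le_trans (hZ M); apply: ler_sum => i _;
  by rewrite /h ?oppr_eq0 ?normrN.
Qed.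

Lemma normc_int (R : realType) (z : int) : normc (z%:~R : R[i]) = `|z|%:~R.
Proof.
have -> : (z%:~R : R[i]) = (z%:~R)%:C by rewrite rmorph_int.
by rewrite normcR intr_norm.
Qed.

(** With [b + c + d = n], the letters [B, C, D] stand for [|b|, |c|, |d|] and [M1, M2, M3] for
    [|b + c|, |n - c|, |n - b|]. The denominators of the normal form pay for the derivative
    [|b| + |c| + |d|] and still gain [1/|n|]. *)
Lemma weight_le (R : realType) (B C D M1 M2 M3 N : R) :
  0 < B -> 0 < M1 -> 0 < M2 -> 0 < M3 -> 0 < N -> C <= M1 + B -> D <= M2 + B ->
  2 * N <= M1 + M2 + M3 -> N <= B + M3 ->
  (B + C + D) / (B * (3 * M3 * M1 * M2)) <=
  N^-1 * ((M1 * M2)^-1 + (M1 * M3)^-1 + (M2 * M3)^-1 + (B * M1)^-1 + (B * M2)^-1).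
Proof.
move=> B0 m1 m2 m3 N0 hC hD h1 h2.
have X0 : 0 < B * M1 * M2 * M3 by rewrite !mulr_gt0.
have -> : (M1 * M2)^-1 + (M1 * M3)^-1 + (M2 * M3)^-1 + (B * M1)^-1 + (B * M2)^-1 =
   (M3 * B + M2 * B + M1 * B + M2 * M3 + M1 * M3) / (B * M1 * M2 * M3).
  by field; rewrite !gt_eqF.
have -> : (B + C + D) / (B * (3 * M3 * M1 * M2)) = (B + C + D) / 3 / (B * M1 * M2 * M3).
  by field; rewrite !gt_eqF.
rewrite mulrA ler_pM2r ?invr_gt0// ler_pdivlMl//.
have a1 : N * (B + C + D) <= N * (3 * B + M1 + M2) by rewrite ler_pM2l//; lra.
have a2 : N * B <= (M1 + M2 + M3) / 2 * B by rewrite ler_pM2r//; lra.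
have a3 : N * (M1 + M2) <= (B + M3) * (M1 + M2) by rewrite ler_pM2r// addr_gt0.
have := mulr_gt0 B0 m1; have := mulr_gt0 B0 m2; have := mulr_gt0 B0 m3.
have := mulr_gt0 m1 m3; have := mulr_gt0 m2 m3.
nra.
Qed.

(** Turns the product of majorants and weights into sums of products of two squares, to be summed by
    [double_sum_le]. *)
Lemma weight_squares (R : realType) (x y z p q r s : R) :
  (x * y + x * z + y * z) * (p * q + p * r + q * r + s * p + s * q) <=
  3 / 2 * (x ^+ 2 * y ^+ 2 + x ^+ 2 * z ^+ 2 + y ^+ 2 * z ^+ 2)
  + 5 / 2 * (p ^+ 2 * q ^+ 2 + p ^+ 2 * r ^+ 2 + q ^+ 2 * r ^+ 2 + s ^+ 2 * p ^+ 2 + s ^+ 2 * q ^+ 2).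
Proof.
rewrite -!exprMn; move: (x * y) (x * z) (y * z) (p * q) (p * r) (q * r) (s * p) (s * q).
clear; move=> X Y W k1 k2 k3 k4 k5.
have h1 : (X + Y + W) ^+ 2 <= 3 * (X ^+ 2 + Y ^+ 2 + W ^+ 2).
  have := sqr_ge0 (X - Y); have := sqr_ge0 (X - W); have := sqr_ge0 (Y - W); nra.
have h2 : (k1 + k2 + k3 + k4 + k5) ^+ 2 <= 5 * (k1 ^+ 2 + k2 ^+ 2 + k3 ^+ 2 + k4 ^+ 2 + k5 ^+ 2).
  clear h1; have := sqr_ge0 (k1 - k2); have := sqr_ge0 (k1 - k3); have := sqr_ge0 (k1 - k4).
  have := sqr_ge0 (k2 - k3); have := sqr_ge0 (k2 - k4); have := sqr_ge0 (k2 - k5).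
  have := sqr_ge0 (k3 - k4); have := sqr_ge0 (k3 - k5); have := sqr_ge0 (k4 - k5).
  have := sqr_ge0 (k1 - k5); nra.
have := sqr_ge0 (X + Y + W - (k1 + k2 + k3 + k4 + k5)).
rewrite sqrrB; move: h1 h2.
move: (X ^+ 2) (Y ^+ 2) (W ^+ 2) (k1 ^+ 2) (k2 ^+ 2) (k3 ^+ 2) (k4 ^+ 2) (k5 ^+ 2).
move: (X + Y + W) (k1 + k2 + k3 + k4 + k5); clear => u w x1 x2 x3 x4 x5 x6 x7 x8.
rewrite mulr2n; move: (u * w) (u ^+ 2) (w ^+ 2); clear => *; lra.
Qed.

Lemma mul_le_sqrD (R : realType) (x y : R) : x * y <= x ^+ 2 + y ^+ 2.
Proof. by have := sqr_ge0 (x - y); have := sqr_ge0 x; have := sqr_ge0 y; nra. Qed.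

Lemma quartic_le (R : realType) (nb nc nd gb gc gd x y z ls : R) :
  nb * (gb * (y * z)) <= nb * ls -> nc * (gc * (x * z)) <= nc * ls ->
  nd * (gd * (x * y)) <= nd * ls -> 0 <= ls * nb -> 0 <= ls * nc -> 0 <= ls * nd ->
  nb / 2 * gb * (y * z) + x * (nc / 2 * gc * z + y * (nd / 2 * gd)) <= ls * (nb + nc + nd).
Proof.
move=> h1 h2 h3 p1 p2 p3.
have -> : nb / 2 * gb * (y * z) + x * (nc / 2 * gc * z + y * (nd / 2 * gd)) =
  (nb * (gb * (y * z)) + nc * (gc * (x * z)) + nd * (gd * (x * y))) / 2 by ring.
by rewrite !mulrDr; rewrite !(mulrC _ ls) in h1 h2 h3; lra.
Qed.

(** * The truncated normal form for a system of modes [v] with nonlinearity [G] *)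

Section normal_form.
Variables (R : realType) (v G : int -> R -> R[i]).
Local Notation Ci := (0 +i* 1 : R[i]).
Hypotheses (v0 : forall t, v 0 t = 0)
  (dv : forall n t, Cderive (v n) t (- (Ci * n%:~R / 2) * G n t)).

Definition phase (Q : int) (t : R) : R[i] := cis (- (Q%:~R * t)).

Lemma phaseD Q Q' t : phase (Q + Q') t = phase Q t * phase Q' t.
Proof. by rewrite /phase intrD mulrDl opprD cisD. Qed.

Lemma phase0 t : phase 0 t = 1.
Proof. by rewrite /phase mul0r oppr0 cis0. Qed.

Lemma normc_phase Q t : normc (phase Q t) = 1.
Proof. exact: normc_cis. Qed.

Lemma phase_derive Q t : Cderive (phase Q) t (- (Ci * Q%:~R) * phase Q t).
Proof.
by apply: CderiveE (Cderive_cis Q%:~R t) _ _ => //; rewrite rmorph_int.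
Qed.

(** The truncated convolution once the linear flow is removed from the modes: the phase that remains
    is [m^3 - c^3 - (m - c)^3 = 3 m c (m - c)]. *)
Definition int_conv (K : nat) (m : int) (t : R) : R[i] :=
  \sum_(c <- zrange K | m - c \in zrange K)
    phase (3 * m * c * (m - c)) t * (v c t * v (m - c) t).

Variables (n : int) (K : nat).
Local Notation Z := (zrange K).

(** With [d = n - b - c], the phase [Phi] is [n^3 - b^3 - c^3 - d^3 = 3 (c + d) (b + c) (b + d)]. It
    vanishes on [res], and for [c + d = n - b = 0], which [A1] excludes. *)
Let A1 b := (n - b \in Z) && ((b != 0) && (n - b != 0)).
Let A2 b c := [&& n - b - c \in Z, c != 0 & n - b - c != 0].
Let res (b c : int) := (b + c == 0) || (n - c == 0).
Let Phi (b c : int) : int := 3 * (n - b) * (b + c) * (n - c).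
Let vvv b c t := v b t * (v c t * v (n - b - c) t).
Let dvvv b c t := (- (Ci * b%:~R / 2) * G b t) * (v c t * v (n - b - c) t) +
  v b t * ((- (Ci * c%:~R / 2) * G c t) * v (n - b - c) t +
           v c t * (- (Ci * (n - b - c)%:~R / 2) * G (n - b - c) t)).

(** Boundary term of the first integration by parts: the factor [n/2] of the nonlinearity over the
    phase [3 n b (n - b)]. *)
Definition nf_pair t : R[i] := \sum_(b <- Z | A1 b)
  (6 * b * (n - b))%:~R^-1 * (phase (3 * n * b * (n - b)) t * (v b t * v (n - b) t)).

(** Boundary term of the second integration by parts, over the non-resonant triples. *)
Definition nf_triple t : R[i] := \sum_(b <- Z | A1 b) \sum_(c <- Z | A2 b c && ~~ res b c)
  (b * Phi b c)%:~R^-1 * (phase (Phi b c) t * vvv b c t).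

Definition nf_quartic t : R[i] := \sum_(b <- Z | A1 b) \sum_(c <- Z | A2 b c && ~~ res b c)
  (b * Phi b c)%:~R^-1 * (phase (Phi b c) t * dvvv b c t).

Definition nf_resonant t : R[i] := \sum_(b <- Z | A1 b) \sum_(c <- Z | A2 b c && res b c)
  b%:~R^-1 * vvv b c t.

(** The error made when [G (n - b)] is replaced by its truncated convolution in the sum that the
    first integration by parts produces. *)
Definition nf_tail t : R[i] := \sum_(b <- Z | A1 b)
  b%:~R^-1 * (phase (3 * n * b * (n - b)) t * (v b t * (G (n - b) t - int_conv K (n - b) t))).

Definition nf_energy t : R[i] := v n t - nf_pair t + 6^-1 * nf_triple t.

(** The product rule puts the derivative once on [v_b] and once on [v_(n-b)]; the reflection that
    exchanges [b] and [n - b] makes the two sums equal, whence a single sum with weight [1/b]. *)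
Lemma nf_pair_derive t : Cderive nf_pair t (- (Ci * n%:~R / 2) * int_conv K n t -
  Ci / 6 * \sum_(b <- Z | A1 b) b%:~R^-1 * (phase (3 * n * b * (n - b)) t * (v b t * G (n - b) t))).
Proof.
have h b : Cderive (fun t => (6 * b * (n - b))%:~R^-1 * (phase (3 * n * b * (n - b)) t * (v b t * v (n - b) t))) t _ :=
  CderiveZ _ (CderiveM (phase_derive _ t) (CderiveM (dv b t) (dv (n - b) t))).
apply: CderiveE (Cderive_sum Z (fun b _ => h b)) _ _ => //.
pose W b := b%:~R^-1 * (phase (3 * n * b * (n - b)) t * (v b t * G (n - b) t)).
have e b : A1 b -> (6 * b * (n - b))%:~R^-1 *
    (- (Ci * (3 * n * b * (n - b))%:~R) * phase (3 * n * b * (n - b)) t * (v b t * v (n - b) t) +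
     phase (3 * n * b * (n - b)) t *
     (- (Ci * b%:~R / 2) * G b t * v (n - b) t + v b t * (- (Ci * (n - b)%:~R / 2) * G (n - b) t))) =
   - (Ci * n%:~R / 2) * (phase (3 * n * b * (n - b)) t * (v b t * v (n - b) t))
   + (- (Ci / 12) * W b + - (Ci / 12) * W (n - b)).
  move=> /and3P[_ b0 a0]; rewrite /W (_ : n - (n - b) = b); last by rewrite opprB addrC subrK.
  rewrite (_ : 3 * n * (n - b) * b = 3 * n * b * (n - b)); last by ring.
  have b0' : (b%:~R : R[i]) != 0 by rewrite intr_eq0.
  have a0' : ((n - b)%:~R : R[i]) != 0 by rewrite intr_eq0.
  rewrite !intrM; move: (phase _ t) (v b t) (v (n - b) t) (G b t) (G (n - b) t) Ci => p x y z w i.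
  move: ((n - b)%:~R : R[i]) (b%:~R : R[i]) a0' b0' => a b' a0' b0'.
  by field; rewrite a0' b0'.
rewrite (eq_bigr _ e) big_split /=; congr (_ + _).
  rewrite -mulr_sumr /int_conv; congr (_ * _).
  rewrite big_mkcond [RHS]big_mkcond; apply: eq_bigr => b _; rewrite /A1.
  case: (n - b \in Z) => //=; have [->|b0] := eqVneq b 0; first by rewrite v0 mul0r mulr0.
  by have [->|a0] := eqVneq (n - b) 0; rewrite //= v0 !mulr0.
rewrite big_split /= -!mulr_sumr -[X in _ + X](congr1 (fun x => - (Ci / 12) * x)
  (sum_zrange_reflect (P := fun b => (b != 0) && (n - b != 0)) K W _)); last first.
  by move=> b; rewrite andbC opprB addrC subrK.
rewrite -mulrDr; pose S := \sum_(b <- Z | A1 b) W b.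
change (- (Ci / 12) * (S + S) = - (Ci / 6 * S)); by move: S => S; field.
Qed.

Lemma nf_triple_derive t : Cderive nf_triple t (- Ci * \sum_(b <- Z | A1 b)
  \sum_(c <- Z | A2 b c && ~~ res b c) b%:~R^-1 * (phase (Phi b c) t * vvv b c t) + nf_quartic t).
Proof.
have h b c : Cderive (fun t => (b * Phi b c)%:~R^-1 * (phase (Phi b c) t * vvv b c t)) t _ :=
  CderiveZ _ (CderiveM (phase_derive _ t) (CderiveM (dv b t) (CderiveM (dv c t) (dv (n - b - c) t)))).
apply: CderiveE (Cderive_sum Z (fun b _ => Cderive_sum Z (fun c _ => h b c))) _ _ => //.
rewrite /nf_quartic mulr_sumr -big_split /=; apply: eq_bigr => b /and3P[_ b0 a0].
rewrite mulr_sumr -big_split /=; apply: eq_bigr => c /andP[_]; rewrite /res negb_or => /andP[m1 m2].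
have P0 : (Phi b c)%:~R != 0 :> R[i] by rewrite intr_eq0 /Phi !mulf_neq0.
have b0' : (b%:~R : R[i]) != 0 by rewrite intr_eq0.
rewrite -/(dvvv b c t) mulrDr; congr (_ + _); rewrite intrM /vvv.
move: (phase _ t) (v b t * _) Ci => p x i.
move: ((Phi b c)%:~R : R[i]) (b%:~R : R[i]) P0 b0' => a b' P0 b0'.
by field; rewrite P0 b0'.
Qed.

(** The derivative of [nf_pair] cancels the truncated convolution in that of [v_n]. In the sum it
    leaves, [G (n - b)] is expanded once more, and [nf_triple] removes the non-resonant triples. *)
Lemma nf_energy_derive t : Cderive nf_energy t
  (- (Ci * n%:~R / 2) * (G n t - int_conv K n t) +
   Ci / 6 * (nf_tail t + nf_resonant t) + 6^-1 * nf_quartic t).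
Proof.
apply: CderiveE (CderiveD (CderiveD (dv n t) (CderiveZ (-1) (nf_pair_derive t)))
  (CderiveZ (6^-1) (nf_triple_derive t))) _ _ => [s|].
  by rewrite /nf_energy mulN1r.
have e : \sum_(b <- Z | A1 b) b%:~R^-1 * (phase (3 * n * b * (n - b)) t * (v b t * G (n - b) t)) =
    nf_tail t + (nf_resonant t + \sum_(b <- Z | A1 b)
      \sum_(c <- Z | A2 b c && ~~ res b c) b%:~R^-1 * (phase (Phi b c) t * vvv b c t)).
  rewrite /nf_tail /nf_resonant -!big_split /=; apply: eq_bigr => b /and3P[_ b0 a0].
  have -> : \sum_(c <- Z | A2 b c && res b c) b%:~R^-1 * vvv b c t =
     \sum_(c <- Z | A2 b c && res b c) b%:~R^-1 * (phase (Phi b c) t * vvv b c t).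
    apply: eq_bigr => c /andP[_]; rewrite /res /Phi => /orP[]/eqP ->; by rewrite ?mulr0 ?mul0r phase0 mul1r.
  rewrite -(bigID (res b) (A2 b)) /= -mulr_sumr -mulrDr; congr (_ * _).
  have -> : \sum_(c <- Z | A2 b c) phase (Phi b c) t * vvv b c t =
      phase (3 * n * b * (n - b)) t * (v b t * int_conv K (n - b) t).
    rewrite /int_conv !mulr_sumr big_mkcond [RHS]big_mkcond; apply: eq_bigr => c _.
    rewrite /A2; case: (n - b - c \in Z) => //=; have [->|c0] := eqVneq c 0.
      by rewrite v0 mul0r !mulr0.
    have [->|d0] := eqVneq (n - b - c) 0; first by rewrite v0 !mulr0.
    rewrite /= (_ : Phi b c = 3 * n * b * (n - b) + 3 * (n - b) * c * (n - b - c)).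
      by rewrite phaseD /vvv; ring.
    by rewrite /Phi; ring.
  ring.
rewrite e; set s1 := \sum_(b <- Z | A1 b) _.
move: (nf_tail t) (nf_resonant t) (nf_quartic t) s1 (G n t) (int_conv K n t) Ci => x1 x2 x3 x4 x5 x6 i.
by field.
Qed.

Local Notation N z := (`|z|%:~R : R).
Let iv (z : int) : R := (N z)^-1 ^+ 2.

Definition nf_sigma (al : int -> R) b c d := al b * al c + al b * al d + al c * al d.

(** The estimates that both rounds of the bootstrap supply. The majorants [al] are [|v_m|] in the
    first round and [|m|^(-3/4)] in the second; [lam] is a constant in the first and [O(|n|^(-3/4))]
    in the second. The outcome is a variation [O(lam / |n|)] of the mode. *)
Definition nf_control (lam A t : R) : Prop := exists al : int -> R,
  [/\ forall m, 0 <= al m,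
      forall M, \sum_(m <- zrange M) al m ^+ 2 <= A,
      forall a b, a + b = n -> a != 0 -> b != 0 ->
        normc (v a t) * normc (v b t) / (N a * N b) <= lam / N n * (al a ^+ 2 + al b ^+ 2),
      forall b c d, b + c + d = n -> b != 0 -> c != 0 -> d != 0 ->
        normc (G b t) * (normc (v c t) * normc (v d t)) <= lam * nf_sigma al b c d /\
        normc (v b t) * (normc (v c t) * normc (v d t)) <= lam * nf_sigma al b c d &
      normc (v n t) ^+ 3 <= lam].

Lemma N_ge1 (z : int) : z != 0 -> 1 <= N z.
Proof. by move=> z0; rewrite -[1]/(1%:~R) ler_int; lia. Qed.

Lemma N_gt0 (z : int) : z != 0 -> 0 < N z.
Proof. by move=> /N_ge1; exact: lt_le_trans. Qed.

Lemma N_leD (a b c : int) : (`|a| <= `|b| + `|c|) -> N a <= N b + N c.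
Proof. by rewrite -intrD ler_int. Qed.

Variables (lam A E Zc t : R).
Hypotheses (n0 : n != 0) (lam0 : 0 <= lam) (nK : (absz n <= K)%N)
  (hZ : forall M, \sum_(m <- zrange M) (N m)^-1 ^+ 2 <= Zc)
  (ctl : nf_control lam A t).
Let B := (9 * A ^+ 2 + 25 * Zc ^+ 2) / 2.

Let P b c := [&& A1 b, A2 b c & ~~ res b c].

Lemma double_sumE (f : int -> int -> R) :
  \sum_(b <- Z | A1 b) \sum_(c <- Z | A2 b c && ~~ res b c) f b c =
  \sum_(b <- Z) \sum_(c <- Z | P b c) f b c.
Proof.
rewrite big_mkcond; apply: eq_bigr => b _; rewrite /P; case: (A1 b) => //=.
by rewrite big_pred0.
Qed.

Lemma nf_weight_le al b c : (forall m, 0 <= al m) -> P b c ->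
  lam * nf_sigma al b c (n - b - c) * (N b + N c + N (n - b - c)) / (N b * N (Phi b c)) <=
  lam / N n * (3 / 2 * (al b ^+ 2 * al c ^+ 2 + al b ^+ 2 * al (n - b - c) ^+ 2 + al c ^+ 2 * al (n - b - c) ^+ 2)
    + 5 / 2 * (iv (b + c) * iv (n - c) + iv (b + c) * iv (n - b) + iv (n - c) * iv (n - b)
      + iv b * iv (b + c) + iv b * iv (n - c))).
Proof.
move=> al0 /and3P[/and3P[_ b0 m3] /and3P[_ c0 d0]]; rewrite negb_or => /andP[m1 m2].
have w : (N b + N c + N (n - b - c)) / (N b * (3 * N (n - b) * N (b + c) * N (n - c))) <=
    (N n)^-1 * ((N (b + c) * N (n - c))^-1 + (N (b + c) * N (n - b))^-1 + (N (n - c) * N (n - b))^-1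
     + (N b * N (b + c))^-1 + (N b * N (n - c))^-1).
  apply: weight_le; rewrite ?N_gt0//.
  - by apply: N_leD; lia.
  - by apply: N_leD; lia.
  - by rewrite -[2]/(2%:~R) -intrM -!intrD ler_int; lia.
  - by apply: N_leD; lia.
have s0 : 0 <= nf_sigma al b c (n - b - c) by rewrite /nf_sigma !addr_ge0// mulr_ge0.
rewrite (_ : N (Phi b c) = 3 * N (n - b) * N (b + c) * N (n - c)); last first.
  by rewrite /Phi !normrM !intrM.
rewrite -(mulrA (lam * _)) -!(mulrA lam); apply: ler_wpM2l => //.
apply: le_trans (ler_wpM2l s0 w) _.
rewrite mulrCA; apply: ler_wpM2l; first by rewrite invr_ge0 ltW// N_gt0.
by rewrite /nf_sigma /iv !invfM; exact: weight_squares.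
Qed.

(** Common to the cubic and quartic sums. After [nf_weight_le] each term is a product of two
    squares, in two of the quantities [b, c, n - b - c, b + c, n - b, n - c]; each of the eight
    pairs that occur determines [(b, c)]. *)
Lemma nf_double_sum (f : int -> int -> R) :
  (forall al b c, (forall m, 0 <= al m) -> (forall M, \sum_(m <- zrange M) al m ^+ 2 <= A) ->
    (forall b c d, b + c + d = n -> b != 0 -> c != 0 -> d != 0 ->
        normc (G b t) * (normc (v c t) * normc (v d t)) <= lam * nf_sigma al b c d /\
        normc (v b t) * (normc (v c t) * normc (v d t)) <= lam * nf_sigma al b c d) ->
     P b c ->
     f b c <= lam * nf_sigma al b c (n - b - c) * (N b + N c + N (n - b - c)) / (N b * N (Phi b c))) ->
  \sum_(b <- Z | A1 b) \sum_(c <- Z | A2 b c && ~~ res b c) f b c <= lam / N n * B.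
Proof.
move=> hf; case: ctl => al [al0 alA _ alG _].
rewrite double_sumE.
apply: (@le_trans _ _ (lam / N n * \sum_(b <- Z) \sum_(c <- Z | P b c)
  (3 / 2 * (al b ^+ 2 * al c ^+ 2 + al b ^+ 2 * al (n - b - c) ^+ 2 + al c ^+ 2 * al (n - b - c) ^+ 2)
    + 5 / 2 * (iv (b + c) * iv (n - c) + iv (b + c) * iv (n - b) + iv (n - c) * iv (n - b)
      + iv b * iv (b + c) + iv b * iv (n - c))))).
  rewrite mulr_sumr; apply: ler_sum => b _; rewrite mulr_sumr; apply: ler_sum => c Pbc.
  by apply: le_trans (hf al b c al0 alA alG Pbc) _; exact: nf_weight_le.
apply: ler_wpM2l; first by rewrite mulr_ge0// invr_ge0 ltW// N_gt0.
have al2 m : 0 <= al m ^+ 2 by exact: sqr_ge0.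
have iv2 m : 0 <= iv m by exact: sqr_ge0.
pose D f g F H := \sum_(b <- Z) \sum_(c <- Z | P b c) (F (f b c : int) : R) * (H (g b c : int) : R).
have e : \sum_(b <- Z) \sum_(c <- Z | P b c)
  (3 / 2 * (al b ^+ 2 * al c ^+ 2 + al b ^+ 2 * al (n - b - c) ^+ 2 + al c ^+ 2 * al (n - b - c) ^+ 2)
    + 5 / 2 * (iv (b + c) * iv (n - c) + iv (b + c) * iv (n - b) + iv (n - c) * iv (n - b)
      + iv b * iv (b + c) + iv b * iv (n - c))) =
  3 / 2 * (D (fun b c => b) (fun b c => c) (fun m => al m ^+ 2) (fun m => al m ^+ 2) +
     D (fun b c => b) (fun b c => n - b - c) (fun m => al m ^+ 2) (fun m => al m ^+ 2) +
     D (fun b c => c) (fun b c => n - b - c) (fun m => al m ^+ 2) (fun m => al m ^+ 2)) +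
  5 / 2 * (D (fun b c => b + c) (fun b c => n - c) iv iv + D (fun b c => b + c) (fun b c => n - b) iv iv +
     D (fun b c => n - c) (fun b c => n - b) iv iv + D (fun b c => b) (fun b c => b + c) iv iv +
     D (fun b c => b) (fun b c => n - c) iv iv).
  rewrite /D -!big_split /= !mulr_sumr -big_split /=; apply: eq_bigr => b _.
  by rewrite -!big_split /= !mulr_sumr -big_split.
rewrite e {e}.
have hal := @double_sum_le R K P _ _ (fun m => al m ^+ 2) (fun m => al m ^+ 2) A A _ al2 al2 alA alA.
have hiv := @double_sum_le R K P _ _ iv iv Zc Zc _ iv2 iv2 hZ hZ.
have := hal (fun b c => b) (fun b c => c) ltac:(move=> ? ? ? ? /= ? ?; lia); have := hal (fun b c => b) (fun b c => n - b - c) ltac:(move=> ? ? ? ? /= ? ?; lia).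
have := hal (fun b c => c) (fun b c => n - b - c) ltac:(move=> ? ? ? ? /= ? ?; lia).
have := hiv (fun b c => b + c) (fun b c => n - c) ltac:(move=> ? ? ? ? /= ? ?; lia); have := hiv (fun b c => b + c) (fun b c => n - b) ltac:(move=> ? ? ? ? /= ? ?; lia).
have := hiv (fun b c => n - c) (fun b c => n - b) ltac:(move=> ? ? ? ? /= ? ?; lia); have := hiv (fun b c => b) (fun b c => b + c) ltac:(move=> ? ? ? ? /= ? ?; lia).
have := hiv (fun b c => b) (fun b c => n - c) ltac:(move=> ? ? ? ? /= ? ?; lia).
rewrite -/(D (fun b c => b) (fun b c => n - c) iv iv) -/(D (fun b c => b) (fun b c => b + c) iv iv)
 -/(D (fun b c => n - c) (fun b c => n - b) iv iv) -/(D (fun b c => b + c) (fun b c => n - b) iv iv)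
 -/(D (fun b c => b + c) (fun b c => n - c) iv iv)
 -/(D (fun b c => c) (fun b c => n - b - c) (fun m => al m ^+ 2) (fun m => al m ^+ 2))
 -/(D (fun b c => b) (fun b c => n - b - c) (fun m => al m ^+ 2) (fun m => al m ^+ 2))
 -/(D (fun b c => b) (fun b c => c) (fun m => al m ^+ 2) (fun m => al m ^+ 2)) -!expr2 /B.
move: (D _ _ _ _) (D _ _ _ _) (D _ _ _ _) (D _ _ _ _) (D _ _ _ _) (D _ _ _ _) (D _ _ _ _) (D _ _ _ _) (A ^+ 2) (Zc ^+ 2).
by move=> *; lra.
Qed.

Lemma normc_nf_pair : normc (nf_pair t) <= lam / N n * (A / 3).
Proof.
case: ctl => al [al0 alA alp _ _].
apply: le_trans (normc_sum _ _ _) _.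
apply: (@le_trans _ _ (\sum_(b <- Z | A1 b) lam / N n * (1 / 6) * (al b ^+ 2 + al (n - b) ^+ 2))).
  apply: ler_sum => b /and3P[_ b0 a0]; rewrite !normcM normc_phase mul1r normcV normc_int !normrM !intrM.
  have -> : (`|6|%:~R * N b * N (n - b))^-1 * (normc (v b t) * normc (v (n - b) t)) =
     1 / 6 * (normc (v b t) * normc (v (n - b) t) / (N b * N (n - b))).
    by rewrite !invfM; ring.
  rewrite [lam / _ * _]mulrC -[leRHS]mulrA ler_wpM2l ?divr_ge0//.
  by apply: alp => //; rewrite addrC subrK.
have sP b : (n - b != 0) && (n - (n - b) != 0) = (b != 0) && (n - b != 0).
  by rewrite andbC opprB addrC subrK.
have e : \sum_(b <- Z | A1 b) al (n - b) ^+ 2 = \sum_(b <- Z | A1 b) al b ^+ 2.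
  exact: (esym (@sum_zrange_reflect R K n _ (fun b => al b ^+ 2) sP)).
rewrite -mulr_sumr big_split /= e.
have h : \sum_(b <- Z | A1 b) al b ^+ 2 <= A.
  apply: le_trans (alA K); rewrite big_mkcond; apply: ler_sum => b _; case: ifP => // _; exact: sqr_ge0.
rewrite -mulrA; apply: ler_wpM2l; first by rewrite divr_ge0// ltW// N_gt0.
by move: h; rewrite /A1; move: (\sum_(b <- Z | _) _); move=> *; lra.
Qed.

Lemma normc_nf_triple : normc (nf_triple t) <= lam / N n * B.
Proof.
apply: le_trans (normc_sum _ _ _) _.
apply: (@le_trans _ _ (\sum_(b <- Z | A1 b) \sum_(c <- Z | A2 b c && ~~ res b c)
  normc ((b * Phi b c)%:~R^-1 * (phase (Phi b c) t * vvv b c t)))).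
  by apply: ler_sum => b _; exact: normc_sum.
apply: nf_double_sum => al b c al0 _ alG /and3P[/and3P[_ b0 a0] /and3P[_ c0 d0] _].
have e : b + c + (n - b - c) = n by ring.
have [_ h] := alG b c (n - b - c) e b0 c0 d0.
rewrite !normcM normc_phase mul1r normcV normc_int normrM intrM mulrC.
apply: ler_wpM2r; first by rewrite invr_ge0 mulr_ge0// ler0z.
apply: le_trans h _; rewrite ler_peMr//.
  by rewrite mulr_ge0// /nf_sigma !addr_ge0// mulr_ge0.
have := N_ge1 b0; have : 0 <= N c by rewrite ler0z.
have : 0 <= N (n - b - c) by rewrite ler0z.
lra.
Qed.

Lemma normc_half_Ci (z : int) (x : R[i]) : normc (- (Ci * z%:~R / 2) * x) = N z / 2 * normc x.
Proof.
have nc : normc Ci = 1 by rewrite /normc /= expr0n expr1n add0r sqrtr1.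
have n2 : normc (2^-1 : R[i]) = 2^-1.
  by rewrite normcV -[2 in LHS]/(2%:~R) normc_int.
by rewrite normcM normcN !normcM nc n2 normc_int mul1r.
Qed.

Lemma normc_nf_quartic : normc (nf_quartic t) <= lam / N n * B.
Proof.
apply: le_trans (normc_sum _ _ _) _.
apply: (@le_trans _ _ (\sum_(b <- Z | A1 b) \sum_(c <- Z | A2 b c && ~~ res b c)
  normc ((b * Phi b c)%:~R^-1 * (phase (Phi b c) t * dvvv b c t)))).
  by apply: ler_sum => b _; exact: normc_sum.
apply: nf_double_sum => al b c al0 _ alG /and3P[/and3P[_ b0 a0] /and3P[_ c0 d0] _].
have e1 : b + c + (n - b - c) = n by ring.
have e2 : c + b + (n - b - c) = n by ring.
have e3 : (n - b - c) + b + c = n by ring.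
have [h1 _] := alG _ _ _ e1 b0 c0 d0; have [h2 _] := alG _ _ _ e2 c0 b0 d0.
have [h3 _] := alG _ _ _ e3 d0 b0 c0.
rewrite !normcM normc_phase mul1r normcV normc_int normrM intrM mulrC.
apply: ler_wpM2r; first by rewrite invr_ge0 mulr_ge0// ler0z.
have s0 : 0 <= nf_sigma al b c (n - b - c) by rewrite /nf_sigma !addr_ge0// mulr_ge0.
have E2 : nf_sigma al c b (n - b - c) = nf_sigma al b c (n - b - c) by rewrite /nf_sigma; ring.
have E3 : nf_sigma al (n - b - c) b c = nf_sigma al b c (n - b - c) by rewrite /nf_sigma; ring.
rewrite E2 in h2; rewrite E3 in h3.
apply: le_trans (normcD _ _) _; rewrite normcM normc_half_Ci [normc (v c t * _)]normcM.
rewrite [normc (v b t * _)]normcM.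
have g := normcD (- (Ci * c%:~R / 2) * G c t * v (n - b - c) t) (v c t * (- (Ci * (n - b - c)%:~R / 2) * G (n - b - c) t)).
rewrite (normcM _ (v (n - b - c) t)) (normcM (v c t)) !normc_half_Ci in g.
have {}g := ler_wpM2l (normc_ge0 (v b t)) g.
apply: le_trans (lerD (lexx _) g) _.
have Nb : 0 <= N b by rewrite ler0z.
have Nc : 0 <= N c by rewrite ler0z.
have Nd : 0 <= N (n - b - c) by rewrite ler0z.
have {}h1 := ler_wpM2l Nb h1; have {}h2 := ler_wpM2l Nc h2; have {}h3 := ler_wpM2l Nd h3.
have ls : 0 <= lam * nf_sigma al b c (n - b - c) by exact: mulr_ge0.
by apply: quartic_le => //; exact: mulr_ge0.
Qed.

Hypothesis vN : forall m, normc (v (- m) t) = normc (v m t).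

(** The resonances of a given [b] are [c = -b] and [c = n], and each gives [v_n v_b v_(-b) / b];
    they coincide for [b = -n], hence the weight 1. *)
Lemma nf_resonantE : nf_resonant t = v n t * \sum_(b <- Z)
  (if A1 b then if b == - n then 1 else 2 else 0) * (v b t * v (- b) t / b%:~R).
Proof.
rewrite /nf_resonant big_mkcond mulr_sumr; apply: eq_big_seq => b bZ.
have [A1b|_] := boolP (A1 b); last by rewrite mul0r mulr0.
case/and3P: (A1b) => aZ b0 a0.
have nbZ : - b \in Z by rewrite mem_zrange abszN -mem_zrange.
have nZ : n \in Z by rewrite mem_zrange.
rewrite big_seq_cond (eq_bigl (fun c => (c \in Z) && ((c == - b) || (c == n)))); last first.
  move=> c; case cZ: (c \in Z) => //=; rewrite /A2 /res (_ : (n - c == 0) = (c == n)); last by rewrite subr_eq0 eq_sym.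
  rewrite (_ : (b + c == 0) = (c == - b)); last by rewrite addrC addr_eq0.
  have [->|cb] := eqVneq c (- b); rewrite /=.
    by rewrite opprK subrK nZ oppr_eq0 b0 n0.
  have [->|cn] := eqVneq c n; rewrite ?andbF//= andbT.
  by rewrite (_ : n - b - n = - b) ?nbZ ?n0 ?oppr_eq0 ?b0//; ring.
rewrite -big_seq_cond big_pred2_seq ?zrange_uniq// /vvv.
rewrite opprK subrK (_ : n - b - n = - b); last by ring.
rewrite eqr_oppLR.
by case: ifP => _; ring.
Qed.

(** The summand [v_b v_(-b) / b] is odd in [b], so everything cancels where the weight [chi] is
    even. What is left sits at [b = n] and [b = -n], and gives [|v_n|^2 / |n|], and at the edge
    [|b| > K - |n|] of the truncation, an error that vanishes as [K] grows. *)
Lemma normc_nf_resonant : (absz n < K)%N ->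
  (forall M, \sum_(m <- zrange M) normc (v m t) ^+ 2 <= E) ->
  normc (nf_resonant t) <= 2 * (lam / N n) + (1 + E) * (E / (K%:R - N n)).
Proof.
move=> nK' hE.
have KN : 0 < K%:R - N n by rewrite subr_gt0 -[K%:R]/(K%:Z%:~R) ltr_int; lia.
have hl : normc (v n t) ^+ 3 <= lam by case: ctl => al [].
pose X b := v b t * v (- b) t / b%:~R.
pose chi b : R := if A1 b then if b == - n then 1 else 2 else 0.
have X1 b : X (- b) = - X b by rewrite /X opprK (mulrC (v (- b) t)) intrN invrN mulrN.
have XE b : normc (X b) = normc (v b t) ^+ 2 / N b by rewrite /X !normcM vN normcV normc_int.
have E0 : 0 <= E by apply: le_trans (hE 0%N); apply: sumr_ge0 => *; exact: sqr_ge0.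
rewrite nf_resonantE.
have -> : \sum_(b <- Z) (if A1 b then if b == - n then 1 else 2 else 0) * (v b t * v (- b) t / b%:~R) =
   \sum_(b <- Z) (chi b)%:C * X b.
  apply: eq_bigr => b _; congr (_ * _); rewrite /chi; case: (A1 b) => //; case: ifP => //.
  by rewrite (rmorph_nat (real_complex R) 2).
set S := \sum_(b <- Z) _.
(* Adding the reflected sum leaves only the difference [chi b - chi (-b)]. *)
have S2 : 2 * S = \sum_(b <- Z) (chi b - chi (- b))%:C * X b.
  have e : S = \sum_(b <- Z) - ((chi (- b))%:C * X b).
    have eZ (h : int -> R[i]) : \sum_(b <- Z | (0 - b \in Z) && xpredT b) h b = \sum_(b <- Z) h b.
      rewrite big_seq_cond [RHS]big_seq; apply: eq_bigl => b; rewrite sub0r !mem_zrange abszN.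
      by case: (_ <= _)%N.
    rewrite /S -eZ (@sum_zrange_reflect _ K 0 xpredT (fun b => (chi b)%:C * X b) (fun=> erefl)) eZ.
    by apply: eq_bigr => b _; rewrite sub0r X1 mulrN.
  rewrite mulr_natl mulr2n {1}e -big_split /=; apply: eq_bigr => b _.
  by rewrite rmorphB mulrBl addrC.
pose S1 := \sum_(b <- Z | (b == n) || (b == - n)) 2 * normc (X b).
pose T1 := \sum_(b <- Z | (K < absz b + absz n)%N) 2 * normc (X b).
have chi_le b : 0 <= chi b <= 2 by rewrite /chi; case: ifP => _; [case: ifP => _|]; lra.
have bd : normc (2 * S) <= S1 + T1.
  rewrite S2; apply: le_trans (normc_sum _ _ _) _.
  rewrite /S1 /T1 !(big_mkcond (fun b => _ || _)) !(big_mkcond (fun b => (_ < _)%N)) -big_split /= big_seq [leRHS]big_seq.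
  apply: ler_sum => b bZ; rewrite normcM normcR.
  have x0 := normc_ge0 (X b).
  have c2 : `|chi b - chi (- b)| <= 2.
    by rewrite ler_norml; have := chi_le b; have := chi_le (- b); lra.
  have := ler_wpM2r x0 c2.
  case: ifP => [_|/negbT]; first by case: ifP => _ h; lra.
  rewrite negb_or => /andP[bn bNn]; case: ifP => [_|/negbT Kb]; first by rewrite add0r.
  move=> _; rewrite addr0.
  suff -> : chi b = chi (- b) by rewrite subrr normr0 mul0r.
  rewrite -leqNgt in Kb.
  rewrite /chi /A1 opprK (negbTE bNn) eqr_opp (negbTE bn).
  rewrite !mem_zrange oppr_eq0.
  have -> : (absz (n - b)%R <= K)%N by lia.
  have -> : (absz (n + b)%R <= K)%N by lia.
  have -> : n - b != 0 by rewrite subr_eq0 eq_sym.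
  by have -> : n + b != 0 by rewrite addr_eq0 -eqr_oppLR eq_sym.
have S1b : S1 <= 4 * (normc (v n t) ^+ 2 / N n).
  have nZ : n \in Z by rewrite mem_zrange.
  have nnZ : - n \in Z by rewrite mem_zrange abszN.
  rewrite /S1 big_pred2_seq ?zrange_uniq// !XE vN normrN.
  have := divr_ge0 (sqr_ge0 (normc (v n t))) (ltW (N_gt0 n0)); move: (_ / _) => x x0.
  by case: ifP => _; lra.
have T1b : T1 <= 2 * (E / (K%:R - N n)).
  rewrite /T1 -mulr_sumr ler_pM2l//.
  apply: (@le_trans _ _ (\sum_(b <- Z) normc (v b t) ^+ 2 / (K%:R - N n))).
    rewrite big_mkcond; apply: ler_sum => b _; case: ifP => [hb|_]; last first.
      by rewrite divr_ge0 ?sqr_ge0// ltW.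
    rewrite XE ler_wpM2l ?sqr_ge0//.
    have hN : K%:R - N n < N b by rewrite ltrBlDr -intrD -[K%:R]/(K%:Z%:~R) ltr_int; lia.
    rewrite lef_pV2 ?posrE// ?ltW//.
    exact: lt_trans hN.
  by rewrite -mulr_suml ler_wpM2r ?hE// invr_ge0 ltW.
have nS : normc (2 * S) = 2 * normc S by rewrite normcM -[2 in LHS]/(2%:~R) normc_int.
rewrite nS in bd; rewrite normcM.
have hS : normc S <= 2 * (normc (v n t) ^+ 2 / N n) + E / (K%:R - N n) by lra.
have v1 : normc (v n t) <= 1 + E.
  have := hE K; have nZ : n \in Z by rewrite mem_zrange.
  rewrite (bigD1_seq n) ?zrange_uniq//=.
  have : 0 <= \sum_(i <- Z | i != n) normc (v i t) ^+ 2 by apply: sumr_ge0 => *; exact: sqr_ge0.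
  have := sqr_ge0 (normc (v n t) - 1); rewrite sqrrB mulr1 expr1n mulr2n.
  by move: (\sum_(_ <- _ | _) _) (normc (v n t)) (normc (v n t) ^+ 2) => s x y; lra.
apply: le_trans (ler_wpM2l (normc_ge0 _) hS) _; rewrite mulrDr; apply: lerD.
  rewrite mulrCA ler_pM2l// mulrA -exprS ler_wpM2r// invr_ge0 ltW// N_gt0//.
by rewrite ler_wpM2r// divr_ge0// ltW.
Qed.

(** Both [1/b] and [v_b] are square summable, so a uniform bound for the error in [G] is enough. *)
Lemma normc_nf_tail e : 0 <= e -> (forall m, normc (G m t - int_conv K m t) <= e) ->
  (forall M, \sum_(m <- zrange M) normc (v m t) ^+ 2 <= E) ->
  normc (nf_tail t) <= e * (Zc + E).
Proof.
move=> e0 he hE; apply: le_trans (normc_sum _ _ _) _.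
apply: (@le_trans _ _ (\sum_(b <- Z) e * ((N b)^-1 ^+ 2 + normc (v b t) ^+ 2))).
  rewrite big_mkcond; apply: ler_sum => b _; case: ifP => _; last first.
    by rewrite mulr_ge0// addr_ge0// sqr_ge0.
  rewrite !normcM normc_phase mul1r normcV normc_int.
  have g := he (n - b); have x0 := normc_ge0 (v b t).
  have y0 : 0 <= (N b)^-1 by rewrite invr_ge0 ler0z.
  move: g x0 y0; move: (normc (G _ t - _)) (normc_ge0 (G (n - b) t - int_conv K (n - b) t)).
  move: (normc (v b t)) ((N b)^-1) => x y; clear - e0.
  move=> z z0 ze x0 y0.
  have xy : 0 <= x * y by exact: mulr_ge0.
  have h : y * (x * z) <= e * (x * y) by rewrite (_ : y * (x * z) = x * y * z) ?(mulrC e) ?ler_wpM2l//; ring.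
  by apply: le_trans h _; rewrite ler_wpM2l// mulrC mul_le_sqrD.
by rewrite -mulr_sumr ler_wpM2l// big_split lerD.
Qed.

End normal_form.

(* Mean value inequality for [nf_energy], with truncation [K -> oo]. *)
Lemma nf_bound (R : realType) (T A : R) : 0 <= T -> exists2 C : R, 0 <= C &
  forall (v G : int -> R -> R[i]) (E : R),
  (forall t, v 0 t = 0) ->
  (forall n t, Cderive (v n) t (- ((0 +i* 1) * n%:~R / 2) * G n t)) ->
  (forall n t, normc (v (- n) t) = normc (v n t)) ->
  (forall t, `|t| <= T -> forall M, \sum_(m <- zrange M) normc (v m t) ^+ 2 <= E) ->
  (forall e, 0 < e -> exists K0 : nat, forall K, (K0 <= K)%N -> forall m t, `|t| <= T ->
     normc (G m t - int_conv v K m t) <= e) ->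
  forall n lam, n != 0 -> 0 <= lam ->
  (forall t, `|t| <= T -> nf_control v G n lam A t) ->
  forall t, `|t| <= T -> normc (v n t - v n 0) <= C * (lam / `|n|%:~R).
Proof.
move=> T0; have [Zc Zc0 hZ'] := @zrange_pseries R 2 (ltr1n _ 2).
have hZ M : \sum_(m <- zrange M) (`|m|%:~R : R)^-1 ^+ 2 <= Zc.
  apply: le_trans (hZ' M); apply: ler_sum => m _; case: eqVneq => [->|m0].
    by rewrite normr0 invr0 expr0n.
  by rewrite powRN powR_mulrn ?ler0z// exprVn.
pose B := (9 * A ^+ 2 + 25 * Zc ^+ 2) / 2.
have B0 : 0 <= B by rewrite divr_ge0// addr_ge0// mulr_ge0// sqr_ge0.
(* The boundary terms cost [|A| + B], and the derivative over a time at most [T] costs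
   [T (1 + B)]. *)
exists (`|A| + B + T * (1 + B)); first by rewrite !addr_ge0// mulr_ge0// addr_ge0.
move=> v G E v0 dv vN vE hG n lam n0 lam0 ctl t tT.
set N : R := `|n|%:~R; have N0 : 0 < N by exact: N_gt0.
have z0T : `|0 : R| <= T by rewrite normr0.
have E0 : 0 <= E by apply: le_trans (vE t tT 0%N); apply: sumr_ge0 => *; exact: sqr_ge0.
have L0 : 0 <= lam / N by rewrite divr_ge0// ltW.
apply/ler_addgt0Pr => e e0.
(* With [d = e / D] the truncation errors together stay below [e]; the choice of [K] then makes both
   [G - int_conv] and [1/(K - |n|)] at most [d]. *)
pose D := (1 + T) * (1 + N + Zc + E + (1 + E) * E).
have D0 : 0 < D.
  rewrite mulr_gt0// ?ltr_pwDl// ?mulr_ge0 ?addr_ge0 ?(ltW N0)//.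
pose d := e / D; have d0 : 0 < d by rewrite /d divr_gt0.
have [K0 hK0] := hG d d0.
pose K := (K0 + absz n + (Num.truncn d^-1).+1)%N.
have nK : (absz n < K)%N by rewrite /K addnS ltnS -addnA addnCA leq_addr.
have KN : d^-1 <= K%:R - N.
  have -> : N = (absz n)%:R by rewrite /N natr_absz.
  rewrite /K !natrD addrAC addrK; apply: ltW; apply: lt_le_trans (truncnS_gt _) _.
  by rewrite lerDr.
have KN0 : 0 < K%:R - N by apply: lt_le_trans KN; rewrite invr_gt0.
have KN' : (K%:R - N)^-1 <= d by rewrite -[d]invrK lef_pV2// posrE// invr_gt0.
have K0K : (K0 <= K)%N by rewrite /K -addnA leq_addr.
have hK := hK0 K K0K.
pose P s := normc (nf_pair v n K s); pose Q s := normc (nf_triple v n K s).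
have hP s : `|s| <= T -> P s <= lam / N * (A / 3).
  by move=> sT; have := normc_nf_pair K lam0 (ctl s sT).
have hQ s : `|s| <= T -> Q s <= lam / N * B.
  by move=> sT; exact: normc_nf_triple n0 lam0 (ltnW nK) hZ (ctl s sT).
have hR s : `|s| <= T -> normc (nf_resonant v n K s) <= 2 * (lam / N) + (1 + E) * (E / (K%:R - N)).
  by move=> sT; exact: normc_nf_resonant n0 lam0 (ltnW nK) (ctl s sT) (fun m => vN m s) nK (vE s sT).
have hS s : `|s| <= T -> normc (nf_quartic v G n K s) <= lam / N * B.
  by move=> sT; exact: normc_nf_quartic n0 lam0 (ltnW nK) hZ (ctl s sT).
have hU s : `|s| <= T -> normc (nf_tail v G n K s) <= d * (Zc + E).
  move=> sT; apply: le_trans (normc_nf_tail n hZ (ltW d0) (fun m => hK m s sT) (vE s sT)) _ => //.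
have hW s : `|s| <= T -> normc (G n s - int_conv v K n s) <= d by exact: hK.
pose M := N / 2 * d + (d * (Zc + E) + (2 * (lam / N) + (1 + E) * E * d)) / 6 + lam / N * B / 6.
have n6 : normc (6^-1 : R[i]) = 6^-1 by rewrite normcV -[6 in LHS]/(6%:~R) normc_int.
have mv : normc (nf_energy v n K t - nf_energy v n K 0) <= M * `|t|.
  rewrite -[in leRHS](subr0 t).
  apply: (Cderive_mean_value (T := T) (fun s _ => @nf_energy_derive R v G v0 dv n K s)) => // s sT.
  apply: le_trans (normcD _ _) _; apply: lerD; last first.
    by rewrite normcM n6 mulrC ler_pM2r ?hS// invr_gt0.
  apply: le_trans (normcD _ _) _; apply: lerD.
    by rewrite normc_half_Ci ler_wpM2l ?hW// divr_ge0// ltW.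
  have nC : normc ((0 +i* 1) / 6 : R[i]) = 6^-1.
    by rewrite normcM n6 /normc /= expr0n expr1n add0r sqrtr1 mul1r.
  rewrite normcM nC mulrC ler_pM2r ?invr_gt0//.
  apply: le_trans (normcD _ _) _; apply: lerD; first exact: hU.
  apply: le_trans (hR s sT) _; rewrite lerD2l mulrA ler_wpM2l// mulr_ge0// addr_ge0//.
have tri : normc (v n t - v n 0) <= normc (nf_energy v n K t - nf_energy v n K 0) +
    (P t + P 0) + (Q t + Q 0) / 6.
  have -> : v n t - v n 0 = (nf_energy v n K t - nf_energy v n K 0) +
     (nf_pair v n K t - nf_pair v n K 0) - 6^-1 * (nf_triple v n K t - nf_triple v n K 0).
    by rewrite /nf_energy; ring.
  apply: le_trans (normcB _ _) _; apply: lerD.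
    by apply: le_trans (normcD _ _) _; rewrite lerD2l normcB.
  by rewrite normcM n6 mulrC ler_pM2r ?invr_gt0// normcB.
apply: le_trans tri _.
have := hP t tT; have := hP 0 z0T; have := hQ t tT; have := hQ 0 z0T.
have M0 : 0 <= M.
  have a1 : 0 <= N / 2 * d by rewrite mulr_ge0 ?divr_ge0// ltW.
  have a2 : 0 <= d * (Zc + E) by rewrite mulr_ge0 ?addr_ge0// ltW.
  have a3 : 0 <= (1 + E) * E * d by exact: mulr_ge0 (mulr_ge0 (addr_ge0 ler01 E0) E0) (ltW d0).
  have a4 : 0 <= lam / N * B by rewrite mulr_ge0.
  by rewrite /M !addr_ge0// divr_ge0// !addr_ge0// mulr_ge0.
have Mt : M * `|t| <= M * T by rewrite ler_wpM2l.
have h1 : lam / N * A <= lam / N * `|A| by rewrite ler_wpM2l// ler_norm.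
have h2 : 0 <= lam / N * `|A| by rewrite mulr_ge0.
have h3 : 0 <= lam / N * B by rewrite mulr_ge0.
have h4 : 0 <= T * (lam / N * B) by rewrite mulr_ge0.
have h5 : 0 <= T * (lam / N) by rewrite mulr_ge0.
have dD : T * (N / 2 * d + (d * (Zc + E) + (1 + E) * E * d) / 6) <= e.
  rewrite (_ : e = d * D); last by rewrite /d divfK// gt_eqF.
  rewrite (_ : T * _ = d * (T * (N / 2 + ((Zc + E) + (1 + E) * E) / 6))); last by ring.
  rewrite ler_pM2l// /D.
  have a : 0 <= (1 + E) * E by rewrite mulr_ge0// addr_ge0.
  apply: ler_pM => //.
  - by rewrite addr_ge0// divr_ge0// ?(ltW N0)// !addr_ge0.
  - by rewrite lerDr.
  - by move: a N0; move: ((1 + E) * E) => x *; lra.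
move: mv Mt dD h1 h2 h3 h4 h5; rewrite /M.
have -> : (N / 2 * d + (d * (Zc + E) + (2 * (lam / N) + (1 + E) * E * d)) / 6 + lam / N * B / 6) * T =
  T * (N / 2 * d + (d * (Zc + E) + (1 + E) * E * d) / 6) + T * (lam / N) / 3 + T * (lam / N * B) / 6 by move: (lam / N) => L; field.
have -> : (`|A| + B + T * (1 + B)) * (lam / N) = lam / N * `|A| + lam / N * B + T * (lam / N) + T * (lam / N * B) by ring.
rewrite !mulrA; move: (lam / N * `|A|) (lam / N * B) (T * lam / N) (T * lam / N * B) (lam / N * A).
move: (P t) (P 0) (Q t) (Q 0) (normc _) (_ * `|t|) (T * _); clear.
move=> *; lra.
Qed.

(** * Derivatives of oriented integrals and uniformity in time *)

Section oriented_integrals.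
Variable R : realType.
Local Notation mu := (@lebesgue_measure R).
Local Notation Tm := (measurableTypeR R).

(** One of the two integrals is always over the empty set or a point; near [t] their difference is
    that of a primitive based at [-M], to the left of both [0] and [t]. *)
Lemma oriented_Rintegral_derive (f : R -> R) (t : R) : continuous f ->
  is_derive t 1 (fun s => Rintegral mu `[0, s] f - Rintegral mu `[s, 0] f) (f t).
Proof.
move=> cf; pose M := `|t| + 1.
have fi a b : mu.-integrable `[a, b] (EFin \o f) by exact: rintegrable_cont.
pose F y := Rintegral mu `[- M, y] f.
have tM : t < M by rewrite /M; have := ler_norm t; lra.
have Mt : - M < t by rewrite /M; have := ler_norm (- t); rewrite normrN; lra.
have M0 : 0 < M by rewrite /M; have := normr_ge0 t; lra.
have [h1 h2] := continuous_FTC1_closed tM (fi (- M) M) Mt (cf t).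
have dF : is_derive t 1 F (f t) by apply: DeriveDef => //; rewrite -derive1E.
have dG : is_derive t 1 (fun s => F s - F 0) (f t).
  by apply: is_derive_ext (is_deriveB dF (is_derive_cst (F 0) t 1)) _ _ => //; rewrite subr0.
apply: near_eq_is_derive dG; apply: filterS (near_in_itvoo (_ : t \in `]- M, M[)); last first.
  by rewrite in_itv /= Mt tM.
move=> s; rewrite in_itv /= => /andP[Ms sM].
have split a b : - M <= a -> a <= b -> F b - F a = Rintegral mu `[a, b] f.
  move=> Ma ab; rewrite /F (@Rintegral_itvB R f (BLeft (- M)) (BRight b) a) ?bnd_simp//.
  rewrite Rintegral_itv_obnd_cbnd//.
  by apply: integrableS (fi a b) => //; apply: subset_itvr; rewrite bnd_simp.
have [s0|s0] := leP 0 s.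
  rewrite split ?oppr_le0 ?(ltW M0)//.
  have [->|s1] := eqVneq s 0; first by rewrite set_itv1 !Rintegral_set1 subr0.
  rewrite (_ : `[s, 0]%classic = set0) ?Rintegral_set0 ?subr0// set_itv_ge// bnd_simp -ltNge.
  by rewrite lt_neqAle eq_sym s1.
rewrite -opprB split ?(ltW s0) ?(ltW Ms)//.
rewrite (_ : `[0, s]%classic = set0) ?Rintegral_set0 ?sub0r// set_itv_ge// bnd_simp -ltNge//.
Qed.

Lemma oriented_Cintegral_derive (f : R -> R[i]) (t : R) : Ccontinuous f ->
  Cderive (fun s => oriented_Cintegral 0 s f) t (f t).
Proof. by move=> [h1 h2]; split; apply: oriented_Rintegral_derive. Qed.

Lemma Ccontinuous_near (f : R -> R[i]) :
  (forall t e, 0 < e -> exists2 d, 0 < d & forall s, `|s - t| < d -> normc (f s - f t) <= e) ->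
  Ccontinuous f.
Proof.
move=> h; split=> t; apply/cvgrPdist_le => e e0; have [d d0 hd] := h t e e0.
- apply/nbhs_ballP; exists d => //= s; rewrite /ball /= distrC => /hd.
  by apply: le_trans; rewrite distrC -ReN -ReD normc_Re.
- apply/nbhs_ballP; exists d => //= s; rewrite /ball /= distrC => /hd.
  by apply: le_trans; rewrite distrC -ImN -ImD normc_Im.
Qed.

(** A property that is locally uniform in [t] and monotone in [i] holds with a single [i] on a
    compact interval of times. *)
Lemma uniform_on_segment (P : R -> nat -> Prop) (T : R) :
  (forall t i j, (i <= j)%N -> P t i -> P t j) ->
  (forall t, exists d i, 0 < d /\ forall s, `|s - t| < d -> P s i) ->
  exists i, forall t, `|t| <= T -> P t i.
Proof.
move=> mP hP.
have := (compact_near_coveringP _).1 (@segment_compact R (- T) T) nat \oo (fun i t => P t i) _.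
case=> [t _|i _ hi]; last first.
  exists i => t tT; apply: (hi i) => //=.
  by rewrite in_itv /= -ler_norml.
have [d [i [d0 hd]]] := hP t.
exists (ball t d, [set j | (i <= j)%N]) => /=.
  by split; [exact: nbhsx_ballx|exists i].
move=> [s j] [/= st ij]; apply: (mP _ i) => //; apply: hd.
by rewrite distrC.
Qed.

Lemma fourierN (f : R -> R) (n : int) : rintegrable `[0, period R] (f : Tm -> R) ->
  fourier f (- n) = conjc (fourier f n).
Proof.
move=> hf; rewrite /fourier conjcM -Cintegral_conj//; last exact: fourier_integrable.
congr (_ * _); first by rewrite /conjc /= oppr0.
apply: eq_Cintegral => x _; rewrite conjcM; congr (_ * _); first by rewrite /conjc /= oppr0.
by rewrite intrN mulNr opprK cisN /conjc; case: (cis _) => a b /=; rewrite opprK.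
Qed.

End oriented_integrals.

(** * The modes of a KdV solution in the interaction picture *)

Section kdv_modes.
Variables (R : realType) (g : R -> R) (u : R -> R -> R).
Hypotheses (hu : continuous_in_L2 u) (hD : kdv_duhamel g u) (g0 : fourier g 0 = 0).
Local Notation mu := (@lebesgue_measure R).
Local Notation per := (period R).
Local Notation Ci := (0 +i* 1 : R[i]).

(** The linear flow is undone, so that for the Airy equation [mode n] would be constant in time. *)
Definition mode (n : int) (t : R) : R[i] := cis (- (t * n%:~R ^+ 3)) * fourier (u t) n.
Definition nonlinearity (n : int) (t : R) : R[i] :=
  cis (- (t * n%:~R ^+ 3)) * fourier (fun x => u t x ^+ 2) n.

Lemma L2_torus_square_integrable (f : R -> R) : L2_torus f -> square_integrable f.
Proof. by move=> [_ [mf hf]]; split => //; exact: measurable_funTS. Qed.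

Lemma u_L2 t : square_integrable (u t).
Proof. exact: L2_torus_square_integrable (hu.1 t). Qed.

Lemma u_near t e : 0 < e -> exists2 d, 0 < d & forall s, `|s - t| < d ->
  energy (fun x => u s x - u t x) <= e.
Proof.
move=> e0; have /cvgrPdist_le/(_ e e0)/nbhs_ballP[d /= d0 hd] := hu.2 t.
exists d => // s st; have /= := hd s; rewrite /ball /= distrC => /(_ st).
rewrite sub0r normrN => /(le_trans (ler_norm _)); exact.
Qed.

Lemma energy_perturb f h : square_integrable f -> square_integrable h ->
  energy f <= 2 * energy (fun x => f x - h x) + 2 * @energy R h.
Proof.
move=> hf hh; have hfh := L2B hf hh.
have mD : measurable (`[0, per]%classic : set (measurableTypeR R)) by [].
rewrite /energy -(RintegralZl _ mD hfh.2) -(RintegralZl _ mD hh.2).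
rewrite -(RintegralD mD (rintegrableZ 2 mD hfh.2) (rintegrableZ 2 mD hh.2)).
apply: le_Rintegral => //; first exact: hf.2.
  exact: rintegrableD (rintegrableZ 2 mD hfh.2) (rintegrableZ 2 mD hh.2).
move=> x _; have := sqr_ge0 (f x - h x - h x); nra.
Qed.

Lemma energy_bounded T : exists E : R, forall t, `|t| <= T -> energy (u t) <= E.
Proof.
have [||i hi] := @uniform_on_segment R (fun t i => energy (u t) <= i%:R) T.
- by move=> t i j ij /le_trans; apply; rewrite ler_nat.
- move=> t; have [d d0 hd] := u_near t ltr01.
  exists d, (Num.truncn (2 + 2 * energy (u t))).+1; split => // s /hd h.
  apply: le_trans (ltW (truncnS_gt _)); apply: le_trans (energy_perturb (u_L2 s) (u_L2 t)) _.
  by rewrite lerD2r; lra.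
by exists i%:R.
Qed.

(** A truncation that is good at time [t] is good at all nearby times, by [proj_defect_perturb];
    compactness does the rest. *)
Lemma defect_uniform T e : 0 < e -> exists K0 : nat, forall K t, (K0 <= K)%N -> `|t| <= T ->
  proj_defect (u t) K <= e.
Proof.
move=> e0; have e4 : 0 < e / 4 by rewrite divr_gt0.
have [||i hi] := @uniform_on_segment R (fun t i => forall K, (i <= K)%N -> proj_defect (u t) K <= e) T.
- by move=> t i j ij h K jK; apply: h; exact: leq_trans jK.
- move=> t; have [d d0 hd] := u_near t e4; have [K0 hK] := proj_defect_small (u_L2 t) e4.
  exists d, K0; split => // s /hd h K /hK h'.
  apply: le_trans (proj_defect_perturb K (u_L2 s) (u_L2 t)) _; lra.
by exists i => K t iK tT; exact: hi.
Qed.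

Lemma normc_mode n t : normc (mode n t) = normc (fourier (u t) n).
Proof. by rewrite normcM normc_cis mul1r. Qed.

Lemma mode_opp n t : normc (mode (- n) t) = normc (mode n t).
Proof.
by rewrite !normc_mode fourierN ?normcJ//; exact: square_integrable_rintegrable (u_L2 t).
Qed.

Lemma mode0 t : mode 0 t = 0.
Proof.
have z : (0 +i* ((0 : int)%:~R / 2)) = 0 :> R[i] by rewrite (_ : ((0 : int)%:~R : R) = 0)// mul0r.
by rewrite /mode hD g0 z mul0r mulr0 subr0 mulr0.
Qed.

Lemma mode_energy t E M : energy (u t) <= E ->
  \sum_(m <- zrange M) normc (mode m t) ^+ 2 <= per^-1 * E.
Proof.
move=> h; have := bessel (u_L2 t) (zrange_uniq M).
rewrite (eq_bigr (fun m => normc (mode m t) ^+ 2)) => [|m _]; last by rewrite normsqE normc_mode.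
by move=> /le_trans; apply; rewrite ler_pM2l// invr_gt0 period_gt0.
Qed.

Lemma conv_reindex K (F : int -> R[i]) m :
  conv K F m = \sum_(c <- zrange K | m - c \in zrange K) F c * F (m - c).
Proof.
rewrite /conv [RHS]big_mkcond; apply: eq_bigr => a _.
rewrite (eq_bigl (pred1 (m - a))) => [|b /=]; last by rewrite [in RHS]eq_sym subr_eq eq_sym addrC.
case: ifP => h; first by rewrite -big_filter filter_pred1_uniq ?zrange_uniq// big_seq1.
by rewrite big_seq_cond big_pred0// => b /=; case: (b =P m - a) => [->|_]; rewrite ?h ?andbF.
Qed.

Lemma int_conv_mode K m t :
  int_conv mode K m t = cis (- (t * m%:~R ^+ 3)) * conv K (fourier (u t)) m.
Proof.
rewrite conv_reindex mulr_sumr; apply: eq_bigr => c _; rewrite /mode /phase.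
have -> : cis (- (t * (m%:~R : R) ^+ 3)) = cis (- ((3 * m * c * (m - c))%:~R * t)) *
   cis (- (t * c%:~R ^+ 3)) * cis (- (t * (m - c)%:~R ^+ 3)).
  rewrite -!cisD; congr cis; rewrite !intrM intrB; ring.
by ring.
Qed.

Lemma nonlinearity_conv T e : 0 < e -> exists K0 : nat, forall K, (K0 <= K)%N ->
  forall m t, `|t| <= T -> normc (nonlinearity m t - int_conv mode K m t) <= e.
Proof.
move=> e0; have [E hE] := energy_bounded T.
have per0 := period_gt0 R.
(* [lam] makes the part with the energy at most half of the target; the truncation then makes the
   other part, with its large factor [1 + lam^-1], at most the other half. *)
pose lam := e * per / 2 / (1 + `|E|).
have E1 : 0 < 1 + `|E| by rewrite ltr_pwDl.
have l0 : 0 < lam by rewrite /lam !divr_gt0// mulr_gt0.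
have l1 : 0 < 1 + lam^-1 by rewrite ltr_pwDl// invr_ge0 ltW.
have d0 : 0 < e * per / 2 / (1 + lam^-1) by rewrite !divr_gt0// mulr_gt0.
have [K0 hK] := defect_uniform T d0.
exists K0 => K KK m t tT; rewrite int_conv_mode -mulrBr normcM normc_cis mul1r.
apply: le_trans (fourier_sqr_conv m K (u_L2 t) l0) _.
rewrite mulrC ler_pdivrMr//.
have h1 : (1 + lam^-1) * proj_defect (u t) K <= e * per / 2.
  by rewrite mulrC -ler_pdivlMr//; exact: hK.
have h2 : lam * energy (u t) <= e * per / 2.
  rewrite /lam mulrAC ler_pdivrMr// ler_wpM2l ?divr_ge0 ?mulr_ge0 ?(ltW e0) ?(ltW per0)//.
  by apply: le_trans (hE t tT) _; have := ler_norm E; lra.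
lra.
Qed.

Lemma nonlinearity_continuous n : Ccontinuous (nonlinearity n).
Proof.
apply: CcontinuousM.
  rewrite (_ : (fun t : R => _) = fun t => cis ((- n%:~R ^+ 3) * t)); last first.
    by apply/funext => t; congr cis; ring.
  exact: Ccontinuous_cis_lin.
apply: Ccontinuous_near => t e e0.
have per0 := period_gt0 R.
have E0 := energy_ge0 (u t).
have E1 : 0 < 1 + energy (u t) by rewrite ltr_pwDl.
pose lam := e * per / 2 / (1 + energy (u t)).
have l0 : 0 < lam by rewrite /lam !divr_gt0// mulr_gt0.
have l1 : 0 < 1 + lam^-1 by rewrite ltr_pwDl// invr_ge0 ltW.
have d0 : 0 < e * per / 2 / (1 + lam^-1) by rewrite !divr_gt0// mulr_gt0.
have [d dd hd] := u_near t d0; exists d => // s /hd h.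
apply: le_trans (fourier_sqr_perturb n (u_L2 s) (u_L2 t) l0) _.
rewrite mulrC ler_pdivrMr//.
have h1 : (1 + lam^-1) * energy (fun x => u s x - u t x) <= e * per / 2.
  by rewrite mulrC -ler_pdivlMr.
have h2 : lam * energy (u t) <= e * per / 2.
  rewrite /lam mulrAC ler_pdivrMr// ler_wpM2l ?divr_ge0 ?mulr_ge0 ?(ltW e0) ?(ltW per0)//.
  by rewrite lerDr.
lra.
Qed.

(** Duhamel's formula multiplied by the inverse of the linear flow, so that the integrand no longer
    depends on [t]. *)
Lemma modeE n t : mode n t = fourier g n - (Ci * n%:~R / 2) * oriented_Cintegral 0 t (nonlinearity n).
Proof.
have cn := nonlinearity_continuous n.
have c0 : (0 +i* (n%:~R / 2)) = Ci * n%:~R / 2 :> R[i].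
  have eN : (n%:~R : R[i]) = (n%:~R)%:C by rewrite rmorph_int.
  have e2 : (2 : R[i])^-1 = (2^-1)%:C by rewrite fmorphV rmorph_nat.
  rewrite eN e2 -mulrA -(rmorphM (real_complex R)); apply/eqP.
  by rewrite eq_complex Re_mul Im_mul /=; apply/andP; split; apply/eqP; ring.
have e : oriented_Cintegral 0 t (fun s => cis ((t - s) * n%:~R ^+ 3) * fourier (fun x => u s x ^+ 2) n)
   = cis (t * n%:~R ^+ 3) * oriented_Cintegral 0 t (nonlinearity n).
  rewrite /oriented_Cintegral mulrBr -!CintegralZ//; try exact: Cintegrable_cont.
  have e s : cis ((t - s) * n%:~R ^+ 3) * fourier (fun x => u s x ^+ 2) n = cis (t * n%:~R ^+ 3) * nonlinearity n s.
    by rewrite /nonlinearity mulrA -cisD; congr (cis _ * _); ring.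
  by congr (_ - _); apply: eq_Cintegral => s _; rewrite e.
rewrite /mode hD e c0; move: (oriented_Cintegral _ _ _) => O.
rewrite mulrBr (mulrA (cis (- _))) cisNl mul1r; congr (_ - _).
by rewrite mulrCA (mulrA (cis (- _))) cisNl mul1r.
Qed.

Lemma mode_derive n t : Cderive (mode n) t (- (Ci * n%:~R / 2) * nonlinearity n t).
Proof.
have h := CderiveD (Cderive_cst (fourier g n) t)
  (CderiveZ (- (Ci * n%:~R / 2)) (oriented_Cintegral_derive t (nonlinearity_continuous n))).
apply: CderiveE h _ _ => [s|]; first by rewrite modeE mulNr.
by rewrite add0r.
Qed.

End kdv_modes.

Lemma ler_sum_mem (S : numDomainType) (I : eqType) (s : seq I) (m : I) (F : I -> S) :
  m \in s -> (forall i, 0 <= F i) -> F m <= \sum_(i <- s) F i.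
Proof.
move=> ms F0; rewrite (big_rem m ms) /= lerDl; apply: sumr_ge0 => i _; exact: F0.
Qed.

(** * Weights for the second round of the bootstrap *)

Section quarter_roots.
Variable R : realType.
Local Notation N z := (`|z|%:~R : R).

(** [|m|^(-1/4)], and 0 at [m = 0] since [0^-1 = 0]. The rates [|m|^(-3/4)], [1/|m|] and
    [|m|^(-7/4)] of the second round become its natural powers. *)
Definition qroot (m : int) : R := (N m `^ (1 / 4))^-1.

Lemma qroot0 : qroot 0 = 0.
Proof. by rewrite /qroot normr0 powR0 ?invr0// gt_eqF. Qed.

Lemma qroot_ge0 m : 0 <= qroot m.
Proof. by rewrite invr_ge0 powR_ge0. Qed.

Lemma qroot_le1 m : qroot m <= 1.
Proof.
have [->|m0] := eqVneq m 0; first by rewrite qroot0.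
rewrite invf_le1 ?powR_gt0 ?N_gt0// -[leLHS](powRr0 (N m)).
by apply: ler_powR; rewrite ?N_ge1.
Qed.

Lemma qrootX m (k : nat) : qroot m ^+ k = if m == 0 then (k == 0%N)%:R else N m `^ (- (k%:R / 4)).
Proof.
case: eqVneq => [->|m0]; first by rewrite qroot0 expr0n.
rewrite /qroot exprVn -powR_mulrn ?powR_ge0// -powRrM -powRN; congr (_ `^ _); ring.
Qed.

Lemma qroot4 m : m != 0 -> qroot m ^+ 4 = (N m)^-1.
Proof. by move=> m0; rewrite qrootX (negbTE m0) divff// -powR_inv1 ?ler0z. Qed.

Lemma qroot_le_double a n : a != 0 -> n != 0 -> `|n| <= 16 * `|a| -> qroot a <= 2 * qroot n.
Proof.
move=> a0 n0 h.
have pa : 0 < N a `^ (1 / 4) by rewrite powR_gt0 ?N_gt0.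
have pn : 0 < N n `^ (1 / 4) by rewrite powR_gt0 ?N_gt0.
rewrite /qroot ler_pdivlMr// ler_pdivrMl//.
have -> : N a `^ (1 / 4) * 2 = (16 * N a) `^ (1 / 4).
  rewrite powRM ?ler0z// mulrC; congr (_ * _).
  rewrite (_ : 16 = 2 ^+ 4); last by ring.
  by rewrite -powR_mulrn// -powRrM (_ : 4%:R * (1 / 4) = 1) ?powRr1//; field.
apply: ge0_ler_powR; rewrite ?nnegrE ?mulr_ge0 ?ler0z//.
by rewrite -[16]/(16%:~R) -intrM ler_int.
Qed.

Lemma qroot_anti a b : b != 0 -> `|b| <= `|a| -> qroot a <= qroot b.
Proof.
move=> b0 h; have a0 : a != 0 by lia.
rewrite /qroot lef_pV2 ?posrE ?powR_gt0 ?N_gt0//.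
by apply: ge0_ler_powR; rewrite ?nnegrE ?ler0z// ler_int.
Qed.

Lemma qroot_sum (k : nat) : (4 < k)%N -> exists2 Z : R, 0 <= Z & forall M,
  \sum_(m <- zrange M) qroot m ^+ k <= Z.
Proof.
move=> k4; have k1 : 1 < k%:R / 4 :> R by rewrite ltr_pdivlMr// mul1r ltr_nat.
have [Z Z0 hZ] := zrange_pseries k1; exists Z => // M; apply: le_trans (hZ M).
by apply: ler_sum => m _; rewrite qrootX; case: ifP => // _; case: k k4 {k1 hZ}.
Qed.

(** The larger of [|a|] and [|b|] is at least [|n|/2], so three of its four powers pass to [n]; its
    fourth joins the other factor to make a fifth power, which is summable. *)
Lemma qroot_pair4 a b n : a + b = n -> a != 0 -> b != 0 -> n != 0 ->
  qroot a ^+ 4 * qroot b ^+ 4 <= 8 * qroot n ^+ 3 * (qroot a ^+ 5 + qroot b ^+ 5).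
Proof.
wlog ba : a b / `|b| <= `|a|.
  move=> h e a0 b0 n0; have [ab|ab] := lerP `|b| `|a|; first exact: h.
  by rewrite mulrC (addrC (qroot a ^+ _)); apply: h => //; [exact: ltW|rewrite addrC].
move=> e a0 b0 n0; have h1 := qroot_anti b0 ba.
have h2 : qroot a <= 2 * qroot n by apply: qroot_le_double => //; lia.
have := qroot_ge0 a; have := qroot_ge0 b; have := qroot_ge0 n.
move: (qroot a) (qroot b) (qroot n) h1 h2 => A B X; clear => h1 h2 X0 B0 A0.
have h3 : A ^+ 3 <= 8 * X ^+ 3.
  by rewrite (_ : 8 * X ^+ 3 = (2 * X) ^+ 3) ?lerXn2r ?nnegrE ?mulr_ge0//; ring.
rewrite (_ : A ^+ 4 * B ^+ 4 = A ^+ 3 * (A * B ^+ 4)); last by ring.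
apply: ler_pM; rewrite ?exprn_ge0 ?mulr_ge0 ?exprn_ge0//.
rewrite -[leLHS]add0r lerD ?exprn_ge0// [leRHS]exprS ler_wpM2r ?exprn_ge0//.
Qed.

Lemma qroot_pair8 a b n : a + b = n -> a != 0 -> b != 0 -> n != 0 ->
  qroot a ^+ 8 * qroot b ^+ 8 <= 128 * qroot n ^+ 7 * (qroot a ^+ 6 + qroot b ^+ 6).
Proof.
wlog ba : a b / `|b| <= `|a|.
  move=> h e a0 b0 n0; have [ab|ab] := lerP `|b| `|a|; first exact: h.
  by rewrite mulrC (addrC (qroot a ^+ _)); apply: h => //; [exact: ltW|rewrite addrC].
move=> e a0 b0 n0.
have h2 : qroot a <= 2 * qroot n by apply: qroot_le_double => //; lia.
have := qroot_ge0 a; have := qroot_ge0 b; have := qroot_ge0 n.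
have := qroot_le1 a; have := qroot_le1 b.
move: (qroot a) (qroot b) (qroot n) h2 => A B X; clear => h2 B1 A1 X0 B0 A0.
have h3 : A ^+ 7 <= 128 * X ^+ 7.
  by rewrite (_ : 128 * X ^+ 7 = (2 * X) ^+ 7) ?lerXn2r ?nnegrE ?mulr_ge0//; ring.
rewrite (_ : A ^+ 8 * B ^+ 8 = A ^+ 7 * (A * B ^+ 2 * B ^+ 6)); last by ring.
apply: ler_pM; rewrite ?exprn_ge0 ?mulr_ge0 ?exprn_ge0//.
rewrite -[leLHS]add0r lerD ?exprn_ge0// ler_piMl ?exprn_ge0//.
by rewrite mulr_ile1 ?exprn_ge0// exprn_ile1.
Qed.

(** One of the three frequencies has modulus at least [|n|/16], and its factor passes to [n]; the
    other two form a term of [nf_sigma]. *)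
Lemma qroot_triple b c d n : b + c + d = n -> b != 0 -> c != 0 -> d != 0 -> n != 0 ->
  qroot b ^+ 3 * (qroot c ^+ 3 * qroot d ^+ 3) <=
  8 * qroot n ^+ 3 * nf_sigma (fun m => qroot m ^+ 3) b c d.
Proof.
move=> e b0 c0 d0 n0.
have h3 a : a != 0 -> `|n| <= 16 * `|a| -> qroot a ^+ 3 <= 8 * qroot n ^+ 3.
  move=> a0 /(qroot_le_double a0 n0) h.
  rewrite (_ : 8 * qroot n ^+ 3 = (2 * qroot n) ^+ 3); last by ring.
  by rewrite lerXn2r ?nnegrE ?mulr_ge0// qroot_ge0.
have pos m : 0 <= qroot m ^+ 3 by rewrite exprn_ge0 ?qroot_ge0.
have := pos b; have := pos c; have := pos d; have := pos n; rewrite /nf_sigma.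
have : [\/ qroot b ^+ 3 <= 8 * qroot n ^+ 3, qroot c ^+ 3 <= 8 * qroot n ^+ 3 | qroot d ^+ 3 <= 8 * qroot n ^+ 3].
  have [h|h] := lerP `|n| (16 * `|b|); first by constructor 1; exact: h3.
  have [h'|h'] := lerP `|n| (16 * `|c|); first by constructor 2; exact: h3.
  by constructor 3; apply: h3 => //; lia.
move: (qroot b ^+ 3) (qroot c ^+ 3) (qroot d ^+ 3) (qroot n ^+ 3); clear => x y z w h w0 z0 y0 x0.
have xy := mulr_ge0 x0 y0; have xz := mulr_ge0 x0 z0; have yz := mulr_ge0 y0 z0.
have w8 : 0 <= 8 * w by rewrite mulr_ge0.
have key (s t : R) : 0 <= t -> s <= 8 * w -> s * t <= 8 * w * t by move=> t0 sw; rewrite ler_wpM2r.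
have p1 := mulr_ge0 w8 xy; have p2 := mulr_ge0 w8 xz; have p3 := mulr_ge0 w8 yz.
rewrite !mulrDr; case: h => h.
- by have := key _ _ yz h; lra.
- by have := key _ _ xz h; rewrite mulrCA; lra.
- by have := key _ _ xy h; rewrite (_ : x * (y * z) = z * (x * y)); [lra|ring].
Qed.

End quarter_roots.

Lemma weighted_pair_le (R : realType) (x y p q r lam : R) : 0 <= x -> 0 <= y ->
  1 <= p -> 1 <= q -> 0 < r -> r <= p + q -> 1 <= lam ->
  x * y / (p * q) <= lam / r * (x ^+ 2 + y ^+ 2).
Proof.
move=> x0 y0 p1 q1 r0 h l1.
have S0 : 0 <= x ^+ 2 + y ^+ 2 by rewrite addr_ge0// sqr_ge0.
have pq0 : 0 < p * q by nra.
apply: (@le_trans _ _ (1 / r * (x ^+ 2 + y ^+ 2))); last first.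
  by rewrite ler_wpM2r// ler_pM2r ?invr_gt0.
rewrite ler_pdivrMr// mul1r (_ : _ * _ * _ = p * q * (x ^+ 2 + y ^+ 2) / r); last by ring.
rewrite ler_pdivlMr//.
have xy : x * y <= (x ^+ 2 + y ^+ 2) / 2 by have := sqr_ge0 (x - y); nra.
have pq : p + q <= 2 * (p * q) by nra.
apply: (@le_trans _ _ ((x ^+ 2 + y ^+ 2) / 2 * (2 * (p * q)))).
  by apply: ler_pM => //; [exact: mulr_ge0|exact: ltW|exact: le_trans h pq].
by rewrite (_ : _ / 2 * _ = p * q * (x ^+ 2 + y ^+ 2))//; field.
Qed.

Section kdv_decay.
Variables (R : realType) (g : R -> R) (u : R -> R -> R).
Hypotheses (hu : continuous_in_L2 u) (hD : kdv_duhamel g u) (g0 : fourier g 0 = 0).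
Local Notation per := (period R).
Local Notation N z := (`|z|%:~R : R).
Local Notation v := (mode u).
Local Notation G := (nonlinearity u).
Variable Cg : R.
Hypothesis hg : forall n, n != 0 -> normc (fourier g n) <= Cg / N n.

Lemma mode_at0 n : v n 0 = fourier g n.
Proof.
rewrite (modeE hu hD) (_ : oriented_Cintegral _ _ _ = 0) ?mulr0 ?subr0//.
by rewrite /oriented_Cintegral subrr.
Qed.

(** The energy alone makes [|v_m|] square summable and [G] bounded. This gives
    [v_n(t) - v_n(0) = O(1/n)], and the data are [O(1/n)] as well. *)
Lemma kdv_decay_step1 T : 0 <= T -> exists2 V : R, 1 <= V &
  forall t, `|t| <= T -> forall n, n != 0 -> normc (v n t) <= V / N n.
Proof.
move=> T0; have [E hE] := energy_bounded hu T.
have per0 := period_gt0 R.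
pose A := per^-1 * E.
have E0 : 0 <= E by apply: le_trans (energy_ge0 (u 0)) (hE 0 _); rewrite normr0.
have A0 : 0 <= A by rewrite mulr_ge0// invr_ge0 ltW.
have [C C0 hC] := nf_bound A T0.
have [lam [l1 lam0 l3]] : exists lam, [/\ 1 + A <= lam, 0 <= lam & (1 + A) ^+ 3 <= lam].
  exists ((1 + A) ^+ 3); split => //; first by apply: ler_eXnr => //; rewrite lerDl.
  by rewrite exprn_ge0// addr_ge0.
have vA t M : `|t| <= T -> \sum_(m <- zrange M) normc (v m t) ^+ 2 <= A.
  by move=> tT; apply: (mode_energy hu); exact: hE.
have v1 t m : `|t| <= T -> normc (v m t) <= 1 + A.
  move=> tT; have h : normc (v m t) ^+ 2 <= A.
    apply: le_trans (vA t (absz m) tT).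
    apply: (@ler_sum_mem _ _ _ m (fun m => normc (v m t) ^+ 2)); rewrite ?mem_zrange// => i.
    exact: sqr_ge0.
  have := sqr_ge0 (normc (v m t) - 1); rewrite sqrrB mulr1 expr1n mulr2n.
  by move: h; move: (normc (v m t)) (normc (v m t) ^+ 2) => x y; lra.
have hz t n : `|t| <= T -> n != 0 -> normc (v n t - v n 0) <= C * (lam / N n).
  move=> tT n0.
  apply: (hC v G A (mode0 hD g0) (mode_derive hu hD) (mode_opp hu) (fun s sT M => vA s M sT)
    (fun e e0 => nonlinearity_conv hu T e0) n lam n0 lam0 _ t tT) => s sT; exists (fun m => normc (v m s)); split => //.
  - by move=> m; exact: normc_ge0.
  - by move=> M; exact: vA.
  - move=> a b ab a0 b0.
    apply: weighted_pair_le; rewrite ?normc_ge0 ?N_ge1 ?N_gt0//.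
      by apply: N_leD; lia.
    by apply: le_trans l1; rewrite lerDl.
  - move=> b c d e b0 c0 d0; have x0 m := normc_ge0 (v m s).
    have cd : normc (v c s) * normc (v d s) <= nf_sigma (fun m => normc (v m s)) b c d.
      by rewrite /nf_sigma lerDr addr_ge0// mulr_ge0.
    split; apply: ler_pM; rewrite ?normc_ge0 ?mulr_ge0//.
      rewrite /nonlinearity normcM normc_cis mul1r.
      apply: le_trans (normc_fourier_sqr_le b (u_L2 hu s)) _; apply: (@le_trans _ _ A).
        by rewrite ler_pM2l ?invr_gt0// hE.
      by apply: le_trans l1; rewrite lerDr.
    by apply: le_trans l1; exact: v1.
  - by apply: le_trans l3; rewrite lerXn2r ?nnegrE ?normc_ge0 ?addr_ge0// v1.
exists (1 + `|Cg| + C * lam).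
  by rewrite -addrA lerDl addr_ge0// mulr_ge0.
move=> t tT n n0; have Nn := N_gt0 R n0.
apply: le_trans (normc_leB _ (v n 0)) _.
have h1 := hz t n tT n0; have h2 := hg n0; rewrite -mode_at0 in h2.
have h3 : Cg / N n <= `|Cg| / N n by rewrite ler_pM2r ?invr_gt0// ler_norm.
have h4 : 0 <= 1 / N n by rewrite divr_ge0// ltW.
rewrite !mulrDl; move: h1 h2 h3 h4; rewrite mulrA.
by move: (C * lam / N n) (Cg / N n) (`|Cg| / N n) (1 / N n) (normc _) (normc _) => *; lra.
Qed.

(** With [v_m = O(1/|m|)] the convolution gives [G_n = O(|n|^(-3/4))], and every estimate in
    [nf_control] gains the factor [|n|^(-3/4)]. *)
Lemma kdv_decay T : 0 <= T -> exists2 C : R, 0 <= C &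
  forall t, `|t| <= T -> forall n, n != 0 -> normc (v n t - v n 0) <= C * N n `^ (- (7 / 4)).
Proof.
move=> T0; have [V V1 hV] := kdv_decay_step1 T0.
have V0 : 0 <= V by apply: le_trans V1.
have [E hE] := energy_bounded hu T.
have [Z5 Z50 hZ5] := @qroot_sum R 5 isT; have [A A0 hA] := @qroot_sum R 6 isT.
have [C C0 hC] := nf_bound A T0.
have hV4 t m : `|t| <= T -> normc (v m t) <= V * qroot R m ^+ 4.
  move=> tT; have [->|m0] := eqVneq m 0.
    by rewrite (mode0 hD g0) normc0 mulr_ge0// exprn_ge0// qroot_ge0.
  by rewrite qroot4//; exact: hV.
pose W := V ^+ 2 * (16 * Z5).
have W0 : 0 <= W by rewrite !mulr_ge0 ?exprn_ge0.
have hG t n : `|t| <= T -> n != 0 -> normc (G n t) <= W * qroot R n ^+ 3.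
  move=> tT n0; apply/ler_addgt0Pl => e e0.
  have [K0 hK] := nonlinearity_conv hu T e0.
  have h := hK K0 (leqnn _) n t tT.
  apply: le_trans (normc_leB _ (int_conv v K0 n t)) _; rewrite addrC; apply: lerD => //.
  apply: le_trans (normc_sum _ _ _) _.
  apply: (@le_trans _ _ (\sum_(c <- zrange K0 | (n - c \in zrange K0) && true)
     V ^+ 2 * (8 * qroot R n ^+ 3 * (qroot R c ^+ 5 + qroot R (n - c) ^+ 5)))).
    under [leRHS]eq_bigl do rewrite andbT.
    apply: ler_sum => c _; rewrite normcM normc_phase mul1r normcM.
    have q0 m k : 0 <= qroot R m ^+ k by rewrite exprn_ge0// qroot_ge0.
    have pos : 0 <= V ^+ 2 * (8 * qroot R n ^+ 3 * (qroot R c ^+ 5 + qroot R (n - c) ^+ 5)).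
      apply: mulr_ge0; first exact: exprn_ge0.
      by apply: mulr_ge0; [exact: mulr_ge0|exact: addr_ge0].
    have [c0|c0] := eqVneq c 0; first by rewrite {1}c0 (mode0 hD g0) normc0 mul0r.
    have [d0|d0] := eqVneq (n - c) 0; first by rewrite {1}d0 (mode0 hD g0) normc0 mulr0.
    apply: (@le_trans _ _ ((V * qroot R c ^+ 4) * (V * qroot R (n - c) ^+ 4))).
      by apply: ler_pM; rewrite ?normc_ge0 ?hV4.
    rewrite mulrACA -expr2; apply: ler_wpM2l; first exact: exprn_ge0.
    by apply: qroot_pair4 => //; rewrite addrC subrK.
  rewrite -mulr_sumr -mulr_sumr big_split /=.
  have e2 := @sum_zrange_reflect R K0 n xpredT (fun c => qroot R c ^+ 5) (fun=> erefl).
  rewrite -e2.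
  have h5 : \sum_(c <- zrange K0 | (n - c \in zrange K0) && true) qroot R c ^+ 5 <= Z5.
    apply: le_trans (hZ5 K0); rewrite big_mkcond; apply: ler_sum => c _.
    by case: ifP => // _; rewrite exprn_ge0// qroot_ge0.
  rewrite /W -[leRHS]mulrA ler_wpM2l ?exprn_ge0//.
  rewrite (_ : 16 * Z5 * qroot R n ^+ 3 = 8 * qroot R n ^+ 3 * (Z5 + Z5)); last by ring.
  by rewrite ler_wpM2l ?lerD// mulr_ge0// exprn_ge0// qroot_ge0.
pose L := 128 * V ^+ 2 + 8 * W * V ^+ 2 + 8 * V ^+ 3.
have [L1 L2 L3] : [/\ 128 * V ^+ 2 <= L, 8 * W * V ^+ 2 <= L & 8 * V ^+ 3 <= L].
  have a1 : 0 <= 128 * V ^+ 2 by rewrite mulr_ge0// exprn_ge0.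
  have a2 : 0 <= 8 * W * V ^+ 2 by rewrite !mulr_ge0// exprn_ge0.
  have a3 : 0 <= 8 * V ^+ 3 by rewrite mulr_ge0// exprn_ge0.
  by rewrite /L; split; lra.
have L0 : 0 <= L by apply: le_trans L1; rewrite mulr_ge0// exprn_ge0.
exists (C * L); first exact: mulr_ge0.
move=> t tT n n0.
have -> : C * L * N n `^ (- (7 / 4)) = C * (L * qroot R n ^+ 3 / N n).
  rewrite -qroot4// (_ : N n `^ _ = qroot R n ^+ 3 * qroot R n ^+ 4); first by rewrite !mulrA.
  by rewrite -exprD qrootX (negbTE n0).
have q0 m k : 0 <= qroot R m ^+ k by rewrite exprn_ge0// qroot_ge0.
have lam0 : 0 <= L * qroot R n ^+ 3 by exact: mulr_ge0.
apply: (hC v G (per^-1 * E) (mode0 hD g0) (mode_derive hu hD) (mode_opp hu)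
  (fun s sT M => mode_energy hu M (hE s sT)) (fun e e0 => nonlinearity_conv hu T e0) n _ n0 lam0 _ t tT) => s sT; exists (fun m => qroot R m ^+ 3); split.
- by [].
- by move=> M; apply: le_trans (hA M); apply: ler_sum => m _; rewrite -exprM.
- move=> a b ab a0 b0.
  apply: (@le_trans _ _ ((V * qroot R a ^+ 4) * (V * qroot R b ^+ 4) / (N a * N b))).
    by rewrite ler_wpM2r ?invr_ge0 ?mulr_ge0 ?ler0z// ler_pM ?normc_ge0 ?hV4.
  rewrite invfM -!qroot4// -!exprM.
  rewrite (_ : _ * _ * _ = V ^+ 2 * (qroot R a ^+ 8 * qroot R b ^+ 8)); last by ring.
  apply: le_trans (ler_wpM2l (exprn_ge0 2 V0) (qroot_pair8 R ab a0 b0 n0)) _.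
  rewrite (_ : V ^+ 2 * (128 * _ * _) = (128 * V ^+ 2) * (qroot R n ^+ 7 * (qroot R a ^+ 6 + qroot R b ^+ 6))); last by ring.
  rewrite (_ : L * _ * _ * _ = L * (qroot R n ^+ 7 * (qroot R a ^+ 6 + qroot R b ^+ 6))); last by ring.
  by rewrite ler_wpM2r// mulr_ge0// addr_ge0.
- move=> b c d e b0 c0 d0.
  have q43 m : qroot R m ^+ 4 <= qroot R m ^+ 3.
    by rewrite [leLHS]exprS ler_piMl ?qroot_le1.
  have hV3 m : normc (v m s) <= V * qroot R m ^+ 3.
    by apply: le_trans (hV4 s m sT) _; rewrite ler_wpM2l.
  have s0 : 0 <= qroot R n ^+ 3 * nf_sigma (fun m => qroot R m ^+ 3) b c d.
    by rewrite mulr_ge0// /nf_sigma !addr_ge0// mulr_ge0.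
  have tr := qroot_triple R e b0 c0 d0 n0.
  split.
    apply: (@le_trans _ _ (W * qroot R b ^+ 3 * ((V * qroot R c ^+ 3) * (V * qroot R d ^+ 3)))).
      by apply: ler_pM; rewrite ?normc_ge0 ?mulr_ge0 ?normc_ge0 ?hG// ler_pM ?normc_ge0.
    rewrite (_ : _ * _ = W * V ^+ 2 * (qroot R b ^+ 3 * (qroot R c ^+ 3 * qroot R d ^+ 3))); last by ring.
    apply: le_trans (ler_wpM2l (mulr_ge0 W0 (exprn_ge0 2 V0)) tr) _.
    rewrite (_ : W * V ^+ 2 * (8 * _ * _) = 8 * W * V ^+ 2 * (qroot R n ^+ 3 * nf_sigma (fun m => qroot R m ^+ 3) b c d)); last by ring.
    by rewrite -(mulrA L) ler_wpM2r.
  apply: (@le_trans _ _ (V * qroot R b ^+ 3 * ((V * qroot R c ^+ 3) * (V * qroot R d ^+ 3)))).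
    by apply: ler_pM; rewrite ?normc_ge0 ?mulr_ge0 ?normc_ge0// ler_pM ?normc_ge0.
  rewrite (_ : _ * _ = V ^+ 3 * (qroot R b ^+ 3 * (qroot R c ^+ 3 * qroot R d ^+ 3))); last by ring.
  apply: le_trans (ler_wpM2l (exprn_ge0 3 V0) tr) _.
  rewrite (_ : V ^+ 3 * (8 * _ * _) = 8 * V ^+ 3 * (qroot R n ^+ 3 * nf_sigma (fun m => qroot R m ^+ 3) b c d)); last by ring.
  by rewrite -(mulrA L) ler_wpM2r.
- have h : normc (v n s) ^+ 3 <= (V * qroot R n ^+ 4) ^+ 3.
    apply: lerXn2r; rewrite ?nnegrE; [exact: normc_ge0|exact: mulr_ge0|exact: hV4].
  apply: le_trans h _; rewrite exprMn -exprM.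
  apply: ler_pM => //; first exact: exprn_ge0.
    by apply: le_trans L3; rewrite ler_peMl ?exprn_ge0// ler1n.
  rewrite (_ : (4 * 3)%N = (9 + 3)%N)// exprD ler_piMl//.
  by rewrite exprn_ile1 ?qroot_ge0 ?qroot_le1.
Qed.

Lemma mode_lipschitz T : exists2 C : R, 0 <= C & forall s t, `|s| <= T -> `|t| <= T ->
  forall n, normc (v n t - v n s) <= C * N n * `|t - s|.
Proof.
have [E hE] := energy_bounded hu T.
have per0 := period_gt0 R.
exists (per^-1 * `|E|); first by rewrite mulr_ge0// invr_ge0 ltW.
move=> s t sT tT n.
apply: (Cderive_mean_value (T := T) (fun r _ => mode_derive hu hD n r)) => // r rT.
rewrite normc_half_Ci /nonlinearity normcM normc_cis mul1r mulrC.
have h := normc_fourier_sqr_le n (u_L2 hu r).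
have h2 : per^-1 * energy (u r) <= per^-1 * `|E|.
  by rewrite ler_pM2l ?invr_gt0//; apply: le_trans (hE r rT) (ler_norm _).
apply: ler_pM; rewrite ?normc_ge0 ?divr_ge0 ?ler0z//; first exact: le_trans h h2.
by rewrite ler_pdivrMr// ler_peMr ?ler0z// ler1n.
Qed.

End kdv_decay.

(** * The correction to the Airy evolution as a uniformly convergent series *)

Section correction.
Variables (R : realType) (z : int -> R -> R[i]).
Local Notation mu := (@lebesgue_measure R).
Local Notation per := (period R).
Local Notation N m := (`|m|%:~R : R).
Hypotheses (z0 : forall t, z 0 t = 0)
  (zN : forall n t, z (- n) t = conjc (z n t))
  (zb : forall T, 0 <= T -> exists2 C : R, 0 <= C & forall t, `|t| <= T ->
     forall n, n != 0 -> normc (z n t) <= C * N n `^ (- (7 / 4)))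
  (zl : forall T, exists2 C : R, 0 <= C & forall s t, `|s| <= T -> `|t| <= T ->
     forall n, normc (z n t - z n s) <= C * N n * `|t - s|).

Let p t (n : int) : R[i] := cis (t * n%:~R ^+ 3) * z n t.

Definition correction_sum (M : nat) (t x : R) : R[i] := trig (zrange M) (p t) x.

Lemma correction_sum_real M t x : complex.Im (correction_sum M t x) = 0.
Proof.
have h : conjc (correction_sum M t x) = correction_sum M t x.
  rewrite /correction_sum /trig conjc_sum.
  have := @sum_zrange_reflect _ M 0 xpredT (fun n => p t n * cis (n%:~R * x)) (fun=> erefl).
  have eZ (h : int -> R[i]) : \sum_(b <- zrange M | (0 - b \in zrange M) && xpredT b) h b = \sum_(b <- zrange M) h b.
    rewrite big_seq_cond [RHS]big_seq; apply: eq_bigl => b; rewrite sub0r !mem_zrange abszN.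
    by case: (_ <= _)%N.
  rewrite !eZ => ->; apply: eq_bigr => n _; rewrite sub0r /p zN !conjcM -!cisN.
  congr (cis _ * _ * cis _); first by rewrite intrN; ring.
  by rewrite intrN mulNr.
have := congr1 (@complex.Im R) h; rewrite ImJ; lra.
Qed.

(** The interpolation [min (1, y) <= y^r], which turns a bounded Lipschitz quantity into a Hölder
    one. *)
Lemma powR_interp (M y r a : R) : 0 < r -> r <= 1 -> 0 <= M -> 0 <= y ->
  a <= M * y -> a <= M -> a <= M * y `^ r.
Proof.
move=> r0 r1 M0 y0 h1 h2; have [y1|y1] := leP y 1; last first.
  apply: le_trans h2 _; rewrite ler_peMr// -[leLHS](powRr0 y) ler_powR// ltW//.
apply: le_trans h1 _; rewrite ler_wpM2l//.
have [->|yn] := eqVneq y 0; first exact: powR_ge0.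
by apply: ger1_powR => //; rewrite y1 andbT lt_neqAle eq_sym yn.
Qed.

(** The phase of the [n]-th term is Lipschitz with constant [O(|n|^3)], so its increment is
    [O(|n|^(-7/4) (|n|^3 dl)^(1/5))], and [7/4 - 3/5 = 23/20 > 1]. *)
Lemma correction_sum_holder T : 0 <= T -> exists2 K : R, 0 <= K & forall M t s x y,
  `|t| <= T -> `|s| <= T ->
  normc (correction_sum M t x - correction_sum M s y) <= K * (`|t - s| + `|x - y|) `^ (1 / 5).
Proof.
move=> T0; have [C C0 hC] := zb T0; have [D D0 hD] := zl T.
have p1 : 1 < 23 / 20 :> R by lra.
have [Z Z0 hZ] := zrange_pseries p1.
pose B := C + (2 * C + D).
have B0 : 0 <= B by rewrite !addr_ge0// mulr_ge0.
exists (2 * B * Z); first by rewrite !mulr_ge0.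
move=> M t s x y tT sT; set dl := `|t - s| + `|x - y|.
have dl0 : 0 <= dl by rewrite addr_ge0.
rewrite /correction_sum /trig -sumrB; apply: le_trans (normc_sum _ _ _) _.
apply: (@le_trans _ _ (\sum_(n <- zrange M) 2 * B * dl `^ (1 / 5) * (if n == 0 then 0 else N n `^ (- (23 / 20))))); last first.
  rewrite -mulr_sumr mulrAC ler_wpM2r ?powR_ge0// ler_wpM2l ?mulr_ge0//.
apply: ler_sum => n _; case: eqVneq => [->|n0].
  by rewrite /p !z0 !mulr0 !mul0r subrr normc0.
have Nn := N_ge1 R n0; have Np := N_gt0 R n0.
pose A1 := cis (t * n%:~R ^+ 3 + n%:~R * x); pose A2 := cis (s * n%:~R ^+ 3 + n%:~R * y) : R[i].
have -> : p t n * cis (n%:~R * x) - p s n * cis (n%:~R * y) = (A1 - A2) * z n t + A2 * (z n t - z n s).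
  by rewrite /p /A1 /A2 !cisD; ring.
pose Y := N n ^+ 3 * dl.
have Y0 : 0 <= Y by rewrite mulr_ge0// exprn_ge0// ltW.
have a1 : normc (A1 - A2) <= 2 * Y `^ (1 / 5).
  apply: powR_interp => //; try lra; last exact: normc_cisB_le2.
  apply: le_trans (cis_lipschitz _ _) _.
  have -> : t * n%:~R ^+ 3 + n%:~R * x - (s * n%:~R ^+ 3 + n%:~R * y) = (t - s) * n%:~R ^+ 3 + n%:~R * (x - y) by ring.
  apply: le_trans (ler_normD _ _) _; rewrite (normrM (t - s)) normrX (normrM n%:~R) -intr_norm.
  have h : N n * `|x - y| <= N n ^+ 3 * `|x - y| by rewrite ler_wpM2r// ler_eXnr.
  have h0 : 0 <= Y by [].
  move: h h0; rewrite /Y /dl mulrDr [`|t - s| * _]mulrC.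
  by move: (N n ^+ 3 * `|t - s|) (N n ^+ 3 * `|x - y|) (N n * `|x - y|) => *; lra.
have W0 : 0 <= N n `^ (- (7 / 4)) by exact: powR_ge0.
have hz1 := hC t tT n n0; have hz2 := hC s sT n n0.
have a2 : normc (z n t - z n s) <= (2 * C + D) * N n `^ (- (7 / 4)) * Y `^ (1 / 5).
  have M0 : 0 <= (2 * C + D) * N n `^ (- (7 / 4)) by rewrite mulr_ge0// addr_ge0// mulr_ge0.
  apply: powR_interp => //; try lra.
    apply: le_trans (hD s t sT tT n) _.
    have e1 : N n <= N n `^ (- (7 / 4)) * N n ^+ 3.
      rewrite -powR_mulrn ?(ltW Np)// -powRD ?(gt_eqF Np) ?implybT//.
      by apply: (@le_trans _ _ (N n `^ 1)); [rewrite powRr1 ?(ltW Np)|apply: ler_powR => //; lra].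
    have e2 : `|t - s| <= dl by rewrite lerDl.
    rewrite -!mulrA; apply: (@le_trans _ _ (D * (N n `^ (- (7 / 4)) * N n ^+ 3 * dl))).
      by rewrite ler_wpM2l// ler_pM// ltW.
    by rewrite /Y -!mulrA ler_wpM2r ?mulr_ge0 ?exprn_ge0 ?(ltW Np)// lerDr mulr_ge0.
  apply: le_trans (normcB _ _) _; rewrite mulrDl.
  have := mulr_ge0 D0 W0; move: hz1 hz2; rewrite -mulrA.
  by move: (C * _) (D * _) (normc _) (normc _) => *; lra.
apply: le_trans (normcD _ _) _; rewrite !normcM normc_cis mul1r.
have YE : Y `^ (1 / 5) = N n `^ (3 / 5) * dl `^ (1 / 5).
  rewrite /Y powRM ?exprn_ge0 ?(ltW Np)// -powR_mulrn ?ltW// -powRrM; congr (_ `^ _ * _).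
  by field.
have NE : N n `^ (- (7 / 4)) * N n `^ (3 / 5) = N n `^ (- (23 / 20)).
  by rewrite -powRD ?(gt_eqF Np) ?implybT//; congr (_ `^ _); field.
have {}a1 : normc (A1 - A2) * normc (z n t) <= 2 * Y `^ (1 / 5) * (C * N n `^ (- (7 / 4))).
  by apply: ler_pM; rewrite ?normc_ge0.
apply: le_trans (lerD a1 a2) _; rewrite YE.
rewrite (_ : 2 * _ * _ + _ * _ * _ = (2 * C + (2 * C + D)) * (dl `^ (1 / 5) * (N n `^ (- (7 / 4)) * N n `^ (3 / 5)))); last by ring.
rewrite NE -mulrA ler_wpM2r ?mulr_ge0 ?powR_ge0// /B; lra.
Qed.

(** [7/4 = 1/2 + 5/4]: half a power is kept as the rate, the rest is summable. *)
Lemma correction_sum_tail t : exists2 K : R, 0 <= K & forall M M' x, (0 < M)%N -> (M <= M')%N ->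
  normc (correction_sum M' t x - correction_sum M t x) <= K * M%:R `^ (- (1 / 2)).
Proof.
have [C C0 hC] := zb (normr_ge0 t).
have p1 : 1 < 5 / 4 :> R by lra.
have [Z Z0 hZ] := zrange_pseries p1.
exists (C * Z); first exact: mulr_ge0.
move=> M M' x M0 MM'.
have -> : correction_sum M' t x - correction_sum M t x =
    \sum_(n <- zrange M' | n \notin zrange M) p t n * cis (n%:~R * x).
  rewrite /correction_sum /trig (bigID (fun n => n \in zrange M)) /= addrC.
  suff -> : \sum_(n <- zrange M' | n \in zrange M) p t n * cis (n%:~R * x) =
      \sum_(n <- zrange M) p t n * cis (n%:~R * x) by rewrite addrK.
  rewrite -big_filter; apply: perm_big; apply: uniq_perm; rewrite ?filter_uniq ?zrange_uniq// => n.
  rewrite mem_filter; case nM : (n \in zrange M) => //=.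
  exact: zrange_sub nM.
apply: le_trans (normc_sum _ _ _) _.
apply: (@le_trans _ _ (\sum_(n <- zrange M') C * M%:R `^ (- (1 / 2)) * (if n == 0 then 0 else N n `^ (- (5 / 4))))); last first.
  by rewrite -mulr_sumr mulrAC ler_wpM2r ?powR_ge0// ler_wpM2l.
rewrite big_mkcond; apply: ler_sum => n _; case: ifP => [nM|_]; last first.
  by rewrite !mulr_ge0 ?powR_ge0//; case: ifP => // _; exact: powR_ge0.
have n0 : n != 0 by apply: contraNN nM => /eqP ->; rewrite mem_zrange.
rewrite (negbTE n0) /p !normcM !normc_cis mul1r mulr1.
apply: le_trans (hC t (lexx _) n n0) _; rewrite -mulrA ler_wpM2l//.
have Np := N_gt0 R n0.
have -> : N n `^ (- (7 / 4)) = N n `^ (- (1 / 2)) * N n `^ (- (5 / 4)).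
  by rewrite -powRD ?(gt_eqF Np) ?implybT//; congr (_ `^ _); field.
rewrite ler_wpM2r ?powR_ge0// !powRN lef_pV2 ?posrE ?powR_gt0 ?N_gt0 ?ltr0n//.
apply: ge0_ler_powR; rewrite ?nnegrE ?ler0z// -[M%:R]/(M%:Z%:~R) ler_int.
by move: nM; rewrite mem_zrange; lia.
Qed.

Definition correction (t x : R) : R := lim ((fun M => complex.Re (correction_sum M t x)) @ \oo).

Lemma powR_half_small (K e : R) : 0 <= K -> 0 < e -> exists2 M : nat, (0 < M)%N &
  forall M', (M <= M')%N -> K * M'%:R `^ (- (1 / 2)) <= e.
Proof.
move=> K0 e0; pose M := (Num.truncn ((K / e) ^+ 2)).+1; exists M => // M' MM'.
have M'0 : 0 < M'%:R :> R by rewrite ltr0n; apply: leq_trans MM'.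
have h : (K / e) ^+ 2 <= M'%:R.
  by apply: le_trans (ltW (truncnS_gt _)) _; rewrite ler_nat.
rewrite powRN ler_pdivrMr ?powR_gt0// mulrC -ler_pdivrMr//.
have Ke : 0 <= K / e by rewrite divr_ge0// ltW.
have -> : K / e = ((K / e) ^+ 2) `^ (1 / 2).
  by rewrite -powR_mulrn// -powRrM (_ : 2%:R * (1 / 2) = 1) ?powRr1//; field.
by apply: ge0_ler_powR => //; rewrite nnegrE ?sqr_ge0// ltW.
Qed.

Lemma correction_cvg t x : (fun M => complex.Re (correction_sum M t x)) @ \oo --> correction t x.
Proof.
apply: cauchy_cvg; apply/cauchy_ballP => e e0.
have [K K0 hK] := correction_sum_tail t.
have e2 : 0 < e / 4 by rewrite divr_gt0.
have [M M0 hM] := powR_half_small K0 e2.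
have d0 M' : (M <= M')%N -> `|complex.Re (correction_sum M' t x) - complex.Re (correction_sum M t x)| <= e / 4.
  move=> MM'; rewrite -ReN -ReD; apply: le_trans (normc_Re _) _.
  by apply: le_trans (hK M M' x M0 MM') _; exact: hM.
exists ([set complex.Re (correction_sum M' t x) | M' in [set M' | (M <= M')%N]],
        [set complex.Re (correction_sum M' t x) | M' in [set M' | (M <= M')%N]]) => /=.
  by split; exists M => // M' /= MM'; exists M'.
move=> [_ _] /= [[M1 /d0 h1 <-] [M2 /d0 h2 <-]]; rewrite /ball /=.
move: h1 h2; rewrite !ler_norml ltr_norml => /andP[? ?] /andP[? ?]; lra.
Qed.

Lemma correction_rate t : exists2 K : R, 0 <= K & forall M x, (0 < M)%N ->
  normc ((correction t x)%:C - correction_sum M t x) <= K * M%:R `^ (- (1 / 2)).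
Proof.
have [K K0 hK] := correction_sum_tail t; exists K => // M x M0.
have -> : correction_sum M t x = (complex.Re (correction_sum M t x))%:C.
  by apply/eqP; rewrite eq_complex /= correction_sum_real !eqxx.
rewrite -rmorphB normcR.
have h : (fun M' => `|complex.Re (correction_sum M' t x) - complex.Re (correction_sum M t x)|) @ \oo -->
    `|correction t x - complex.Re (correction_sum M t x)|.
  by apply: cvg_norm; apply: cvgB; [exact: correction_cvg|exact: cvg_cst].
rewrite -(cvg_lim _ h)//; apply: limr_le; first by apply/cvg_ex; eexists; exact: h.
exists M => // M' /= MM'; rewrite -ReN -ReD; apply: le_trans (normc_Re _) _; exact: hK.
Qed.

Lemma correction_holder T : 0 <= T -> exists2 K : R, 0 <= K & forall t s x y,
  `|t| <= T -> `|s| <= T ->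
  `|correction t x - correction s y| <= K * (`|t - s| + `|x - y|) `^ (1 / 5).
Proof.
move=> T0; have [K K0 hK] := correction_sum_holder T0; exists K => // t s x y tT sT.
have h : (fun M => `|complex.Re (correction_sum M t x) - complex.Re (correction_sum M s y)|) @ \oo -->
    `|correction t x - correction s y|.
  by apply: cvg_norm; apply: cvgB; exact: correction_cvg.
rewrite -(cvg_lim _ h)//; apply: limr_le; first by apply/cvg_ex; eexists; exact: h.
by exists 0%N => // M _; rewrite -ReN -ReD; apply: le_trans (normc_Re _) _; exact: hK.
Qed.

Lemma correction_continuous : continuous (fun q : R * R => correction q.1 q.2).
Proof.
move=> [t x]; apply/cvgrPdist_le => e e0.
have T0 : 0 <= `|t| + 1 by rewrite addr_ge0.
have [K K0 hK] := correction_holder T0.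
pose d := Num.min 1 ((e / (K + 1)) ^+ 5 / 2).
have K1 : 0 < K + 1 by rewrite ltr_pwDr.
have eK : 0 < e / (K + 1) by rewrite divr_gt0.
have d0 : 0 < d by rewrite lt_min ltr01 divr_gt0// exprn_gt0.
exists (ball t d, ball x d) => /=; first by split; exact: nbhsx_ballx.
move=> [s y] [/= ts xy].
have s1 : `|s| <= `|t| + 1.
  have : `|t - s| < 1 by apply: lt_le_trans ts _; rewrite /d ge_min lexx.
  by have := ler_normB t (t - s); rewrite opprB addrC subrK; lra.
have t1 : `|t| <= `|t| + 1 by lra.
apply: le_trans (hK t s x y t1 s1) _.
have h : `|t - s| + `|x - y| <= (e / (K + 1)) ^+ 5.
  have d2 : d <= (e / (K + 1)) ^+ 5 / 2 by rewrite /d ge_min lexx orbT.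
  have := lt_le_trans ts d2; have := lt_le_trans xy d2.
  by move: (_ ^+ 5) (`|t - s|) (`|x - y|) => *; lra.
have h2 : (`|t - s| + `|x - y|) `^ (1 / 5) <= e / (K + 1).
  have -> : e / (K + 1) = ((e / (K + 1)) ^+ 5) `^ (1 / 5).
    by rewrite -powR_mulrn ?(ltW eK)// -powRrM (_ : 5%:R * (1 / 5) = 1) ?powRr1 ?(ltW eK)//; field.
  by apply: ge0_ler_powR => //; rewrite nnegrE ?addr_ge0// exprn_ge0// ltW.
apply: le_trans (ler_wpM2l K0 h2) _.
by rewrite mulrA ler_pdivrMr// mulrC ler_pM2l// lerDl.
Qed.

Lemma correction_periodic t : periodic (correction t) per.
Proof.
move=> x; rewrite /correction; congr (lim (_ @ \oo)); apply/funext => M.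
congr complex.Re; rewrite /correction_sum /trig; apply: eq_bigr => n _.
by rewrite mulrDr cisD cis_period_int mulr1.
Qed.

Lemma correction_continuous_x t : continuous (correction t).
Proof.
move=> x; apply/cvgrPdist_le => e e0.
have := @correction_continuous (t, x); move=> /cvgrPdist_le/(_ e e0)/nbhs_ballP[d /= d0 hd].
apply/nbhs_ballP; exists d => // y xy; apply: (hd (t, y)); split => //=; exact: ballxx.
Qed.

(** The partial sums have the right coefficients and converge uniformly; by [dist_trig] the error in
    each coefficient is at most a multiple of the L^2 distance. *)
Lemma correction_fourier t n : fourier (correction t) n = cis (t * n%:~R ^+ 3) * z n t.
Proof.
have sc : square_integrable (correction t).
  by apply: continuous_square_integrable; exact: correction_continuous_x.
have per0 := period_gt0 R.
have [K K0 hK] := correction_rate t.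
apply/eqP; rewrite eq_sym -subr_eq0; apply/eqP/eq0_normc/eqP.
rewrite eq_le normc_ge0 andbT; apply/ler_addgt0Pr => e e0; rewrite add0r.
have [M0 M00 hM] := powR_half_small K0 e0.
pose M := maxn M0 (absz n).
have Mp : (0 < M)%N by rewrite leq_max M00.
have rate x : normc ((correction t x)%:C - correction_sum M t x) <= e.
  by apply: le_trans (hK M x Mp) _; apply: hM; rewrite leq_maxl.
have id := dist_trig (p t) sc (zrange_uniq M).
have bs := bessel sc (zrange_uniq M).
have mem : normsq (p t n - fourier (correction t) n) <= \sum_(m <- zrange M) normsq (p t m - fourier (correction t) m).
  apply: (@ler_sum_mem _ _ _ n (fun m => normsq (p t m - fourier (correction t) m))).
    by rewrite mem_zrange leq_maxr.
  by move=> i; rewrite normsqE sqr_ge0.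
have up : Rintegral mu `[0, per] (fun x => normsq ((correction t x)%:C - trig (zrange M) (p t) x)) <= per * e ^+ 2.
  apply: (@le_trans _ _ (Rintegral mu `[0, per] (fun=> e ^+ 2))).
    apply: le_Rintegral => //.
    - exact: rintegrable_dist.
    - by apply: rintegrable_cont => x; exact: cst_continuous.
    by move=> x _; rewrite normsqE lerXn2r ?nnegrE ?normc_ge0 ?(ltW e0)//; exact: rate.
  by rewrite Rintegral_cst_itv ?(ltW per0)// subr0 mulrC.
rewrite id in up.
have : normsq (p t n - fourier (correction t) n) <= e ^+ 2.
  apply: le_trans mem _; rewrite -(ler_pM2l per0); apply: le_trans up.
  rewrite lerDr subr_ge0 -ler_pdivlMl//.
rewrite normsqE ler_sqr ?nnegrE ?normc_ge0 ?(ltW e0)//.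
Qed.

End correction.

Section kdv_correction.
Variables (R : realType) (g : R -> R) (u : R -> R -> R) (Cg : R).
Local Notation N m := (`|m|%:~R : R).

(** The modes of [w] are those of [u] minus their initial values, so that [u - w] has the modes of
    the free evolution. *)
Lemma kdv_correction : continuous_in_L2 u -> kdv_duhamel g u -> fourier g 0 = 0 ->
  (forall n, n != 0 -> normc (fourier g n) <= Cg / N n) ->
  exists w : R -> R -> R,
  [/\ continuous (fun q : R * R => w q.1 q.2),
      forall T, 0 <= T -> exists2 K : R, 0 <= K & forall t s x y, `|t| <= T -> `|s| <= T ->
        `|w t x - w s y| <= K * (`|t - s| + `|x - y|) `^ (1 / 5) &
      airy_solution g (fun t x => u t x - w t x)].
Proof.
move=> hu hD g0 hg; pose z n t := mode u n t - mode u n 0.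
have z0 t : z 0 t = 0 by rewrite /z !(mode0 hD g0) subrr.
have mN n t : mode u (- n) t = conjc (mode u n t).
  rewrite /mode fourierN ?conjcM -?cisN; last exact: square_integrable_rintegrable (u_L2 hu t).
  by congr (cis _ * _); rewrite intrN; ring.
have zN n t : z (- n) t = conjc (z n t).
  by rewrite /z !mN rmorphB.
have zb : forall T, 0 <= T -> exists2 C : R, 0 <= C & forall t, `|t| <= T ->
     forall n, n != 0 -> normc (z n t) <= C * N n `^ (- (7 / 4)).
  by move=> T T0; exact: (kdv_decay hu hD g0 hg T0).
have zl T : exists2 C : R, 0 <= C & forall s t, `|s| <= T -> `|t| <= T ->
     forall n, normc (z n t - z n s) <= C * N n * `|t - s|.
  have [C C0 hC] := mode_lipschitz hu hD T; exists C => // s t sT tT n.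
  by rewrite /z opprB addrA subrK; exact: hC.
exists (correction z); split.
- exact: (correction_continuous z0 zb zl).
- exact: (correction_holder z0 zb zl).
have cw t : continuous (correction z t) by exact: (correction_continuous_x z0 zb zl).
split => t.
  have [pu [mu' iu]] := hu.1 t.
  have L2w : square_integrable (fun x => u t x - correction z t x).
    by apply: L2B; [exact: (u_L2 hu t)|exact: continuous_square_integrable].
  split; first by move=> x; rewrite pu (correction_periodic z t).
  split; last exact: L2w.2.
  by apply: measurable_funB => //; exact: continuous_measurable_fun.
move=> n; rewrite fourierB; last 2 first.
- exact: square_integrable_rintegrable (u_L2 hu t).
- apply: square_integrable_rintegrable; apply: continuous_square_integrable.
  exact: cw.
rewrite (correction_fourier z0 zN zb zl) /z -(mode_at0 hu hD).
rewrite -[fourier (u t) n]mul1r -(cisNr (t * n%:~R ^+ 3)) -mulrA -/(mode u n t) -mulrBr.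
by congr (_ * _); rewrite opprB addrC subrK.
Qed.

End kdv_correction.

(** * Oscillation of the linear part *)

Section line_variation.
Variables (R : realType) (k l : nat) (F : int -> R[i]) (c Cg : R).
Local Notation mu := (@lebesgue_measure R).
Local Notation N m := (`|m|%:~R : R).
Local Notation P := (line_end R l).
Local Notation om := (line_om R k l).
Hypotheses (k0 : (0 < k)%N) (l0 : (0 < l)%N) (F0 : F 0 = 0)
  (Fb : forall n, n != 0 -> normc (F n) <= Cg / N n).

Let r : R := k%:R / l%:R.

Definition line_osc (M : nat) (x : R) : R[i] :=
  osc k l (zrange M) (fun n => F n * cis (c * n%:~R ^+ 3)) x.

Definition osc_increment (h : R) (n : int) : R[i] :=
  F n * cis (c * n%:~R ^+ 3) * (cis (om n * h) - 1).

(** Small enough that every frequency with [n <= m < 2n] turns by at most one radian over the step,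
    as [|om m| <= 8 (1 + r) n^3]. *)
Definition line_step (n : nat) : R := (8 * (1 + r))^-1 * n%:R ^- 3.

Lemma line_osc_shift M x h :
  line_osc M (x + h) - line_osc M x = osc k l (zrange M) (osc_increment h) x.
Proof.
rewrite /line_osc /osc -sumrB; apply: eq_bigr => n _.
by rewrite /osc_increment mulrDr cisD; ring.
Qed.

Let r_gt0 : 0 < r.
Proof. by rewrite divr_gt0// ltr0n. Qed.

Lemma line_omE n : om n = n%:~R - r * n%:~R ^+ 3.
Proof.
have lN : (l%:R : R) != 0 by rewrite pnatr_eq0 -lt0n.
rewrite /line_om /line_int /r intrB (intrM R k%:Z) (intrM R l%:Z) (rmorphXn (intmul 1)) /=.
by rewrite -[l%:Z%:~R]/(l%:R) -[k%:Z%:~R]/(k%:R); field.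
Qed.

Lemma line_om_le n : `|om n| <= (1 + r) * N n ^+ 3.
Proof.
have [->|n0] := eqVneq n 0.
  rewrite (_ : om 0 = 0); last by rewrite line_omE mulr0z expr0n /= mulr0 subr0.
  by rewrite !normr0 mulr0z expr0n mulr0.
rewrite line_omE; apply: le_trans (ler_normB _ _) _; rewrite (normrM r) normrX -intr_norm.
by rewrite (gtr0_norm r_gt0) mulrDl mul1r lerD2r ler_eXnr// N_ge1.
Qed.

Lemma line_om_ge (n : nat) : (2 * l <= n)%N -> r / 2 * n%:R ^+ 3 <= `|om n%:Z|.
Proof.
move=> ln; rewrite line_omE -[n%:Z%:~R]/(n%:R).
have h : (n%:R : R) <= r / 2 * n%:R ^+ 3.
  have l1 : 0 < l%:R :> R by rewrite ltr0n.
  have n1 : 0 <= n%:R :> R by [].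
  have n2 : 2 * l%:R <= n%:R :> R by rewrite -natrM ler_nat.
  have k1 : 1 <= k%:R :> R by rewrite ler1n.
  have l2 : 1 <= l%:R :> R by rewrite ler1n.
  rewrite [_ ^+ 3]exprSr mulrA ler_peMl// /r.
  rewrite -mulrA mulrC mulrA ler_pdivlMr// mul1r.
  have h1 : (2 * l%:R) ^+ 2 <= n%:R ^+ 2 :> R by rewrite lerXn2r ?nnegrE ?mulr_ge0.
  have h2 : 0 <= (n%:R : R) ^+ 2 by exact: sqr_ge0.
  have h3 : (n%:R : R) ^+ 2 <= n%:R ^+ 2 * k%:R by rewrite ler_peMr.
  by nra.
rewrite distrC ger0_norm ?subr_ge0; last by apply: le_trans h _; rewrite ler_wpM2r ?exprn_ge0//; have := ltW r_gt0; lra.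
by move: h; rewrite (_ : r * n%:R ^+ 3 = r / 2 * n%:R ^+ 3 + r / 2 * n%:R ^+ 3); [lra|field].
Qed.

Lemma line_step_gt0 n : (0 < n)%N -> 0 < line_step n.
Proof.
by move=> n0; rewrite mulr_gt0// invr_gt0 ?exprn_gt0 ?ltr0n// mulr_gt0// ltr_pwDl// ltW.
Qed.

(** [min (1, y) <= y^th] with [y = (1 + r) h |n|^3]. The exponent satisfies
    [6 th - 2 + e = -(1 + e)], so that the sum over [n] converges. *)
Lemma osc_increment_le e h n : 0 < e -> e < 1 / 2 -> 0 <= h -> n != 0 ->
  normsq (osc_increment h n) * (absz n)%:R `^ e <=
  4 * Cg ^+ 2 * (((1 + r) * h) `^ ((1 - 2 * e) / 6)) ^+ 2 * N n `^ (- (1 + e)).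
Proof.
move=> e0 e1 h0 n0; have Np := N_gt0 R n0; set th := (1 - 2 * e) / 6.
have th0 : 0 < th by rewrite /th; lra.
have r1 : 0 <= (1 + r) * h by rewrite mulr_ge0// addr_ge0// ltW.
have b1 : normc (cis (om n * h) - 1) <= 2 * ((1 + r) * h * N n ^+ 3) `^ th.
  apply: powR_interp; rewrite ?mulr_ge0 ?exprn_ge0 ?ler0z ?addr_ge0 ?(ltW r_gt0)//.
  - by rewrite /th; lra.
  - rewrite -cis0; apply: le_trans (cis_lipschitz _ _) _; rewrite subr0 normrM (ger0_norm h0).
    apply: (@le_trans _ _ ((1 + r) * h * N n ^+ 3)).
      by rewrite mulrAC ler_wpM2r// line_om_le.
    by have := mulr_ge0 r1 (exprn_ge0 3 (ltW Np)); lra.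
  - by rewrite -cis0; exact: normc_cisB_le2.
rewrite powRM ?exprn_ge0 ?(ltW Np)// in b1.
set H := ((1 + r) * h) `^ th in b1 *.
have H0 : 0 <= H by exact: powR_ge0.
have nE : (N n ^+ 3) `^ th = N n `^ (3 * th).
  by rewrite -powR_mulrn ?(ltW Np)// -powRrM.
rewrite nE in b1.
have b2 : normc (osc_increment h n) <= Cg / N n * (2 * (H * N n `^ (3 * th))).
  rewrite /osc_increment !normcM normc_cis mulr1.
  by apply: ler_pM; rewrite ?normc_ge0// Fb.
rewrite normsqE.
have b3 : normc (osc_increment h n) ^+ 2 <= (Cg / N n * (2 * (H * N n `^ (3 * th)))) ^+ 2.
  by rewrite lerXn2r ?nnegrE ?normc_ge0//; exact: le_trans (normc_ge0 _) b2.
apply: le_trans (ler_wpM2r (powR_ge0 _ _) b3) _.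
rewrite natr_absz.
have -> : (Cg / N n * (2 * (H * N n `^ (3 * th)))) ^+ 2 * N n `^ e =
   4 * Cg ^+ 2 * H ^+ 2 * ((N n)^-1 ^+ 2 * (N n `^ (3 * th)) ^+ 2 * N n `^ e) by ring.
rewrite le_eqVlt; apply/orP; left; apply/eqP; congr (_ * _).
rewrite -powR_inv1 ?(ltW Np)// -!powR_mulrn ?powR_ge0// -!powRrM -!powRD ?(gt_eqF Np) ?implybT//.
by congr (_ `^ _); rewrite /th; field.
Qed.

Lemma osc_increment_sum e : 0 < e -> e < 1 / 2 -> exists2 C : R, 0 <= C & forall h M, 0 <= h ->
  \sum_(n <- zrange M) normsq (osc_increment h n) * (absz n)%:R `^ e <=
  C * (h `^ ((1 - 2 * e) / 6)) ^+ 2.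
Proof.
move=> e0 e1; have p1 : 1 < 1 + e by rewrite ltrDl.
have [Z Z0 hZ] := zrange_pseries p1.
pose C := 4 * Cg ^+ 2 * ((1 + r) `^ ((1 - 2 * e) / 6)) ^+ 2.
have C0 : 0 <= C := mulr_ge0 (mulr_ge0 (ler0n _ 4) (sqr_ge0 _)) (sqr_ge0 _).
exists (C * Z); first exact: mulr_ge0.
move=> h M h0.
apply: (@le_trans _ _ (\sum_(n <- zrange M) C * (h `^ ((1 - 2 * e) / 6)) ^+ 2 * (if n == 0 then 0 else N n `^ (- (1 + e))))).
  apply: ler_sum => n _; case: eqVneq => [->|n0].
    by rewrite /osc_increment F0 !mul0r normsqE normc0 expr0n mul0r mulr0.
  apply: le_trans (osc_increment_le e0 e1 h0 n0) _.
  rewrite powRM ?addr_ge0 ?(ltW r_gt0)// exprMn /C.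
  by rewrite !mulrA.
by rewrite -mulr_sumr mulrAC ler_wpM2r ?sqr_ge0// ler_wpM2l.
Qed.

(** For [n <= m < 2n] the angle [om m h] lies between [r / (16 (1 + r))] and 1 in modulus, so the
    chord it spans is bounded below. *)
Lemma osc_increment_lower (n m : nat) : (2 * l < n)%N -> (n <= m)%N -> (m < n.*2)%N ->
  (r / (64 * (1 + r))) ^+ 2 * normsq (F m%:Z) <= normsq (osc_increment (line_step n) m%:Z).
Proof.
move=> ln nm mn; have n0 : (0 < n)%N by lia.
have h0 := line_step_gt0 n0.
have n1 : 0 < n%:R :> R by rewrite ltr0n.
have r1 : 0 < 1 + r by rewrite ltr_pwDl// ltW.
have lm : (2 * l <= m)%N by lia.
have hn : line_step n * n%:R ^+ 3 = (8 * (1 + r))^-1.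
  by rewrite /line_step mulfVK// expf_neq0// gt_eqF.
have up : `|om m%:Z * line_step n| <= 1.
  rewrite normrM (gtr0_norm h0); apply: (@le_trans _ _ ((1 + r) * (8 * n%:R ^+ 3) * line_step n)).
    rewrite ler_wpM2r ?(ltW h0)//; apply: le_trans (line_om_le _) _.
    rewrite ler_wpM2l ?(ltW r1)// (_ : 8 * n%:R ^+ 3 = (2 * n%:R) ^+ 3); last by ring.
    rewrite lerXn2r ?nnegrE ?ler0z ?mulr_ge0// -[N _]/(m%:R) -natrM ler_nat; lia.
  rewrite (_ : _ * _ * _ = 8 * (1 + r) * (line_step n * n%:R ^+ 3)); last by ring.
  by rewrite hn mulfV// gt_eqF// mulr_gt0.
have lo : r / (16 * (1 + r)) <= `|om m%:Z * line_step n|.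
  rewrite normrM (gtr0_norm h0); apply: (@le_trans _ _ (r / 2 * n%:R ^+ 3 * line_step n)).
    rewrite -mulrA (mulrC (n%:R ^+ 3)) hn le_eqVlt; apply/orP; left; apply/eqP.
    by field; rewrite gt_eqF.
  rewrite ler_wpM2r ?(ltW h0)//; apply: le_trans (line_om_ge lm).
  by rewrite ler_wpM2l ?divr_ge0 ?(ltW r_gt0)// lerXn2r ?nnegrE// ler_nat.
have pi1 : `|om m%:Z * line_step n| <= pi.
  apply: le_trans up _; apply: le_trans (pi_ge2 R); rewrite ler1n//.
have hc := cis_chord_ge pi1.
rewrite /osc_increment !normsqE !normcM normc_cis mulr1 -exprMn.
have q0 : 0 <= r / (64 * (1 + r)) by rewrite divr_ge0 ?(ltW r_gt0)// mulr_ge0 ?(ltW r1).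
apply: lerXn2r; rewrite ?nnegrE; [exact: mulr_ge0 q0 (normc_ge0 _)|by rewrite mulr_ge0 ?normc_ge0|].
rewrite mulrC ler_wpM2l ?normc_ge0// normc_distrC; apply: le_trans hc.
rewrite (_ : r / (64 * (1 + r)) = r / (16 * (1 + r)) / 4); last by field; rewrite gt_eqF.
by rewrite ler_pM2r// invr_gt0.
Qed.

(** The second moment is at least of order [1/n], the fourth at most of order [n^(4e - 2)]; a
    threshold [lam] of order [n^(2e - 1/2)] makes the fourth moment over [lam^2] at most half of the
    second. *)
Lemma line_osc_variation (e c0 : R) (N0 : nat) : 0 < e -> e < 1 / 2 -> 0 < c0 ->
  (forall n, (N0 <= n)%N -> c0 / n%:R <= \sum_(i < n) normsq (F (n + i)%N%:Z)) ->
  exists2 K : R, 0 < K & exists N1 : nat, forall n M, (N1 <= n)%N -> (n.*2 <= M)%N ->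
    K * n%:R `^ (- (1 / 2 + 2 * e)) <=
    Rintegral mu `[0, P] (fun x => normc (line_osc M (x + line_step n) - line_osc M x)).
Proof.
move=> e0 e1 c00 hlow; have P0 := @line_end_gt0 R l l0.
have [C C_ge0 hC] := @osc_L1 R k l k0 l0 e e0.
have [D D0 hD] := osc_increment_sum e0 e1.
pose c1 := (r / (64 * (1 + r))) ^+ 2 * c0.
have r1 : 0 < 1 + r by rewrite ltr_pwDl// ltW.
have c10 : 0 < c1 by rewrite mulr_gt0// exprn_gt0// divr_gt0// mulr_gt0.
pose th := (1 - 2 * e) / 6.
pose kap : R := (8 * (1 + r))^-1.
have kap0 : 0 < kap by rewrite invr_gt0 mulr_gt0.
pose B := C * (D * (kap `^ th) ^+ 2) ^+ 2.
have B0 : 0 <= B by rewrite mulr_ge0// sqr_ge0.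
(* The constant that makes the fourth-moment term at most [P c1 / (2n)]. *)
pose L := Num.sqrt (2 * (B + 1) / (P * c1)).
have Pc : 0 < P * c1 by exact: mulr_gt0.
have L0 : 0 < L by rewrite sqrtr_gt0 divr_gt0// mulr_gt0// ltr_pwDr.
have L2 : L ^+ 2 = 2 * (B + 1) / (P * c1).
  by apply: sqr_sqrtr; exact: divr_ge0 (mulr_ge0 (ler0n _ 2) (addr_ge0 B0 ler01)) (ltW Pc).
exists (P * c1 / 2 / L); first by rewrite !divr_gt0.
exists (N0 + (2 * l).+1)%N => n M Nn nM.
have hl : (2 * l < n)%N := leq_trans (leq_addl N0 _) Nn.
have hN : (N0 <= n)%N := leq_trans (leq_addr _ N0) Nn.
have n0 : (0 < n)%N := leq_ltn_trans (leq0n _) hl.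
have n1 : 0 < n%:R :> R by rewrite ltr0n.
have h0 := line_step_gt0 n0.
pose lam := L * n%:R `^ (2 * e - 1 / 2).
have lam0 : 0 < lam by rewrite mulr_gt0// powR_gt0.
rewrite (_ : (fun x => _) = fun x => normc (osc k l (zrange M) (osc_increment (line_step n)) x)); last first.
  by apply/funext => x; rewrite line_osc_shift.
have a0 : osc_increment (line_step n) 0 = 0 by rewrite /osc_increment F0 !mul0r.
have := hC (zrange M) (osc_increment (line_step n)) lam (zrange_uniq M) a0 lam0.
have low : c1 / n%:R <= \sum_(m <- zrange M | (2 * l < absz m)%N) normsq (osc_increment (line_step n) m).
  apply: (@le_trans _ _ (\sum_(i < n) normsq (osc_increment (line_step n) (n + i)%N%:Z))).
    rewrite /c1 -mulrA; apply: le_trans (ler_wpM2l (sqr_ge0 _) (hlow n hN)) _.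
    rewrite mulr_sumr; apply: ler_sum => i _; apply: osc_increment_lower => //; first exact: leq_addr.
    by rewrite -addnn ltn_add2l.
  rewrite -[leRHS]big_filter.
  rewrite (_ : \sum_(i < n) _ = \sum_(m <- [seq (n + i)%N%:Z | i <- iota 0 n]) normsq (osc_increment (line_step n) m)); last first.
    by rewrite big_map -[X in iota 0 X](subn0 n) -/(index_iota 0 n) big_mkord.
  apply: sum_subset.
  - by rewrite map_inj_uniq ?iota_uniq// => i j [] /addnI.
  - by rewrite filter_uniq// zrange_uniq.
  - move=> _ /mapP[i + ->]; rewrite mem_iota mem_filter mem_zrange add0n => hi; apply/andP; split.
      exact: leq_trans hl (leq_addr _ _).
    by apply: leq_trans nM; rewrite -addnn leq_add2l ltnW.
  - by move=> m; rewrite normsqE sqr_ge0.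
have upp := hD (line_step n) M (ltW h0).
have stepE : (line_step n `^ th) ^+ 2 = (kap `^ th) ^+ 2 * n%:R `^ (2 * e - 1).
  have n3 : 0 <= n%:R ^- 3 :> R by rewrite invr_ge0 exprn_ge0.
  have -> : line_step n `^ th = kap `^ th * (n%:R ^- 3) `^ th by apply: powRM => //; exact: ltW.
  rewrite exprMn; congr (_ * _).
  have -> : n%:R ^- 3 = n%:R `^ (- 3%:R) :> R by rewrite powRN powR_mulrn.
  rewrite -powR_mulrn ?powR_ge0// -!powRrM; congr (_ `^ _).
  by rewrite /th; field.
rewrite stepE in upp.
have lam2 : lam ^+ 2 = L ^+ 2 * n%:R `^ (4 * e - 1).
  rewrite /lam exprMn -(powR_mulrn 2 (powR_ge0 n%:R _)) -powRrM; congr (_ * _ `^ _).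
  by field.
have S0 : 0 <= \sum_(m <- zrange M) normsq (osc_increment (line_step n) m) * `|m|%N%:R `^ e.
  by apply: sumr_ge0 => m _; rewrite mulr_ge0 ?powR_ge0// normsqE sqr_ge0.
have upp2 : C * (\sum_(m <- zrange M) normsq (osc_increment (line_step n) m) * `|m|%N%:R `^ e) ^+ 2 / lam ^+ 2 <=
   P * c1 / 2 / n%:R.
  have sq : C * (\sum_(m <- zrange M) normsq (osc_increment (line_step n) m) * `|m|%N%:R `^ e) ^+ 2 <= B * n%:R `^ (4 * e - 2).
    rewrite /B -mulrA ler_wpM2l//.
    have -> : n%:R `^ (4 * e - 2) = (n%:R `^ (2 * e - 1)) ^+ 2 :> R.
      by rewrite -powR_mulrn ?powR_ge0// -powRrM; congr (_ `^ _); ring.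
    by rewrite -exprMn lerXn2r ?nnegrE ?mulr_ge0 ?sqr_ge0 ?powR_ge0// -mulrA.
  have lp : 0 < lam ^+ 2 by rewrite exprn_gt0.
  rewrite ler_pdivrMr//; apply: le_trans sq _; rewrite lam2 L2.
  have -> : P * c1 / 2 / n%:R * (2 * (B + 1) / (P * c1) * n%:R `^ (4 * e - 1)) = (B + 1) * (n%:R^-1 * n%:R `^ (4 * e - 1)).
    by field; rewrite !gt_eqF.
  rewrite -powR_inv1 ?(ltW n1)// -powRD ?(gt_eqF n1) ?implybT// (_ : -1 + (4 * e - 1) = 4 * e - 2); last by ring.
  by rewrite ler_wpM2r ?powR_ge0// lerDl.
move=> main.
have main2 : P * c1 / 2 / n%:R <= lam * Rintegral mu `[0, P] (fun x => normc (osc k l (zrange M) (osc_increment (line_step n)) x)).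
  apply: le_trans main; have := ler_wpM2l (ltW P0) low.
  rewrite (_ : P * (c1 / n%:R) = P * c1 / 2 / n%:R + P * c1 / 2 / n%:R); last by field; rewrite gt_eqF.
  by move: upp2; move: (_ / lam ^+ 2) (P * \sum_(_ <- _ | _) _) (P * c1 / 2 / n%:R) => *; lra.
rewrite -(ler_pM2l lam0); apply: le_trans main2.
rewrite /lam (_ : L * _ * _ = P * c1 / 2 * (n%:R `^ (2 * e - 1 / 2) * n%:R `^ (- (1 / 2 + 2 * e)))); last first.
  by field; rewrite gt_eqF.
rewrite -powRD ?(gt_eqF n1) ?implybT// (_ : 2 * e - 1 / 2 + _ = -1); last by field.
by rewrite powR_inv1 ?(ltW n1).
Qed.

End line_variation.

(** * Box dimension of graphs *)

Section box_dimension.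
Variable R : realType.
Local Notation mu := (@lebesgue_measure R).
Local Notation T := (measurableTypeR R).
Implicit Types (F : R -> R) (E : set (R * R)).

Lemma indic_cc_rintegrable (s t a b : R) :
  rintegrable (`[s, t]%classic : set T) (\1_(`[a, b]%classic : set T)).
Proof.
apply: (@rintegrable_le _ _ _ (fun=> 1)) => //.
- by apply: rintegrable_cont => x; exact: cst_continuous.
- by move=> x _; rewrite indicE ger0_norm// lern1 leq_b1.
Qed.

Lemma indic_cc_Rintegral_le (s t a b : R) : a <= b ->
  Rintegral mu `[s, t] (\1_(`[a, b]%classic : set T)) <= b - a.
Proof.
move=> ab; rewrite /Rintegral integral_indic//.
have m1 : measurable (`[a, b]%classic : set T) by [].
have m2 : measurable (`[s, t]%classic : set T) by [].
have h : (mu (`[a, b]%classic `&` `[s, t]%classic) <= (b - a)%:E)%E.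
  rewrite -lebesgue_measure_cc//; apply: le_measure; rewrite ?inE//; exact: measurableI.
apply: (@fine_le _ (mu (`[a, b]%classic `&` `[s, t]%classic)) ((b - a)%:E)) => //.
by rewrite ge0_fin_numE//; exact: le_lt_trans h (ltry _).
Qed.

Lemma interval_cover_length (n : nat) (q : 'I_n -> R) (S : pred 'I_n) (a b h : R) : 0 < h -> a <= b ->
  (forall y, a <= y <= b -> exists2 i, S i & `|y - q i| < h) ->
  b - a <= \sum_(i < n | S i) 2 * h.
Proof.
move=> h0 ab hy; rewrite -lee_fin -lebesgue_measure_cc//.
pose A (i : nat) : set T := if insub i is Some j then
  (if S j then `[q j - h, q j + h]%classic else set0) else set0.
have mA i : measurable (A i) by rewrite /A; case: insubP => // j _ _; case: ifP.
apply: (@le_trans _ _ (mu (\big[setU/set0]_(i < n) A i))).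
  apply: le_measure; rewrite ?inE//; first exact: bigsetU_measurable.
  move=> y /=; rewrite in_itv /= => /hy[i Si yi].
  rewrite -bigcup_mkord; exists i => /=; first exact: ltn_ord.
  rewrite /A valK Si /= in_itv /=.
  by move: yi; rewrite ltr_norml => /andP[? ?]; apply/andP; split; lra.
apply: (le_trans (Boole_inequality mu (A := A) (n := n) _)) => [i _|]; first exact: mA.
rewrite -sumEFin [leRHS]big_mkcond /=; apply: lee_sum => i _; rewrite /A valK.
case: ifP => _; last by rewrite measure0.
by rewrite lebesgue_measure_cc ?lee_fin; lra.
Qed.

(** By the intermediate value theorem the graph over [[x, x + h]] meets every height between [F x]
    and [F (x + h)]. The discs whose centres are within [2h] of [x] horizontally thus cover that
    range of heights, each at most [2h] of it. Integrated over [x], a disc counts along a length at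
    most [4h]. *)
Lemma graph_cover_variation (F : R -> R) (P h : R) (n : nat) (p : 'I_n -> R * R) :
  continuous F -> 0 < h -> h <= P ->
  graph_on 0 P F `<=` \bigcup_(i in [set: 'I_n]) disc (p i) h ->
  Rintegral mu `[0, P - h] (fun x => `|F (x + h) - F x|) <= 8 * h ^+ 2 * n%:R.
Proof.
move=> cF h0 hP cov.
pose J i : set T := `[(p i).1 - 2 * h, (p i).1 + 2 * h]%classic.
have mJ i : measurable (J i) by exact: measurable_itv.
have ptw x : 0 <= x <= P - h -> `|F (x + h) - F x| <= \sum_(i < n) 2 * h * \1_(J i) x.
  move=> /andP[x0 xP].
  have key a b : (forall y, a <= y <= b -> exists2 s, x <= s <= x + h & F s = y) -> a <= b ->
      b - a <= \sum_(i < n) 2 * h * \1_(J i) x.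
    move=> hs ab; apply: le_trans (@interval_cover_length n (fun i => (p i).2) (fun i => `|x - (p i).1| <= 2 * h) a b h h0 ab _) _.
      move=> y /hs[s /andP[s1 s2] Fs].
      have [|i _ /= di] := cov (s, y).
        by exists s; rewrite ?Fs//= in_itv /=; apply/andP; split; lra.
      rewrite /disc /= in di; have := sqr_ge0 (s - (p i).1); have := sqr_ge0 (y - (p i).2).
      have hh : 0 <= h by exact: ltW.
      exists i.
        have : `|s - (p i).1| < h.
          by rewrite -(@ltr_pXn2r _ 2)// ?nnegrE// real_normK ?num_real//; lra.
        by rewrite ltr_norml ler_norml => /andP[? ?]; apply/andP; split; lra.
      by rewrite -(@ltr_pXn2r _ 2)// ?nnegrE// real_normK ?num_real//; lra.
    rewrite big_mkcond; apply: ler_sum => i _; case: ifP => [hi|_]; last by rewrite !mulr_ge0// ltW.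
    rewrite indicE mem_set ?mulr1// /J /= in_itv /=.
    by move: hi; rewrite ler_norml => /andP[? ?]; apply/andP; split; lra.
  have cw : {within `[x, x + h], continuous F} by exact: continuous_subspaceT.
  have xh : x <= x + h by lra.
  have ivt y : Num.min (F x) (F (x + h)) <= y <= Num.max (F x) (F (x + h)) ->
      exists2 s, x <= s <= x + h & F s = y.
    by move=> /(IVT xh cw)[s]; rewrite in_itv /=; exists s.
  have [le|lt] := leP (F x) (F (x + h)).
    rewrite ger0_norm ?subr_ge0//; apply: key => // y hy; apply: ivt.
    by rewrite min_l// max_r.
  rewrite distrC ger0_norm ?subr_ge0 ?(ltW lt)//; apply: key => [y hy|]; last exact: ltW.
  by apply: ivt; rewrite min_r ?max_l// ltW.
have cd : continuous (fun x => F (x + h) - F x).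
  move=> x; apply: cvgB; last exact: cF.
  apply: (@continuous_comp R R R (fun y => y + h) F x); last exact: cF.
  by apply: cvgD; [exact: cvg_id|exact: cvg_cst].
have mD : measurable (`[0, P - h]%classic : set T) by [].
have iJ i : rintegrable (`[0, P - h] : set T) (fun x => 2 * h * \1_(J i) x).
  by apply: rintegrableZ => //; exact: indic_cc_rintegrable.
apply: (@le_trans _ _ (Rintegral mu `[0, P - h] (fun x => \sum_(i < n) 2 * h * \1_(J i) x))).
  apply: le_Rintegral => //.
  - by apply: rintegrable_cont => x; apply: cvg_norm; exact: cd.
  - exact: rintegrable_sum.
rewrite Rintegral_sum//.
apply: (@le_trans _ _ (\sum_(i < n) 8 * h ^+ 2)); last first.
  by rewrite sumr_const card_ord -[_ *+ _]mulr_natr.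
apply: ler_sum => i _; rewrite (RintegralZl _ mD); last exact: indic_cc_rintegrable.
rewrite (_ : 8 * h ^+ 2 = 2 * h * (4 * h)); last by ring.
rewrite ler_wpM2l ?mulr_ge0 ?(ltW h0)//.
apply: le_trans (indic_cc_Rintegral_le _ _ _) _; lra.
Qed.

Definition covers E e n := exists p : 'I_n -> R * R, E `<=` \bigcup_(i in [set: 'I_n]) disc (p i) e.

Lemma covering_number_le E e n : covers E e n -> covering_number E e <= n%:R.
Proof.
move=> h; apply: ge_inf; last by exists n.
by exists 0 => _ [m _ <-].
Qed.

Lemma covering_number_ge E e n (B : R) : covers E e n -> (forall m, covers E e m -> B <= m%:R) ->
  B <= covering_number E e.
Proof.
move=> h hB; apply: lb_le_inf; first by exists n%:R; exists n.
by move=> _ [m hm <-]; exact: hB.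
Qed.

(** Squares of side [e]: about [P/e] columns, in each of which [F] departs by at most [B e] from its
    value at the left end. The discs are centred at corners of the squares, and [2 e^2 <= rad^2] is
    the length of the diagonal. *)
Lemma hoelder_cover (F : R -> R) (P C r e rad : R) : 0 < P -> 0 <= C -> 0 < r -> r <= 1 -> 0 < e -> e <= 1 ->
  2 * e ^+ 2 <= rad ^+ 2 ->
  (forall x y, 0 <= x <= P -> 0 <= y <= P -> `|F x - F y| <= C * `|x - y| `^ r) ->
  exists2 n, covers (graph_on 0 P F) rad n & n%:R <= (P + 1) * (2 * C + 3) * e `^ (- (2 - r)).
Proof.
move=> P0 C0 r0 r1 e0 e1 hrad hF.
pose m := (Num.truncn (P / e)).+1.
pose B := C * e `^ (r - 1).
have er0 : 0 < e `^ (r - 1) by exact: powR_gt0.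
have B0 : 0 <= B by rewrite mulr_ge0// ltW.
pose q := (Num.truncn B).+1.
pose cen (j : 'I_m) (i : 'I_(q.*2.+1)) : R * R :=
  (j%:R * e, F (Num.min P (j%:R * e)) + (i%:R - q%:R) * e).
pose enc := [seq cen x.1 x.2 | x <- enum {: 'I_m * 'I_(q.*2.+1)}].
have senc : size enc = (m * q.*2.+1)%N.
  by rewrite size_map -cardE card_prod !card_ord.
exists (m * q.*2.+1)%N; last first.
  have e1' : 1 <= e^-1 by rewrite invf_ge1.
  have m1 : m%:R <= (P + 1) / e.
    rewrite /m -natr1 mulrDl mul1r lerD// ?truncn_le ?divr_ge0 ?(ltW P0) ?(ltW e0)//.
  have q1 : (q.*2.+1)%:R <= 2 * B + 3.
    rewrite -addn1 natrD -mul2n natrM /q -natr1.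
    have h : (Num.truncn B)%:R <= B by rewrite truncn_le.
    lra.
  have q2 : 2 * B + 3 <= (2 * C + 3) * e `^ (r - 1).
    rewrite (_ : 2 * B = 2 * C * e `^ (r - 1)); last by rewrite /B mulrA.
    have E1 : 1 <= e `^ (r - 1).
      rewrite -[r - 1]opprB powRN -[leLHS]invr1 lef_pV2 ?posrE ?powR_gt0//.
      apply: (@le_trans _ _ (1 `^ (1 - r))); last by rewrite powR1.
      apply: ge0_ler_powR; rewrite ?nnegrE ?subr_ge0//; exact: ltW.
    by rewrite [leRHS]mulrDl; move: E1; move: (e `^ (r - 1)) => x *; lra.
  rewrite natrM; apply: (@le_trans _ _ ((P + 1) / e * ((2 * C + 3) * e `^ (r - 1)))).
    by apply: ler_pM => //; exact: le_trans q1 q2.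
  rewrite (_ : _ / e * _ = (P + 1) * (2 * C + 3) * (e^-1 * e `^ (r - 1))); last by ring.
  rewrite -powR_inv1 ?(ltW e0)// -powRD ?(gt_eqF e0) ?implybT//.
  by rewrite (_ : -1 + (r - 1) = - (2 - r))//; ring.
rewrite /covers -senc; exists (fun i => nth (0, 0) enc i).
move=> pt [x + <-]; rewrite /= in_itv /= => /andP[x0 xP].
pose j := Num.truncn (x / e).
have jx := truncn_itv (divr_ge0 x0 (ltW e0)).
have je : j%:R * e <= x by case/andP: jx => h _; rewrite -ler_pdivlMr.
have xj : x < j%:R * e + e by case/andP: jx => _ h; rewrite ltr_pdivrMr// -natr1 mulrDl mul1r in h.
have jm : (j < m)%N.
  by rewrite ltnS; apply: le_truncn; rewrite ler_pM2r// invr_gt0.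
have jeP : 0 <= j%:R * e <= P.
  by rewrite mulr_ge0 ?(ltW e0)//=; apply: le_trans xP.
have xP' : 0 <= x <= P by rewrite x0 xP.
have dF : `|F x - F (j%:R * e)| <= B * e.
  apply: le_trans (hF _ _ xP' jeP) _; rewrite /B -mulrA ler_wpM2l//.
  have -> : e `^ (r - 1) * e = e `^ r.
    by rewrite -{2}(powRr1 (ltW e0)) -powRD ?(gt_eqF e0) ?implybT// subrK.
  apply: ge0_ler_powR; rewrite ?nnegrE ?(ltW r0) ?(ltW e0)//.
  by rewrite ger0_norm ?subr_ge0// lerBlDl ltW.
pose y := (F x - F (j%:R * e)) / e + q%:R.
have qB : B < q%:R by exact: truncnS_gt.
have yb : 0 <= y <= q%:R + q%:R.
  have : `|(F x - F (j%:R * e)) / e| <= B by rewrite normrM normfV (gtr0_norm e0) ler_pdivrMr.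
  by rewrite /y ler_norml => /andP[? ?]; apply/andP; split; lra.
have [y0 y1] := andP yb; pose i := Num.truncn y.
have iy := truncn_itv y0.
have iq : (i < q.*2.+1)%N.
  rewrite ltnS -(ler_nat R) -addnn natrD; apply: le_trans y1.
  by case/andP: iy.
pose idx := index (cen (Ordinal jm) (Ordinal iq)) enc.
have mem : cen (Ordinal jm) (Ordinal iq) \in enc.
  by apply/mapP; exists (Ordinal jm, Ordinal iq); rewrite // mem_enum inE.
have lidx : (idx < size enc)%N by rewrite index_mem.
exists (Ordinal lidx) => //=; rewrite /disc /= nth_index// /cen /= min_r//; last by case/andP: jeP.
have h1 : 0 <= x - j%:R * e < e by apply/andP; split; lra.
have h2 : `|F x - (F (j%:R * e) + (i%:R - q%:R) * e)| < e.
  have -> : F x - (F (j%:R * e) + (i%:R - q%:R) * e) = (y - i%:R) * e.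
    by rewrite /y; field; rewrite gt_eqF.
  rewrite normrM (gtr0_norm e0) -[ltRHS]mul1r ltr_pM2r//.
  case/andP: iy => i1; rewrite -natr1 => i2.
  by rewrite ger0_norm ?subr_ge0// ltrBlDl.
have h3 : (x - j%:R * e) ^+ 2 < e ^+ 2.
  by rewrite -(real_normK (num_real (x - _))) ltrXn2r// ?nnegrE ?(ltW e0)// ger0_norm; case/andP: h1.
have h4 : (F x - (F (j%:R * e) + (i%:R - q%:R) * e)) ^+ 2 < e ^+ 2.
  by rewrite -(real_normK (num_real (F x - _))) ltrXn2r// ?nnegrE ?(ltW e0).
lra.
Qed.

(** The constant [C] disappears in the quotient of logarithms as soon as [|ln C| <= eta ln (1/e)],
    which fixes the scale [d]. *)
Lemma box_dim_le E (C s e0 : R) : 0 < C -> 0 <= s -> 0 < e0 ->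
  (forall e, 0 < e -> e < e0 -> covering_number E e <= C * e `^ (- s)) ->
  (box_dim E <= s%:E)%E.
Proof.
move=> C0 s0 e00 hC; apply/lee_addgt0Pr => eta eta0.
pose d := Num.min e0 (expR (- ((`|ln C| + 1) / eta))).
have d0 : 0 < d by rewrite lt_min e00 expR_gt0.
apply: (@le_trans _ _ (ereal_sup [set (ln (covering_number E e) / ln e^-1)%:E | e in [set e | 0 < e < d]])).
  apply: ereal_inf_lbound; exists [set e | 0 < e < d] => //=.
  by apply/nbhs_ballP; exists d => //= e; rewrite /ball /= sub0r normrN => ed e1; rewrite e1 (le_lt_trans (ler_norm _) ed).
apply: ge_ereal_sup => _ [e /= /andP[e1 ed] <-]; rewrite -EFinD lee_fin.
have ee : e < expR (- ((`|ln C| + 1) / eta)) by apply: lt_le_trans ed _; rewrite /d ge_min lexx orbT.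
have le : (`|ln C| + 1) / eta < ln e^-1.
  rewrite lnV ?posrE// ltrNr -(expRK (- _)) ltr_ln ?posrE ?expR_gt0//.
have lp : 0 < ln e^-1.
  by apply: le_lt_trans le; rewrite divr_ge0 ?(ltW eta0)// addr_ge0.
rewrite ler_pdivrMr//.
have b : ln C <= eta * ln e^-1.
  move: le; rewrite ltr_pdivrMr// mulrC => le; have := ler_norm (ln C); lra.
(* A covering number 0 is harmless, since [ln] vanishes at nonpositive arguments. *)
have [N0|N0] := leP (covering_number E e) 0.
  by rewrite ln0// mulr_ge0 ?addr_ge0 ?(ltW eta0) ?(ltW lp).
have ed' : e < e0 by apply: lt_le_trans ed _; rewrite /d ge_min lexx.
apply: (@le_trans _ _ (ln (C * e `^ (- s)))); first by rewrite ler_ln ?posrE ?mulr_gt0 ?powR_gt0// hC.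
rewrite lnM ?posrE ?powR_gt0// ln_powR lnV ?posrE// in b lp *.
by rewrite mulrDl; lra.
Qed.

(** The dimension is an upper limit, so a lower bound along scales tending to 0 is enough. *)
Lemma box_dim_ge E (C s : R) : 0 < C ->
  (forall e0, 0 < e0 -> exists2 e, 0 < e < e0 & C * e `^ (- s) <= covering_number E e) ->
  (s%:E <= box_dim E)%E.
Proof.
move=> C0 hC; apply: le_ereal_inf_tmp => _ [V /= hV <-].
apply/lee_subgt0Pr => eta eta0; rewrite -EFinB.
have [d /= d0 hd] := (nbhs_ballP _ _).1 hV.
pose d' := Num.min d (expR (- ((`|ln C| + 1) / eta))).
have d'0 : 0 < d' by rewrite lt_min d0 expR_gt0.
have [e /andP[e1 ed] hN] := hC d' d'0.
apply: ereal_sup_ge; exists (ln (covering_number E e) / ln e^-1)%:E.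
  exists e => //; apply: hd => //; rewrite /ball /= sub0r normrN gtr0_norm//.
  by apply: lt_le_trans ed _; rewrite /d' ge_min lexx.
rewrite lee_fin.
have ee : e < expR (- ((`|ln C| + 1) / eta)) by apply: lt_le_trans ed _; rewrite /d' ge_min lexx orbT.
have le : (`|ln C| + 1) / eta < ln e^-1.
  rewrite lnV ?posrE// ltrNr -(expRK (- _)) ltr_ln ?posrE ?expR_gt0//.
have lp : 0 < ln e^-1.
  by apply: le_lt_trans le; rewrite divr_ge0 ?(ltW eta0)// addr_ge0.
rewrite ler_pdivlMr//.
have b : - ln C <= eta * ln e^-1.
  move: le; rewrite ltr_pdivrMr// mulrC => le; have := ler_norm (- ln C); rewrite normrN; lra.
have p0 : 0 < C * e `^ (- s) by rewrite mulr_gt0// powR_gt0.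
apply: (@le_trans _ _ (ln (C * e `^ (- s)))); last by rewrite ler_ln ?posrE// (lt_le_trans p0 hN).
rewrite lnM ?posrE ?powR_gt0// ln_powR lnV ?posrE// in b lp *.
by rewrite mulrBl; lra.
Qed.

End box_dimension.

(** * Fourier coefficients of step functions *)

Section step_data.
Variables (R : realType) (g : R -> R).
Hypotheses (g_step : step_function g) (g_mean : mean_zero g).
Local Notation mu := (@lebesgue_measure R).
Local Notation T := (measurableTypeR R).
Local Notation per := (period R).
Local Notation D := (`[0, per]%classic : set T).

Lemma measurable_interval (I : interval R) : measurable ([set` I] : set T).
Proof. exact: measurable_itv. Qed.

(* Only the trace of the interval on the period matters, up to its endpoints. *)
Lemma interval_trace (I : interval R) : exists a b : R, a <= b /\
  forall phi : R -> R, continuous phi ->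
    Rintegral mu D (fun x => phi x * \1_([set` I] : set T) x) = Rintegral mu `[a, b] phi.
Proof.
have red (phi : R -> R) : continuous phi -> Rintegral mu D (fun x => phi x * \1_([set` I] : set T) x) =
    Rintegral mu ([set` (`[0, per] `&` I)%O] : set T) phi.
  move=> cphi; rewrite /Rintegral set_itvI; congr fine.
  rewrite [RHS]integral_mkcondr; apply: eq_integral => x _.
  rewrite /patch indicE mem_setE; case: (x \in _) => /=; by rewrite ?mulr1 ?mulr0.
have bounded (bl br : bool) (a b : R) (phi : R -> R) : continuous phi -> a <= b ->
    Rintegral mu ([set` Interval (BSide bl a) (BSide br b)] : set T) phi = Rintegral mu `[a, b] phi.
  move=> cphi ab; have i1 : mu.-integrable (`[a, b] : set T) (EFin \o phi) by exact: rintegrable_cont.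
  have i2 bl' br' : mu.-integrable ([set` Interval (BSide bl' a) (BSide br' b)] : set T) (EFin \o phi).
    by apply: integrableS i1 => //; apply: subset_itv; rewrite bnd_simp; case: bl'; case: br'.
  case: bl; case: br => //.
  - by rewrite Rintegral_itv_bndo_bndc.
  - by rewrite Rintegral_itv_obnd_cbnd ?Rintegral_itv_bndo_bndc//; exact: i2.
  - by rewrite Rintegral_itv_obnd_cbnd.
have empty (J : interval R) : [set` J] = set0 :> set R -> exists a b : R, a <= b /\
    forall phi : R -> R, continuous phi -> Rintegral mu ([set` J] : set T) phi = Rintegral mu `[a, b] phi.
  move=> J0; exists 0, 0; split => // phi _; rewrite J0 Rintegral_set0.
  by rewrite set_itv1 Rintegral_set1.
suff [a [b [ab h]]] : exists a b : R, a <= b /\ forall phi : R -> R, continuous phi ->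
    Rintegral mu ([set` (`[0, per] `&` I)%O] : set T) phi = Rintegral mu `[a, b] phi.
  by exists a, b; split => // phi cphi; rewrite red// h.
case E : (`[0, per] `&` I)%O => [l u].
have sub : ([set` Interval l u] : set R) `<=` [set` `[0, per]].
  by rewrite -E set_itvI => x [].
case: l E sub => [bl a|bl] E sub; last first.
  case: bl E sub => E sub; last first.
    by apply: empty; rewrite -subset0 => x /=; rewrite in_itv.
  case: u E sub => [br b|[]] E sub.
  - have := sub (Num.min (b - 1) (-1)); rewrite /= !in_itv /=.
    have h : Num.min (b - 1) (-1) < b by rewrite gt_min ltrBlDr ltrDl ltr01.
    have h2 : Num.min (b - 1) (-1) <= -1 by rewrite ge_min lexx orbT.
    have -> : (Num.min (b - 1) (-1) < b ?<= if ~~ br) by case: (br) => /=; rewrite ?ltW.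
    by move=> /(_ isT) /andP[h0 _]; have := le_trans h0 h2; rewrite oppr_ge0 ler10.
  - by apply: empty; rewrite -subset0 => x /=; rewrite in_itv.
  - by have := sub (-1); rewrite /= !in_itv /= => /(_ isT) /andP[h0 _]; move: h0; rewrite oppr_ge0 ler10.
case: u E sub => [br b|bu] E sub; last first.
  case: bu E sub => E sub.
    by apply: empty; rewrite -subset0 => x /=; rewrite in_itv /= andbF.
  have := sub (Num.max (a + 1) (per + 1)); rewrite /= !in_itv /= andbT.
  have h : a < Num.max (a + 1) (per + 1) by rewrite lt_max ltrDl ltr01.
  have h2 : per + 1 <= Num.max (a + 1) (per + 1) by rewrite le_max lexx orbT.
  have -> : (a < Num.max (a + 1) (per + 1) ?<= if bl) by case: (bl) => /=; rewrite ?ltW.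
  by move=> /(_ isT) /andP[_ h0]; have := le_trans h2 h0; rewrite gerDl ler10.
have [ab|ba] := leP a b; first by exists a, b; split => // phi cphi; exact: bounded.
apply: empty; rewrite set_itv_ge//; case: (bl); case: (br); rewrite bnd_simp -?ltNge -?leNgt//; exact: ltW.
Qed.

Let s := sval (cid g_step.2).

(** Known to agree with [g] on the half-open period [[0, per)] only; integrals over the closed
    period are compared through the half-open one. *)
Definition step_model (x : R) : R := \sum_(p <- s) p.1 * \1_[set` p.2] x.

Lemma step_modelE x : 0 <= x < per -> g x = step_model x.
Proof. exact: (svalP (cid g_step.2)). Qed.

Lemma step_model_measurable : measurable_fun (setT : set T) (step_model : T -> R).
Proof.
rewrite /step_model; elim: s => [|p t IH].
  by under eq_fun do rewrite big_nil; exact: measurable_cst.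
under eq_fun do rewrite big_cons.
by apply: measurable_funD => //; exact: measurable_funM.
Qed.

Lemma step_model_square_integrable : square_integrable (step_model : T -> R).
Proof.
have m := measurable_funTS step_model_measurable (D := D).
split => //; pose B := \sum_(p <- s) `|p.1|.
have B0 : 0 <= B by apply: sumr_ge0.
apply: (@rintegrable_le _ _ _ (fun=> B ^+ 2)) => //.
- exact: measurable_funX.
- by apply: rintegrable_cont => x; exact: cst_continuous.
move=> x _; rewrite normrX lerXn2r ?nnegrE//.
apply: le_trans (ler_norm_sum _ _ _) _; apply: ler_sum => p _.
by rewrite normrM ler_piMr// indicE ger0_norm// lern1 leq_b1.
Qed.

Lemma step_agree_measurable : measurable_fun D (g : T -> R).
Proof.
apply/measurable_fun_itv_bndo_bndcP.
apply: (eq_measurable_fun step_model) => [x|]; last exact: measurable_funTS step_model_measurable.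
by rewrite inE /= in_itv /= => /step_modelE.
Qed.

Lemma Rintegral_period_agree (f h : R -> R) : measurable_fun D f -> measurable_fun D h ->
  (forall x, 0 <= x < per -> f x = h x) ->
  (\int[mu]_(x in D) (f x)%:E = \int[mu]_(x in D) (h x)%:E)%E.
Proof.
move=> mf mh fh.
rewrite -[LHS]integral_itv_bndo_bndc; last exact/measurable_EFinP/measurable_fun_itv_bndo_bndcP.
rewrite -[RHS]integral_itv_bndo_bndc; last exact/measurable_EFinP/measurable_fun_itv_bndo_bndcP.
by apply: eq_integral => x; rewrite inE /= in_itv /= => /fh ->.
Qed.

Lemma step_square_integrable : square_integrable (g : T -> R).
Proof.
have [m1 i1] := step_model_square_integrable; have m2 := step_agree_measurable.
split => //; apply/integrableP; split.
  by apply/measurable_EFinP; exact: measurable_funX.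
have [_] := integrableP _ _ _ i1; apply: le_lt_trans.
rewrite le_eqVlt; apply/orP; left; apply/eqP.
apply: (Rintegral_period_agree (f := fun x => `|g x ^+ 2|) (h := fun x => `|step_model x ^+ 2|)).
- by apply: measurableT_comp => //; exact: measurable_funX.
- by apply: measurableT_comp => //; exact: measurable_funX.
by move=> x /step_modelE ->.
Qed.

Lemma Rintegral_mul_agree (phi : R -> R) : continuous phi ->
  Rintegral mu D (fun x => g x * phi x) = Rintegral mu D (fun x => step_model x * phi x).
Proof.
move=> cphi; have [m1 i1] := step_model_square_integrable; have m2 := step_agree_measurable.
have m3 : measurable_fun D (phi : T -> R) by exact: continuous_measurable_on.
congr fine; apply: (Rintegral_period_agree (f := fun x => g x * phi x) (h := fun x => step_model x * phi x)).
- exact: measurable_funM.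
- exact: measurable_funM.
by move=> x /step_modelE ->.
Qed.

Lemma step_model_integral : exists js : seq (R * (R * R)), (forall p, p \in js -> p.2.1 <= p.2.2) /\
  forall phi : R -> R, continuous phi ->
  Rintegral mu D (fun x => g x * phi x) = \sum_(p <- js) p.1 * Rintegral mu `[p.2.1, p.2.2] phi.
Proof.
suff [js [h1 h2]] : exists js : seq (R * (R * R)), (forall p, p \in js -> p.2.1 <= p.2.2) /\
    forall phi : R -> R, continuous phi ->
    Rintegral mu D (fun x => step_model x * phi x) = \sum_(p <- js) p.1 * Rintegral mu `[p.2.1, p.2.2] phi.
  by exists js; split => // phi cphi; rewrite Rintegral_mul_agree// h2.
rewrite /step_model; elim: s => [|p t [js [h1 h2]]].
  exists [::]; split => // phi _; rewrite big_nil.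
  under eq_Rintegral do rewrite big_nil mul0r.
  by rewrite /Rintegral integral0.
have [a [b [ab hab]]] := interval_trace p.2.
exists ((p.1, (a, b)) :: js); split; first by move=> q; rewrite inE => /orP[/eqP ->|/h1].
move=> phi cphi; rewrite big_cons -h2// -hab//=.
have mD : measurable D by [].
have iphi (h : T -> R) (B : R) : measurable_fun D h -> (forall x, `|h x| <= B) -> rintegrable D (fun x => h x * phi x).
  move=> mh hB; apply: (@rintegrable_le _ _ _ (fun x => B * `|phi x|)) => //.
  - by apply: measurable_funM => //; exact: continuous_measurable_on.
  - by apply: rintegrableZ => //; apply: rintegrable_cont => x; apply: cvg_norm; exact: cphi.
  - by move=> x _; rewrite normrM ler_wpM2r.
have mI (J : interval R) : measurable_fun D (\1_[set` J] : T -> R).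
  by apply: measurable_indic; exact: measurable_interval.
have bI (J : interval R) x : `|\1_([set` J] : set T) x| <= 1 :> R.
  by rewrite indicE ger0_norm// lern1 leq_b1.
have i1 : rintegrable D (fun x => phi x * \1_([set` p.2] : set T) x).
  by apply: (eq_integrable mD _ _ _ (iphi _ _ (mI p.2) (bI p.2))) => x _ /=; rewrite mulrC.
have i2 : rintegrable D (fun x => (\sum_(q <- t) q.1 * \1_([set` q.2] : set T) x) * phi x).
  apply: (iphi _ (\sum_(q <- t) `|q.1|)).
    by apply: measurable_sum => q; apply: measurable_funM => //; exact: measurable_cst.
  move=> x; apply: le_trans (ler_norm_sum _ _ _) _; apply: ler_sum => q _.
  by rewrite normrM ler_piMr.
rewrite -(RintegralZl _ mD i1) -(RintegralD mD (rintegrableZ p.1 mD i1) i2).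
by apply: eq_Rintegral => x _; rewrite big_cons; ring.
Qed.

Lemma step_fourier0 : fourier g 0 = 0.
Proof.
rewrite /fourier (_ : (fun x => _) = fun x => (g x)%:C); last first.
  by apply/funext => x; rewrite mulr0z mul0r oppr0 cis0 mulr1.
by rewrite CintegralR g_mean mulr0.
Qed.

(** Each interval contributes the primitive of an exponential at its two ends, with opposite signs;
    on degenerate intervals the two cancel. *)
Lemma step_fourier : exists js : seq (R[i] * R), forall n : int, n != 0 ->
  fourier g n = (n%:~R)^-1 * \sum_(p <- js) p.1 * cis (- (n%:~R * p.2)).
Proof.
have [js [h1 h2]] := step_model_integral.
(* From the [1/per] in the definition of the coefficients and the [1/(-i n)] in the primitive of
   [e^(-inx)]. *)
pose c : R[i] := (per^-1)%:C / (0 +i* (- 1)).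
exists (flatten [seq [:: (c * (p.1)%:C, p.2.2); (- c * (p.1)%:C, p.2.1)] | p <- js]) => n n0.
have n0' : (n%:~R : R) != 0 by rewrite intr_eq0.
have e : Cintegral D (fun x => (g x)%:C * cis (- (n%:~R * x))) =
    \sum_(p <- js) (p.1)%:C * Cintegral `[p.2.1, p.2.2] (fun x => cis (- n%:~R * x)).
  have [c1 c2] := Ccontinuous_cis_lin (- n%:~R : R).
  apply/eqP; rewrite eq_complex Re_sum Im_sum /=; apply/andP; split; apply/eqP.
    rewrite (_ : Rintegral _ _ _ = Rintegral mu D (fun x => g x * complex.Re (cis (- n%:~R * x)))); last first.
      by apply: eq_Rintegral => x _; rewrite /= mulNr mul0r subr0.
    by rewrite h2//; apply: eq_bigr => p _; rewrite /= mul0r subr0.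
  rewrite (_ : Rintegral _ _ _ = Rintegral mu D (fun x => g x * complex.Im (cis (- n%:~R * x)))); last first.
    by apply: eq_Rintegral => x _; rewrite /= mulNr mul0r addr0.
  by rewrite h2//; apply: eq_bigr => p _; rewrite /= mul0r addr0.
rewrite /fourier e big_flatten big_map !mulr_sumr; apply: eq_big_seq => p pjs.
rewrite !big_cons big_nil /=.
have -> : Cintegral `[p.2.1, p.2.2] (fun x => cis (- n%:~R * x)) =
    (cis (- n%:~R * p.2.2) - cis (- n%:~R * p.2.1)) / (0 +i* (- n%:~R)).
  have := h1 p pjs; rewrite le_eqVlt => /orP[/eqP ->|lt]; last by rewrite Cintegral_cis// oppr_eq0.
  by rewrite subrr mul0r set_itv1 /Cintegral !Rintegral_set1.
have -> : (0 +i* (- n%:~R) : R[i]) = n%:~R * (0 +i* (- 1)).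
  have eN : (n%:~R : R[i]) = (n%:~R)%:C by rewrite rmorph_int.
  rewrite eN; apply/eqP.
  by rewrite eq_complex Re_mul Im_mul /=; apply/andP; split; apply/eqP; ring.
rewrite invfM /c !mulNr; move: (0 +i* (-1))^-1 (n%:~R)^-1 (cis _) (cis _) => i m z w; ring.
Qed.

End step_data.

(** * Null sets under translation *)

Section translations.
Variable R : realType.
Local Notation mu := (@lebesgue_measure R).
Local Notation T := (measurableTypeR R).
Local Notation per := (period R).

Definition translate (c : R) (x : T) : T := x + c.

Lemma translate_measurable c : measurable_fun setT (translate c).
Proof.
apply: (@continuous_measurable_fun R (translate c)) => x.
by apply: cvgD; [exact: cvg_id|exact: cvg_cst].
Qed.

HB.instance Definition _ c := isMeasurableFun.Build _ _ _ _ (translate c) (translate_measurable c).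

Lemma lebesgue_measure_translate c (A : set T) : measurable A -> mu (translate c @^-1` A) = mu A.
Proof.
move=> mA; rewrite -[LHS]/(pushforward mu (translate c) A).
apply/esym/lebesgue_measure_unique => //= _ [[a b]] _ <-.
rewrite /pushforward (_ : translate c @^-1` _ = `]a - c, b - c]%classic); last first.
  by apply/seteqP; split => x /=; rewrite /translate !in_itv /= ltrBlDr lerBrDr.
by rewrite !lebesgue_measure_itv/= !lte_fin ltrD2r -!EFinD opprB addrA subrK.
Qed.

Lemma negligible_translate c (A : set T) : mu.-negligible A -> mu.-negligible (translate c @^-1` A).
Proof.
move=> [B [mB B0 AB]]; exists (translate c @^-1` B); split.
- by rewrite -[X in measurable X]setTI; exact: translate_measurable.
- by apply: etrans B0; exact: lebesgue_measure_translate.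
- by move=> x /AB.
Qed.

(** The exceptional set is covered by countably many translates of the one in a single period. *)
Lemma periodic_ae0 (g : R -> R) : periodic g per ->
  {ae mu, forall x : T, `[0, per]%classic x -> g x = 0} -> {ae mu, forall x : T, g x = 0}.
Proof.
move=> pg h; have per0 := period_gt0 R.
pose N0 : set T := [set x | ~ (`[0, per]%classic x -> g x = 0)].
have nN : mu.-negligible N0 by exact: h.
suff : mu.-negligible [set x : T | g x <> 0] by [].
pose U : set T := (\bigcup_i ((translate (i%:R * per) @^-1` N0) `|` (translate (- (i%:R * per)) @^-1` N0))).
have sU : [set x : T | g x <> 0] `<=` U.
  move=> x /= gx; pose m := Num.floor (x / per).
  have mi : m%:~R * per <= x < (m + 1)%:~R * per.
    have := floor_itv (x / per); rewrite -/m.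
    by rewrite ler_pdivlMr// ltr_pdivrMr.
  have gn (n : nat) y : g (y + n%:R * per) = g y.
    by rewrite mulr_natl; exact: periodicn.
  exists (absz m) => //; case: (lerP 0 m) => m0.
    right; rewrite /= /translate /N0 /=; apply/not_implyP; split.
      have -> : (absz m)%:R = m%:~R :> R by rewrite natr_absz ger0_norm.
      move: mi; rewrite in_itv /= intrD mulrDl mul1r => /andP[? ?]; apply/andP; split; lra.
    by move=> g0; apply: gx; have := gn (absz m) (x - (absz m)%:R * per); rewrite subrK => ->.
  left; rewrite /= /translate /N0 /=; apply/not_implyP; split.
    have -> : (absz m)%:R = - m%:~R :> R by rewrite natr_absz ltr0_norm// intrN.
    move: mi; rewrite in_itv /= intrD mulrDl mul1r mulNr => /andP[? ?]; apply/andP; split; lra.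
  by rewrite gn.
apply: (negligibleS sU); apply: negligible_bigcup => i.
by apply: negligibleU; exact: negligible_translate.
Qed.

End translations.

Section exponential_sums.
Variable R : realType.
Implicit Types js : seq (R[i] * R).

Definition power_sum (zs : seq R[i]) (A : R[i] -> R[i]) (n : nat) : R[i] := \sum_(z <- zs) A z * z ^+ n.

(* Terms with the same frequency are merged; the distinct frequencies with a
   nonzero coefficient remain. *)
Lemma merge_frequencies js : exists (zs : seq R[i]) (A : R[i] -> R[i]),
  [/\ uniq zs, {in zs, forall z, normc z = 1}, {in zs, forall z, A z != 0} &
   forall n : nat, \sum_(p <- js) p.1 * cis (- (n%:R * p.2)) = power_sum zs A n].
Proof.
pose f (p : R[i] * R) := cis (- p.2).
pose A z := \sum_(p <- js | f p == z) p.1.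
exists [seq z <- undup (map f js) | A z != 0], A; split.
- by rewrite filter_uniq// undup_uniq.
- by move=> z; rewrite mem_filter mem_undup => /andP[_ /mapP[p _ ->]]; exact: normc_cis.
- by move=> z; rewrite mem_filter => /andP[].
move=> n; rewrite /power_sum big_filter [RHS]big_mkcond /=.
rewrite [RHS](eq_bigr (fun z => A z * z ^+ n)); last first.
  by move=> z _; case: (eqVneq (A z) 0) => [->|//]; rewrite mul0r.
transitivity (\sum_(z <- undup (map f js)) \sum_(p <- js | f p == z) p.1 * z ^+ n); last first.
  by apply: eq_bigr => z _; rewrite mulr_suml.
rewrite (exchange_big_dep xpredT)//=.
rewrite big_seq [RHS]big_seq; apply: eq_bigr => p pjs.
rewrite (eq_bigl (pred1 (f p))) => [|z /=]; last by rewrite eq_sym.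
rewrite -big_filter filter_pred1_uniq ?undup_uniq//; last by rewrite mem_undup map_f.
by rewrite big_seq1 /f cisMn mulrN.
Qed.

Lemma geometric_sum_bound (q : R[i]) (m n : nat) : normc q = 1 -> q != 1 ->
  normc (\sum_(i < n) q ^+ (m + i)) <= 2 / normc (1 - q).
Proof.
move=> q1 qn; have d0 : 0 < normc (1 - q).
  rewrite lt_neqAle normc_ge0 andbT eq_sym; apply: contra qn => /eqP /eq0_normc /eqP.
  by rewrite subr_eq0 eq_sym.
rewrite ler_pdivlMr// -normcM.
have -> : (\sum_(i < n) q ^+ (m + i)) * (1 - q) = q ^+ m * (1 - q ^+ n).
  under eq_bigr do rewrite exprD.
  rewrite -mulr_sumr -mulrA; congr (_ * _).
  by rewrite -(opprB q) -(opprB (q ^+ n)) subrX1 mulrN mulrC.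
rewrite normcM normcX q1 expr1n mul1r; apply: le_trans (normcB _ _) _.
by rewrite normcX q1 expr1n normc1.
Qed.

(** The diagonal gives [n] times the sum of [|A z|^2]. Off the diagonal [z conj(w)] has modulus 1
    and differs from 1, so its geometric sums are bounded independently of their length and of their
    starting point. *)
Lemma power_sum_mean_square (zs : seq R[i]) (A : R[i] -> R[i]) : uniq zs -> zs != [::] ->
  {in zs, forall z, normc z = 1} -> {in zs, forall z, A z != 0} ->
  exists2 a : R, 0 < a & exists N0 : nat, forall n, (N0 <= n)%N ->
    a * n%:R <= \sum_(i < n) normsq (power_sum zs A (n + i)).
Proof.
move=> uz z0 z1 hA.
pose S2 := \sum_(z <- zs) normsq (A z).
have S0 : 0 < S2.
  case: zs z0 hA uz z1 @S2 => [//|z zs] _ hA _ _ /=; rewrite big_cons.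
  have : 0 <= \sum_(j <- zs) normsq (A j) by apply: sumr_ge0 => *; rewrite normsqE sqr_ge0.
  have : 0 < normsq (A z).
    rewrite normsqE exprn_gt0// lt_neqAle normc_ge0 andbT eq_sym.
    by apply: contra (hA z (mem_head _ _)) => /eqP /eq0_normc ->.
  by move: (normsq _) (\sum_(_ <- _) _) => *; lra.
pose C := \sum_(z <- zs) \sum_(w <- zs | w != z) normc (A z) * normc (A w) * (2 / normc (1 - z * conjc w)).
have C0 : 0 <= C.
  by apply: sumr_ge0 => z _; apply: sumr_ge0 => w _; rewrite !mulr_ge0 ?normc_ge0// invr_ge0 normc_ge0.
exists (S2 / 2); first by rewrite divr_gt0.
(* From here on the bounded off-diagonal part is at most half of the diagonal one. *)
exists (Num.truncn (2 * C / S2)).+1 => n hn.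
have nC : C <= S2 / 2 * n%:R.
  have : 2 * C / S2 < n%:R by apply: lt_le_trans (truncnS_gt _) _; rewrite ler_nat.
  by rewrite ltr_pdivrMr//; move: (n%:R : R) => x; nra.
pose Sm := \sum_(i < n) normsq (power_sum zs A (n + i)).
have key : (Sm)%:C = (S2 * n%:R)%:C + \sum_(z <- zs) \sum_(w <- zs | w != z)
    A z * conjc (A w) * \sum_(i < n) (z * conjc w) ^+ (n + i).
  have e i : (normsq (power_sum zs A i))%:C = \sum_(z <- zs) \sum_(w <- zs) A z * conjc (A w) * (z * conjc w) ^+ i.
    rewrite normsqE -normc_mulJ /power_sum mulr_suml; apply: eq_bigr => z _.
    rewrite conjc_sum mulr_sumr; apply: eq_bigr => w _.
    by rewrite conjcM rmorphXn /= exprMn; ring.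
  rewrite /Sm rmorph_sum /=; under eq_bigr do rewrite e.
  rewrite exchange_big /= rmorphM /S2 rmorph_sum /= mulr_suml -big_split /=.
  rewrite big_seq [RHS]big_seq; apply: eq_bigr => z zz.
  rewrite exchange_big /= (bigD1_seq z)//=; congr (_ + _); last first.
    by apply: eq_bigr => w _; rewrite mulr_sumr.
  rewrite (eq_bigr (fun=> (normsq (A z))%:C)) => [|i _].
    by rewrite sumr_const card_ord rmorph_nat mulr_natr.
  by rewrite !normc_mulJ (z1 z zz) expr1n expr1n mulr1 normsqE.
have err : normc ((Sm - S2 * n%:R)%:C) <= C.
  have -> : (Sm - S2 * n%:R)%:C = (Sm)%:C - (S2 * n%:R)%:C by exact: rmorphB.
  rewrite key addrC addKr.
  apply: le_trans (normc_sum _ _ _) _; rewrite /C big_seq [leRHS]big_seq; apply: ler_sum => z zz.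
  apply: le_trans (normc_sum _ _ _) _; rewrite big_seq_cond [leRHS]big_seq_cond; apply: ler_sum => w /andP[wz nwz].
  rewrite !normcM normcJ ler_wpM2l ?mulr_ge0 ?normc_ge0//.
  apply: geometric_sum_bound; first by rewrite normcM normcJ !z1// mulr1.
  apply: contra nwz => /eqP zw; apply/eqP.
  have : z * conjc w * w = w by rewrite zw mul1r.
  by rewrite -mulrA (mulrC (conjc w)) normc_mulJ z1// expr1n mulr1.
move: err; rewrite normcR ler_norml => /andP[h _]; rewrite -/Sm.
by move: h nC; rewrite mulrAC; move: (S2 * n%:R) => x *; lra.
Qed.

End exponential_sums.

Section step_lower.
Variables (R : realType) (g : R -> R).
Hypotheses (g_step : step_function g) (g_mean : mean_zero g) (g_nc : ~ ae_constant g).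
Local Notation mu := (@lebesgue_measure R).
Local Notation N m := (`|m|%:~R : R).

Lemma step_real n : fourier g (- n) = conjc (fourier g n).
Proof. by apply: fourierN; exact: square_integrable_rintegrable (step_square_integrable g_step). Qed.

Lemma step_coefficients : exists js : seq (R[i] * R), exists Cg c0 : R, exists N0 : nat,
  [/\ forall n : nat, fourier g n%:Z = (n%:R^-1)%:C * jump_sum js n,
      forall n, n != 0 -> normc (fourier g n) <= Cg / N n,
      0 < c0 &
      forall n, (N0 <= n)%N -> c0 / n%:R <= \sum_(i < n) normsq (fourier g (n + i)%N%:Z)].
Proof.
have [js hjs] := step_fourier g_step.
exists js, (\sum_(p <- js) normc p.1).
have hn (n : nat) : fourier g n%:Z = (n%:R^-1)%:C * jump_sum js n.
  case: n => [|n]; first by rewrite (step_fourier0 g_mean) invr0 mul0r.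
  rewrite hjs// fmorphV rmorph_nat; congr (_ * _).
have [zs [A [uz z1 hA hz]]] := merge_frequencies js.
(* Without frequencies all the coefficients would vanish and [g] would be 0 almost everywhere. *)
have zs0 : zs != [::].
  apply/negP => /eqP zs0; apply: g_nc; exists 0.
  have f0 (n : nat) : fourier g n%:Z = 0.
    by rewrite hn /jump_sum hz /power_sum zs0 big_nil mulr0.
  apply: (periodic_ae0 g_step.1).
  apply: (fourier_eq0_ae (step_square_integrable g_step)) => -[n|n]; first exact: f0.
  by rewrite NegzE step_real f0 /conjc /= oppr0.
have [a a0 [N0 hN]] := power_sum_mean_square uz zs0 z1 hA.
(* In the window [n + i < 2n], so [1/(n + i)^2] is at least [1/(4 n^2)]; the successor keeps [n]
   positive. *)
exists (a / 4), N0.+1; split => //.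
- move=> n n0; rewrite hjs// normcM normcV normc_int mulrC ler_wpM2r ?invr_ge0 ?ler0z//.
  apply: le_trans (normc_sum _ _ _) _; apply: ler_sum => p _.
  by rewrite normcM normc_cis mulr1.
- by rewrite divr_gt0.
move=> n nN; have n0 : 0 < n%:R :> R by rewrite ltr0n; apply: leq_trans nN.
have := hN n (ltnW nN); rewrite -(@ler_pM2r _ ((4 * n%:R ^+ 2)^-1)) ?invr_gt0 ?mulr_gt0 ?exprn_gt0//.
rewrite (_ : a * n%:R / (4 * n%:R ^+ 2) = a / 4 / n%:R); last by field; rewrite gt_eqF.
move=> /le_trans; apply; rewrite mulr_suml; apply: ler_sum => i _.
rewrite hn /jump_sum hz normsqE normsqE normcM normcR exprMn mulrC.
rewrite ler_wpM2r ?sqr_ge0// normfV normr_nat exprVn lef_pV2 ?posrE ?mulr_gt0 ?exprn_gt0// ?ltr0n ?addn_gt0 -?(ltr0n R) ?n0//.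
rewrite (_ : 4 * n%:R ^+ 2 = (2 * n%:R) ^+ 2); last by ring.
rewrite lerXn2r ?nnegrE ?mulr_ge0// -natrM ler_nat mul2n -addnn leq_add2l ltnW//.
Qed.

End step_lower.

(** * Restriction to the line *)

Lemma uniform_limit (R : realType) (X : Type) (f : nat -> X -> R) (rate : nat -> R) :
  (forall M M' x, (0 < M)%N -> (M <= M')%N -> `|f M' x - f M x| <= rate M) ->
  (forall e, 0 < e -> exists2 M : nat, (0 < M)%N & rate M <= e) ->
  exists L : X -> R, forall M x, (0 < M)%N -> `|L x - f M x| <= rate M.
Proof.
move=> hf hr.
have cv x : cvg ((fun M => f M x) @ \oo).
  apply/cauchy_cvgP/cauchy_ballP => e e0.
  have [M M0 hM] := hr (e / 4) (ltac:(by rewrite divr_gt0)).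
  have d0 M' : (M <= M')%N -> `|f M' x - f M x| <= e / 4.
    by move=> MM'; apply: le_trans (hf M M' x M0 MM') hM.
  exists ([set f M' x | M' in [set M' | (M <= M')%N]], [set f M' x | M' in [set M' | (M <= M')%N]]) => /=.
    by split; exists M => // M' /= MM'; exists M'.
  move=> [_ _] /= [[M1 /d0 h1 <-] [M2 /d0 h2 <-]]; rewrite /ball /=.
  move: h1 h2; rewrite !ler_norml ltr_norml => /andP[? ?] /andP[? ?]; lra.
exists (fun x => lim ((fun M => f M x) @ \oo)) => M x M0.
have h : (fun M' => `|f M' x - f M x|) @ \oo --> `|lim ((fun M => f M x) @ \oo) - f M x|.
  by apply: cvg_norm; apply: cvgB; [exact: cv|exact: cvg_cst].
rewrite -(cvg_lim _ h)//; apply: limr_le; first by apply/cvg_ex; eexists; exact: h.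
by exists M => // M' /= MM'; exact: hf.
Qed.

Lemma powR_neg_small (R : realType) (K d e : R) : 0 <= K -> 0 < d -> 0 < e ->
  exists2 M : nat, (0 < M)%N & forall M', (M <= M')%N -> K * M'%:R `^ (- d) <= e.
Proof.
move=> K0 d0 e0; pose y := (K / e) `^ d^-1.
exists (Num.truncn y).+1 => // M' hM.
have M1 : 0 < M'%:R :> R by rewrite ltr0n; apply: leq_trans hM.
have yM : y <= M'%:R.
  by apply: le_trans (ltW (truncnS_gt _)) _; rewrite ler_nat.
rewrite powRN ler_pdivrMr ?powR_gt0// mulrC -ler_pdivrMr//.
have Ke : 0 <= K / e by rewrite divr_ge0// ltW.
have -> : K / e = y `^ d by rewrite /y -powRrM mulVf ?gt_eqF// powRr1.
by apply: ge0_ler_powR; rewrite ?nnegrE ?powR_ge0// ltW.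
Qed.

Lemma big_zrange_pairs (S : nmodType) (N : nat) (f : int -> S) :
  \sum_(n <- zrange N) f n = f 0 + \sum_(i < N) (f i.+1%:Z + f (- i.+1%:Z)).
Proof.
elim: N => [|N IH]; first by rewrite big_ord0 addr0 /zrange /= big_cons big_nil addr0.
rewrite big_ord_recr /= addrA -IH.
have E : perm_eq (zrange N.+1) (zrange N ++ [:: N.+1%:Z; - N.+1%:Z]); last first.
  by rewrite (perm_big _ E) big_cat /= !big_cons big_nil addr0.
apply: uniq_perm; rewrite ?zrange_uniq//.
  rewrite cat_uniq zrange_uniq andTb; apply/andP; split; last by rewrite cons_uniq inE /=; lia.
  apply/hasPn => z zin; change (z \notin zrange N); rewrite mem_zrange; move: zin.
  by rewrite !in_cons in_nil orbF => /orP[]/eqP ->; lia.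
by move=> n; rewrite mem_cat !mem_zrange !in_cons in_nil orbF; apply/idP/idP; lia.
Qed.

Section line_graph.
Variables (R : realType) (k l : nat) (g : R -> R) (js : seq (R[i] * R)) (c : R).
Local Notation mu := (@lebesgue_measure R).
Local Notation Tm := (measurableTypeR R).
Local Notation P := (line_end R l).
Hypotheses (k0 : (0 < k)%N) (l0 : (0 < l)%N)
  (hn : forall n : nat, fourier g n%:Z = (n%:R^-1)%:C * jump_sum js n)
  (hreal : forall n, fourier g (- n) = conjc (fourier g n))
  (hweyl : forall d, 0 < d -> d < 1 / 9 -> exists2 d', d < d' & weyl_good k l js c d').

Definition line_partial (N : nat) (x : R) : R[i] := airy_partial_sum g N (line_time k l c x) x.

(** The terms [n] and [-n] are conjugate because [g] is real; [N.+1] appears because [line_sum]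
    stops before its bound. *)
Lemma line_partialE N x : line_partial N x = (2 * complex.Re (line_sum k l js c x N.+1))%:C.
Proof.
rewrite /line_partial /airy_partial_sum /=.
rewrite -(big_zrange N (fun n => fourier g n * cis (line_time k l c x * n%:~R ^+ 3 + n%:~R * x))).
rewrite big_zrange_pairs.
have f0 : fourier g 0 = 0 by rewrite (hn 0) invr0 mul0r.
rewrite f0 mul0r add0r.
have tE (n : nat) : fourier g n%:Z * cis (line_time k l c x * n%:Z%:~R ^+ 3 + n%:Z%:~R * x) = line_term k l js c x n.
  by rewrite hn /line_term /line_phase mulrC [_%:C * _]mulrC mulrC.
have tN (n : nat) : fourier g (- n%:Z) * cis (line_time k l c x * (- n%:Z)%:~R ^+ 3 + (- n%:Z)%:~R * x) = conjc (line_term k l js c x n).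
  rewrite -tE hreal; have -> : line_time k l c x * (- n%:Z)%:~R ^+ 3 + (- n%:Z)%:~R * x =
     - (line_time k l c x * n%:Z%:~R ^+ 3 + n%:Z%:~R * x) by rewrite intrN; ring.
  by rewrite cisN; apply: esym; exact: conjcM.
have dbl (z : R[i]) : z + conjc z = (2 * complex.Re z)%:C.
  by case: z => a b; apply/eqP; rewrite eq_complex /=; apply/andP; split; apply/eqP; ring.
rewrite (eq_bigr (fun i : 'I_N => (2 * complex.Re (line_term k l js c x i.+1))%:C)); last first.
  by move=> i _; rewrite tE tN dbl.
rewrite /line_sum big_ord_recl /=.
have -> : line_term k l js c x 0 = 0 by rewrite /line_term invr0 mulr0 mul0r.
rewrite add0r Re_sum mulr_sumr rmorph_sum /=.
by apply: eq_bigr => i _; rewrite /bump.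
Qed.

Lemma line_partial_osc N x : line_partial N x = line_osc k l (fourier g) c N x.
Proof.
rewrite /line_partial /airy_partial_sum /= /line_osc /osc.
rewrite -(big_zrange N (fun n => fourier g n * cis (line_time k l c x * n%:~R ^+ 3 + n%:~R * x))).
apply: eq_bigr => n _; rewrite -mulrA -cisD; congr (_ * cis _).
by rewrite (line_omE R k l0) /line_time; ring.
Qed.

Lemma line_limit : exists (L : R -> R) (d K : R), [/\ 0 < d, 0 <= K,
  forall N x, (0 < N)%N -> normc ((L x)%:C - line_partial N x) <= K * N%:R `^ (- d) &
  forall r, 0 < r -> r < 1 / 27 -> exists2 K' : R, 0 <= K' & forall x h, `|L (x + h) - L x| <= K' * `|h| `^ r].
Proof.
(* For convergence any exponent in [(0, 1/9)] will do. *)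
have [d dl [C C0 hC]] := hweyl (d := 1 / 10) (ltac:(lra)) (ltac:(lra)).
have d0 : 0 < d by apply: lt_trans dl; lra.
have [K1 K10 hK1] := line_sum_cauchy d0 C0 hC.
pose f N x := 2 * complex.Re (line_sum k l js c x N.+1).
have hf M M' x : (0 < M)%N -> (M <= M')%N -> `|f M' x - f M x| <= 2 * K1 * M%:R `^ (- d).
  move=> M0 MM'; rewrite /f -mulrBr normrM ger0_norm// -mulrA ler_pM2l// -ReN -ReD.
  apply: le_trans (normc_Re _) _; apply: le_trans (hK1 x M.+1 M'.+1 _ _) _ => //.
  rewrite ler_wpM2l// !powRN lef_pV2 ?posrE ?powR_gt0 ?ltr0n//.
  by apply: ge0_ler_powR; rewrite ?nnegrE ?ler_nat// ltW.
have K20 : 0 <= 2 * K1 by rewrite mulr_ge0.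
have [|L hL] := uniform_limit hf.
  by move=> e e0; have [M M0 hM] := powR_neg_small K20 d0 e0; exists M => //; exact: hM.
exists L, d, (2 * K1); split => //.
  by move=> N x N0; rewrite line_partialE -rmorphB normcR; exact: hL.
move=> r r0 r27.
(* Here the exponent must exceed [3 r], which is possible because [3 r < 1/9]. *)
have [d' dl' [C' C'0 hC']] := hweyl (d := 3 * r) (ltac:(by rewrite mulr_gt0)) (ltac:(lra)).
have d'0 : 0 < d' by apply: lt_trans dl'; rewrite mulr_gt0.
have [K' K'0 hK'] := line_sum_holder d'0 C'0 hC' r0 (ltac:(lra)) dl'.
exists (2 * K'); first by rewrite mulr_ge0.
move=> x h; apply/ler_addgt0Pr => e e0.
have e2 : 0 < e / 2 by rewrite divr_gt0.
have [M M0 hM] := powR_neg_small K20 d0 e2.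
(* Partial sums of dyadic length, to which [line_sum_holder] applies; the shift by 1 is that of
   [line_partialE]. *)
have [N [J [N0 NM NJ]]] : exists N J : nat, [/\ (0 < N)%N, (M <= N)%N & N.+1 = (2 ^ J)%N].
  exists (2 ^ M.+1).-1, M.+1; have : (M.+1 < 2 ^ M.+1)%N by exact: ltn_expl.
  by move: (2 ^ M.+1)%N => X hh; split; clear - hh; lia.
have a1 := hL N (x + h) N0; have a2 := hL N x N0; have a3 := hM N NM.
have a4 : `|f N (x + h) - f N x| <= 2 * K' * `|h| `^ r.
  rewrite /f -mulrBr normrM ger0_norm// -mulrA ler_pM2l// -ReN -ReD NJ.
  by apply: le_trans (normc_Re _) _; exact: hK'.
rewrite distrC in a2.
have -> : L (x + h) - L x = (L (x + h) - f N (x + h)) + (f N (x + h) - f N x) + (f N x - L x) by ring.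
apply: le_trans (ler_normD _ _) _; apply: le_trans (lerD (ler_normD _ _) (lexx _)) _.
by move: a1 a2 a3 a4; move: (2 * K1 * N%:R `^ _) (2 * K' * _) => *; lra.
Qed.

End line_graph.

Section graph_dimension.
Variables (R : realType) (k l : nat) (g : R -> R) (c Cg c0 : R) (N0 : nat).
Local Notation mu := (@lebesgue_measure R).
Local Notation T := (measurableTypeR R).
Local Notation P := (line_end R l).
Local Notation N m := (`|m|%:~R : R).
Hypotheses (k0 : (0 < k)%N) (l0 : (0 < l)%N) (f0 : fourier g 0 = 0)
  (Fb : forall n, n != 0 -> normc (fourier g n) <= Cg / N n) (c00 : 0 < c0)
  (low : forall n, (N0 <= n)%N -> c0 / n%:R <= \sum_(i < n) normsq (fourier g (n + i)%N%:Z)).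
Variables (L W : R -> R) (d K KW : R).
Hypotheses (d0 : 0 < d) (K0 : 0 <= K)
  (hL : forall M x, (0 < M)%N -> normc ((L x)%:C - line_partial k l g c M x) <= K * M%:R `^ (- d))
  (hLr : forall r, 0 < r -> r < 1 / 27 ->
     exists2 K' : R, 0 <= K' & forall x h, `|L (x + h) - L x| <= K' * `|h| `^ r)
  (cW : continuous W) (KW0 : 0 <= KW)
  (hW : forall x y, 0 <= x <= P -> 0 <= y <= P -> `|W x - W y| <= KW * `|x - y| `^ (1 / 5)).

Let F x := L x + W x.
Let P0 : 0 < P := @line_end_gt0 R l l0.

Lemma hoelder_continuous (f : R -> R) (C r : R) : 0 <= C -> 0 < r ->
  (forall x h, `|f (x + h) - f x| <= C * `|h| `^ r) -> continuous f.
Proof.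
move=> C_ge0 r0 hf x; apply/cvgrPdist_le => e e0.
have C1 : 0 < C + 1 by rewrite ltr_pwDr.
have eC : 0 < e / (C + 1) by rewrite divr_gt0.
apply/nbhs_ballP; exists ((e / (C + 1)) `^ r^-1) => /=; first exact: powR_gt0.
move=> y; rewrite /ball /= => xy.
have := hf x (y - x); rewrite (addrC x) subrK distrC => /le_trans; apply.
have h : `|y - x| `^ r <= e / (C + 1).
  have -> : e / (C + 1) = ((e / (C + 1)) `^ r^-1) `^ r by rewrite -powRrM mulVf ?gt_eqF// powRr1// ltW.
  by apply: ge0_ler_powR; rewrite ?nnegrE ?powR_ge0// ltW// distrC.
apply: le_trans (ler_wpM2l C_ge0 h) _.
by rewrite mulrA ler_pdivrMr// mulrC ler_pM2l// lerDl.
Qed.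

Lemma L_continuous : continuous L.
Proof.
have [K' K'0 h] := hLr (r := 1 / 54) (ltac:(lra)) (ltac:(lra)).
by apply: (hoelder_continuous K'0 _ h); lra.
Qed.

Lemma F_continuous : continuous F.
Proof. by move=> x; apply: cvgD; [exact: L_continuous|exact: cW]. Qed.

Lemma F_hoelder r : 0 < r -> r < 1 / 27 -> exists2 C : R, 0 <= C & forall x y, 0 <= x <= P -> 0 <= y <= P ->
  `|F x - F y| <= C * `|x - y| `^ r.
Proof.
move=> r0 r1; have [K' K'0 h] := hLr r0 r1.
exists (K' + KW * P `^ (1 / 5 - r)); first by rewrite addr_ge0// mulr_ge0// powR_ge0.
move=> x y hx hy; rewrite (_ : F x - F y = (L x - L y) + (W x - W y)); last by rewrite /F; ring.
apply: le_trans (ler_normD _ _) _; rewrite mulrDl; apply: lerD.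
  by have := h y (x - y); rewrite (addrC y) subrK.
apply: le_trans (hW hx hy) _; rewrite -mulrA ler_wpM2l//.
have [->|xy] := eqVneq x y.
  by rewrite subrr normr0 powR0 ?mulr_ge0 ?powR_ge0// gt_eqF//; lra.
have xy0 : 0 < `|x - y| by rewrite normr_gt0 subr_eq0.
have -> : `|x - y| `^ (1 / 5) = `|x - y| `^ (1 / 5 - r) * `|x - y| `^ r.
  by rewrite -powRD ?(gt_eqF xy0) ?implybT// subrK.
rewrite ler_wpM2r ?powR_ge0//; apply: ge0_ler_powR; rewrite ?nnegrE ?(ltW P0)//; first lra.
by move: hx hy => /andP[x0 xP] /andP[y0 yP]; rewrite ler_norml; apply/andP; split; lra.
Qed.

Lemma graph_covers r : 0 < r -> r < 1 / 27 -> exists2 C : R, 0 < C & forall e, 0 < e -> e <= 2 ->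
  exists2 n, covers (graph_on 0 P F) e n & n%:R <= C * e `^ (- (2 - r)).
Proof.
move=> r0 r1; have [C C_ge0 hC] := F_hoelder r0 r1.
pose A := (P + 1) * (2 * C + 3).
have A0 : 0 < A by apply: mulr_gt0; [exact: addr_gt0|have := C_ge0; lra].
exists (A * (1 / 2) `^ (- (2 - r))); first by rewrite mulr_gt0// powR_gt0.
move=> e e0 e2; have e20 : 0 < e / 2 by rewrite divr_gt0.
have [|||n hn hb] := @hoelder_cover R F P C r (e / 2) e P0 C_ge0 r0 _ e20 _ _ hC; [lra|lra| |].
  by have := sqr_ge0 e; rewrite (_ : 2 * (e / 2) ^+ 2 = e ^+ 2 / 2); [lra|field].
exists n => //; apply: le_trans hb _.
rewrite -/A -mulrA ler_pM2l// -powRM ?divr_ge0 ?(ltW e0)//.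
by rewrite (_ : 1 / 2 * e = e / 2)//; ring.
Qed.

Lemma dim_upper : (box_dim (graph_on 0 P F) <= (53 / 27)%:E)%E.
Proof.
apply/lee_addgt0Pr => eta eta0.
(* The value [1/54] only keeps [r] positive when [eta] is large. *)
pose r : R := Num.max (1 / 54) (1 / 27 - eta).
have r0 : 0 < r by rewrite lt_max; apply/orP; left; lra.
have r1 : r < 1 / 27 by rewrite gt_max; apply/andP; split; lra.
have r2 : 1 / 27 - eta <= r by rewrite le_max lexx orbT.
have [C C1 hC] := graph_covers r0 r1.
apply: (@le_trans _ _ (2 - r)%:E); last by rewrite -EFinD lee_fin; lra.
apply: (box_dim_le C1 _ (ltr0n _ 2)); first by lra.
move=> e e0 /ltW e2; have [n hn hb] := hC e e0 e2.
by apply: le_trans (covering_number_le hn) hb.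
Qed.

(** Passes from the partial sums to their uniform limit; the error is absorbed in an arbitrary
    [eta]. *)
Lemma L_variation e : 0 < e -> e < 1 / 2 -> exists2 A : R, 0 < A & exists N1 : nat, forall n, (N1 <= n)%N ->
  A * n%:R `^ (- (1 / 2 + 2 * e)) <= Rintegral mu `[0, P] (fun x => `|L (x + line_step R k l n) - L x|).
Proof.
move=> e0 e1; have [A A0 [N1 hA]] := @line_osc_variation R k l (fourier g) c Cg k0 l0 f0 Fb e c0 N0 e0 e1 c00 low.
exists A => //; exists N1 => n hn; set h := line_step R k l n.
apply/ler_addgt0Pr => eta eta0.
have PK : 0 <= 2 * (P * K) by rewrite mulr_ge0// mulr_ge0// ltW.
have [M M0 hM] := powR_neg_small PK d0 eta0.
pose M' := maxn M n.*2.
have M'0 : (0 < M')%N by rewrite leq_max M0.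
have mD : measurable (`[0, P]%classic : set T) by [].
have sh (f : R -> R) : continuous f -> continuous (fun x => f (x + h)).
  move=> cf x; apply: (@continuous_comp R R R (fun y => y + h) f x); last exact: cf.
  by apply: cvgD; [exact: cvg_id|exact: cvg_cst].
have i1 : rintegrable (`[0, P] : set T) (fun x => `|L (x + h) - L x|).
  apply: rintegrable_cont => x; apply: cvg_norm; apply: cvgB; last exact: L_continuous.
  exact: (sh L L_continuous).
have i2 : rintegrable (`[0, P] : set T) (fun=> 2 * K * M'%:R `^ (- d)).
  by apply: rintegrable_cont => x; exact: cst_continuous.
apply: le_trans (hA n M' hn _) _; first by rewrite leq_maxr.
apply: (@le_trans _ _ (Rintegral mu `[0, P] (fun x => `|L (x + h) - L x| + 2 * K * M'%:R `^ (- d)))).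
  apply: le_Rintegral => //.
  - apply: rintegrable_cont; apply: continuous_normc.
    rewrite (_ : (fun x => line_osc k l (fourier g) c M' (x + h) - line_osc k l (fourier g) c M' x) =
      fun x => osc k l (zrange M') (osc_increment k l (fourier g) c h) x).
      exact: exp_sum_continuous.
    by apply/funext => x; exact: line_osc_shift.
  - exact: rintegrableD.
  move=> x _; rewrite -!line_partial_osc//.
  have b1 := hL (x + h) M'0; have b2 := hL x M'0.
  have -> : line_partial k l g c M' (x + h) - line_partial k l g c M' x =
     (L (x + h) - L x)%:C - ((L (x + h))%:C - line_partial k l g c M' (x + h)) + ((L x)%:C - line_partial k l g c M' x).
    by rewrite rmorphB /=; ring.
  apply: le_trans (normcD _ _) _; apply: le_trans (lerD (normcB _ _) (lexx _)) _.
  by rewrite normcR -[2 * K * _]mulrA; move: b1 b2; move: (K * M'%:R `^ _) => y *; lra.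
rewrite (RintegralD mD i1 i2) lerD2l Rintegral_cst_itv ?(ltW P0)// subr0.
apply: le_trans (hM M' _); first by rewrite le_eqVlt; apply/orP; left; apply/eqP; ring.
by rewrite leq_maxl.
Qed.

Lemma dim_lower : ((11 / 6)%:E <= box_dim (graph_on 0 P F))%E.
Proof.
apply/lee_subgt0Pr => eta eta0; rewrite -EFinB.
(* The bound [1/25] keeps [be] below [1/5]. *)
pose e : R := Num.min eta (1 / 25).
have e0 : 0 < e by rewrite lt_min eta0; lra.
have e1 : e <= 1 / 25 by rewrite ge_min lexx orbT.
have e2 : e <= eta by rewrite ge_min lexx.
have [A A0 [N1 hA]] := L_variation e0 (ltac:(lra)).
have [KL KL0 hKL] := hLr (r := 1 / 54) (ltac:(lra)) (ltac:(lra)).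
(* As [h] is of order [n^-3], the lower bound [n^(-(1/2 + 2e))] is of order [h^be]. *)
pose be : R := 1 / 6 + 2 / 3 * e.
apply: (@le_trans _ _ (2 - be)%:E); first by rewrite lee_fin /be; lra.
pose r : R := k%:R / l%:R; pose kap : R := (8 * (1 + r))^-1.
have r0 : 0 <= r by rewrite divr_ge0.
have kap0 : 0 < kap by rewrite invr_gt0 mulr_gt0// ltr_pwDl.
have kap1 : kap <= 1 by rewrite invf_le1 ?mulr_gt0 ?ltr_pwDl//; lra.
pose A' := A * kap `^ (- be).
have A'0 : 0 < A' by rewrite mulr_gt0// powR_gt0.
pose K3 := KL + P * KW.
have K30 : 0 <= K3 by rewrite addr_ge0// mulr_ge0// ltW.
apply: (@box_dim_ge R _ (A' / 16)); first by rewrite divr_gt0.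
move=> eps eps0.
have gam : 0 < 1 / 5 - be by rewrite /be; lra.
(* Below this scale [K3 h^(1/5)] is at most [(A'/2) h^be]. *)
pose h1 := (A' / 2 / (K3 + 1)) `^ (1 / 5 - be)^-1.
have K31 : 0 < K3 + 1 by rewrite ltr_pwDr.
have h10 : 0 < h1 by rewrite powR_gt0// !divr_gt0.
pose m0 := Num.min (Num.min eps h1) (Num.min 1 P).
have m00 : 0 < m0 by rewrite !lt_min eps0 h10 ltr01.
pose n := maxn N1 (Num.truncn m0^-1).+1.
have n0 : (0 < n)%N by rewrite leq_max orbT.
have n1 : 1 <= n%:R :> R by rewrite ler1n.
have hN1 : (N1 <= n)%N by rewrite leq_maxl.
set h := line_step R k l n.
have h0 : 0 < h by exact: line_step_gt0.
have hE : h = kap * n%:R ^- 3 by [].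
have hm : h < m0.
  have a1 : m0^-1 < n%:R by apply: lt_le_trans (truncnS_gt _) _; rewrite ler_nat leq_maxr.
  have a2 : n%:R^-1 < m0 by rewrite -[m0]invrK ltf_pV2 ?posrE ?invr_gt0// (lt_le_trans ltr01).
  apply: le_lt_trans a2; rewrite hE -[leRHS]mul1r; apply: ler_pM => //; first exact: ltW.
  by rewrite lef_pV2 ?posrE ?exprn_gt0 ?(lt_le_trans ltr01)// ler_eXnr.
have [heps hh1 hone hP] : [/\ h < eps, h < h1, h < 1 & h < P].
  by move: hm; rewrite !lt_min => /andP[/andP[? ?] /andP[? ?]].
exists h; first by rewrite h0 heps.
have var := hA n hN1; rewrite -/h in var.
have nE : n%:R `^ (- (1 / 2 + 2 * e)) = kap `^ (- be) * h `^ be.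
  have n00 : 0 < n%:R :> R by rewrite ltr0n.
  have n3 : 0 <= n%:R ^- 3 :> R by rewrite invr_ge0 exprn_ge0.
  have -> : h `^ be = kap `^ be * (n%:R ^- 3) `^ be by rewrite hE; apply: powRM => //; exact: ltW.
  rewrite mulrA -powRD ?(gt_eqF kap0) ?implybT// addNr powRr0 [1 * (_ `^ _)]mul1r.
  have -> : n%:R ^- 3 = n%:R `^ (- 3%:R) :> R by rewrite powRN powR_mulrn.
  by rewrite -powRrM (_ : - 3%:R * be = - (1 / 2 + 2 * e))//; rewrite /be; move: (e) => y; field.
rewrite nE mulrA -/A' in var.
have hbe0 : 0 < h `^ be by exact: powR_gt0.
have small : K3 * h `^ (1 / 5) <= A' / 2 * h `^ be.
  have -> : h `^ (1 / 5) = h `^ (1 / 5 - be) * h `^ be.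
    by rewrite -powRD ?(gt_eqF h0) ?implybT// subrK.
  rewrite mulrA ler_pM2r//.
  have b : h `^ (1 / 5 - be) <= A' / 2 / (K3 + 1).
    have -> : A' / 2 / (K3 + 1) = h1 `^ (1 / 5 - be).
      by rewrite /h1 -powRrM mulVf ?gt_eqF// powRr1// !divr_ge0// ltW.
    by apply: ge0_ler_powR; rewrite ?nnegrE ?(ltW gam) ?(ltW h0) ?(ltW h10) ?(ltW hh1).
  apply: le_trans (ler_wpM2l K30 b) _.
  rewrite mulrA ler_pdivrMr// mulrC ler_wpM2l ?divr_ge0 ?(ltW A'0)// lerDl//.
have cF := F_continuous; have cL := L_continuous.
have sh (f : R -> R) : continuous f -> continuous (fun x => `|f (x + h) - f x|).
  move=> cf x; apply: cvg_norm; apply: cvgB; last exact: cf.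
  apply: (@continuous_comp R R R (fun y => y + h) f x); last exact: cf.
  by apply: cvgD; [exact: cvg_id|exact: cvg_cst].
have mD : measurable (`[0, P - h]%classic : set T) by [].
have iL a b : rintegrable (`[a, b] : set T) (fun x => `|L (x + h) - L x|) by exact: rintegrable_cont (sh L cL).
have iF a b : rintegrable (`[a, b] : set T) (fun x => `|F (x + h) - F x|) by exact: rintegrable_cont (sh F cF).
have ic a b (y : R) : rintegrable (`[a, b] : set T) (fun=> y).
  by apply: rintegrable_cont => x; exact: cst_continuous.
(* The graph is taken over [[0, P]], so increments of [F] are usable up to [P - h] only; the
   remaining interval has length [h]. *)
have split : Rintegral mu `[0, P] (fun x => `|L (x + h) - L x|) =
    Rintegral mu `[0, P - h] (fun x => `|L (x + h) - L x|) + Rintegral mu `[P - h, P] (fun x => `|L (x + h) - L x|).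
  have := @Rintegral_itvB R (fun x => `|L (x + h) - L x|) (BLeft 0) (BRight P) (P - h) (iL 0 P).
  rewrite !bnd_simp => /(_ (ltac:(by rewrite subr_ge0 ltW)) (ltac:(by rewrite gerBl ltW))).
  rewrite Rintegral_itv_obnd_cbnd => [<-|]; first by rewrite addrC subrK.
  by apply: integrableS (iL (P - h) P) => //; apply: subset_itvr; rewrite bnd_simp.
have h15 : h <= h `^ (1 / 5).
  by apply: ger1_powR; [rewrite h0 ltW|lra].
have end_part : Rintegral mu `[P - h, P] (fun x => `|L (x + h) - L x|) <= KL * h `^ (1 / 5).
  apply: (@le_trans _ _ (Rintegral mu `[P - h, P] (fun=> KL))).
    apply: le_Rintegral; [by []|exact: iL|exact: ic|].
    move=> x _; apply: le_trans (hKL x h) _; rewrite ler_piMr//.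
    rewrite (gtr0_norm h0) -(powR1 _ (1 / 54)) || rewrite (gtr0_norm h0).
    apply: (@le_trans _ _ (1 `^ (1 / 54))); last by rewrite powR1.
    by apply: ge0_ler_powR; rewrite ?nnegrE ?(ltW h0) ?(ltW hone)//; lra.
  rewrite Rintegral_cst_itv ?gerBl ?(ltW h0)// opprB addrC subrK.
  by rewrite ler_wpM2l.
have main_part : Rintegral mu `[0, P - h] (fun x => `|L (x + h) - L x|) <=
    Rintegral mu `[0, P - h] (fun x => `|F (x + h) - F x|) + P * KW * h `^ (1 / 5).
  apply: (@le_trans _ _ (Rintegral mu `[0, P - h] (fun x => `|F (x + h) - F x| + KW * h `^ (1 / 5)))).
    apply: le_Rintegral; [by []|exact: iL|apply: rintegrableD; [by []|exact: iF|exact: ic]|].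
    move=> x; rewrite /= in_itv /= => /andP[x0 xP].
    have -> : L (x + h) - L x = (F (x + h) - F x) - (W (x + h) - W x) by rewrite /F; ring.
    apply: le_trans (ler_normB _ _) _; rewrite lerD2l.
    have hx : 0 <= x <= P by apply/andP; split; lra.
    have hxh : 0 <= x + h <= P by apply/andP; split; lra.
    by have := hW hxh hx; rewrite addrAC subrr add0r (gtr0_norm h0).
  rewrite (RintegralD mD (iF _ _) (ic _ _ _)) lerD2l Rintegral_cst_itv ?subr_ge0 ?(ltW hP)// subr0.
  rewrite mulrC mulrA ler_wpM2r ?powR_ge0// ler_wpM2r// gerBl ltW//.
have lowF : A' / 2 * h `^ be <= Rintegral mu `[0, P - h] (fun x => `|F (x + h) - F x|).
  move: var small end_part main_part; rewrite split /K3 [(KL + _) * _]mulrDl.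
  rewrite (_ : A' * h `^ be = A' / 2 * h `^ be + A' / 2 * h `^ be); last by field.
  move: (Rintegral _ _ _) (Rintegral _ _ _) (Rintegral _ _ _) (KL * _) (P * KW * _) (A' / 2 * _) => *; lra.
have [C C1 hC] := graph_covers (r := 1 / 54) (ltac:(lra)) (ltac:(lra)).
have [m hm' _] := hC h h0 (ltac:(lra)).
apply: (covering_number_ge hm') => m1 [p hp].
have h2 : 0 < h ^+ 2 by rewrite exprn_gt0.
have h8 : 0 < 8 * h ^+ 2 by exact: mulr_gt0.
have var2 := le_trans lowF (graph_cover_variation cF h0 (ltW hP) hp).
rewrite -(ler_pM2l h8); apply: le_trans var2.
have -> : - (2 - be) = be - 2%:R by rewrite opprB.
rewrite powRD ?(gt_eqF h0) ?implybT// powRN powR_mulrn ?(ltW h0)//.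
by rewrite le_eqVlt; apply/orP; left; apply/eqP; field; exact: lt0r_neq0.
Qed.

End graph_dimension.

Lemma airy_restriction_limit (R : realType) (k l : nat) (g : R -> R) (c d K : R) (L : R -> R) :
  (0 < l)%N -> 0 < d -> 0 <= K -> continuous L ->
  (forall N x, (0 < N)%N -> normc ((L x)%:C - line_partial k l g c N x) <= K * N%:R `^ (- d)) ->
  airy_restriction k l g c L.
Proof.
move=> l0 d0 K0 cL hL; have P0 := @line_end_gt0 R l l0.
split.
  split; first exact: (@continuous_measurable_fun R L).
  by apply: rintegrable_cont => x; under eq_fun do rewrite expr2; apply: cvgM; exact: cL.
apply/cvgrPdist_le => e e0.
have PK : 0 <= line_end R l * K ^+ 2 by apply: mulr_ge0; [exact: ltW|exact: sqr_ge0].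
have d20 : 0 < 2 * d by rewrite mulr_gt0.
have [M M0 hM] := powR_neg_small PK d20 e0.
exists M => // N /= MN; have N0 : (0 < N)%N by exact: leq_trans MN.
rewrite sub0r normrN ger0_norm; last by apply: Rintegral_ge0 => x _; rewrite normsqE sqr_ge0.
have E x : airy_partial_sum g N (line_time k l c x) x =
    osc k l (zrange N) (fun n => fourier g n * cis (c * n%:~R ^+ 3)) x.
  exact: line_partial_osc.
have cont : continuous (fun x => normsq (airy_partial_sum g N (line_time k l c x) x - (L x)%:C)).
  rewrite (_ : (fun x => _) = fun x =>
    normsq (osc k l (zrange N) (fun n => fourier g n * cis (c * n%:~R ^+ 3)) x + (- L x)%:C)).
    apply: Ccontinuous_normsq; apply: CcontinuousD; first exact: exp_sum_continuous.
    by apply: Ccontinuous_real => x; apply: cvgN; exact: cL.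
  by apply/funext => x; rewrite E rmorphN.
pose B := K * N%:R `^ (- d).
have B0 : 0 <= B by apply: mulr_ge0 => //; exact: powR_ge0.
apply: (@le_trans _ _ (Rintegral (@lebesgue_measure R) `[0, line_end R l] (fun=> B ^+ 2))).
  apply: le_Rintegral => //.
  - exact: rintegrable_cont.
  - by apply: rintegrable_cont => x; exact: cst_continuous.
  move=> x _; rewrite normsqE; apply: lerXn2r; rewrite ?nnegrE ?normc_ge0//.
  by rewrite -normcN opprB; exact: hL.
rewrite Rintegral_cst_itv ?(ltW P0)// subr0; apply: le_trans (hM N MN).
rewrite /B (mulrC 2 d) -mulNr powRrM powR_mulrn ?powR_ge0//.
by rewrite le_eqVlt; apply/orP; left; apply/eqP; ring.
Qed.

(** In the Airy case the correction is 0, so that both equations are treated alike from here on. *)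
Lemma solution_splitting (R : realType) (g : R -> R) (u : R -> R -> R) (Cg : R) :
  airy_solution g u \/ kdv_solution g u -> fourier g 0 = 0 ->
  (forall n, n != 0 -> normc (fourier g n) <= Cg / `|n|%:~R) ->
  exists V w : R -> R -> R,
  [/\ airy_solution g V, continuous (fun q : R * R => w q.1 q.2),
      forall t x, u t x = V t x + w t x &
      forall T, 0 <= T -> exists2 K : R, 0 <= K & forall t s x y, `|t| <= T -> `|s| <= T ->
        `|w t x - w s y| <= K * (`|t - s| + `|x - y|) `^ (1 / 5)].
Proof.
move=> [hu _ _|[cu du _] f0 Fb].
  exists u, (fun _ _ => 0); split => //.
  - by move=> x; exact: cst_continuous.
  - by move=> t x; rewrite addr0.
  by move=> T _; exists 0 => // t s x y _ _; rewrite subr0 normr0 mul0r.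
have [w [cw hw hV]] := kdv_correction cu du f0 Fb.
by exists (fun t x => u t x - w t x), w; split => // t x; rewrite subrK.
Qed.

Lemma line_time_continuous (R : realType) (k l : nat) (c : R) : continuous (line_time k l c).
Proof.
move=> x; rewrite /line_time; apply: cvgB; first exact: cvg_cst.
by apply: cvgM; [exact: cvg_cst|exact: cvg_id].
Qed.

Lemma line_restrict_continuous (R : realType) (k l : nat) (c : R) (w : R -> R -> R) :
  continuous (fun q : R * R => w q.1 q.2) -> continuous (fun x => w (line_time k l c x) x).
Proof.
move=> cw x.
apply: (@continuous_comp R (R * R)%type R (fun x => (line_time k l c x, x)) (fun q => w q.1 q.2) x).
  have h1 := @line_time_continuous R k l c x; have h2 : y @[y --> x] --> x by exact: cvg_id.
  exact: (cvg_pair h1 h2).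
exact: cw.
Qed.

(** Time is an affine function of [x] along the line, so Hölder continuity in space-time is
    inherited with the same exponent. *)
Lemma line_restrict_hoelder (R : realType) (k l : nat) (c : R) (w : R -> R -> R) : (0 < l)%N ->
  (forall T, 0 <= T -> exists2 K : R, 0 <= K & forall t s x y, `|t| <= T -> `|s| <= T ->
     `|w t x - w s y| <= K * (`|t - s| + `|x - y|) `^ (1 / 5)) ->
  exists2 K : R, 0 <= K & forall x y, 0 <= x <= line_end R l -> 0 <= y <= line_end R l ->
    `|w (line_time k l c x) x - w (line_time k l c y) y| <= K * `|x - y| `^ (1 / 5).
Proof.
move=> l0 hw; have P0 := @line_end_gt0 R l l0.
have r0 : 0 <= k%:R / l%:R :> R by rewrite divr_ge0.
have [|K K0 hK] := hw (`|c| + k%:R / l%:R * line_end R l).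
  by apply: addr_ge0 => //; apply: mulr_ge0 => //; exact: ltW.
have bT x : 0 <= x <= line_end R l -> `|line_time k l c x| <= `|c| + k%:R / l%:R * line_end R l.
  move=> /andP[x0 xP]; apply: le_trans (ler_normB _ _) _; rewrite lerD2l.
  by rewrite normrM (ger0_norm r0) (ger0_norm x0) ler_wpM2l.
exists (K * (1 + k%:R / l%:R) `^ (1 / 5)); first by apply: mulr_ge0 => //; exact: powR_ge0.
move=> x y hx hy; apply: le_trans (hK _ _ x y (bT x hx) (bT y hy)) _.
rewrite -mulrA -powRM ?addr_ge0//.
rewrite (_ : line_time k l c x - line_time k l c y = k%:R / l%:R * (y - x)); last by rewrite /line_time; ring.
suff -> : `|k%:R / l%:R * (y - x)| + `|x - y| = (1 + k%:R / l%:R) * `|x - y| by [].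
by rewrite normrM (ger0_norm r0) (distrC y); ring.
Qed.

(** The exceptional set depends on the exponent; a sequence of exponents increasing to [1/9] leaves
    one null set for all [d]. The shift by 10 keeps these exponents positive. *)
Lemma weyl_good_all_ae (R : realType) (k l : nat) (js : seq (R[i] * R)) : (0 < k)%N -> (0 < l)%N ->
  {ae @lebesgue_measure R, forall c : R, forall d : R, 0 < d -> d < 1 / 9 ->
     exists2 d', d < d' & weyl_good k l js c d'}.
Proof.
move=> k0 l0; pose dm (m : nat) : R := 1 / 9 - (m + 10)%:R^-1.
have A : {ae @lebesgue_measure R, forall c : R, forall m : nat, weyl_good k l js c (dm m)}.
  apply: ae_foralln => m; have m0 : 0 < (m + 10)%:R :> R by rewrite ltr0n addnS.
  apply: weyl_good_ae => //; rewrite /dm; last by rewrite gtrBl invr_gt0.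
  rewrite subr_gt0 mul1r ltf_pV2 ?posrE//.
  by rewrite ltr_nat addnS ltnS leq_addl.
apply: (@filterS _ _ (ae_filter_ringOfSetsType _) _ _ _ A) => c hc d d0 d9.
exists (dm (Num.truncn (1 / 9 - d)^-1)) => //.
have e0 : 0 < 1 / 9 - d by rewrite subr_gt0.
rewrite /dm ltrBrDr -ltrBrDl -[ltRHS]invrK ltf_pV2 ?posrE ?invr_gt0//.
by apply: lt_le_trans (truncnS_gt _) _; rewrite ler_nat addnS ltnS leq_addr.
Qed.

Theorem theorem1p3 (R : realType) (g : R -> R) (u : R -> R -> R) (k l : nat)
  (g_step : step_function g)
  (g_nonconstant : ~ ae_constant g)
  (g_mean_zero : mean_zero g)
  (u_solution : airy_solution g u \/ kdv_solution g u)
  (k_gt0 : (0 < k)%N) (l_gt0 : (0 < l)%N) (kl_coprime : coprime k l) :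
  {ae @lebesgue_measure R, forall c : R,
     exists F : R -> R,
       [/\ line_restriction k l g u c F,
           hoelder_below 0 (@line_end R l) (1 / 27) F &
           ((11 / 6)%:E <= box_dim (graph_on 0 (@line_end R l) F) <= (53 / 27)%:E)%E]}.
Proof.
have [js [Cg [c0 [N0 [hn Fb c00 low]]]]] := step_coefficients g_step g_mean_zero g_nonconstant.
have f0 : fourier g 0 = 0 by exact: step_fourier0.
have hr := step_real g_step.
have [V [w [hV cw uE hw]]] := solution_splitting u_solution f0 Fb.
apply: (@filterS _ _ (ae_filter_ringOfSetsType _) _ _ _ (weyl_good_all_ae js k_gt0 l_gt0)) => c hweyl.
have [L [d [K [d0 K0 hL hLr]]]] : exists (L : R -> R) (d K : R), [/\ 0 < d, 0 <= K,
  forall N x, (0 < N)%N -> normc ((L x)%:C - line_partial k l g c N x) <= K * N%:R `^ (- d) &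
  forall r, 0 < r -> r < 1 / 27 -> exists2 K' : R, 0 <= K' & forall x h, `|L (x + h) - L x| <= K' * `|h| `^ r].
  exact: (line_limit hn hr hweyl).
have cL : continuous L := L_continuous hLr.
have cW := @line_restrict_continuous R k l c w cw.
have [KW KW0 hW] := line_restrict_hoelder k c l_gt0 hw.
(* The continuous representative: the uniform limit of the linear series plus the restriction of the
   correction. *)
exists (fun x => L x + w (line_time k l c x) x); split.
- exists V, w, L; split => //.
  + by move=> t; apply: aeW => x; exact: uE.
  + exact: airy_restriction_limit l_gt0 d0 K0 cL hL.
  + by apply: aeW.
- move=> r r0 r1.
  have [C _ hC] := F_hoelder l_gt0 hLr KW0 hW r0 r1.
  by exists C.
apply/andP; split.
  exact: (dim_lower k_gt0 l_gt0 f0 Fb c00 low d0 K0 hL hLr cW KW0 hW).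
exact: (dim_upper l_gt0 hLr KW0 hW).
Qed.
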